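(* Let $\omega_X,\omega_C,\gamma,g$ be real parameters, $\gamma\ne0$, and consider the one-dimensional lossless, unforced polariton equations for complex functions $\psi_X(x,t),\psi_C(x,t)$ of $x,t\in\mathbb R$: $$i\partial_t\psi_X=(\omega_X+g|\psi_X|^2)\psi_X+\gamma\psi_C,\qquad i\partial_t\psi_C=(\omega_C-\tfrac12\partial_{xx})\psi_C+\gamma\psi_X. \quad (\mathrm P)$$ For a real frequency $\omega$ write $\varpi_X=\omega-\omega_X$ and $\varpi_C=\omega-\omega_C$. There are bright, dark, and discontinuous stationary soliton solutions of (P) for frequencies $\omega$ within certain bands that depend on $\omega_X$, $\omega_C$, and $\gamma$. The three soliton classes described below exhaust all solutions of the form $$(\psi_X(x,t),\psi_C(x,t))=(\phi_X(x),\phi_C(x))e^{-i\omega t}\qquad(\mathrm S)$$ for which $\phi_X(x)$ and $\phi_C(x)$ have limits (far-field values) as $x\to\pm\infty$. 1. (Dark solitons.) For $g>0$, (P) admits solutions of the form (S) for which $\phi_X(x)$ and $\phi_C(x)$ are antisymmetric, monotonic, and bounded. The frequency bands for which these solutions exist are given by $$\text{band 1.1: } 0<\varpi_X\varpi_C<\gamma^2 \text{ if } \omega<\min\{\omega_C,\omega_X\};$$ $$\text{band 1.2: } \gamma^2<\varpi_X\varpi_C<\tfrac32\gamma^2 \text{ if } \omega>\max\{\omega_C,\omega_X\}.$$ The far-field (supremal) value of $|\phi_X(x)|$ is $$\lim_{|x|\to\infty}|\phi_X(x)|=\frac1{\sqrt g}\left|\varpi_X-\frac{\gamma^2}{\varpi_C}\right|^{1/2}.$$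 2. (Bright solitons.) For $g<0$, (P) admits solutions of the form (S) for which $\phi_X(x)$ and $\phi_C(x)$ are symmetric and bounded and have a unique local maximum or minimum. The frequency bands for which these solutions exist are given by $$\text{band 2.1: } \gamma^2<\varpi_X\varpi_C<\tfrac98\gamma^2 \text{ if } \omega<\min\{\omega_C,\omega_X\};$$ $$\text{band 2.2: } 0<\varpi_X\varpi_C<\gamma^2 \text{ if } \omega>\max\{\omega_C,\omega_X\}.$$ These solitons vanish at the far field ($|x|\to\infty$), and $|g|\phi_X(x)^2$ attains a maximal value of $$\max_{-\infty<x<\infty}|g|\phi_X(x)^2=-\varpi_X+\frac{\gamma^2}{\varpi_C}\left[\frac34+\sqrt{\frac9{16}-\frac{\varpi_X\varpi_C}{2\gamma^2}}\,\right].$$ 3. (Discontinuous solitons.) (P) admits antisymmetric bounded solutions of the form (S) for which $\phi_X(x)$ is discontinuous at $x=0$ but $\phi_C(x)$ is continuous. They satisfy the polariton equations in the distributional sense, and away from the point of discontinuity they satisfy the equations classically. These solutions exist in the following two frequency bands. (a) For $g<0$ and all frequencies satisfying $\omega<\min\{\omega_C,\omega_X\}$ and $\varpi_X\varpi_C>\frac32\gamma^2$ (band 3.1), there is a soliton such that $|\phi_X(x)|$ decreases monotonically from $\left|\varpi_X/g\right|^{1/2}$ down to $\frac1{\sqrt{|g|}}\left|\varpi_X-\frac{\gamma^2}{\varpi_C}\right|^{1/2}$ as $x$ runs from the location of the peak of $|\phi_X(x)|$ to $\infty$. Where $|\phi_X(x)|$ experiences its peak, $|\phi_C(x)|$ experiences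 its nadir (minimum). (b) For $g>0$ and all frequencies satisfying $\omega_X<\omega<\omega_C$ (band 3.2), there is a dark soliton such that $|\phi_X(x)|$ increases monotonically from $\left|\varpi_X/g\right|^{1/2}$ up to $\frac1{\sqrt{|g|}}\left|\varpi_X-\frac{\gamma^2}{\varpi_C}\right|^{1/2}$ as $x$ runs from the location of the nadir (minimum) of $|\phi_X(x)|$ to $\infty$. In the negative detuning case, $\omega_C<\omega_X$, this band is absent.
   Context: A stationary soliton solution is a harmonic solution of the form (S) for which the envelopes $(\phi_X(x),\phi_C(x))$ tend to far-field values as $x\to\pm\infty$. The envelopes $\phi_X,\phi_C$ are taken to be real functions; then (P) for a field of the form (S) becomes the system $$(g\phi_X^2-\varpi_X)\phi_X+\gamma\phi_C=0,\qquad -\tfrac12\phi_C''-\varpi_C\phi_C+\gamma\phi_X=0 .$$ Since the system is invariant under translations in $x$, the symmetry point of each soliton (the location of the peak or nadir, i.e. maximum or minimum, of the amplitude $|\phi_X|$) is taken to be $x=0$; symmetric/antisymmetric means even/odd about this point. The words ''dark'' and ''bright'' are descriptive: a dark soliton has an amplitude dip at its center relative to a nonzero far field, and the bright solitons of item 2 have an amplitude peak at the center and zero far field.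
   Formalization: Envelopes are C² off jumps and dark ones strictly monotonic; exhaustion covers nonconstant solutions with φ_C, |φ_X| continuous and finitely many jumps of φ_X; class 3 also lists the zero-far-field discontinuous soliton at ϖ_Xϖ_C=(9/8)γ², g<0, ω<min{ω_C,ω_X}. *)

(* Defs.v *)
(* Stdlib reals with Coquelicot. *)
From Stdlib Require Export Reals List.
From Coquelicot Require Export Coquelicot.
Open Scope R_scope.

(* * The polariton equations for fields psiX, psiC : (x, t) |-> C *)

(* Both equations of (P) at the point (x, t), derivatives being classical.
   [dC] is the first x-derivative of psiC near x. *)
Definition polariton_at (wX wC gam g : R) (psiX psiC : R -> R -> C) (x t : R)
  : Prop :=
  exists (dtX dtC : C) (dC : R -> C) (dxxC : C),
    is_derive (fun s : R => psiX x s) t dtX /\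
    is_derive (fun s : R => psiC x s) t dtC /\
    locally x (fun y : R => is_derive (fun z : R => psiC z t) y (dC y)) /\
    is_derive dC x dxxC /\
    (Ci * dtX = (wX + g * Cmod (psiX x t) ^ 2)%R * psiX x t
                + gam * psiC x t)%C /\
    (Ci * dtC = wC * psiC x t - (/ 2)%R * dxxC + gam * psiX x t)%C.

(* Real-valued C^infinity functions of (x, t) supported in [-M, M]^2. *)
Definition test_function (theta : R -> R -> R) (M : R) : Prop :=
  (forall (j k : nat) (x t : R),
     ex_derive_n (fun s => theta x s) k t /\
     ex_derive_n (fun y => Derive_n (fun s => theta y s) k t) j x /\
     continuity_2d_pt (partial_derive j k theta) x t) /\
  (forall x t : R, M <= Rabs x \/ M <= Rabs t -> theta x t = 0).

Definition is_RInt_box (f : R -> R -> C) (M : R) (v : C) : Prop :=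
  exists I : R -> C,
    (forall t : R, is_RInt (fun x : R => f x t) (- M) M (I t)) /\
    is_RInt I (- M) M v.

(* (P) in the sense of distributions on the (x, t)-plane: every derivative is
   moved onto the test function.  Real test functions suffice since the pairing
   is complex-linear in the test function. *)
Definition polariton_weak (wX wC gam g : R) (psiX psiC : R -> R -> C) : Prop :=
  forall (theta : R -> R -> R) (M : R), test_function theta M ->
    is_RInt_box (fun x t =>
        - (Ci * psiX x t * partial_derive 0 1 theta x t)
        - (wX + g * Cmod (psiX x t) ^ 2)%R * psiX x t * theta x t
        - gam * psiC x t * theta x t)%C M 0 /\
    is_RInt_box (fun x t =>
        - (Ci * psiC x t * partial_derive 0 1 theta x t)
        - wC * psiC x t * theta x t
        + (/ 2)%R * psiC x t * partial_derive 2 0 theta x t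
        - gam * psiX x t * theta x t)%C M 0.

(* * Harmonic fields with real envelopes *)

(* phi(x) e^{-i w t} *)
Definition harmonic (w : R) (phi : R -> R) (x t : R) : C :=
  (phi x * (cos (- (w * t)), sin (- (w * t))))%C.

(* The first conjunct cannot be dropped: [Derive] is total, so
   [ex_derive_n f 2] alone does not entail that f is differentiable. *)
Definition C2_at (f : R -> R) (x : R) : Prop :=
  locally x (fun y => ex_derive f y /\ ex_derive_n f 2 y) /\
  continuous (Derive_n f 2) x.

(* Classical solutions have twice continuously differentiable envelopes, for
   both components, although (P) contains no x-derivative of psiX. *)
Definition classical_at (wX wC gam g w : R) (phiX phiC : R -> R) (x : R)
  : Prop :=
  C2_at phiX x /\ C2_at phiC x /\
  forall t : R,
    polariton_at wX wC gam g (harmonic w phiX) (harmonic w phiC) x t.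

Definition classical_solution (wX wC gam g w : R) (phiX phiC : R -> R)
  : Prop :=
  forall x : R, classical_at wX wC gam g w phiX phiC x.

(* Solutions that are classical off the points of D.  Nothing is assumed about
   the value of phiX at a point of D. *)
Definition solution_off (D : list R) (wX wC gam g w : R) (phiX phiC : R -> R)
  : Prop :=
  (forall x : R, ~ In x D -> classical_at wX wC gam g w phiX phiC x) /\
  (forall x : R, continuous phiC x) /\
  polariton_weak wX wC gam g (harmonic w phiX) (harmonic w phiC).

(* Coquelicot limits at a finite point ignore the value at that point, so
   this excludes removable discontinuities. *)
Definition discontinuity (f : R -> R) (d : R) : Prop := ~ ex_finite_lim f d.

(* The solutions among which the three soliton classes are exhaustive: phiX may
   be discontinuous at finitely many points, but its amplitude |phiX| may not.
   (Without the latter condition there are further distributional solutions,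
   e.g. fronts that jump from one branch of the cubic
   gam phiC = (w - wX - g phiX^2) phiX to a branch with another amplitude and
   connect the far field 0 to a nonzero one.)  For D = nil these are the
   classical solutions. *)
Definition stationary_solution (wX wC gam g w : R) (phiX phiC : R -> R)
  : Prop :=
  exists D : list R,
    solution_off D wX wC gam g w phiX phiC /\
    forall d : R, In d D ->
      discontinuity phiX d /\ ex_finite_lim (fun x => Rabs (phiX x)) d.

Definition has_far_field (f : R -> R) : Prop :=
  ex_finite_lim f p_infty /\ ex_finite_lim f m_infty.

Definition far_field (f : R -> R) (l : R) : Prop :=
  is_lim f p_infty l /\ is_lim f m_infty l.

Definition is_constant (f : R -> R) : Prop := exists c : R, forall x, f x = c.

Definition shift (f : R -> R) (x0 x : R) : R := f (x + x0).

Definition even_fun (f : R -> R) : Prop := forall x, f (- x) = f x.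

Definition odd_fun (f : R -> R) : Prop := forall x, f (- x) = - f x.

Definition odd_off_0 (f : R -> R) : Prop :=
  forall x, x <> 0 -> f (- x) = - f x.

Definition bounded_fun (f : R -> R) : Prop :=
  exists M : R, forall x, Rabs (f x) <= M.

Definition strictly_monotone (f : R -> R) : Prop :=
  (forall x y, x < y -> f x < f y) \/ (forall x y, x < y -> f y < f x).

Definition local_extremum (f : R -> R) (x : R) : Prop :=
  locally x (fun y => f y <= f x) \/ locally x (fun y => f x <= f y).

(* * Soliton classes *)

(* Monotonicity is strict: phiX = phiC = 0 solves (P) for every frequency. *)
Definition dark_soliton (wX wC gam g w : R) (phiX phiC : R -> R) : Prop :=
  classical_solution wX wC gam g w phiX phiC /\
  odd_fun phiX /\ odd_fun phiC /\
  strictly_monotone phiX /\ strictly_monotone phiC /\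
  bounded_fun phiX /\ bounded_fun phiC.

Definition bright_soliton (wX wC gam g w : R) (phiX phiC : R -> R) : Prop :=
  classical_solution wX wC gam g w phiX phiC /\
  even_fun phiX /\ even_fun phiC /\
  bounded_fun phiX /\ bounded_fun phiC /\
  (exists! x : R, local_extremum phiX x) /\
  (exists! x : R, local_extremum phiC x).

(* The value of phiX at its discontinuity is immaterial in the distributional
   sense, hence [odd_off_0]. *)
Definition discontinuous_soliton (wX wC gam g w : R) (phiX phiC : R -> R)
  : Prop :=
  solution_off (0 :: nil) wX wC gam g w phiX phiC /\
  odd_off_0 phiX /\ odd_fun phiC /\
  bounded_fun phiX /\ bounded_fun phiC /\
  has_far_field phiX /\ has_far_field phiC /\
  discontinuity phiX 0.

(* * Frequency bands *)

Definition band11 (wX wC gam w : R) : Prop :=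
  w < Rmin wC wX /\ 0 < (w - wX) * (w - wC) < gam ^ 2.

Definition band12 (wX wC gam w : R) : Prop :=
  Rmax wC wX < w /\ gam ^ 2 < (w - wX) * (w - wC) < 3 / 2 * gam ^ 2.

Definition band21 (wX wC gam w : R) : Prop :=
  w < Rmin wC wX /\ gam ^ 2 < (w - wX) * (w - wC) < 9 / 8 * gam ^ 2.

Definition band22 (wX wC gam w : R) : Prop :=
  Rmax wC wX < w /\ 0 < (w - wX) * (w - wC) < gam ^ 2.

Definition band31 (wX wC gam w : R) : Prop :=
  w < Rmin wC wX /\ 3 / 2 * gam ^ 2 < (w - wX) * (w - wC).

Definition band32 (wX wC w : R) : Prop := wX < w < wC.

(* * Amplitudes *)

(* |phiX| in the nonzero far field *)
Definition amp_inf (wX wC gam g w : R) : R :=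
  / sqrt (Rabs g) * sqrt (Rabs (w - wX - gam ^ 2 / (w - wC))).

(* one-sided limits of |phiX| at the jump of a discontinuous soliton *)
Definition amp_jump (wX g w : R) : R := sqrt (Rabs ((w - wX) / g)).

(* maximum of |g| phiX^2 for a bright soliton *)
Definition bright_peak (wX wC gam w : R) : R :=
  - (w - wX)
  + gam ^ 2 / (w - wC)
    * (3 / 4 + sqrt (9 / 16 - (w - wX) * (w - wC) / (2 * gam ^ 2))).

(* As phiX is discontinuous at 0, its peak (resp. nadir) amplitude there is the
   limit of |phiX| at 0. *)
Definition decreasing_profile (wX wC gam g w : R) (phiX phiC : R -> R)
  : Prop :=
  is_lim (fun x => Rabs (phiX x)) 0 (amp_jump wX g w) /\
  (forall x y, 0 < x -> x < y -> Rabs (phiX y) < Rabs (phiX x)) /\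
  is_lim (fun x => Rabs (phiX x)) p_infty (amp_inf wX wC gam g w) /\
  (forall x, x <> 0 -> Rabs (phiC 0) < Rabs (phiC x)).

Definition increasing_profile (wX wC gam g w : R) (phiX : R -> R) : Prop :=
  is_lim (fun x => Rabs (phiX x)) 0 (amp_jump wX g w) /\
  (forall x y, 0 < x -> x < y -> Rabs (phiX x) < Rabs (phiX y)) /\
  is_lim (fun x => Rabs (phiX x)) p_infty (amp_inf wX wC gam g w).

(* The three classes together.  The last alternative is the single frequency,
   for g < 0, at which there is a discontinuous soliton with zero far field,
   namely phiX(x) = sgn(x) |(w - wX) / g|^(1/2) e^(- k |x|) with
   k^2 = 2 |w - wC| / 9. *)
Definition soliton (wX wC gam g w : R) (phiX phiC : R -> R) : Prop :=
  (0 < g /\ (band11 wX wC gam w \/ band12 wX wC gam w) /\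
   dark_soliton wX wC gam g w phiX phiC) \/
  (g < 0 /\ (band21 wX wC gam w \/ band22 wX wC gam w) /\
   bright_soliton wX wC gam g w phiX phiC) \/
  (discontinuous_soliton wX wC gam g w phiX phiC /\
   ((g < 0 /\ band31 wX wC gam w /\
     decreasing_profile wX wC gam g w phiX phiC) \/
    (0 < g /\ band32 wX wC w /\ increasing_profile wX wC gam g w phiX) \/
    (g < 0 /\ w < Rmin wC wX /\
     (w - wX) * (w - wC) = 9 / 8 * gam ^ 2 /\
     far_field phiX 0 /\ far_field phiC 0))).

(* Main.v *)
(* Write a = w - wX, b = w - wC, u = phi_X, v = phi_C.  The first equation is the cubic
   gam v = (a - g u^2) u, and the second one has the energy
   (gam v')^2 = ((a - 3 g u^2) u')^2 = potential (u^2) + E, with a potential that is cubic in u^2.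
   A far field l is an equilibrium, so l = 0 or g l^2 = a - gam^2 / b, and potential + E vanishes
   at l^2 (to second order if l <> 0), which fixes E.  A nonconstant profile can neither return
   to the far field nor, because of the factor a - 3 g u^2, cross the value g u^2 = a / 3; the
   position of these values relative to the zeros of potential + E leaves only the bright, dark
   and jump profiles.
   At a jump u changes sign, so the continuity of v gives g u^2 = a there, and testing the weak equation
   near the jump shows that v' is continuous.  The symmetry about the centre is uniqueness for a
   second-order system, by Gronwall.  Existence is separation of variables in the energy
   equation. *)
Require Import Defs.
From Stdlib Require Import Lra Psatz Lia List ClassicalEpsilon.

(** * Calculus on the real line *)

(** The equation for u is singular where [a = 3 g u ^ 2], and the energy determines u'' only where
    u' does not vanish. At the exceptional points or parameters where this happens, the twice
    differentiated cubic and the continuity of the derivatives of u take over; hence the separate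
    lemmas for the degenerate far fields ([a = 0], [a = 3 g l ^ 2]). The band edges record the
    position of the singular value. For a nonzero far field l,
    [b (a - 3 g l ^ 2) = 3 gam ^ 2 - 2 a b], whence 3/2. For the far field 0 the turning points are
    roots of a quadratic in [g u ^ 2] with discriminant [gam ^ 2 (9 gam ^ 2 - 8 a b)], whence 9/8,
    and with value [2 a (gam ^ 2 - a b)] at 0, whence the other edge of the bright bands. Arguments
    that pass through a jump are run on v, v' and u ^ 2, which are continuous there. The
    constructions only have to deliver some nonconstant solution with far fields: its symmetry,
    monotonicity and extremum are then read off from the classification. *)

Lemma locally_R (P : R -> Prop) (x : R) :
  locally x P <-> exists e : R, 0 < e /\ forall y, Rabs (y - x) < e -> P y.
Proof.
  split.
  - intros [e He]. exists e. split; [apply cond_pos|]. intros y Hy. apply He. exact Hy.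
  - intros [e [He H]]. exists (mkposreal e He). intros y Hy. apply H. exact Hy.
Qed.

Lemma continuous_R (f : R -> R) (x : R) :
  continuous f x <->
  forall e, 0 < e -> exists d, 0 < d /\ forall y, Rabs (y - x) < d -> Rabs (f y - f x) < e.
Proof.
  split.
  - intros H e He. apply (proj1 (locally_R (fun y => Rabs (f y - f x) < e) x)).
    apply (H (fun z => Rabs (z - f x) < e)). apply locally_R. exists e. auto.
  - intros H P HP. apply locally_R in HP. destruct HP as [e [He HP]].
    destruct (H e He) as [d [Hd H']]. apply locally_R. exists d. split; auto.
Qed.

Lemma is_lim_p_infty_R (f : R -> R) (l : R) :
  is_lim f p_infty l <->
  forall e, 0 < e -> exists M, forall x, M < x -> Rabs (f x - l) < e.
Proof.
  split.
  - intros H e He. apply is_lim_spec in H. exact (H (mkposreal e He)).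
  - intros H. apply is_lim_spec. intros e. exact (H e (cond_pos e)).
Qed.

Lemma is_lim_m_infty_R (f : R -> R) (l : R) :
  is_lim f m_infty l <->
  forall e, 0 < e -> exists M, forall x, x < M -> Rabs (f x - l) < e.
Proof.
  split.
  - intros H e He. apply is_lim_spec in H. exact (H (mkposreal e He)).
  - intros H. apply is_lim_spec. intros e. exact (H e (cond_pos e)).
Qed.

Lemma is_lim_R (f : R -> R) (a l : R) :
  is_lim f a l <->
  forall e, 0 < e -> exists d, 0 < d /\
    forall x, x <> a -> Rabs (x - a) < d -> Rabs (f x - l) < e.
Proof.
  split.
  - intros H e He. apply is_lim_spec in H. specialize (H (mkposreal e He)).
    apply locally_R in H. destruct H as [d [Hd H']]. exists d. split; [exact Hd|].
    intros x Hx Hd'. exact (H' x Hd' Hx).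
  - intros H. apply is_lim_spec. intros e. destruct (H e (cond_pos e)) as [d [Hd H']].
    apply locally_R. exists d. split; auto.
Qed.

Lemma is_lim_opp_arg (f : R -> R) (l : R) :
  is_lim (fun x => f (- x)) p_infty l <-> is_lim f m_infty l.
Proof.
  rewrite is_lim_p_infty_R, is_lim_m_infty_R. split; intros H e He.
  - destruct (H e He) as [M HM]. exists (- M). intros x Hx.
    specialize (HM (- x)). rewrite Ropp_involutive in HM. apply HM. lra.
  - destruct (H e He) as [M HM]. exists (- M). intros x Hx. apply HM. lra.
Qed.

Lemma is_derive_continuous (f : R -> R) (x l : R) : is_derive f x l -> continuous f x.
Proof. intros H. apply (ex_derive_continuous (V := R_NormedModule)). exists l. exact H. Qed.

Lemma continuous_Rplus (f h : R -> R) (x : R) :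
  continuous f x -> continuous h x -> continuous (fun y => f y + h y) x.
Proof. apply (continuous_plus (V := R_NormedModule)). Qed.

Lemma continuous_Rminus (f h : R -> R) (x : R) :
  continuous f x -> continuous h x -> continuous (fun y => f y - h y) x.
Proof. apply (continuous_minus (V := R_NormedModule)). Qed.

Lemma continuous_Rmult (f h : R -> R) (x : R) :
  continuous f x -> continuous h x -> continuous (fun y => f y * h y) x.
Proof. apply (continuous_mult (K := R_AbsRing)). Qed.

Lemma continuous_continuity_pt (f : R -> R) (x : R) : continuous f x -> continuity_pt f x.
Proof. intros H. apply continuity_pt_filterlim. exact H. Qed.

(** [der] differentiates expressions in functions that are known only through [is_derive]
    hypotheses: these discharge the side conditions of [auto_derive] and give the values of the
    remaining [Derive] terms. *)
Ltac der_side := repeat split; try exact I; try (eexists; eassumption).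
Ltac der_eq :=
  repeat match goal with
  | H : is_derive ?f ?x ?l |- context [Derive ?f' ?x] =>
      replace (Derive f' x) with l by (symmetry; apply is_derive_unique; exact H)
  end.
Ltac der := auto_derive; [der_side | der_eq].

Lemma mvt_open (f f1 : R -> R) (x y : R) :
  x < y -> (forall z, x < z < y -> is_derive f z (f1 z)) ->
  (forall z, x <= z <= y -> continuous f z) ->
  exists z, x < z < y /\ f y - f x = f1 z * (y - x).
Proof.
  intros Hxy Hd Hc.
  assert (pr1 : forall c, x < c < y -> derivable_pt f c).
  { intros c Hcc. exists (f1 c). apply is_derive_Reals. auto. }
  destruct (MVT f id x y pr1 (fun c _ => derivable_pt_id c) Hxy) as [c [P HP]].
  - intros c Hcc. apply continuous_continuity_pt. auto.
  - intros c _. apply derivable_continuous_pt. apply derivable_pt_id.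
  - exists c. split; [exact P|]. rewrite derive_pt_id in HP. unfold id in HP.
    assert (E : derive_pt f c (pr1 c P) = f1 c).
    { apply derive_pt_eq_0. apply is_derive_Reals. auto. }
    rewrite E in HP. lra.
Qed.

(** The list D will hold the jumps of phi_X. Cutting the interval at a point of D shortens the list,
    and continuity joins the pieces. *)
Lemma constant_of_derive_0_off (D : list R) (f : R -> R) (x y : R) :
  x < y -> (forall z, x <= z <= y -> continuous f z) ->
  (forall z, x < z < y -> ~ In z D -> is_derive f z 0) -> f x = f y.
Proof.
  revert x y. induction D as [|d D IH]; intros x y Hxy Hc Hd.
  - destruct (mvt_open f (fun _ => 0) x y Hxy) as [z [_ E]]; auto. lra.
  - destruct (Rlt_dec x d) as [H1|H1]; [destruct (Rlt_dec d y) as [H2|H2]|].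
    + transitivity (f d); apply IH; auto; try (intros z Hz; apply Hc; lra);
        intros z Hz Hn; apply Hd; try lra; intros [E|E]; [lra|auto|lra|auto].
    + apply IH; auto. intros z Hz Hn. apply Hd; auto. intros [E|E]; [lra|auto].
    + apply IH; auto. intros z Hz Hn. apply Hd; auto. intros [E|E]; [lra|auto].
Qed.

Lemma intermediate_value (f : R -> R) (x y r : R) :
  (forall z, continuous f z) -> (f x - r) * (f y - r) <= 0 ->
  exists z, Rmin x y <= z <= Rmax x y /\ f z = r.
Proof.
  intros Hc H.
  destruct (IVT_gen_consistent f x y r Hc) as [z Hz].
  - unfold Rmin, Rmax. destruct (Rle_dec (f x) (f y)); split; nra.
  - exists z. exact Hz.
Qed.

Lemma intermediate_value_on (f : R -> R) (x y r : R) :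
  x <= y -> (forall z, x <= z <= y -> continuous f z) -> (f x - r) * (f y - r) <= 0 ->
  exists z, x <= z <= y /\ f z = r.
Proof.
  intros Hxy Hc H.
  destruct (Req_dec (f x) r) as [E|E]; [exists x; split; [lra|auto]|].
  destruct (Req_dec (f y) r) as [E'|E']; [exists y; split; [lra|auto]|].
  destruct (Req_dec x y) as [->|Hne]; [nra|].
  destruct (Rlt_dec (f x) r) as [L|L].
  - destruct (Ranalysis5.IVT_interv (fun z => f z - r) x y) as [z [Hz Ez]]; try lra.
    + intros z Hz. apply continuous_continuity_pt.
      apply (continuous_minus (V := R_NormedModule)); [auto|apply continuous_const].
    + nra.
    + exists z. split; [lra|lra].
  - destruct (Ranalysis5.IVT_interv (fun z => r - f z) x y) as [z [Hz Ez]]; try lra.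
    + intros z Hz. apply continuous_continuity_pt.
      apply (continuous_minus (V := R_NormedModule)); [apply continuous_const|auto].
    + nra.
    + exists z. split; [lra|lra].
Qed.

(** Intermediate value theorem. An order-convex predicate I covers segments, half-lines and the
    whole line, and the product spares a choice of sign. *)
Lemma same_sign_on (f : R -> R) (I : R -> Prop) (x y : R) :
  (forall p q z, I p -> I q -> p <= z <= q -> I z) ->
  (forall z, I z -> continuous f z) -> (forall z, I z -> f z <> 0) ->
  I x -> I y -> 0 < f x * f y.
Proof.
  intros HI Hc Hn Hx Hy.
  destruct (Rle_lt_dec (f x * f y) 0) as [H|H]; [exfalso|exact H].
  destruct (Rle_dec x y) as [Hxy|Hxy].
  - destruct (intermediate_value_on f x y 0 Hxy) as [z [Hz Ez]].
    + intros z Hz. apply Hc. apply (HI x y); auto.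
    + lra.
    + apply (Hn z); auto. apply (HI x y); auto.
  - destruct (intermediate_value_on f y x 0) as [z [Hz Ez]]; try lra.
    + intros z Hz. apply Hc. apply (HI y x); auto.
    + apply (Hn z); auto. apply (HI y x); auto.
Qed.

Lemma monotone_of_derive_sign (f f1 : R -> R) (I : R -> Prop) (c : R) :
  (forall p q z, I p -> I q -> p <= z <= q -> I z) ->
  (forall z, I z -> is_derive f z (f1 z)) -> (forall z, I z -> 0 < c * f1 z) ->
  forall x y, I x -> I y -> x < y -> 0 < c * (f y - f x).
Proof.
  intros HI Hd Hs x y Hx Hy Hxy.
  destruct (mvt_open f f1 x y Hxy) as [z [Hz E]].
  - intros z Hz. apply Hd. apply (HI x y); auto; lra.
  - intros z Hz. apply is_derive_continuous with (f1 z). apply Hd. apply (HI x y); auto; lra.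
  - assert (Iz : I z) by (apply (HI x y); auto; lra). specialize (Hs z Iz).
    rewrite E. replace (c * (f1 z * (y - x))) with ((c * f1 z) * (y - x)) by ring.
    apply Rmult_lt_0_compat; lra.
Qed.

Lemma strictly_monotone_of_derive (f f1 : R -> R) :
  (forall z, is_derive f z (f1 z)) -> (forall z, continuous f1 z) ->
  (forall z, f1 z <> 0) -> strictly_monotone f.
Proof.
  intros Hd Hc Hn.
  assert (S : forall z, 0 < f1 0 * f1 z).
  { intros z. apply (same_sign_on f1 (fun _ => True)); auto. }
  assert (M := monotone_of_derive_sign f f1 (fun _ => True) (f1 0)
                 (fun _ _ _ _ _ _ => I) (fun z _ => Hd z) (fun z _ => S z)).
  destruct (Rlt_dec 0 (f1 0)) as [H|H].
  - left. intros x y Hxy. specialize (M x y I I Hxy). nra.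
  - right. intros x y Hxy. specialize (M x y I I Hxy). specialize (Hn 0). nra.
Qed.

Lemma exists_max_of_vanishing (f : R -> R) (x1 : R) :
  (forall x, continuous f x) -> is_lim f p_infty 0 -> is_lim f m_infty 0 -> 0 < f x1 ->
  exists x0, 0 < f x0 /\ forall x, f x <= f x0.
Proof.
  intros Hc Hp Hm H1.
  apply is_lim_p_infty_R with (e := f x1) in Hp; [|exact H1].
  apply is_lim_m_infty_R with (e := f x1) in Hm; [|exact H1].
  destruct Hp as [P HP]. destruct Hm as [M HM].
  set (A := Rmin M x1). set (B := Rmax P x1).
  assert (HA : A <= M /\ A <= x1) by (unfold A; split; [apply Rmin_l|apply Rmin_r]).
  assert (HB : P <= B /\ x1 <= B) by (unfold B; split; [apply Rmax_l|apply Rmax_r]).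
  destruct (continuity_ab_maj f A B) as [x0 [H0 Hx0]]; [lra| |].
  - intros c _. apply continuous_continuity_pt. auto.
  - assert (L : f x1 <= f x0) by (apply H0; lra).
    exists x0. split; [lra|]. intros x.
    destruct (Rlt_dec x A) as [H|H]; [|destruct (Rlt_dec B x) as [H'|H']].
    + specialize (HM x ltac:(lra)). apply Rabs_def2 in HM. lra.
    + specialize (HP x ltac:(lra)). apply Rabs_def2 in HP. lra.
    + apply H0. lra.
Qed.

Lemma derive_0_at_max (f : R -> R) (x l e : R) :
  0 < e -> is_derive f x l -> (forall y, Rabs (y - x) < e -> f y <= f x) -> l = 0.
Proof.
  intros He Hd Hm. apply is_derive_Reals in Hd.
  destruct (Rtotal_order l 0) as [H|[H|H]]; [exfalso|exact H|exfalso].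
  - destruct (Hd (- l / 2)) as [d H']; [lra|]. pose proof (cond_pos d).
    set (h := - (Rmin d e / 2)).
    assert (0 < Rmin d e) by (apply Rmin_glb_lt; auto).
    assert (Rmin d e <= d) by apply Rmin_l. assert (Rmin d e <= e) by apply Rmin_r.
    specialize (H' h ltac:(unfold h; lra)).
    specialize (H' ltac:(unfold h; apply Rabs_def1; lra)). apply Rabs_def2 in H'.
    specialize (Hm (x + h)). replace (x + h - x) with h in Hm by ring.
    specialize (Hm ltac:(unfold h; apply Rabs_def1; lra)).
    assert (0 <= (f (x + h) - f x) / h).
    { replace ((f (x + h) - f x) / h) with ((f x - f (x + h)) / (- h)) by (field; unfold h; lra).
      apply Rdiv_le_0_compat; unfold h in *; lra. }
    lra.
  - destruct (Hd (l / 2)) as [d H']; [lra|]. pose proof (cond_pos d).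
    set (h := Rmin d e / 2).
    assert (0 < Rmin d e) by (apply Rmin_glb_lt; auto).
    assert (Rmin d e <= d) by apply Rmin_l. assert (Rmin d e <= e) by apply Rmin_r.
    specialize (H' h ltac:(unfold h; lra)).
    specialize (H' ltac:(unfold h; apply Rabs_def1; lra)). apply Rabs_def2 in H'.
    specialize (Hm (x + h)). replace (x + h - x) with h in Hm by ring.
    specialize (Hm ltac:(unfold h; apply Rabs_def1; lra)).
    assert (0 <= (f x - f (x + h)) / h) by (apply Rdiv_le_0_compat; unfold h in *; lra).
    replace ((f (x + h) - f x) / h) with (- ((f x - f (x + h)) / h)) in H' by (field; unfold h; lra).
    lra.
Qed.

(** [exp (- K x) N x] is nonincreasing, and its upper limit at c is at most 0. Only smallness near c
    is assumed, since at a jump the initial data are available only as limits. *)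
Lemma gronwall_right (N N1 : R -> R) (c K : R) :
  (forall x, c < x -> is_derive N x (N1 x)) ->
  (forall x, c < x -> N1 x <= K * N x) ->
  (forall e, 0 < e -> exists d, 0 < d /\ forall x, c < x < c + d -> N x < e) ->
  forall y, c < y -> N y <= 0.
Proof.
  intros Hd HK H0 y Hy.
  set (g := fun x => exp (- K * x) * N x).
  assert (Hg : forall x, c < x -> is_derive g x (exp (- K * x) * (N1 x - K * N x))).
  { intros x Hx. unfold g. specialize (Hd x Hx).
    evar_last. apply (is_derive_mult (fun x => exp (- K * x)) N x (- K * exp (- K * x)) (N1 x)).
    - auto_derive; auto; ring.
    - exact Hd.
    - intros; apply Rmult_comm.
    - simpl. unfold plus, mult; simpl. ring. }
  assert (Hmono : forall x, c < x < y -> g y <= g x).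
  { intros x Hx. destruct (mvt_open g (fun x => exp (- K * x) * (N1 x - K * N x)) x y) as [z [Hz E]]; [lra| | |].
    - intros z Hz. apply Hg; lra.
    - intros z Hz. eapply is_derive_continuous. apply Hg; lra.
    - assert (0 <= exp (- K * z) * (K * N z - N1 z)).
      { apply Rmult_le_pos; [left; apply exp_pos|]. specialize (HK z ltac:(lra)). lra. }
      assert (exp (- K * z) * (N1 z - K * N z) * (y - x) <= 0) by nra. lra. }
  destruct (Rle_lt_dec (N y) 0) as [H|H]; [exact H|exfalso].
  assert (Gy : 0 < g y) by (unfold g; apply Rmult_lt_0_compat; [apply exp_pos|exact H]).
  (* B bounds the weight [exp (- K x)] on [c, y] for either sign of K. *)
  set (B := Rmax (exp (- K * c)) (exp (- K * y))).
  assert (HB : 0 < B) by (apply Rlt_le_trans with (exp (- K * c)); [apply exp_pos|apply Rmax_l]).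
  destruct (H0 (g y / B)) as [d [Hd0 H']]; [apply Rdiv_lt_0_compat; auto|].
  set (x := c + Rmin d (y - c) / 2).
  assert (0 < Rmin d (y - c)) by (apply Rmin_glb_lt; lra).
  assert (Rmin d (y - c) <= d) by apply Rmin_l.
  assert (Rmin d (y - c) <= y - c) by apply Rmin_r.
  specialize (H' x ltac:(unfold x; lra)).
  assert (Hx : c < x < y) by (unfold x; lra).
  specialize (Hmono x Hx).
  assert (E : exp (- K * x) <= B).
  { unfold B. destruct (Rle_dec 0 K).
    - apply Rle_trans with (exp (- K * c)); [|apply Rmax_l].
      destruct (Req_dec (- K * x) (- K * c)) as [->|]; [lra|]. left. apply exp_increasing. nra.
    - apply Rle_trans with (exp (- K * y)); [|apply Rmax_r]. left. apply exp_increasing. nra. }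
  assert (g x < g y); [|lra].
  unfold g at 1. assert (0 < exp (- K * x)) by apply exp_pos.
  destruct (Rle_dec (N x) 0); [nra|].
  apply Rle_lt_trans with (B * N x); [nra|].
  apply Rmult_lt_reg_r with (/ B); [apply Rinv_0_lt_compat; auto|].
  replace (B * N x * / B) with (N x) by (field; lra). exact H'.
Qed.

(** A differential inequality instead of an equation, because the energy gives u' only up to sign.
    The function [N = (f - f x0) ^ 2] satisfies |N'| <= 2 |K| N. *)
Lemma gronwall_local (f f1 : R -> R) (x0 e K : R) :
  0 < e -> (forall x, Rabs (x - x0) < e -> is_derive f x (f1 x)) ->
  (forall x, Rabs (x - x0) < e -> Rabs (f1 x) <= K * Rabs (f x - f x0)) ->
  forall y, Rabs (y - x0) < e -> f y = f x0.
Proof.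
  intros He Hd HK y Hy.
  assert (HK' : forall x, Rabs (x - x0) < e -> Rabs (f1 x) <= Rabs K * Rabs (f x - f x0)).
  { intros x Hx. eapply Rle_trans; [apply HK; auto|].
    apply Rmult_le_compat_r; [apply Rabs_pos|apply Rle_abs]. }
  set (L := Rabs K). assert (HL : 0 <= L) by apply Rabs_pos. clear HK.
  set (N := fun x => (f x - f x0) ^ 2).
  set (N1 := fun x => 2 * (f x - f x0) * f1 x).
  assert (HN : forall x, Rabs (x - x0) < e -> is_derive N x (N1 x)).
  { intros x Hx. unfold N, N1. specialize (Hd x Hx). der. ring. }
  assert (HN1 : forall x, Rabs (x - x0) < e -> Rabs (N1 x) <= 2 * L * N x).
  { intros x Hx. specialize (HK' x Hx). fold L in HK'. unfold N1, N. rewrite !Rabs_mult.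
    rewrite (Rabs_pos_eq 2) by lra. rewrite <- (pow2_abs (f x - f x0)).
    pose proof (Rabs_pos (f x - f x0)). pose proof (Rabs_pos (f1 x)). nra. }
  (* Both exponentially weighted functions are monotone and N vanishes at x0. *)
  assert (HE : forall c x, Rabs (x - x0) < e ->
     is_derive (fun x => exp (c * x) * N x) x (exp (c * x) * (N1 x + c * N x))).
  { intros c x Hx. evar_last.
    apply (is_derive_mult (fun x => exp (c * x)) N x (c * exp (c * x)) (N1 x)).
    - auto_derive; auto; ring.
    - apply HN; auto.
    - intros; apply Rmult_comm.
    - simpl. unfold plus, mult; simpl. ring. }
  assert (N0 : N x0 = 0) by (unfold N; ring).
  assert (Ny : N y <= 0).
  { destruct (Rtotal_order y x0) as [H|[H|H]]; [|subst; lra|].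
    - apply Rabs_def2 in Hy.
      destruct (mvt_open (fun x => exp (2 * L * x) * N x)
          (fun x => exp (2 * L * x) * (N1 x + 2 * L * N x)) y x0 H) as [z [Hz E]].
      + intros z Hz. apply HE. apply Rabs_def1; lra.
      + intros z Hz. eapply is_derive_continuous. apply HE. apply Rabs_def1; lra.
      + assert (Hz' : Rabs (z - x0) < e) by (apply Rabs_def1; lra).
        specialize (HN1 z Hz'). apply Rabs_le_between in HN1.
        assert (0 < exp (2 * L * z)) by apply exp_pos.
        assert (0 < exp (2 * L * y)) by apply exp_pos. rewrite N0 in E.
        assert (0 <= exp (2 * L * z) * (N1 z + 2 * L * N z) * (x0 - y)).
        { apply Rmult_le_pos; [apply Rmult_le_pos|]; lra. }
        nra.
    - apply Rabs_def2 in Hy.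
      destruct (mvt_open (fun x => exp (- (2 * L) * x) * N x)
          (fun x => exp (- (2 * L) * x) * (N1 x + - (2 * L) * N x)) x0 y H) as [z [Hz E]].
      + intros z Hz. apply HE. apply Rabs_def1; lra.
      + intros z Hz. eapply is_derive_continuous. apply HE. apply Rabs_def1; lra.
      + assert (Hz' : Rabs (z - x0) < e) by (apply Rabs_def1; lra).
        specialize (HN1 z Hz'). apply Rabs_le_between in HN1.
        assert (0 < exp (- (2 * L) * z)) by apply exp_pos.
        assert (0 < exp (- (2 * L) * y)) by apply exp_pos. rewrite N0 in E.
        assert (0 <= exp (- (2 * L) * z) * (- (N1 z + - (2 * L) * N z)) * (y - x0)).
        { apply Rmult_le_pos; [apply Rmult_le_pos|]; lra. }
        nra. }
  unfold N in Ny. nra.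
Qed.

(** Connectedness of the line: the indicator function of P has derivative 0 everywhere. *)
Lemma constant_of_locally_constant (P : R -> Prop) (x0 : R) :
  (forall x, P x -> locally x P) -> (forall x, ~ P x -> locally x (fun y => ~ P y)) ->
  P x0 -> forall x, P x.
Proof.
  intros H1 H2 H0 x.
  set (f := fun x => if excluded_middle_informative (P x) then 1 else 0).
  assert (Hf : forall z, is_derive f z 0).
  { intros z. apply is_derive_ext_loc with (fun _ => f z); [|apply @is_derive_const].
    destruct (excluded_middle_informative (P z)) as [Hz|Hz].
    - eapply filter_imp; [|apply (H1 z Hz)]. intros y Hy. cbv beta in Hy. unfold f.
      destruct (excluded_middle_informative (P z)); destruct (excluded_middle_informative (P y)); reflexivity || tauto.
    - eapply filter_imp; [|apply (H2 z Hz)]. intros y Hy. cbv beta in Hy. unfold f.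
      destruct (excluded_middle_informative (P z)); destruct (excluded_middle_informative (P y)); reflexivity || tauto. }
  assert (E : f x0 = f x).
  { destruct (Rtotal_order x0 x) as [H|[H|H]]; [|subst; auto|symmetry];
      apply (constant_of_derive_0_off nil); auto; intros z _; apply is_derive_continuous with 0; auto. }
  unfold f in E. destruct (excluded_middle_informative (P x0)); [|tauto].
  destruct (excluded_middle_informative (P x)); [auto|lra].
Qed.

(* Taylor: f (x + 1) - f x = f1 x + f2 / 2 and f1 (x + 1) - f1 x = f2; in the limit both
   left-hand sides involve only L. *)
Lemma derivatives_vanish_at_infinity (f f1 f2 : R -> R) (X l L : R) :
  (forall x, X < x -> is_derive f x (f1 x)) ->
  (forall x, X < x -> is_derive f1 x (f2 x)) ->
  is_lim f p_infty l -> is_lim f2 p_infty L ->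
  L = 0 /\ is_lim f1 p_infty 0.
Proof.
  intros Hf Hf1 Hl HL.
  assert (H1 : forall e, 0 < e -> exists M, forall x, M < x -> Rabs (f1 x + L / 2) < e).
  { intros e He.
    destruct (proj1 (is_lim_p_infty_R f l) Hl (e / 4) ltac:(lra)) as [A HA].
    destruct (proj1 (is_lim_p_infty_R f2 L) HL (e / 2) ltac:(lra)) as [B HB].
    exists (Rmax X (Rmax A B)). intros x Hx.
    assert (X <= Rmax X (Rmax A B)) by apply Rmax_l.
    assert (Rmax A B <= Rmax X (Rmax A B)) by apply Rmax_r.
    assert (A <= Rmax A B) by apply Rmax_l. assert (B <= Rmax A B) by apply Rmax_r.
    destruct (mvt_open (fun t => f t - f1 x * (t - x) - L * (t - x) ^ 2 / 2)
      (fun t => f1 t - f1 x - L * (t - x)) x (x + 1)) as [z [Hz E]]; [lra| | |].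
    - intros z Hz. pose proof (Hf z ltac:(lra)) as D. der. field.
    - intros z Hz. pose proof (Hf z ltac:(lra)) as D.
      apply (ex_derive_continuous (V := R_NormedModule)). auto_derive. der_side.
    - destruct (mvt_open f1 f2 x z) as [w [Hw Ew]]; [lra| | |].
      + intros; apply Hf1; lra.
      + intros; eapply is_derive_continuous; apply Hf1; lra.
      + assert (P1 := HA x ltac:(lra)). assert (P2 := HA (x + 1) ltac:(lra)).
        assert (P3 := HB w ltac:(lra)).
        apply Rabs_def2 in P1. apply Rabs_def2 in P2. apply Rabs_def2 in P3.
        apply Rabs_def1; nra. }
  assert (L0 : L = 0).
  { destruct (Req_dec L 0) as [H|H]; [exact H|exfalso].
    assert (Hp : 0 < Rabs L) by (apply Rabs_pos_lt; auto).
    destruct (H1 (Rabs L / 4) ltac:(lra)) as [A HA].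
    destruct (proj1 (is_lim_p_infty_R f2 L) HL (Rabs L / 4) ltac:(lra)) as [B HB].
    set (x := Rmax X (Rmax A B) + 1).
    assert (X <= Rmax X (Rmax A B)) by apply Rmax_l.
    assert (Rmax A B <= Rmax X (Rmax A B)) by apply Rmax_r.
    assert (A <= Rmax A B) by apply Rmax_l. assert (B <= Rmax A B) by apply Rmax_r.
    destruct (mvt_open f1 f2 x (x + 1)) as [z [Hz E]]; [lra| | |].
    - intros; apply Hf1; unfold x in *; lra.
    - intros; eapply is_derive_continuous; apply Hf1; unfold x in *; lra.
    - assert (P1 := HA x ltac:(unfold x; lra)). assert (P2 := HA (x + 1) ltac:(unfold x; lra)).
      assert (P3 := HB z ltac:(unfold x in *; lra)).
      apply Rabs_def2 in P1. apply Rabs_def2 in P2. apply Rabs_def2 in P3.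
      unfold Rabs in *. destruct (Rcase_abs L); lra. }
  split; [exact L0|]. apply is_lim_p_infty_R. intros e He. destruct (H1 e He) as [M HM].
  exists M. intros x Hx. specialize (HM x Hx). rewrite L0 in HM.
  replace (f1 x - 0) with (f1 x + 0 / 2) by field. exact HM.
Qed.

Lemma locally_not_In (D : list R) (x : R) : ~ In x D -> locally x (fun y => ~ In y D).
Proof.
  induction D as [|d D IH]; intros H.
  - apply filter_forall. auto.
  - assert (H1 : locally x (fun y => ~ In y D)) by (apply IH; intro; apply H; right; auto).
    assert (H2 : locally x (fun y => d <> y)).
    { apply locally_R. exists (Rabs (x - d)). split.
      - apply Rabs_pos_lt. intro. apply H. left. lra.
      - intros y Hy E. subst y. rewrite Rabs_minus_sym in Hy. lra. }
    generalize (filter_and _ _ H1 H2). apply filter_imp. intros y [A B] [C|C]; auto.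
Qed.

Lemma locally_punctured_not_In (D : list R) (x : R) :
  exists e, 0 < e /\ forall y, y <> x -> Rabs (y - x) < e -> ~ In y D.
Proof.
  assert (H : ~ In x (remove Req_dec_T x D)) by apply remove_In.
  apply locally_not_In in H. apply locally_R in H. destruct H as [e [He H]].
  exists e. split; auto. intros y Hy Hd Hin. apply (H y Hd). apply in_in_remove; auto.
Qed.

Lemma exists_not_In_between (D : list R) (x y : R) : x < y -> exists z, x < z < y /\ ~ In z D.
Proof.
  intros Hxy. destruct (locally_punctured_not_In D x) as [e [He H]].
  exists (x + Rmin e (y - x) / 2).
  assert (0 < Rmin e (y - x)) by (apply Rmin_glb_lt; lra).
  assert (Rmin e (y - x) <= e) by apply Rmin_l. assert (Rmin e (y - x) <= y - x) by apply Rmin_r.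
  split; [lra|]. apply H; [lra|]. apply Rabs_def1; lra.
Qed.

Lemma list_upper_bound (D : list R) : exists X, forall x, X < x -> ~ In x D.
Proof.
  induction D as [|d D [X HX]].
  - exists 0. auto.
  - exists (Rmax d X). intros x Hx [E|E].
    + subst. pose proof (Rmax_l x X). lra.
    + pose proof (Rmax_r d X). apply (HX x); auto. lra.
Qed.

(** * Profiles and their energy *)

(* In terms of the paper, a and b are the detunings varpi_X and varpi_C, u and v are the
   envelopes phi_X and phi_C.  At a jump the value of u is normalised so that u ^ 2 is
   continuous there. *)
Record profile (a b gam g : R) (D : list R) (u u1 u2 v v1 : R -> R) : Prop := {
  pr_u : forall x, ~ In x D -> is_derive u x (u1 x);
  pr_u1 : forall x, ~ In x D -> is_derive u1 x (u2 x);
  pr_u2 : forall x, ~ In x D -> continuous u2 x;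
  pr_v : forall x, is_derive v x (v1 x);
  pr_v1 : forall x, ~ In x D -> is_derive v1 x (2 * (gam * u x - b * v x));
  pr_v1_cont : forall x, continuous v1 x;
  pr_alg : forall x, gam * v x = (a - g * u x ^ 2) * u x;
  pr_jump : forall d, In d D -> g * u d ^ 2 = a /\ u d <> 0 /\ continuous (fun x => u x ^ 2) d;
  pr_flip : forall d, In d D -> exists e, 0 < e /\
    forall x y, d - e < x < d -> d < y < d + e -> u x * u y < 0
}.

Arguments pr_u {a b gam g D u u1 u2 v v1}.
Arguments pr_u1 {a b gam g D u u1 u2 v v1}.
Arguments pr_u2 {a b gam g D u u1 u2 v v1}.
Arguments pr_v {a b gam g D u u1 u2 v v1}.
Arguments pr_v1 {a b gam g D u u1 u2 v v1}.
Arguments pr_v1_cont {a b gam g D u u1 u2 v v1}.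
Arguments pr_alg {a b gam g D u u1 u2 v v1}.
Arguments pr_jump {a b gam g D u u1 u2 v v1}.
Arguments pr_flip {a b gam g D u u1 u2 v v1}.

Lemma is_derive_reflect (f : R -> R) (x l : R) :
  is_derive f (- x) l -> is_derive (fun y => f (- y)) x (- l).
Proof.
  intros H. evar_last. apply (is_derive_comp f Ropp x l (-1)); [exact H|].
  - auto_derive; auto.
  - simpl. unfold scal; simpl; unfold mult; simpl. ring.
Qed.

Lemma is_derive_scal_flip (f : R -> R) (k c x l : R) :
  is_derive f (c - x) l -> is_derive (fun y => k * f (c - y)) x (- k * l).
Proof.
  intros H. evar_last.
  - apply (is_derive_scal (fun y => f (c - y)) x k (- l)). evar_last.
    + apply (is_derive_comp f (fun y => c - y) x l (-1)); [exact H|]. auto_derive; [exact I|simpl; ring].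
    + simpl. unfold scal; simpl; unfold mult; simpl. ring.
  - simpl. ring.
Qed.

Lemma continuous_reflect (f : R -> R) (x : R) : continuous f (- x) -> continuous (fun y => f (- y)) x.
Proof.
  intros H. apply (continuous_comp Ropp f); auto.
  apply (continuous_opp (V := R_NormedModule)). apply continuous_id.
Qed.

Lemma in_map_opp (D : list R) (x : R) : In x (map Ropp D) <-> In (- x) D.
Proof.
  rewrite in_map_iff. split.
  - intros [y [E H]]. subst. rewrite Ropp_involutive. auto.
  - intros H. exists (- x). split; auto. ring.
Qed.

(** Everything at minus infinity or to the left of a jump is obtained from its right-hand
    counterpart through this reflection. *)
Lemma profile_reflect a b gam g D u u1 u2 v v1 :
  profile a b gam g D u u1 u2 v v1 ->
  profile a b gam g (map Ropp D) (fun x => u (- x)) (fun x => - u1 (- x)) (fun x => u2 (- x))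
    (fun x => v (- x)) (fun x => - v1 (- x)).
Proof.
  intros P. constructor.
  - intros x Hx. rewrite in_map_opp in Hx. apply is_derive_reflect. apply (pr_u P); auto.
  - intros x Hx. rewrite in_map_opp in Hx.
    rewrite <- (Ropp_involutive (u2 (- x))). apply (is_derive_opp (V := R_NormedModule)).
    apply is_derive_reflect. apply (pr_u1 P); auto.
  - intros x Hx. rewrite in_map_opp in Hx. apply continuous_reflect.
    apply (pr_u2 P); auto.
  - intros x. apply is_derive_reflect. apply (pr_v P); auto.
  - intros x Hx. rewrite in_map_opp in Hx.
    rewrite <- (Ropp_involutive (2 * _)). apply (is_derive_opp (V := R_NormedModule)).
    apply is_derive_reflect. apply (pr_v1 P); auto.
  - intros x. apply (continuous_opp (V := R_NormedModule)). apply continuous_reflect.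
    apply (pr_v1_cont P).
  - intros x. apply (pr_alg P).
  - intros d Hd. rewrite in_map_opp in Hd. destruct (pr_jump P _ Hd) as [A [B C]].
    repeat split; auto. apply (continuous_reflect (fun x => u x ^ 2)). auto.
  - intros d Hd. rewrite in_map_opp in Hd. destruct (pr_flip P _ Hd) as [e [He H]].
    exists e. split; auto. intros x y Hx Hy. rewrite Rmult_comm. apply H; lra.
Qed.

(** What is left of the continuity of u at a jump; intermediate values are therefore sought for u ^
    2. *)
Lemma profile_sq_continuous a b gam g D u u1 u2 v v1 :
  profile a b gam g D u u1 u2 v v1 -> forall x, continuous (fun x => u x ^ 2) x.
Proof.
  intros P x. destruct (in_dec Req_dec_T x D) as [H|H].
  - apply (pr_jump P _ H).
  - pose proof (pr_u P x H). eapply is_derive_continuous. der. reflexivity.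
Qed.

Lemma profile_v1_eq a b gam g D u u1 u2 v v1 :
  profile a b gam g D u u1 u2 v v1 -> forall x, ~ In x D ->
  gam * v1 x = (a - 3 * g * u x ^ 2) * u1 x.
Proof.
  intros P x Hx. pose proof (pr_u P x Hx) as Du.
  pose proof (pr_v P x) as Dv.
  assert (A : is_derive (fun x => gam * v x) x (gam * v1 x)) by (der; ring).
  assert (B : is_derive (fun x => gam * v x) x ((a - 3 * g * u x ^ 2) * u1 x)).
  { apply is_derive_ext with (fun x => (a - g * u x ^ 2) * u x).
    - intros t. symmetry. apply (pr_alg P).
    - der. ring. }
  apply is_derive_unique in A. apply is_derive_unique in B. congruence.
Qed.

(** The derivative of [profile_v1_eq]. It is the substitute for the energy at points where
    [a = 3 g u ^ 2], since there the energy carries no information on u'. *)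
Lemma profile_second_order a b gam g D u u1 u2 v v1 :
  profile a b gam g D u u1 u2 v v1 -> forall x, ~ In x D ->
  - 6 * g * u x * u1 x ^ 2 + (a - 3 * g * u x ^ 2) * u2 x
  = 2 * u x * (gam ^ 2 - b * (a - g * u x ^ 2)).
Proof.
  intros P x Hx. pose proof (pr_u P x Hx) as Du.
  pose proof (pr_u1 P x Hx) as Du1.
  pose proof (pr_v1 P x Hx) as Dv1.
  pose proof (pr_alg P x) as Al.
  assert (A : is_derive (fun x => gam * v1 x) x (2 * u x * (gam ^ 2 - b * (a - g * u x ^ 2)))).
  { der. transitivity (2 * (gam ^ 2 * u x - b * (gam * v x))); [ring|rewrite Al; ring]. }
  assert (B : is_derive (fun x => gam * v1 x) x
     (- 6 * g * u x * u1 x ^ 2 + (a - 3 * g * u x ^ 2) * u2 x)).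
  { apply is_derive_ext_loc with (fun x => (a - 3 * g * u x ^ 2) * u1 x).
    - eapply filter_imp; [|apply (locally_not_In D x Hx)]. intros y Hy.
      symmetry. apply (profile_v1_eq _ _ _ _ _ _ _ _ _ _ P); auto.
    - der. ring. }
  apply is_derive_unique in A. apply is_derive_unique in B. congruence.
Qed.

(** Its derivative in s is [2 (a - 3 g s) (gam ^ 2 - b (a - g s))]. The critical points are thus the
    value where the cubic degenerates and the square of the nonzero far field. There is no constant
    term, so the far field 0 has E = 0. *)
Definition potential (a b gam g s : R) : R :=
  2 * gam ^ 2 * a * s - 3 * gam ^ 2 * g * s ^ 2 - 2 * b * s * (a - g * s) ^ 2.

(** Formulated with v' and u ^ 2, which are continuous across jumps; hence a single constant E
    serves all the intervals between jumps. *)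
Lemma profile_energy a b gam g D u u1 u2 v v1 :
  profile a b gam g D u u1 u2 v v1 ->
  exists E, forall x, gam ^ 2 * v1 x ^ 2 = potential a b gam g (u x ^ 2) + E.
Proof.
  intros P. set (f := fun x => gam ^ 2 * v1 x ^ 2 - potential a b gam g (u x ^ 2)).
  assert (Hc : forall x, continuous f x).
  { intros x. unfold f, potential.
    pose proof (pr_v1_cont P x) as C1.
    pose proof (profile_sq_continuous _ _ _ _ _ _ _ _ _ _ P x) as C2.
    apply (continuous_comp_2 v1 (fun x => u x ^ 2) (fun p s => gam ^ 2 * p ^ 2 -
      (2 * gam ^ 2 * a * s - 3 * gam ^ 2 * g * s ^ 2 - 2 * b * s * (a - g * s) ^ 2))); auto.
    apply (continuous_minus (V := R_NormedModule)).
    - apply (continuous_comp fst (fun p => gam ^ 2 * p ^ 2)); [apply continuous_fst|].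
      apply (ex_derive_continuous (V := R_NormedModule)). auto_derive. auto.
    - apply (continuous_comp snd (fun s => 2 * gam ^ 2 * a * s - 3 * gam ^ 2 * g * s ^ 2 -
        2 * b * s * (a - g * s) ^ 2)); [apply continuous_snd|].
      apply (ex_derive_continuous (V := R_NormedModule)). auto_derive. auto. }
  assert (Hd : forall x, ~ In x D -> is_derive f x 0).
  { intros x Hx. pose proof (pr_u P x Hx) as Du.
    pose proof (pr_v1 P x Hx) as Dv1.
    pose proof (pr_alg P x) as Al.
    pose proof (profile_v1_eq _ _ _ _ _ _ _ _ _ _ P x Hx) as W.
    unfold f, potential. der.
    transitivity (4 * ((gam * v1 x) * (gam ^ 2 * u x - b * (gam * v x))
      - (gam ^ 2 * u x - b * ((a - g * u x ^ 2) * u x)) * ((a - 3 * g * u x ^ 2) * u1 x))).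
    - ring.
    - rewrite W, Al. ring. }
  exists (f 0). intros x. assert (E : f x = f 0).
  { destruct (Rtotal_order x 0) as [H|[H|H]]; [|subst; auto|symmetry];
      apply (constant_of_derive_0_off D); auto. }
  rewrite <- E. unfold f. ring.
Qed.

Lemma profile_energy_slope a b gam g D u u1 u2 v v1 E :
  profile a b gam g D u u1 u2 v v1 ->
  (forall x, gam ^ 2 * v1 x ^ 2 = potential a b gam g (u x ^ 2) + E) ->
  forall x, ~ In x D ->
  ((a - 3 * g * u x ^ 2) * u1 x) ^ 2 = potential a b gam g (u x ^ 2) + E.
Proof.
  intros P HE x Hx. rewrite <- (HE x), <- (profile_v1_eq _ _ _ _ _ _ _ _ _ _ P x Hx). ring.
Qed.

Lemma profile_v_zero a b gam g D u u1 u2 v v1 (hgam : gam <> 0) :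
  profile a b gam g D u u1 u2 v v1 -> (forall x, v x = 0) -> forall x, ~ In x D -> u x = 0.
Proof.
  intros P H x Hx.
  assert (H1 : forall y, v1 y = 0).
  { intros y. pose proof (pr_v P y) as Dv. apply is_derive_unique in Dv.
    rewrite <- Dv. rewrite (Derive_ext v (fun _ => 0)) by auto. apply Derive_const. }
  pose proof (pr_v1 P x Hx) as Dv. apply is_derive_unique in Dv.
  rewrite (Derive_ext v1 (fun _ => 0)) in Dv by auto. rewrite Derive_const, H in Dv.
  apply (Rmult_eq_reg_l gam); auto. lra.
Qed.

(** If a = 0, then [g u d ^ 2 = a] forces g = 0, the cubic gives v = 0, and u vanishes off D,
    against the change of sign at d. *)
Lemma profile_jump_detuning a b gam g D u u1 u2 v v1 (hgam : gam <> 0) d :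
  profile a b gam g D u u1 u2 v v1 -> In d D -> a <> 0 /\ 0 < a * g.
Proof.
  intros P Hd. destruct (pr_jump P _ Hd) as [J1 [J2 _]].
  assert (Ha : a <> 0).
  { intros Ha. assert (Hg : g = 0).
    { rewrite Ha in J1. apply Rmult_integral in J1. destruct J1 as [J|J]; auto.
      exfalso. apply J2. nra. }
    destruct (pr_flip P _ Hd) as [e [He H]].
    destruct (exists_not_In_between D d (d + e)) as [y [Hy Hn]]; [lra|].
    assert (u y = 0).
    { apply (profile_v_zero _ _ _ _ _ _ _ _ _ _ hgam P); auto. intros x.
      pose proof (pr_alg P x) as Al. rewrite Ha, Hg in Al.
      apply (Rmult_eq_reg_l gam); auto. lra. }
    specialize (H (d - e / 2) y ltac:(lra) ltac:(lra)). rewrite H0 in H. lra. }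
  split; auto. rewrite <- J1 in *. assert (0 < u d ^ 2) by nra.
  assert (g <> 0) by (intro; subst; apply Ha; ring). nra.
Qed.

Lemma is_lim_continuous_comp (f u : R -> R) (x : Rbar) (l : R) :
  is_lim u x l -> continuous f l -> is_lim (fun y => f (u y)) x (f l).
Proof. intros H C. apply (is_lim_comp_continuous u f x l H C). Qed.

Lemma is_lim_p_infty_ext (f h : R -> R) (X l : R) :
  (forall x, X < x -> f x = h x) -> is_lim f p_infty l -> is_lim h p_infty l.
Proof. intros E. apply is_lim_ext_loc. exists X. auto. Qed.

(** Through the cubic, v and v'' converge together with u, so [derivatives_vanish_at_infinity] sends
    v' and v'' to 0. The two conclusions are the limits of the equation for v'' and of the
    energy. *)
Lemma profile_far_right a b gam g D u u1 u2 v v1 E (l : R) (hgam : gam <> 0) :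
  profile a b gam g D u u1 u2 v v1 ->
  (forall x, gam ^ 2 * v1 x ^ 2 = potential a b gam g (u x ^ 2) + E) ->
  is_lim u p_infty l ->
  l * (gam ^ 2 - b * (a - g * l ^ 2)) = 0 /\ potential a b gam g (l ^ 2) + E = 0.
Proof.
  intros P HE Hl. destruct (list_upper_bound D) as [X HX].
  set (vl := / gam * ((a - g * l ^ 2) * l)).
  assert (Hv : is_lim v p_infty vl).
  { apply is_lim_p_infty_ext with (fun x => / gam * ((a - g * u x ^ 2) * u x)) 0.
    - intros x _. rewrite <- (pr_alg P x). field; auto.
    - apply (is_lim_continuous_comp (fun z => / gam * ((a - g * z ^ 2) * z))); auto.
      apply (ex_derive_continuous (V := R_NormedModule)). auto_derive. auto. }
  assert (Hv2 : is_lim (fun x => 2 * (gam * u x - b * v x)) p_infty (2 * (gam * l - b * vl))).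
  { apply is_lim_p_infty_ext with
      (fun x => 2 * (gam * u x - b * (/ gam * ((a - g * u x ^ 2) * u x)))) 0.
    - intros x _. rewrite <- (pr_alg P x). field; auto.
    - apply (is_lim_continuous_comp (fun z => 2 * (gam * z - b * (/ gam * ((a - g * z ^ 2) * z))))); auto.
      apply (ex_derive_continuous (V := R_NormedModule)). auto_derive. auto. }
  destruct (derivatives_vanish_at_infinity v v1 (fun x => 2 * (gam * u x - b * v x)) X vl
     (2 * (gam * l - b * vl))) as [L0 L1]; auto.
  - intros x _. apply (pr_v P).
  - intros x Hx. apply (pr_v1 P). auto.
  - split.
    + unfold vl in L0. transitivity (gam * (gam * l - b * (/ gam * ((a - g * l ^ 2) * l)))).
      * field. auto.
      * replace (gam * l - b * (/ gam * ((a - g * l ^ 2) * l))) with 0 by lra. ring.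
    + assert (A : is_lim (fun x => gam ^ 2 * v1 x ^ 2) p_infty (gam ^ 2 * 0 ^ 2)).
      { apply (is_lim_continuous_comp (fun z => gam ^ 2 * z ^ 2)); auto.
        apply (ex_derive_continuous (V := R_NormedModule)). auto_derive. auto. }
      assert (B : is_lim (fun x => gam ^ 2 * v1 x ^ 2) p_infty (potential a b gam g (l ^ 2) + E)).
      { apply is_lim_p_infty_ext with (fun x => potential a b gam g (u x ^ 2) + E) 0.
        - intros x _. auto.
        - apply (is_lim_continuous_comp (fun z => potential a b gam g (z ^ 2) + E)); auto.
          apply (ex_derive_continuous (V := R_NormedModule)). unfold potential. auto_derive. auto. }
      apply is_lim_unique in A. apply is_lim_unique in B. rewrite A in B.
      apply (f_equal real) in B.
      change (gam ^ 2 * 0 ^ 2 = potential a b gam g (l ^ 2) + E) in B. rewrite <- B. ring.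
Qed.

Lemma profile_far_left a b gam g D u u1 u2 v v1 E (l : R) (hgam : gam <> 0) :
  profile a b gam g D u u1 u2 v v1 ->
  (forall x, gam ^ 2 * v1 x ^ 2 = potential a b gam g (u x ^ 2) + E) ->
  is_lim u m_infty l ->
  l * (gam ^ 2 - b * (a - g * l ^ 2)) = 0 /\ potential a b gam g (l ^ 2) + E = 0.
Proof.
  intros P HE Hl. apply profile_reflect in P.
  apply (profile_far_right _ _ _ _ _ _ _ _ _ _ E l hgam P).
  - intros x. rewrite <- HE. ring.
  - apply is_lim_opp_arg. exact Hl.
Qed.

(** Near x0 the energy gives [|(a - 3 g u ^ 2) u'| <= |C| |u - u x0|], and the factor keeps at least
    half of its modulus at x0, so [gronwall_local] applies. *)
Lemma profile_equilibrium_locally a b gam g D u u1 u2 v v1 E C x0 :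
  profile a b gam g D u u1 u2 v v1 ->
  (forall x, gam ^ 2 * v1 x ^ 2 = potential a b gam g (u x ^ 2) + E) ->
  ~ In x0 D -> a - 3 * g * u x0 ^ 2 <> 0 ->
  (forall z, Rabs (z - u x0) < 1 -> potential a b gam g (z ^ 2) + E <= C ^ 2 * (z - u x0) ^ 2) ->
  locally x0 (fun x => u x = u x0).
Proof.
  intros P HE Hx0 HD HC.
  set (m := Rabs (a - 3 * g * u x0 ^ 2) / 2).
  assert (Hm : 0 < m) by (unfold m; apply Rdiv_lt_0_compat; [apply Rabs_pos_lt; auto|lra]).
  assert (Cu : continuous u x0).
  { eapply is_derive_continuous. apply (pr_u P x0 Hx0). }
  assert (CD : continuous (fun x => a - 3 * g * u x ^ 2) x0).
  { pose proof (pr_u P x0 Hx0).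
    eapply is_derive_continuous. der. reflexivity. }
  destruct (proj1 (continuous_R _ _) Cu 1 ltac:(lra)) as [d1 [Hd1 H1]].
  destruct (proj1 (continuous_R _ _) CD m Hm) as [d2 [Hd2 H2]].
  destruct (proj1 (locally_R _ _) (locally_not_In D x0 Hx0)) as [d3 [Hd3 H3]].
  set (e := Rmin d1 (Rmin d2 d3)).
  assert (He : 0 < e) by (unfold e; repeat apply Rmin_glb_lt; auto).
  assert (e <= d1) by apply Rmin_l.
  assert (e <= d2) by (unfold e; eapply Rle_trans; [apply Rmin_r|apply Rmin_l]).
  assert (e <= d3) by (unfold e; eapply Rle_trans; [apply Rmin_r|apply Rmin_r]).
  apply locally_R. exists e. split; auto.
  apply (gronwall_local u u1 x0 e (Rabs C / m) He).
  - intros x Hx. apply (pr_u P). apply H3. lra.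
  - intros x Hx. specialize (H1 x ltac:(lra)). specialize (H2 x ltac:(lra)).
    specialize (H3 x ltac:(lra)). specialize (HC (u x) H1).
    rewrite <- (profile_energy_slope _ _ _ _ _ _ _ _ _ _ E P HE x H3) in HC.
    assert (HS : Rabs ((a - 3 * g * u x ^ 2) * u1 x) <= Rabs (C * (u x - u x0))).
    { apply Rsqr_le_abs_0. unfold Rsqr. nra. }
    rewrite !Rabs_mult in HS.
    assert (HmD : m <= Rabs (a - 3 * g * u x ^ 2)).
    { pose proof (Rabs_triang_inv (a - 3 * g * u x0 ^ 2) (a - 3 * g * u x0 ^ 2 - (a - 3 * g * u x ^ 2))).
      replace (a - 3 * g * u x0 ^ 2 - (a - 3 * g * u x0 ^ 2 - (a - 3 * g * u x ^ 2)))
        with (a - 3 * g * u x ^ 2) in * by ring.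
      rewrite Rabs_minus_sym in H2.
      unfold m in *. lra. }
    pose proof (Rabs_pos (u1 x)).
    apply Rmult_le_reg_l with m; auto.
    replace (m * (Rabs C / m * Rabs (u x - u x0))) with (Rabs C * Rabs (u x - u x0)) by (field; lra).
    nra.
Qed.

(** The set where u ^ 2 = s0 is open by the local lemma and closed by continuity. The argument
    starts with u ^ 2 because u may still jump; once D is known to be empty it is repeated for u. *)
Lemma profile_equilibrium_global a b gam g D u u1 u2 v v1 E s0 :
  profile a b gam g D u u1 u2 v v1 ->
  (forall x, gam ^ 2 * v1 x ^ 2 = potential a b gam g (u x ^ 2) + E) ->
  (forall d, In d D -> u d ^ 2 <> s0) -> a - 3 * g * s0 <> 0 ->
  (forall z0, z0 ^ 2 = s0 -> exists C, forall z, Rabs (z - z0) < 1 ->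
     potential a b gam g (z ^ 2) + E <= C ^ 2 * (z - z0) ^ 2) ->
  forall x0, u x0 ^ 2 = s0 -> D = nil /\ is_constant u.
Proof.
  intros P HE HJ HD HC x0 Hx0.
  assert (H : forall x, u x ^ 2 = s0).
  { apply (constant_of_locally_constant _ x0); auto.
    - intros x Hx. destruct (HC (u x) Hx) as [C HC'].
      assert (Hn : ~ In x D) by (intro Hin; apply (HJ x Hin); auto).
      assert (HD' : a - 3 * g * u x ^ 2 <> 0) by (rewrite Hx; auto).
      generalize (profile_equilibrium_locally _ _ _ _ _ _ _ _ _ _ E C x P HE Hn HD' HC').
      apply filter_imp. intros y Hy. rewrite Hy. auto.
    - intros x Hx. pose proof (profile_sq_continuous _ _ _ _ _ _ _ _ _ _ P x) as Cs.
      destruct (proj1 (continuous_R _ _) Cs (Rabs (u x ^ 2 - s0))) as [d [Hd Hy]].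
      + apply Rabs_pos_lt. lra.
      + apply locally_R. exists d. split; auto. intros y Hyd Ey. specialize (Hy y Hyd).
        rewrite Ey, Rabs_minus_sym in Hy. lra. }
  assert (N : D = nil).
  { destruct D as [|d D]; auto. exfalso. apply (HJ d); [left; auto|auto]. }
  split; auto. subst D. exists (u 0).
  apply (constant_of_locally_constant _ 0); auto.
  - intros x Hx. assert (Hs := H x). destruct (HC (u x) Hs) as [C HC'].
    assert (HD' : a - 3 * g * u x ^ 2 <> 0) by (rewrite Hs; auto).
    generalize (profile_equilibrium_locally _ _ _ _ _ _ _ _ _ _ E C x P HE (fun z => z) HD' HC').
    apply filter_imp. intros y Hy. rewrite Hy. auto.
  - intros x Hx. pose proof (pr_u P x (fun z => z)) as Du.
    apply is_derive_continuous in Du.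
    destruct (proj1 (continuous_R _ _) Du (Rabs (u x - u 0))) as [d [Hd Hy]].
    + apply Rabs_pos_lt. lra.
    + apply locally_R. exists d. split; auto. intros y Hyd Ey. specialize (Hy y Hyd).
      rewrite Ey, Rabs_minus_sym in Hy. lra.
Qed.

(** Gronwall is applied to v and v', whose data at the jump are limits. The Lipschitz hypothesis
    recovers u from v, which the cubic alone does not do, as it can have three preimages. *)
Lemma envelope_unique_right (gam b c L : R) (u v w u' v' w' : R -> R) :
  0 <= L ->
  (forall x, c < x -> is_derive v x (w x)) ->
  (forall x, c < x -> is_derive w x (2 * (gam * u x - b * v x))) ->
  (forall x, c < x -> is_derive v' x (w' x)) ->
  (forall x, c < x -> is_derive w' x (2 * (gam * u' x - b * v' x))) ->
  (forall x, c < x -> Rabs (u x - u' x) <= L * Rabs (v x - v' x)) ->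
  (forall e, 0 < e -> exists d, 0 < d /\ forall x, c < x < c + d ->
     Rabs (v x - v' x) < e /\ Rabs (w x - w' x) < e) ->
  forall x, c < x -> u x = u' x.
Proof.
  intros HL Hv Hw Hv' Hw' HLip H0 x Hx.
  set (M := Rabs gam * L + Rabs b).
  assert (HM : 0 <= M) by (unfold M; pose proof (Rabs_pos gam); pose proof (Rabs_pos b); nra).
  assert (N : (v x - v' x) ^ 2 + (w x - w' x) ^ 2 <= 0).
  { apply (gronwall_right (fun x => (v x - v' x) ^ 2 + (w x - w' x) ^ 2)
      (fun x => 2 * (v x - v' x) * (w x - w' x) +
        2 * (w x - w' x) * (2 * (gam * (u x - u' x) - b * (v x - v' x)))) c (1 + 2 * M)); auto.
    - intros y Hy. specialize (Hv y Hy). specialize (Hw y Hy). specialize (Hv' y Hy).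
      specialize (Hw' y Hy). der. ring.
    - intros y Hy. specialize (HLip y Hy). set (p := v y - v' y) in *. set (q := w y - w' y) in *.
      set (r := gam * (u y - u' y) - b * p).
      assert (Hr : Rabs r <= M * Rabs p).
      { unfold r, M. eapply Rle_trans; [apply Rabs_triang|]. rewrite Rabs_Ropp, !Rabs_mult.
        pose proof (Rabs_pos gam). nra. }
      assert (q * r <= M * (Rabs p * Rabs q)).
      { eapply Rle_trans; [apply Rle_abs|]. rewrite Rabs_mult. pose proof (Rabs_pos q). nra. }
      assert (2 * (Rabs p * Rabs q) <= p ^ 2 + q ^ 2).
      { rewrite <- (pow2_abs p), <- (pow2_abs q). pose proof (pow2_ge_0 (Rabs p - Rabs q)). lra. }
      assert (2 * p * q <= p ^ 2 + q ^ 2) by (pose proof (pow2_ge_0 (p - q)); lra).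
      clearbody p q. unfold r in *. nra.
    - intros e He. destruct (H0 (Rmin 1 (e / 2))) as [d [Hd H]]; [apply Rmin_glb_lt; lra|].
      exists d. split; auto. intros y Hy. destruct (H y Hy) as [A B].
      assert (Rmin 1 (e / 2) <= 1) by apply Rmin_l.
      assert (Rmin 1 (e / 2) <= e / 2) by apply Rmin_r.
      rewrite <- (pow2_abs (v y - v' y)), <- (pow2_abs (w y - w' y)).
      pose proof (Rabs_pos (v y - v' y)). pose proof (Rabs_pos (w y - w' y)). nra. }
  specialize (HLip x Hx). assert (E : v x - v' x = 0).
  { pose proof (pow2_ge_0 (v x - v' x)). pose proof (pow2_ge_0 (w x - w' x)).
    apply Rsqr_eq_0. unfold Rsqr. lra. }
  rewrite E, Rabs_R0, Rmult_0_r in HLip. pose proof (Rabs_pos (u x - u' x)).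
  assert (u x - u' x = 0); [|lra].
  destruct (Req_dec (u x - u' x) 0) as [|Hn]; auto. apply Rabs_pos_lt in Hn. lra.
Qed.

(** [gam (vp - vq) = (p - q) (a - g t)] with t = p ^ 2 + p q + q ^ 2. If t lies in [3 lo, 3 hi], the
    second factor lies between the values [a - 3 g lo] and [a - 3 g hi], which have the same sign.
    The lower bound on t is automatic for lo = 0; otherwise it needs p and q of the same sign. *)
Lemma cubic_inverse_lipschitz (a gam g lo hi : R) :
  gam <> 0 -> 0 <= lo <= hi -> 0 < (a - 3 * g * lo) * (a - 3 * g * hi) ->
  exists L, 0 <= L /\ forall p q vp vq,
    gam * vp = (a - g * p ^ 2) * p -> gam * vq = (a - g * q ^ 2) * q ->
    lo <= p ^ 2 <= hi -> lo <= q ^ 2 <= hi -> (lo = 0 \/ 0 <= p * q) ->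
    Rabs (p - q) <= L * Rabs (vp - vq).
Proof.
  intros hgam Hlo HD. set (A := a - 3 * g * lo) in *. set (B := a - 3 * g * hi) in *.
  set (m := Rmin (Rabs A) (Rabs B)).
  assert (Hm : 0 < m).
  { unfold m. apply Rmin_glb_lt; apply Rabs_pos_lt; intro Z; rewrite Z in HD; lra. }
  exists (Rabs gam / m). split.
  { apply Rdiv_le_0_compat; auto. apply Rabs_pos. }
  intros p q vp vq Hp Hq Hp2 Hq2 Hs.
  set (t := p ^ 2 + p * q + q ^ 2).
  assert (Ht : 3 * lo <= t <= 3 * hi).
  { unfold t. split; [|nra]. destruct Hs as [Hs|Hs]; [subst; nra|].
    assert (lo * lo <= p ^ 2 * q ^ 2) by (apply Rmult_le_compat; lra).
    assert (lo <= p * q) by (destruct (Rle_dec lo (p * q)); auto; nra). nra. }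
  assert (Hd : m <= Rabs (a - g * t)).
  { assert (mA : m <= Rabs A) by apply Rmin_l. assert (mB : m <= Rabs B) by apply Rmin_r.
    destruct (Rlt_dec 0 A) as [PA|PA].
    - assert (PB : 0 < B) by nra. rewrite Rabs_pos_eq in mA by lra. rewrite Rabs_pos_eq in mB by lra.
      apply Rle_trans with (a - g * t); [|apply Rle_abs]. unfold A, B in *. destruct (Rle_dec 0 g); nra.
    - assert (PB : B < 0) by nra. assert (PA' : A < 0) by nra.
      rewrite Rabs_left in mA by lra. rewrite Rabs_left in mB by lra.
      rewrite <- Rabs_Ropp. apply Rle_trans with (- (a - g * t)); [|apply Rle_abs].
      unfold A, B in *. destruct (Rle_dec 0 g); nra. }
  assert (E : gam * (vp - vq) = (p - q) * (a - g * t)) by (unfold t; nra).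
  assert (E' : Rabs gam * Rabs (vp - vq) = Rabs (p - q) * Rabs (a - g * t)).
  { rewrite <- !Rabs_mult. f_equal. exact E. }
  apply Rmult_le_reg_l with m; auto.
  replace (m * (Rabs gam / m * Rabs (vp - vq))) with (Rabs gam * Rabs (vp - vq)) by (field; lra).
  rewrite E'. pose proof (Rabs_pos (p - q)). nra.
Qed.

(* Reflection in x0, combined with u -> eps u: eps = 1 for bright solitons, eps = -1 for dark
   and discontinuous ones. *)
Lemma profile_symmetric a b gam g D u u1 u2 v v1 (hgam : gam <> 0) eps x0 lo hi :
  profile a b gam g D u u1 u2 v v1 -> eps = 1 \/ eps = - 1 ->
  (forall d, In d D -> d = x0) ->
  (eps = 1 -> v1 x0 = 0) -> (eps = - 1 -> v x0 = 0) ->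
  0 <= lo <= hi -> 0 < (a - 3 * g * lo) * (a - 3 * g * hi) ->
  (forall x, x <> x0 -> lo <= u x ^ 2 <= hi) ->
  (lo = 0 \/ forall y, 0 < y -> 0 <= u (x0 + y) * (eps * u (x0 - y))) ->
  forall y, y <> 0 -> u (x0 + y) = eps * u (x0 - y).
Proof.
  intros P Heps HDx H1 H2 Hlo HDD Hs Hsign.
  assert (e2 : eps * eps = 1) by (destruct Heps; subst; ring).
  destruct (cubic_inverse_lipschitz a gam g lo hi hgam Hlo HDD) as [L [HL Lip]].
  assert (HnD : forall x, x <> x0 -> ~ In x D) by (intros x Hx Hin; apply Hx; auto).
  assert (R : forall y, 0 < y -> u (x0 + y) = eps * u (x0 - y)).
  { intros y Hy.
    assert (T := envelope_unique_right gam b x0 L u v v1 (fun x => eps * u (2 * x0 - x))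
      (fun x => eps * v (2 * x0 - x)) (fun x => - eps * v1 (2 * x0 - x)) HL).
    replace (x0 - y) with (2 * x0 - (x0 + y)) by ring. apply T; try lra; clear T.
    - intros x _. apply (pr_v P).
    - intros x Hx. apply (pr_v1 P). apply HnD. lra.
    - intros x _. apply is_derive_scal_flip. apply (pr_v P).
    - intros x Hx. assert (Hn : ~ In (2 * x0 - x) D) by (apply HnD; lra).
      evar_last; [apply (is_derive_scal_flip v1); apply (pr_v1 P _ Hn)|ring].
    - intros x Hx. apply Lip.
      + apply (pr_alg P).
      + pose proof (pr_alg P (2 * x0 - x)) as Al.
        replace (gam * (eps * v (2 * x0 - x))) with (eps * (gam * v (2 * x0 - x))) by ring.
        rewrite Al. replace ((eps * u (2 * x0 - x)) ^ 2) with ((eps * eps) * u (2 * x0 - x) ^ 2) by ring.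
        rewrite e2. ring.
      + apply Hs. lra.
      + replace ((eps * u (2 * x0 - x)) ^ 2) with ((eps * eps) * u (2 * x0 - x) ^ 2) by ring.
        rewrite e2, Rmult_1_l. apply Hs. lra.
      + destruct Hsign as [Z|Z]; [left; auto|right]. specialize (Z (x - x0) ltac:(lra)).
        replace (x0 + (x - x0)) with x in Z by ring.
        replace (x0 - (x - x0)) with (2 * x0 - x) in Z by ring. auto.
    - intros e He.
      assert (C1 : continuous (fun x => v x - eps * v (2 * x0 - x)) x0).
      { apply (continuous_minus (V := R_NormedModule)); eapply is_derive_continuous.
        - apply (pr_v P).
        - apply is_derive_scal_flip. apply (pr_v P). }
      assert (C2 : continuous (fun x => v1 x - (- eps * v1 (2 * x0 - x))) x0).
      { apply (continuous_minus (V := R_NormedModule)).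
        - apply (pr_v1_cont P).
        - apply (continuous_scal_r (V := R_NormedModule) (- eps)).
          apply (continuous_comp (fun x => 2 * x0 - x) v1).
          + eapply is_derive_continuous. der. reflexivity.
          + apply (pr_v1_cont P). }
      destruct (proj1 (continuous_R _ _) C1 e He) as [d1 [Hd1 K1]].
      destruct (proj1 (continuous_R _ _) C2 e He) as [d2 [Hd2 K2]].
      exists (Rmin d1 d2). split; [apply Rmin_glb_lt; auto|]. intros x Hx.
      assert (Rmin d1 d2 <= d1) by apply Rmin_l. assert (Rmin d1 d2 <= d2) by apply Rmin_r.
      specialize (K1 x ltac:(apply Rabs_def1; lra)). specialize (K2 x ltac:(apply Rabs_def1; lra)).
      cbv beta in K1, K2. replace (2 * x0 - x0) with x0 in K1, K2 by ring.
      replace (v x0 - eps * v x0) with 0 in K1.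
      2:{ destruct Heps as [Z|Z]; [rewrite Z; ring|]. rewrite (H2 Z). ring. }
      replace (v1 x0 - - eps * v1 x0) with 0 in K2.
      2:{ destruct Heps as [Z|Z]; [rewrite (H1 Z); ring|]. rewrite Z; ring. }
      rewrite Rminus_0_r in K1, K2. auto. }
  intros y Hy. destruct (Rlt_dec 0 y) as [H|H]; [auto|].
  specialize (R (- y) ltac:(lra)). replace (x0 + - y) with (x0 - y) in R by ring.
  replace (x0 - - y) with (x0 + y) in R by ring. rewrite R, <- Rmult_assoc, e2. ring.
Qed.

(** * Classification of profiles *)

(** For the far field 0 the energy equation reads [((a - 3 q) u') ^ 2 = u ^ 2 * bright_factor q]
    with [q = g u ^ 2], so the roots of this quadratic are the possible turning points. *)
Definition bright_factor (a b gam q : R) : R :=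
  2 * gam ^ 2 * a - 3 * gam ^ 2 * q - 2 * b * (a - q) ^ 2.

Lemma potential_bright a b gam g s : potential a b gam g s = s * bright_factor a b gam (g * s).
Proof. unfold potential, bright_factor. ring. Qed.

(** The double zero at [l ^ 2] expresses that l is an equilibrium. At the third zero, [a - 3 g s]
    equals [- (a - 3 g l ^ 2) / 2]: a profile could turn there only after this factor has changed
    sign, which is how turning points are excluded below. *)
Lemma potential_nonzero_far_field a b gam g E l s :
  gam ^ 2 = b * (a - g * l ^ 2) -> potential a b gam g (l ^ 2) + E = 0 ->
  potential a b gam g s + E = - b * g * (s - l ^ 2) ^ 2 * (2 * g * s - a + g * l ^ 2).
Proof.
  intros H1 H2. replace E with (- potential a b gam g (l ^ 2)) by lra.
  unfold potential. rewrite H1. ring.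
Qed.

Lemma quadratic_bound (F h : R -> R) (z0 : R) :
  (forall z, continuous h z) -> (forall z, F z = h z * (z - z0) ^ 2) ->
  exists C, forall z, Rabs (z - z0) < 1 -> F z <= C ^ 2 * (z - z0) ^ 2.
Proof.
  intros Hc HF. destruct (continuity_ab_maj h (z0 - 1) (z0 + 1)) as [M [HM _]]; [lra| |].
  - intros c _. apply continuous_continuity_pt. auto.
  - exists (1 + Rabs (h M)). intros z Hz. apply Rabs_def2 in Hz. rewrite HF.
    specialize (HM z ltac:(lra)). pose proof (Rle_abs (h M)). pose proof (Rabs_pos (h M)).
    apply Rmult_le_compat_r; [apply pow2_ge_0|]. nra.
Qed.

Lemma is_constant_of_derive_0 (f f1 : R -> R) :
  (forall x, is_derive f x (f1 x)) -> (forall x, f1 x = 0) -> is_constant f.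
Proof.
  intros Hd H0. exists (f 0). intros x.
  assert (Hd' : forall z, is_derive f z 0) by (intros z; rewrite <- (H0 z); auto).
  destruct (Rtotal_order x 0) as [H|[H|H]]; [|subst; auto|symmetry];
    apply (constant_of_derive_0_off nil); auto; intros z _; apply is_derive_continuous with 0; auto.
Qed.

Lemma is_lim_sq (u : R -> R) (x : Rbar) (l : R) :
  is_lim u x l -> is_lim (fun y => u y ^ 2) x (l ^ 2).
Proof.
  intros H. apply (is_lim_continuous_comp (fun z => z ^ 2)); auto.
  apply (ex_derive_continuous (V := R_NormedModule)). auto_derive. auto.
Qed.

Lemma profile_nil a b gam g u u1 u2 v v1 :
  profile a b gam g nil u u1 u2 v v1 ->
  (forall x, is_derive u x (u1 x)) /\ (forall x, is_derive u1 x (u2 x)) /\ (forall x, continuous u2 x).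
Proof.
  intros P. split; [|split]; intros x.
  - apply (pr_u P). auto.
  - apply (pr_u1 P). auto.
  - apply (pr_u2 P). auto.
Qed.

(** The square makes it irrelevant on which side of c the function lies. *)
Lemma zero_slope_at_max_of_sq (u u1 : R -> R) (c x0 : R) :
  is_derive u x0 (u1 x0) -> u x0 <> c ->
  (forall x, (u x - c) ^ 2 <= (u x0 - c) ^ 2) -> u1 x0 = 0.
Proof.
  intros Hd Hn Hm. apply (Rmult_eq_reg_l (2 * (u x0 - c))); [|lra].
  rewrite Rmult_0_r.
  apply (derive_0_at_max (fun x => (u x - c) ^ 2) x0 (2 * (u x0 - c) * u1 x0) 1); auto; [lra|].
  der. ring.
Qed.

(** For g = 0 the potential is [2 a (gam ^ 2 - a b) s]. If it vanishes identically, then a u' = 0,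
    and a = 0 gives v = 0. Otherwise both far fields are 0, and at a maximum of u ^ 2 the energy
    would force u = 0. *)
Lemma profile_linear_constant a b gam u u1 u2 v v1 D lp lm (hgam : gam <> 0) :
  profile a b gam 0 D u u1 u2 v v1 -> is_lim u p_infty (Finite lp) -> is_lim u m_infty (Finite lm) ->
  D = nil /\ is_constant u.
Proof.
  intros P Hp Hm.
  assert (N : D = nil).
  { destruct D as [|d D]; auto. exfalso.
    destruct (profile_jump_detuning _ _ _ _ _ _ _ _ _ _ hgam d P (or_introl eq_refl)) as [_ H]. lra. }
  subst D. split; auto. destruct (profile_nil _ _ _ _ _ _ _ _ _ P) as [Du _].
  destruct (profile_energy _ _ _ _ _ _ _ _ _ _ P) as [E HE].
  destruct (profile_far_right _ _ _ _ _ _ _ _ _ _ E lp hgam P HE Hp) as [P1 P2].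
  destruct (profile_far_left _ _ _ _ _ _ _ _ _ _ E lm hgam P HE Hm) as [M1 M2].
  pose proof (fun x => profile_energy_slope _ _ _ _ _ _ _ _ _ _ E P HE x (fun z => z)) as S.
  destruct (Req_dec a 0) as [Ha|Ha].
  { exists 0. intros x. apply (profile_v_zero _ _ _ _ _ _ _ _ _ _ hgam P); auto.
    intros y. pose proof (pr_alg P y) as Al. rewrite Ha in Al.
    apply (Rmult_eq_reg_l gam); auto. lra. }
  assert (E0 : E = 0).
  { unfold potential in P2. assert (2 * a * lp * (lp * (gam ^ 2 - b * (a - 0 * lp ^ 2))) = 0).
    { rewrite P1. ring. } nra. }
  destruct (Req_dec (gam ^ 2) (a * b)) as [Hab|Hab].
  - apply (is_constant_of_derive_0 u u1 Du). intros x. specialize (S x).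
    rewrite E0 in S. unfold potential in S. rewrite Hab in S.
    assert (Z : (a * u1 x) ^ 2 = 0) by (rewrite <- Rplus_0_r; nra).
    apply (Rmult_eq_reg_l a); auto. rewrite Rmult_0_r. apply Rsqr_0_uniq. unfold Rsqr. lra.
  - assert (Lp : lp = 0).
    { apply Rmult_integral in P1. destruct P1 as [P1|P1]; auto. exfalso. apply Hab. lra. }
    assert (Lm : lm = 0).
    { apply Rmult_integral in M1. destruct M1 as [M1|M1]; auto. exfalso. apply Hab. lra. }
    subst lp lm. exists 0. intros x1. destruct (Req_dec (u x1) 0) as [H|H]; auto. exfalso.
    destruct (exists_max_of_vanishing (fun x => u x ^ 2) x1) as [x0 [X1 X2]].
    + apply (profile_sq_continuous _ _ _ _ _ _ _ _ _ _ P).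
    + apply is_lim_sq in Hp. replace (0 ^ 2) with 0 in Hp by ring. exact Hp.
    + apply is_lim_sq in Hm. replace (0 ^ 2) with 0 in Hm by ring. exact Hm.
    + apply pow2_gt_0; auto.
    + assert (Z : u1 x0 = 0).
      { apply (zero_slope_at_max_of_sq u u1 0); auto.
        - intro Z. rewrite Z in X1. lra.
        - intros x. rewrite !Rminus_0_r. auto. }
      specialize (S x0). rewrite Z, E0 in S. unfold potential in S.
      assert (Q : 2 * a * (gam ^ 2 - a * b) * u x0 ^ 2 = 0) by (rewrite <- Rplus_0_r; nra).
      apply Rmult_integral in Q. destruct Q as [Q|Q]; [|lra].
      apply Rmult_integral in Q. destruct Q as [Q|Q]; lra.
Qed.

(** For relations that hold only where a degenerate condition P fails: at a point approached by such
    places they persist by continuity, and in the interior of P the functions involved are locally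
    constant. *)
Lemma accumulation_or_interior (P : R -> Prop) (x : R) :
  (forall e, 0 < e -> exists y, Rabs (y - x) < e /\ ~ P y) \/ locally x P.
Proof.
  destruct (classic (locally x P)) as [H|H]; [right; auto|left].
  intros e He. apply NNPP. intro C. apply H. apply locally_R. exists e. split; auto.
  intros y Hy. apply NNPP. intro Hn. apply C. exists y. auto.
Qed.

Lemma continuous_value_at_accumulation (f : R -> R) (P : R -> Prop) (x c : R) :
  continuous f x -> (forall e, 0 < e -> exists y, Rabs (y - x) < e /\ ~ P y) ->
  locally x (fun y => ~ P y -> f y = c) -> f x = c.
Proof.
  intros Hc Ha Hl. destruct (Req_dec (f x) c) as [H|H]; auto. exfalso.
  destruct (proj1 (continuous_R _ _) Hc (Rabs (f x - c))) as [d [Hd H1]].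
  { apply Rabs_pos_lt. lra. }
  apply locally_R in Hl. destruct Hl as [d' [Hd' H2]].
  destruct (Ha (Rmin d d')) as [y [Hy HP]]; [apply Rmin_glb_lt; auto|].
  assert (Rmin d d' <= d) by apply Rmin_l. assert (Rmin d d' <= d') by apply Rmin_r.
  specialize (H1 y ltac:(lra)). rewrite (H2 y ltac:(lra) HP), Rabs_minus_sym in H1. lra.
Qed.

(* With a = 0 the cubic (a - g u ^ 2) u degenerates at the far field u = 0, and
   9 g u' ^ 2 + 2 b g u ^ 2 can only take the values 0 (where u = 0 locally) and -3 gam ^ 2. *)
Lemma profile_degenerate_constant b gam g D u u1 u2 v v1 (hgam : gam <> 0) (hg : g <> 0) :
  profile 0 b gam g D u u1 u2 v v1 -> is_lim u p_infty 0 -> D = nil /\ is_constant u.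
Proof.
  intros P Hp.
  assert (N : D = nil).
  { destruct D as [|d D]; auto. exfalso.
    destruct (profile_jump_detuning _ _ _ _ _ _ _ _ _ _ hgam d P (or_introl eq_refl)) as [H _]. lra. }
  subst D. split; auto. destruct (profile_nil _ _ _ _ _ _ _ _ _ P) as [Du [Du1 _]].
  destruct (profile_energy _ _ _ _ _ _ _ _ _ _ P) as [E HE].
  destruct (profile_far_right _ _ _ _ _ _ _ _ _ _ E 0 hgam P HE Hp) as [_ P2].
  pose proof (fun x => profile_energy_slope _ _ _ _ _ _ _ _ _ _ E P HE x (fun z => z)) as S.
  assert (E0 : E = 0) by (unfold potential in P2; lra). subst E.
  set (k := fun x => 9 * g * u1 x ^ 2 + 2 * b * g * u x ^ 2).
  assert (Kc : forall x, continuous k x).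
  { intros x. pose proof (Du x). pose proof (Du1 x). eapply is_derive_continuous. unfold k. der. reflexivity. }
  assert (K1 : forall x, u x <> 0 -> k x = - 3 * gam ^ 2).
  { intros x Hx. specialize (S x). unfold potential in S. unfold k.
    assert (Q : g * u x ^ 4 * (9 * g * u1 x ^ 2 + 2 * b * g * u x ^ 2 + 3 * gam ^ 2) = 0)
      by (ring_simplify in S; ring_simplify; lra).
    apply Rmult_integral in Q. destruct Q as [Q|Q]; [|lra].
    apply Rmult_integral in Q. destruct Q as [Q|Q]; [lra|]. exfalso. apply (pow_nonzero (u x) 4); auto. }
  assert (K2 : forall x, k x = - 3 * gam ^ 2 \/ k x = 0).
  { intros x. destruct (Req_dec (u x) 0) as [Hx|Hx]; [|left; auto].
    destruct (accumulation_or_interior (fun y => u y = 0) x) as [A|A].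
    - left. apply (continuous_value_at_accumulation k (fun y => u y = 0)); auto.
      apply filter_forall. auto.
    - right. unfold k. assert (Z : u1 x = 0).
      { pose proof (is_derive_unique _ _ _ (Du x)) as Z. rewrite <- Z.
        rewrite (Derive_ext_loc u (fun _ => 0)); [apply Derive_const|exact A]. }
      rewrite Z, Hx. ring. }
  assert (G2 : 0 < gam ^ 2) by (apply pow2_gt_0; auto).
  (* The number - gam ^ 2 lies strictly between the two admissible values, so by continuity k takes
     only one of them. *)
  assert (SS : forall x y, 0 < (k x + gam ^ 2) * (k y + gam ^ 2)).
  { intros x y. apply (same_sign_on (fun z => k z + gam ^ 2) (fun _ => True)); auto.
    - intros z _. apply (continuous_plus (V := R_NormedModule)); [apply Kc|apply continuous_const].
    - intros z _. destruct (K2 z) as [H|H]; rewrite H; lra. }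
  destruct (classic (exists x, u x <> 0)) as [[x1 Hx1]|H].
  2:{ exists 0. intros x. apply NNPP. intro Hn. apply H. exists x. auto. }
  exfalso.
  assert (K : forall x, 9 * g * u1 x ^ 2 + 2 * b * g * u x ^ 2 = - 3 * gam ^ 2).
  { intros x. destruct (K2 x) as [H|H]; auto. exfalso. specialize (SS x1 x).
    rewrite (K1 x1 Hx1), H in SS. nra. }
  (* Hence u' ^ 2 tends to a nonzero constant while u tends to 0, which the mean value theorem on
     [x, x + 1] refutes. *)
  assert (L1 : is_lim (fun x => u1 x ^ 2) p_infty (- gam ^ 2 / (3 * g))).
  { apply is_lim_p_infty_ext with (fun x => (- 3 * gam ^ 2 - 2 * b * g * u x ^ 2) / (9 * g)) 0.
    - intros x _. rewrite <- (K x). field. auto.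
    - replace (- gam ^ 2 / (3 * g)) with ((- 3 * gam ^ 2 - 2 * b * g * 0 ^ 2) / (9 * g)) by (field; auto).
      apply (is_lim_continuous_comp (fun z => (- 3 * gam ^ 2 - 2 * b * g * z ^ 2) / (9 * g))); auto.
      apply (ex_derive_continuous (V := R_NormedModule)). auto_derive. auto. }
  set (c := - gam ^ 2 / (3 * g)) in *.
  assert (Hc : c <> 0).
  { unfold c. intro Z. apply (Rmult_eq_compat_r (3 * g)) in Z. unfold Rdiv in Z.
    rewrite Rmult_assoc, Rinv_l, Rmult_0_l in Z; lra. }
  assert (Ha : 0 < Rabs c) by (apply Rabs_pos_lt; auto).
  set (r := Rmin 1 (Rabs c / 2)).
  assert (Hr : 0 < r) by (unfold r; apply Rmin_glb_lt; lra).
  assert (Hr1 : r <= 1) by apply Rmin_l. assert (Hr2 : r <= Rabs c / 2) by apply Rmin_r.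
  destruct (proj1 (is_lim_p_infty_R _ _) L1 (Rabs c / 2) ltac:(lra)) as [A HA].
  destruct (proj1 (is_lim_p_infty_R _ _) Hp (r / 2) ltac:(lra)) as [B HB].
  set (x := Rmax A B + 1).
  assert (A <= Rmax A B) by apply Rmax_l. assert (B <= Rmax A B) by apply Rmax_r.
  destruct (mvt_open u u1 x (x + 1)) as [z [Hz Ez]]; [lra| | |].
  - intros; apply Du.
  - intros w _; eapply is_derive_continuous; apply Du.
  - pose proof (HB x ltac:(unfold x; lra)) as B1. pose proof (HB (x + 1) ltac:(unfold x; lra)) as B2.
    specialize (HA z ltac:(unfold x in *; lra)). apply Rabs_def2 in B1. apply Rabs_def2 in B2.
    assert (- r < u1 z < r) by lra. assert (u1 z ^ 2 < r) by nra.
    pose proof (pow2_ge_0 (u1 z)).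
    apply Rabs_def2 in HA. unfold Rabs in *. destruct (Rcase_abs c); lra.
Qed.

Lemma list_last (D : list R) : D = nil \/ exists d, In d D /\ forall x, d < x -> ~ In x D.
Proof.
  induction D as [|d D [IH|[m [Hm IH]]]]; [left; auto| |].
  - right. exists d. subst. split; [left; auto|]. intros x Hx [E|[]]. lra.
  - right. destruct (Rle_dec m d) as [H|H].
    + exists d. split; [left; auto|]. intros x Hx [E|E]; [lra|]. apply (IH x); auto; lra.
    + exists m. split; [right; auto|]. intros x Hx [E|E]; [lra|]. apply (IH x); auto; lra.
Qed.

Lemma list_predecessor (D : list R) (d1 d2 : R) :
  In d1 D -> d1 < d2 -> exists d, In d D /\ d < d2 /\ forall x, d < x < d2 -> ~ In x D.
Proof.
  intros H1 H2. set (F := filter (fun x => if Rlt_dec x d2 then true else false) D).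
  assert (HF : forall x, In x F <-> In x D /\ x < d2).
  { intros x. unfold F. rewrite filter_In. destruct (Rlt_dec x d2); intuition; discriminate. }
  destruct (list_last F) as [N|[d [Hd H]]].
  - assert (In d1 F) by (apply HF; auto). rewrite N in H. destruct H.
  - apply HF in Hd. exists d. split; [|split]; try tauto.
    intros x Hx Hin. apply (H x); [lra|]. apply HF. split; [auto|lra].
Qed.

(* At the edge a b = 3/2 gam ^ 2 the nonzero far field is a singular point of the cubic:
   (u'' + 2 b u / 9) u vanishes where u ^ 2 <> l ^ 2 and equals 2 b l ^ 2 / 9 where u ^ 2 = l ^ 2
   locally, so by continuity only one of the two regimes occurs. *)
Lemma profile_singular_far_field a b gam g D u u1 u2 v v1 E l (hgam : gam <> 0) (hg : g <> 0) :
  profile a b gam g D u u1 u2 v v1 ->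
  (forall x, gam ^ 2 * v1 x ^ 2 = potential a b gam g (u x ^ 2) + E) ->
  is_lim u p_infty (Finite l) -> l <> 0 ->
  gam ^ 2 = b * (a - g * l ^ 2) -> potential a b gam g (l ^ 2) + E = 0 ->
  a = 3 * g * l ^ 2 -> D = nil /\ is_constant u.
Proof.
  intros P HE Hp Hl Heq H0 Ha.
  assert (G2 : 0 < gam ^ 2) by (apply pow2_gt_0; auto).
  assert (Hl2 : 0 < l ^ 2) by (apply pow2_gt_0; auto).
  assert (Hb : b <> 0) by (intro; subst b; lra).
  assert (S : forall x, ~ In x D -> 9 * u1 x ^ 2 = 2 * b * (l ^ 2 - u x ^ 2)).
  { intros x Hx. pose proof (profile_energy_slope _ _ _ _ _ _ _ _ _ _ E P HE x Hx) as S.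
    rewrite (potential_nonzero_far_field a b gam g E l _ Heq H0) in S.
    pose proof (profile_second_order _ _ _ _ _ _ _ _ _ _ P x Hx) as O.
    set (s := u x ^ 2) in *.
    destruct (Req_dec s (l ^ 2)) as [Hs|Hs].
    - assert (a - 3 * g * s = 0) by (rewrite Hs, Ha; ring). rewrite H in O.
      rewrite Hs, <- Heq in O. assert (Q : g * u x * u1 x ^ 2 = 0) by lra.
      apply Rmult_integral in Q. destruct Q as [Q|Q]; [|rewrite Q, Hs; ring].
      apply Rmult_integral in Q. destruct Q as [Q|Q]; [lra|].
      exfalso. unfold s in Hs. rewrite Q in Hs. lra.
    - assert (Q : g ^ 2 * (s - l ^ 2) ^ 2 * (9 * u1 x ^ 2 - 2 * b * (l ^ 2 - s)) = 0).
      { rewrite Ha in S. ring_simplify in S. ring_simplify. lra. }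
      apply Rmult_integral in Q. destruct Q as [Q|Q]; [|lra]. exfalso.
      apply Rmult_integral in Q. destruct Q as [Q|Q]; [apply (pow_nonzero g 2); auto|].
      apply (pow_nonzero (s - l ^ 2) 2); auto. lra. }
  set (k := fun x => (9 * u2 x + 2 * b * u x) * u x).
  (* Only the half-line beyond the last jump is examined; there k is continuous. *)
  set (I := fun x => forall y, x <= y -> ~ In y D).
  assert (ID : forall x, I x -> ~ In x D) by (intros x Hx; apply Hx; lra).
  assert (Kc : forall x, I x -> continuous k x).
  { intros x Hx. apply ID in Hx. unfold k.
    pose proof (pr_u2 P x Hx) as C2.
    pose proof (is_derive_continuous _ _ _ (pr_u P x Hx)) as C0.
    apply continuous_Rmult; auto.
    apply continuous_Rplus; apply continuous_Rmult; auto; apply continuous_const. }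
  assert (K1 : forall x, ~ In x D -> u x ^ 2 <> l ^ 2 -> k x = 0).
  { intros x Hx Hs. pose proof (S x Hx) as Sx.
    pose proof (profile_second_order _ _ _ _ _ _ _ _ _ _ P x Hx) as O. rewrite Heq, Ha in O.
    assert (Q : g * (l ^ 2 - u x ^ 2) * (9 * u2 x + 2 * b * u x) = 0).
    { replace (- 6 * g * u x * u1 x ^ 2) with (- 6 / 9 * g * u x * (9 * u1 x ^ 2)) in O by field.
      rewrite Sx in O. lra. }
    unfold k. apply Rmult_integral in Q. destruct Q as [Q|Q]; [|rewrite Q; ring].
    apply Rmult_integral in Q. destruct Q as [Q|Q]; lra. }
  assert (K2 : forall x, I x -> k x = 0 \/ k x = 2 * b * l ^ 2).
  { intros x Hx. apply ID in Hx as Hn.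
    destruct (accumulation_or_interior (fun y => u y ^ 2 = l ^ 2) x) as [A|A].
    - left. apply (continuous_value_at_accumulation k (fun y => u y ^ 2 = l ^ 2)); auto.
      eapply filter_imp; [|apply (locally_not_In D x Hn)]. intros y Hy Hyn. auto.
    - right. unfold k. assert (Z : u2 x = 0).
      { pose proof (is_derive_unique _ _ _ (pr_u1 P x Hn)) as Z. rewrite <- Z.
        rewrite (Derive_ext_loc u1 (fun _ => 0)); [apply Derive_const|].
        generalize (filter_and _ _ A (locally_not_In D x Hn)). apply filter_imp.
        intros y [Hy1 Hy2]. specialize (S y Hy2). rewrite Hy1 in S.
        apply Rsqr_0_uniq. unfold Rsqr. lra. }
      apply locally_singleton in A. rewrite Z, <- A. ring. }
  assert (SS : forall x y, I x -> I y -> 0 < (k x - b * l ^ 2) * (k y - b * l ^ 2)).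
  { intros x y. apply (same_sign_on (fun z => k z - b * l ^ 2) I).
    - intros p q z Hpq _ Hz t Ht. apply Hpq. lra.
    - intros z Hz. apply (continuous_minus (V := R_NormedModule)); [apply Kc; auto|apply continuous_const].
    - intros z Hz. assert (b * l ^ 2 <> 0) by (apply Rmult_integral_contrapositive; split; lra).
      destruct (K2 z Hz) as [H'|H']; rewrite H'; lra. }
  destruct (list_upper_bound D) as [X HX].
  assert (IX : forall x, X < x -> I x) by (intros x Hx y Hy; apply HX; lra).
  (* If k vanishes somewhere on I, then u'' = - 2 b u / 9 for large x has a nonzero limit, which the
     convergence of u forbids. Otherwise u ^ 2 = l ^ 2 beyond the last jump. *)
  destruct (classic (exists x1, I x1 /\ k x1 = 0)) as [[x1 [Hx1 Z1]]|HN].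
  - exfalso. assert (K0 : forall x, I x -> k x = 0).
    { intros x Hx. destruct (K2 x Hx) as [H|H]; auto. exfalso. specialize (SS x x1 Hx Hx1).
      rewrite H, Z1 in SS. pose proof (pow2_ge_0 (b * l ^ 2)). lra. }
    destruct (proj1 (is_lim_p_infty_R _ _) Hp (Rabs l)) as [B HB]; [apply Rabs_pos_lt; auto|].
    destruct (derivatives_vanish_at_infinity u u1 u2 (Rmax X B) l (- 2 * b / 9 * l)) as [L0 _].
    + intros x Hx. apply (pr_u P). apply HX.
      pose proof (Rmax_l X B). lra.
    + intros x Hx. apply (pr_u1 P). apply HX.
      pose proof (Rmax_l X B). lra.
    + auto.
    + apply is_lim_p_infty_ext with (fun x => - 2 * b / 9 * u x) (Rmax X B).
      * intros x Hx. pose proof (Rmax_l X B). pose proof (Rmax_r X B).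
        specialize (K0 x (IX x ltac:(lra))). unfold k in K0. apply Rmult_integral in K0.
        destruct K0 as [K0|K0]; [lra|]. exfalso. specialize (HB x ltac:(lra)).
        rewrite K0, Rminus_0_l, Rabs_Ropp in HB. lra.
      * apply (is_lim_continuous_comp (fun z => - 2 * b / 9 * z)); auto.
        apply (ex_derive_continuous (V := R_NormedModule)). auto_derive. auto.
    + assert (Q : b * l = 0) by lra. apply Rmult_integral in Q. tauto.
  - assert (Ks : forall x, I x -> u x ^ 2 = l ^ 2).
    { intros x Hx. apply NNPP. intro Hn. apply HN. exists x. split; auto. }
    destruct (list_last D) as [N|[d [Hd Hlast]]].
    + split; auto. subst D. destruct (profile_nil _ _ _ _ _ _ _ _ _ P) as [Du _].
      apply (is_constant_of_derive_0 u u1 Du). intros x. specialize (S x (fun z => z)).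
      rewrite Ks in S by (intros y _ []). apply Rsqr_0_uniq. unfold Rsqr. lra.
    (* By continuity u d ^ 2 = l ^ 2 at the last jump d, so [g l ^ 2 = a], which is incompatible
       with [a = 3 g l ^ 2]. *)
    + exfalso. destruct (pr_jump P d Hd) as [J1 [J2 J3]].
      assert (Z : u d ^ 2 = l ^ 2).
      { apply (continuous_value_at_accumulation (fun x => u x ^ 2) (fun y => y <= d)); auto.
        - intros e He. exists (d + e / 2). split; [apply Rabs_def1; lra|lra].
        - apply filter_forall. intros y Hy. apply Ks. intros z Hz. apply Hlast. lra. }
      rewrite Z in J1. apply hg. nra.
Qed.

(** Here [t q0] runs through the values of [g u ^ 2] between the far field and the peak q0, and the
    last hypothesis is what the energy equation imposes on them. Besides the bands, the quadratic
    yields that the degenerate value a / 3 is not reached and that there is no second turning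
    point. *)
Lemma bright_factor_bands a b gam g q0 :
  gam <> 0 -> a <> 0 -> q0 <> 0 -> a <> 3 * q0 -> bright_factor a b gam q0 = 0 ->
  0 < q0 * g ->
  (forall t, 0 < t <= 1 -> 0 <= bright_factor a b gam (t * q0) /\
     (a = 3 * (t * q0) -> bright_factor a b gam (t * q0) = 0)) ->
  g < 0 /\ 0 < a * (a - 3 * q0) /\
  ((a < 0 /\ b < 0 /\ gam ^ 2 < a * b < 9 / 8 * gam ^ 2) \/ (0 < a /\ 0 < b /\ a * b < gam ^ 2)) /\
  (forall t, 0 < t <= 1 -> bright_factor a b gam (t * q0) = 0 -> t = 1).
Proof.
  intros hgam Ha Hq Hq3 H1 Hg H.
  assert (G2 : 0 < gam ^ 2) by (apply pow2_gt_0; auto).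
  (* If a / 3 were passed on the way to q0, it would be a root. This means [gam ^ 2 = 8/9 a b] and
     turns the quadratic into [- 2 b (q - a / 3) ^ 2], which leaves no room for the root q0. *)
  assert (HS : 0 < a * (a - 3 * q0)).
  { apply Rnot_le_lt. intros C.
    assert (C' : a * (a - 3 * q0) < 0).
    { destruct C as [C|C]; auto. exfalso. apply Rmult_integral in C. destruct C; lra. }
    assert (T : 0 < a / (3 * q0) < 1).
    { assert (N : 0 < (3 * q0) ^ 2) by (apply pow2_gt_0; lra).
      assert (E : a / (3 * q0) * (3 * q0) ^ 2 = 3 * (a * q0)) by (field; auto). split; nra. }
    destruct (H (a / (3 * q0)) ltac:(lra)) as [_ H2].
    replace (a / (3 * q0) * q0) with (a / 3) in H2 by (field; auto).
    specialize (H2 ltac:(field)). unfold bright_factor in *.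
    assert (E : gam ^ 2 = 8 / 9 * (a * b)) by (apply (Rmult_eq_reg_l a); auto; lra).
    assert (Q : b * (q0 - a / 3) ^ 2 = 0).
    { rewrite E in H1. lra. }
    apply Rmult_integral in Q. destruct Q as [Q|Q].
    - rewrite Q in E. lra.
    - apply (pow_nonzero (q0 - a / 3) 2); auto. lra. }
  (* The value at t = 0 is [2 a (gam ^ 2 - a b)]. K dominates the other coefficients, so if this
     value were negative, t = min (1, c / K) would violate the hypothesis. *)
  assert (L0 : 0 <= a * (gam ^ 2 - a * b)).
  { apply Rnot_lt_le. intros C. set (K := 3 * gam ^ 2 * Rabs q0 + 4 * Rabs (a * b * q0) + 2 * Rabs b * q0 ^ 2 + 1).
    assert (HK : 1 <= K).
    { unfold K. pose proof (Rabs_pos q0). pose proof (Rabs_pos (a * b * q0)). pose proof (Rabs_pos b).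
      pose proof (pow2_ge_0 q0). nra. }
    set (c := - (a * (gam ^ 2 - a * b))) in *. assert (Hc : 0 < c) by (unfold c; lra).
    set (t := Rmin 1 (c / K)).
    assert (Ht : 0 < t) by (apply Rmin_glb_lt; [lra|apply Rdiv_lt_0_compat; lra]).
    assert (Ht1 : t <= 1) by apply Rmin_l.
    assert (Ht2 : t * K <= c).
    { apply Rle_trans with (c / K * K); [|right; field; lra].
      apply Rmult_le_compat_r; [lra|apply Rmin_r]. }
    destruct (H t ltac:(lra)) as [H2 _].
    assert (X : bright_factor a b gam (t * q0) =
      - 2 * c - 3 * gam ^ 2 * q0 * t + 4 * (a * b * q0) * t - 2 * (b * q0 ^ 2) * t * t)
      by (unfold bright_factor, c; ring).
    pose proof (Rle_abs (- q0)) as A1. rewrite Rabs_Ropp in A1.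
    pose proof (Rle_abs (a * b * q0)) as A2. pose proof (Rle_abs (- b)) as A3. rewrite Rabs_Ropp in A3.
    pose proof (pow2_ge_0 q0) as A4. pose proof (Rabs_pos b) as A5.
    assert (A6 : - (b * q0 ^ 2) * (t * t) <= Rabs b * q0 ^ 2 * t).
    { assert (t * t <= t) by nra. assert (- (b * q0 ^ 2) <= Rabs b * q0 ^ 2) by nra.
      assert (0 <= Rabs b * q0 ^ 2) by (apply Rmult_le_pos; auto).
      assert (0 <= t * t) by nra. nra. }
    assert (A7 : - 3 * gam ^ 2 * q0 * t <= 3 * gam ^ 2 * Rabs q0 * t).
    { assert (0 <= gam ^ 2 * t) by nra. nra. }
    assert (A8 : (a * b * q0) * t <= Rabs (a * b * q0) * t) by nra.
    assert (bright_factor a b gam (t * q0) <= - 2 * c + t * K - t).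
    { rewrite X. unfold K. lra. }
    lra. }
  (* Vieta's formula for the product of the roots q0 and t q0. *)
  assert (U : bright_factor a b gam q0 = 0 -> forall t, bright_factor a b gam (t * q0) = 0 ->
    t <> 1 -> 2 * b * t * q0 ^ 2 = - 2 * a * (gam ^ 2 - a * b)).
  { intros Z1 t Z2 Ht. unfold bright_factor in *.
    apply (Rmult_eq_compat_l t) in Z1. apply (Rmult_eq_reg_l (1 - t)); [|lra]. lra. }
  assert (MAIN : g < 0 /\
    ((a < 0 /\ b < 0 /\ gam ^ 2 < a * b < 9 / 8 * gam ^ 2) \/ (0 < a /\ 0 < b /\ a * b < gam ^ 2))).
  { pose proof (proj1 (H (1 / 2) ltac:(lra))) as Hh. unfold bright_factor in Hh, H1.
    destruct (Rlt_dec 0 a) as [Pa|Na].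
    - assert (Q1 : 3 * q0 < a) by nra.
      assert (Hab : a * b <= gam ^ 2) by nra.
      assert (Pb : 0 < b).
      { apply Rnot_le_lt. intro C. assert (0 <= - b * (a - q0) ^ 2) by (apply Rmult_le_pos; [lra|apply pow2_ge_0]). nra. }
      assert (Nq : q0 < 0).
      { apply Rnot_le_lt. intro C. assert (Pq : 0 < q0) by lra.
        assert (b * (a * (a - q0) ^ 2) <= gam ^ 2 * (a - q0) ^ 2) by (pose proof (pow2_ge_0 (a - q0)); nra).
        assert (E : gam ^ 2 * (2 * a ^ 2 - 3 * a * q0) = 2 * (b * (a * (a - q0) ^ 2))).
        { apply (Rmult_eq_compat_l a) in H1. lra. }
        assert (2 * a ^ 2 - 3 * a * q0 <= 2 * (a - q0) ^ 2).
        { apply Rmult_le_reg_l with (gam ^ 2); auto. lra. }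
        nra. }
      split; [nra|]. right. repeat split; auto.
      destruct Hab as [|Hab]; auto. exfalso.
      rewrite <- Hab in H1. assert (Q : b * q0 * (a - 2 * q0) = 0) by lra.
      apply Rmult_integral in Q. destruct Q as [Q|Q]; [|lra].
      apply Rmult_integral in Q. destruct Q; lra.
    - assert (Na' : a < 0) by lra. clear Na.
      assert (Q1 : a < 3 * q0) by nra.
      assert (Hab : gam ^ 2 <= a * b) by nra.
      assert (Nb : b < 0) by nra.
      assert (Nq : q0 < 0).
      { apply Rnot_le_lt. intro C. assert (Pq : 0 < q0) by lra.
        assert (0 < - b * q0 ^ 2) by nra. assert (0 <= q0 * (4 * (a * b) - 3 * gam ^ 2)) by nra. nra. }
      split; [nra|]. left. repeat split; auto.
      + destruct Hab as [|Hab]; auto. exfalso.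
        rewrite Hab in H1. assert (Q : b * q0 * (a - 2 * q0) = 0) by lra.
        apply Rmult_integral in Q. destruct Q as [Q|Q]; [|lra].
        apply Rmult_integral in Q. destruct Q; lra.
      + apply Rnot_le_lt. intro C.
        (* Completing the square: a real root requires [8 a b <= 9 gam ^ 2], and equality would put
           the double root at a / 3, which is excluded. *)
        assert (E : 8 * b * (2 * gam ^ 2 * a - 3 * gam ^ 2 * q0 - 2 * b * (a - q0) ^ 2)
          = - (4 * b * (q0 - a) + 3 * gam ^ 2) ^ 2 - gam ^ 2 * (8 * (a * b) - 9 * gam ^ 2)) by ring.
        rewrite H1, Rmult_0_r in E.
        pose proof (pow2_ge_0 (4 * b * (q0 - a) + 3 * gam ^ 2)) as E2.
        assert (E3 : 0 <= gam ^ 2 * (8 * (a * b) - 9 * gam ^ 2)) by (apply Rmult_le_pos; lra).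
        assert (E4 : (4 * b * (q0 - a) + 3 * gam ^ 2) ^ 2 = 0) by lra.
        assert (E5 : gam ^ 2 * (8 * (a * b) - 9 * gam ^ 2) = 0) by lra.
        apply Rmult_integral in E5. destruct E5 as [E5|E5]; [lra|].
        assert (E6 : 4 * b * (q0 - a) + 3 * gam ^ 2 = 0) by (apply Rsqr_0_uniq; unfold Rsqr; lra).
        assert (Q : b * (3 * q0 - a) = 0) by lra. apply Rmult_integral in Q. lra. }
  destruct MAIN as [M1 M2]. split; [auto|split; [auto|split; [auto|]]].
  intros t Ht Z. destruct (Req_dec t 1) as [|Hne]; auto. exfalso.
  specialize (U H1 t Z Hne). assert (Q2 : 0 < q0 ^ 2) by (apply pow2_gt_0; auto).
  destruct M2 as [[Aa [Bb Cc]]|[Aa [Bb Cc]]].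
  - unfold bright_factor in H1, Z.
    assert (S : 2 * b * (t + 1) * q0 = 4 * (a * b) - 3 * gam ^ 2).
    { apply (Rmult_eq_reg_l ((1 - t) * q0)); [|apply Rmult_integral_contrapositive; split; lra]. lra. }
    assert (a < 3 * q0) by nra. assert (q0 < 0) by nra.
    (* The value of the quadratic at a / 3, factored through its roots. Both roots exceed a / 3, so
       the two sides have opposite signs. *)
    assert (F : a * (gam ^ 2 - 8 / 9 * (a * b)) = - 2 * b * ((a / 3 - q0) * (a / 3 - t * q0))).
    { apply (Rmult_eq_compat_l (a / 3 - q0)) in S. lra. }
    assert (q0 <= t * q0) by nra.
    assert (0 < (q0 - a / 3) * (t * q0 - a / 3)) by (apply Rmult_lt_0_compat; lra).
    assert (0 < - b * ((q0 - a / 3) * (t * q0 - a / 3))) by (apply Rmult_lt_0_compat; lra).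
    assert (0 < - a * (gam ^ 2 - 8 / 9 * (a * b))) by (apply Rmult_lt_0_compat; lra). lra.
  - assert (0 < b * t * q0 ^ 2) by (apply Rmult_lt_0_compat; [nra|auto]).
    assert (0 < a * (gam ^ 2 - a * b)) by nra. lra.
Qed.

Lemma is_lim_nonneg_R (f : R -> R) (X l : R) :
  (forall x, X < x -> 0 <= f x) -> is_lim f p_infty l -> 0 <= l.
Proof.
  intros H Hl. apply Rnot_lt_le. intro C.
  destruct (proj1 (is_lim_p_infty_R _ _) Hl (- l) ltac:(lra)) as [M HM].
  specialize (HM (Rmax X M + 1)). pose proof (Rmax_l X M). pose proof (Rmax_r X M).
  specialize (HM ltac:(lra)). specialize (H (Rmax X M + 1) ltac:(lra)). apply Rabs_def2 in HM. lra.
Qed.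

(* E = 0 is the energy of the far field 0: zero and nonzero far fields never coexist. *)
Lemma far_fields_vanish a b gam g E l :
  gam <> 0 -> g <> 0 -> E = 0 ->
  l * (gam ^ 2 - b * (a - g * l ^ 2)) = 0 -> potential a b gam g (l ^ 2) + E = 0 -> l = 0.
Proof.
  intros hgam hg E0 H1 H2. apply Rmult_integral in H1. destruct H1 as [H1|H1]; auto.
  apply NNPP. intro Hl. assert (H3 : gam ^ 2 = b * (a - g * l ^ 2)) by lra.
  pose proof (potential_nonzero_far_field a b gam g E l 0 H3 H2) as Q.
  assert (G2 : gam ^ 2 <> 0) by (apply pow_nonzero; auto).
  assert (L4 : l ^ 4 <> 0) by (apply pow_nonzero; auto).
  assert (g * l ^ 4 * gam ^ 2 = 0).
  { rewrite H3. unfold potential in Q. rewrite E0 in Q. lra. }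
  apply Rmult_integral in H. destruct H as [H|H]; auto.
  apply Rmult_integral in H. destruct H; auto.
Qed.

Lemma bright_equilibrium_bound a b gam g z0 : z0 ^ 2 = 0 ->
  exists C, forall z, Rabs (z - z0) < 1 -> potential a b gam g (z ^ 2) + 0 <= C ^ 2 * (z - z0) ^ 2.
Proof.
  intros H. assert (Z : z0 = 0) by (apply Rsqr_0_uniq; unfold Rsqr; lra). subst z0.
  apply (quadratic_bound (fun z => potential a b gam g (z ^ 2) + 0)
    (fun z => bright_factor a b gam (g * z ^ 2))).
  - intros z. unfold bright_factor. apply (ex_derive_continuous (V := R_NormedModule)). auto_derive. auto.
  - intros z. rewrite potential_bright. ring.
Qed.

Lemma periodic_vanishing (u : R -> R) (T : R) :
  0 < T -> (forall z, u (z + T) = u z) -> is_lim u p_infty 0 -> forall x, u x = 0.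
Proof.
  intros HT Hper Hl x. apply NNPP. intro Hn.
  assert (Hn' : forall n, u (x + INR n * T) = u x).
  { induction n as [|n IH].
    - simpl. f_equal. ring.
    - rewrite S_INR. replace (x + (INR n + 1) * T) with ((x + INR n * T) + T) by ring.
      rewrite Hper. auto. }
  destruct (proj1 (is_lim_p_infty_R _ _) Hl (Rabs (u x))) as [M HM]; [apply Rabs_pos_lt; auto|].
  destruct (INR_unbounded ((M - x) / T)) as [n Hn2].
  specialize (HM (x + INR n * T)). rewrite Hn', Rminus_0_r in HM.
  assert (M - x < INR n * T).
  { apply Rmult_lt_reg_r with (/ T); [apply Rinv_0_lt_compat; auto|].
    rewrite Rmult_assoc, Rinv_r, Rmult_1_r by lra. exact Hn2. }
  specialize (HM ltac:(lra)). lra.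
Qed.

(** The turning point is the maximum of u ^ 2, which exists because u vanishes at both ends. All
    smaller positive values of u ^ 2 are attained as well, so the energy equation becomes a
    condition on [bright_factor] alone. The sign of [a - 3 g u ^ 2] then makes the cubic invertible
    and yields the symmetry. *)
Theorem smooth_profile_bright a b gam g u u1 u2 v v1 (lm : R) (hgam : gam <> 0) (hg : g <> 0) :
  profile a b gam g nil u u1 u2 v v1 ->
  is_lim u p_infty 0 -> is_lim u m_infty lm -> ~ is_constant u ->
  g < 0 /\
  ((a < 0 /\ b < 0 /\ gam ^ 2 < a * b < 9 / 8 * gam ^ 2) \/ (0 < a /\ 0 < b /\ a * b < gam ^ 2)) /\
  lm = 0 /\
  exists x0, u x0 <> 0 /\ bright_factor a b gam (g * u x0 ^ 2) = 0 /\
    (forall x, u x ^ 2 <= u x0 ^ 2) /\ (forall y, u (x0 + y) = u (x0 - y)) /\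
    (forall x, u1 x = 0 <-> x = x0) /\ (forall x, 0 < a * (a - 3 * g * u x ^ 2)).
Proof.
  intros P Hp Hm Hnc. destruct (profile_nil _ _ _ _ _ _ _ _ _ P) as [Du [Du1 _]].
  assert (Ha : a <> 0).
  { intro Z. subst a. destruct (profile_degenerate_constant _ _ _ _ _ _ _ _ _ hgam hg P Hp). auto. }
  assert (G2 : 0 < gam ^ 2) by (apply pow2_gt_0; auto).
  destruct (profile_energy _ _ _ _ _ _ _ _ _ _ P) as [E HE].
  destruct (profile_far_right _ _ _ _ _ _ _ _ _ _ E 0 hgam P HE Hp) as [_ P2].
  assert (E0 : E = 0) by (unfold potential in P2; lra).
  destruct (profile_far_left _ _ _ _ _ _ _ _ _ _ E lm hgam P HE Hm) as [M1 M2].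
  assert (Lm := far_fields_vanish _ _ _ _ _ _ hgam hg E0 M1 M2). subst lm E.
  pose proof (fun x => profile_energy_slope _ _ _ _ _ _ _ _ _ _ 0 P HE x (fun z => z)) as S.
  assert (Unz : forall x, u x <> 0).
  { intros x Hx. apply Hnc.
    apply (profile_equilibrium_global _ _ _ _ _ _ _ _ _ _ 0 0 P HE) with x.
    - intros d [].
    - lra.
    - apply bright_equilibrium_bound.
    - rewrite Hx. ring. }
  destruct (exists_max_of_vanishing (fun x => u x ^ 2) 0) as [x0 [X1 X2]].
  { apply (profile_sq_continuous _ _ _ _ _ _ _ _ _ _ P). }
  { apply is_lim_sq in Hp. replace (0 ^ 2) with 0 in Hp by ring. exact Hp. }
  { apply is_lim_sq in Hm. replace (0 ^ 2) with 0 in Hm by ring. exact Hm. }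
  { apply pow2_gt_0; auto. }
  assert (Z0 : u1 x0 = 0).
  { apply (zero_slope_at_max_of_sq u u1 0); auto. intros x. rewrite !Rminus_0_r. auto. }
  set (s0 := u x0 ^ 2) in *. set (q0 := g * s0).
  assert (Hq0 : q0 <> 0) by (unfold q0; apply Rmult_integral_contrapositive; split; lra).
  assert (H0 : bright_factor a b gam q0 = 0).
  { specialize (S x0). fold s0 in S. rewrite Z0, potential_bright in S. fold q0 in S.
    apply (Rmult_eq_reg_l s0); lra. }
  assert (Hgs : forall s, 0 < s <= s0 -> 0 <= bright_factor a b gam (g * s) /\
     (a = 3 * (g * s) -> bright_factor a b gam (g * s) = 0)).
  { intros s Hs.
    assert (exists x, u x ^ 2 = s) as [x Hx].
    { pose proof (is_lim_sq _ _ _ Hp) as Hp2.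
      destruct (proj1 (is_lim_p_infty_R _ _) Hp2 s ltac:(lra)) as [M HM].
      specialize (HM (M + 1) ltac:(lra)). apply Rabs_def2 in HM.
      destruct (intermediate_value (fun x => u x ^ 2) x0 (M + 1) s) as [x [_ Hx]].
      - apply (profile_sq_continuous _ _ _ _ _ _ _ _ _ _ P).
      - fold s0. nra.
      - exists x. auto. }
    specialize (S x). rewrite Hx, potential_bright, Rplus_0_r in S. split.
    - apply Rmult_le_reg_l with s; [lra|]. rewrite <- S, Rmult_0_r. apply pow2_ge_0.
    - intros Z. replace (a - 3 * g * s) with 0 in S by lra.
      apply (Rmult_eq_reg_l s); lra. }
  (* At a peak with the degenerate value, [profile_second_order] leaves [gam ^ 2 = 2 b q0], whereas
     the root equation requires [3 gam ^ 2 = 8 b q0]. *)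
  assert (Hq3 : a <> 3 * q0).
  { intro Z. pose proof (profile_second_order _ _ _ _ _ _ _ _ _ _ P x0 (fun z => z)) as O.
    fold s0 in O. rewrite Z0 in O. replace (g * s0) with q0 in O by reflexivity.
    replace (a - 3 * g * s0) with 0 in O by (unfold q0 in Z; lra).
    assert (Q : u x0 * (gam ^ 2 - b * (a - q0)) = 0) by lra.
    apply Rmult_integral in Q. destruct Q as [Q|Q]; [apply (Unz x0); auto|].
    unfold bright_factor in H0. assert (E1 : gam ^ 2 = 2 * (b * q0)) by (rewrite Z in Q; lra).
    rewrite Z in H0. assert (E2 : q0 * (3 * gam ^ 2 - 8 * (b * q0)) = 0) by lra.
    apply Rmult_integral in E2. destruct E2; lra. }
  destruct (bright_factor_bands a b gam g q0 hgam Ha Hq0 Hq3 H0) as [Hg [HD [Hband Huni]]].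
  { unfold q0. replace (g * s0 * g) with (g ^ 2 * s0) by ring.
    apply Rmult_lt_0_compat; auto. apply pow2_gt_0; auto. }
  { intros t Ht. unfold q0. replace (t * (g * s0)) with (g * (t * s0)) by ring. apply Hgs. nra. }
  split; [auto|split; [auto|split; [auto|]]].
  assert (HDx : forall x, 0 < a * (a - 3 * g * u x ^ 2)).
  { intros x. specialize (X2 x). pose proof (pow2_ge_0 (u x)).
    assert (A2 : 0 < a ^ 2) by (apply pow2_gt_0; auto). unfold q0 in HD.
    destruct (Rle_dec 0 (a * g)); nra. }
  assert (Hmax : forall x, u1 x = 0 -> u x ^ 2 = s0).
  { intros x Hx. specialize (S x). rewrite Hx, potential_bright in S.
    assert (Ps : 0 < u x ^ 2) by (apply pow2_gt_0; auto). specialize (X2 x). cbv beta in X2.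
    set (s := u x ^ 2) in *.
    assert (Z : bright_factor a b gam (s / s0 * q0) = 0).
    { replace (s / s0 * q0) with (g * s) by (unfold q0; field; lra). apply (Rmult_eq_reg_l s); lra. }
    assert (T : 0 < s / s0 <= 1).
    { split; [apply Rdiv_lt_0_compat; lra|]. apply Rmult_le_reg_r with s0; auto.
      unfold Rdiv. rewrite Rmult_assoc, Rinv_l; lra. }
    specialize (Huni _ T Z). apply (Rmult_eq_compat_r s0) in Huni.
    unfold Rdiv in Huni. rewrite Rmult_assoc, Rinv_l in Huni; lra. }
  assert (Sym : forall x, u1 x = 0 -> forall y, u (x + y) = u (x - y)).
  { intros x Hx y. destruct (Req_dec y 0) as [->|Hy]; [f_equal; ring|].
    rewrite <- (Rmult_1_l (u (x - y))).
    apply (profile_symmetric _ _ _ _ _ _ _ _ _ _ hgam 1 x 0 s0 P); auto.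
    - intros d [].
    - intros _. pose proof (profile_v1_eq _ _ _ _ _ _ _ _ _ _ P x (fun z => z)) as W.
      rewrite Hx in W. apply (Rmult_eq_reg_l gam); auto. lra.
    - intro; lra.
    - lra.
    - replace (3 * g * s0) with (3 * q0) by (unfold q0; ring). lra.
    - intros z _. split; [apply pow2_ge_0|apply X2]. }
  exists x0. split; [auto|]. split; [auto|]. split; [auto|]. split; [auto|]. split; [|auto].
  intros x. split; [|intros ->; auto]. intros Hx. apply NNPP. intro Hne.
  (* Every critical point is a centre of symmetry, and two centres make u periodic, which the far
     field 0 forbids. *)
  assert (Per : forall z, u (z + 2 * (x - x0)) = u z).
  { intros z. replace (z + 2 * (x - x0)) with (x + (z + x - 2 * x0)) by ring. rewrite (Sym x Hx).
    replace (x - (z + x - 2 * x0)) with (x0 + (x0 - z)) by ring. rewrite (Sym x0 Z0). f_equal. ring. }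
  destruct (Rlt_dec x0 x) as [L|L].
  - apply (Unz 0). apply (periodic_vanishing u (2 * (x - x0))); auto. lra.
  - apply (Unz 0). apply (periodic_vanishing u (2 * (x0 - x))); auto; [lra|].
    intros z. rewrite <- (Per (z + 2 * (x0 - x))). f_equal. ring.
Qed.

(** * Smooth profiles with a nonzero far field *)

Lemma nonzero_equilibrium_bound a b gam g E l z0 :
  gam ^ 2 = b * (a - g * l ^ 2) -> potential a b gam g (l ^ 2) + E = 0 -> z0 ^ 2 = l ^ 2 ->
  exists C, forall z, Rabs (z - z0) < 1 -> potential a b gam g (z ^ 2) + E <= C ^ 2 * (z - z0) ^ 2.
Proof.
  intros H1 H2 Hz.
  apply (quadratic_bound (fun z => potential a b gam g (z ^ 2) + E)
    (fun z => - b * g * (z + z0) ^ 2 * (2 * g * z ^ 2 - a + g * l ^ 2))).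
  - intros z. apply (ex_derive_continuous (V := R_NormedModule)). auto_derive. auto.
  - intros z. rewrite (potential_nonzero_far_field a b gam g E l _ H1 H2), <- Hz. ring.
Qed.

(** Both ends share the energy E. The far field 0 would require E = 0, while the factored form at s
    = 0 gives [E = g l ^ 4 gam ^ 2]. *)
Lemma other_far_field a b gam g E l lm :
  gam <> 0 -> g <> 0 -> gam ^ 2 = b * (a - g * l ^ 2) -> potential a b gam g (l ^ 2) + E = 0 ->
  l <> 0 ->
  lm * (gam ^ 2 - b * (a - g * lm ^ 2)) = 0 -> potential a b gam g (lm ^ 2) + E = 0 -> lm ^ 2 = l ^ 2.
Proof.
  intros hgam hg H1 H2 Hl M1 M2.
  assert (G2 : 0 < gam ^ 2) by (apply pow2_gt_0; auto).
  assert (Hb : b <> 0) by (intro; subst b; lra).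
  apply Rmult_integral in M1. destruct M1 as [M1|M1].
  - exfalso. subst lm. rewrite (potential_nonzero_far_field a b gam g E l _ H1 H2) in M2.
    assert (L4 : l ^ 4 <> 0) by (apply pow_nonzero; auto).
    assert (Q : g * l ^ 4 * gam ^ 2 = 0) by (rewrite H1; lra).
    apply Rmult_integral in Q. destruct Q as [Q|Q]; [|lra].
    apply Rmult_integral in Q. destruct Q; auto.
  - assert (Q : b * g * (lm ^ 2 - l ^ 2) = 0) by lra.
    apply Rmult_integral in Q. destruct Q as [Q|Q]; [|lra].
    apply Rmult_integral in Q. destruct Q; contradiction.
Qed.

(** Since u ^ 2 never meets l ^ 2, the factored energy shows that it meets neither the degenerate
    value nor the third zero, so u' never vanishes. Equal far fields would give (u - l) ^ 2 a
    maximum; hence they are opposite and u has a zero. There the energy reads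
    [(a u') ^ 2 = g l ^ 4 gam ^ 2], so g > 0, and v vanishes too, which makes this zero the centre
    of the odd reflection. *)
Theorem smooth_profile_dark a b gam g u u1 u2 v v1 (l lm : R) (hgam : gam <> 0) (hg : g <> 0) :
  profile a b gam g nil u u1 u2 v v1 ->
  is_lim u p_infty l -> l <> 0 -> is_lim u m_infty lm -> ~ is_constant u ->
  0 < g /\
  ((a < 0 /\ b < 0 /\ a * b < gam ^ 2) \/ (0 < a /\ 0 < b /\ gam ^ 2 < a * b < 3 / 2 * gam ^ 2)) /\
  lm = - l /\ gam ^ 2 = b * (a - g * l ^ 2) /\ (forall x, u1 x <> 0) /\
  (forall x, 0 < a * (a - 3 * g * u x ^ 2)) /\
  exists x0, forall y, u (x0 + y) = - u (x0 - y).
Proof.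
  intros P Hp Hl Hm Hnc. destruct (profile_nil _ _ _ _ _ _ _ _ _ P) as [Du [Du1 _]].
  assert (G2 : 0 < gam ^ 2) by (apply pow2_gt_0; auto).
  assert (L2 : 0 < l ^ 2) by (apply pow2_gt_0; auto).
  destruct (profile_energy _ _ _ _ _ _ _ _ _ _ P) as [E HE].
  destruct (profile_far_right _ _ _ _ _ _ _ _ _ _ E l hgam P HE Hp) as [P1 P2].
  assert (Heq : gam ^ 2 = b * (a - g * l ^ 2)).
  { apply Rmult_integral in P1. destruct P1; [contradiction|lra]. }
  assert (Hb : b <> 0) by (intro; subst b; lra).
  destruct (profile_far_left _ _ _ _ _ _ _ _ _ _ E lm hgam P HE Hm) as [M1 M2].
  assert (Lm := other_far_field _ _ _ _ _ _ _ hgam hg Heq P2 Hl M1 M2).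
  pose proof (fun x => profile_energy_slope _ _ _ _ _ _ _ _ _ _ E P HE x (fun z => z)) as S.
  pose proof (potential_nonzero_far_field a b gam g E l) as F.
  assert (HaD : a - 3 * g * l ^ 2 <> 0).
  { intro Z. apply Hnc. apply (profile_singular_far_field _ _ _ _ _ _ _ _ _ _ E l hgam hg P); auto. lra. }
  assert (Une : forall x, u x ^ 2 <> l ^ 2).
  { intros x Hx. apply Hnc.
    apply (profile_equilibrium_global _ _ _ _ _ _ _ _ _ _ E (l ^ 2) P HE) with x; auto.
    intros z0 Hz0. apply nonzero_equilibrium_bound with l; auto. }
  assert (Sq : forall x, (u x ^ 2 - l ^ 2) ^ 2 <> 0).
  { intros x. apply pow_nonzero. specialize (Une x). lra. }
  assert (Dn : forall x, a - 3 * g * u x ^ 2 <> 0).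
  { intros x Z. specialize (S x). rewrite Z, F in S; auto.
    assert (Q : b * g * (u x ^ 2 - l ^ 2) ^ 2 * (a - 3 * g * l ^ 2) = 0).
    { replace (2 * g * u x ^ 2 - a + g * l ^ 2) with (- (a - 3 * g * l ^ 2) / 3) in S by lra. lra. }
    specialize (Sq x).
    repeat (apply Rmult_integral in Q; destruct Q as [Q|Q]; try contradiction). }
  assert (Ds : forall x y, 0 < (a - 3 * g * u x ^ 2) * (a - 3 * g * u y ^ 2)).
  { intros x y. apply (same_sign_on (fun z => a - 3 * g * u z ^ 2) (fun _ => True)); auto.
    intros z _. apply continuous_Rminus; [apply continuous_const|].
    apply continuous_Rmult; [apply continuous_const|].
    apply (profile_sq_continuous _ _ _ _ _ _ _ _ _ _ P). }
  assert (Dl : forall x, 0 < (a - 3 * g * u x ^ 2) * (a - 3 * g * l ^ 2)).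
  { intros x. assert (0 <= (a - 3 * g * u x ^ 2) * (a - 3 * g * l ^ 2)).
    { apply (is_lim_nonneg_R (fun y => (a - 3 * g * u x ^ 2) * (a - 3 * g * u y ^ 2)) 0).
      - intros y _. left. apply Ds.
      - apply (is_lim_continuous_comp (fun z => (a - 3 * g * u x ^ 2) * (a - 3 * g * z ^ 2))); auto.
        apply (ex_derive_continuous (V := R_NormedModule)). auto_derive. auto. }
    destruct H as [|H]; auto. symmetry in H. apply Rmult_integral in H. specialize (Dn x). tauto. }
  assert (U1 : forall x, u1 x <> 0).
  { intros x Z. specialize (S x). rewrite Z, F in S; auto.
    assert (Q : b * g * (u x ^ 2 - l ^ 2) ^ 2 * (2 * g * u x ^ 2 - a + g * l ^ 2) = 0) by lra.
    specialize (Sq x).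
    apply Rmult_integral in Q. destruct Q as [Q|Q].
    - repeat (apply Rmult_integral in Q; destruct Q as [Q|Q]; try contradiction).
    - specialize (Dl x). replace (a - 3 * g * u x ^ 2) with (- (a - 3 * g * l ^ 2) / 2) in Dl by lra.
      pose proof (pow2_ge_0 (a - 3 * g * l ^ 2)). lra. }
  assert (Lm' : lm = - l).
  { assert (Q : (lm - l) * (lm + l) = 0) by lra. apply Rmult_integral in Q.
    destruct Q as [Q|Q]; [exfalso|lra]. assert (lm = l) by lra. subst lm.
    destruct (exists_max_of_vanishing (fun x => (u x - l) ^ 2) 0) as [x0 [X1 X2]].
    - intros x. pose proof (Du x). eapply is_derive_continuous. der. reflexivity.
    - replace (Finite 0) with (Finite ((l - l) ^ 2)) by (f_equal; ring).
      apply (is_lim_continuous_comp (fun z => (z - l) ^ 2)); auto.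
      apply (ex_derive_continuous (V := R_NormedModule)). auto_derive. auto.
    - replace (Finite 0) with (Finite ((l - l) ^ 2)) by (f_equal; ring).
      apply (is_lim_continuous_comp (fun z => (z - l) ^ 2)); auto.
      apply (ex_derive_continuous (V := R_NormedModule)). auto_derive. auto.
    - apply pow2_gt_0. intro Z. apply (Une 0). replace (u 0) with l by lra. auto.
    - apply (U1 x0). apply (zero_slope_at_max_of_sq u u1 l); auto.
      intro Z. apply (Une x0). rewrite Z. auto. }
  subst lm.
  assert (exists x0, u x0 = 0) as [x0 Hx0].
  { destruct (proj1 (is_lim_p_infty_R _ _) Hp (Rabs l)) as [A HA]; [apply Rabs_pos_lt; auto|].
    destruct (proj1 (is_lim_m_infty_R _ _) Hm (Rabs l)) as [B HB]; [apply Rabs_pos_lt; auto|].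
    specialize (HA (A + 1) ltac:(lra)). specialize (HB (B - 1) ltac:(lra)).
    destruct (intermediate_value u (A + 1) (B - 1) 0) as [x [_ Hx]].
    - intros z. apply is_derive_continuous with (u1 z); auto.
    - rewrite !Rminus_0_r. apply Rabs_def2 in HA. apply Rabs_def2 in HB.
      unfold Rabs in *. destruct (Rcase_abs l); nra.
    - exists x; auto. }
  assert (Da := Dl x0). rewrite Hx0 in Da. replace (a - 3 * g * 0 ^ 2) with a in Da by ring.
  assert (Hg : 0 < g).
  { pose proof (S x0) as Sx. rewrite F in Sx; auto. rewrite Hx0 in Sx.
    assert (Q : g * (l ^ 4 * gam ^ 2) = (a * u1 x0) ^ 2).
    { rewrite Heq. replace (a - 3 * g * 0 ^ 2) with a in Sx by ring. rewrite Sx. ring. }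
    assert (0 < l ^ 4) by (replace (l ^ 4) with (l ^ 2 * l ^ 2) by ring; nra).
    assert (0 < l ^ 4 * gam ^ 2) by nra.
    assert (a <> 0) by (intro; subst a; lra).
    assert (0 < (a * u1 x0) ^ 2).
    { apply pow2_gt_0. apply Rmult_integral_contrapositive. split; auto. }
    apply Rmult_lt_reg_r with (l ^ 4 * gam ^ 2); auto. lra. }
  assert (Hs : forall x, u x ^ 2 <= l ^ 2).
  { intros x. assert (0 < (u x0 ^ 2 - l ^ 2) * (u x ^ 2 - l ^ 2)).
    { apply (same_sign_on (fun z => u z ^ 2 - l ^ 2) (fun _ => True)); auto.
      - intros z _. apply continuous_Rminus; [|apply continuous_const].
        apply (profile_sq_continuous _ _ _ _ _ _ _ _ _ _ P).
      - intros z _. specialize (Une z). lra. }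
    rewrite Hx0 in H. nra. }
  split; [auto|]. split.
  { destruct (Rlt_dec a 0) as [Na|Na].
    - left. assert (Nb : b < 0).
      { apply Rnot_le_lt. intro C. assert (0 < g * l ^ 2) by nra.
        assert (a - g * l ^ 2 < 0) by lra. nra. }
      repeat split; auto. rewrite Heq. assert (0 < g * l ^ 2) by nra. nra.
    - right. assert (Pa : 0 < a) by (assert (a <> 0) by (intro; subst a; lra); lra).
      assert (0 < g * l ^ 2) by nra. assert (0 < a - 3 * g * l ^ 2) by nra.
      assert (Pb : 0 < b) by nra. repeat split; auto; nra. }
  split; [auto|]. split; [auto|]. split; [auto|]. split.
  { intros x. specialize (Ds x x0). rewrite Hx0 in Ds. lra. }
  exists x0. intros y. destruct (Req_dec y 0) as [->|Hy].
  { rewrite Rplus_0_r, Rminus_0_r, Hx0. ring. }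
  replace (- u (x0 - y)) with (-1 * u (x0 - y)) by ring.
  apply (profile_symmetric _ _ _ _ _ _ _ _ _ _ hgam (-1) x0 0 (l ^ 2) P); auto.
  - intros d [].
  - intro; lra.
  - intros _. pose proof (pr_alg P x0) as Al. rewrite Hx0 in Al.
    apply (Rmult_eq_reg_l gam); auto. lra.
  - lra.
  - lra.
  - intros z _. split; [apply pow2_ge_0|auto].
Qed.

(** * Profiles with jumps *)

Lemma profile_sq_derive a b gam g D u u1 u2 v v1 :
  profile a b gam g D u u1 u2 v v1 -> forall x, ~ In x D ->
  is_derive (fun x => u x ^ 2) x (2 * u x * u1 x).
Proof.
  intros P x Hx. pose proof (pr_u P x Hx). der. ring.
Qed.

(* Between two consecutive jumps u ^ 2 would return to the value a / g, so u u' would vanish. *)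
Lemma profile_single_jump a b gam g D u u1 u2 v v1 (hg : g <> 0) :
  profile a b gam g D u u1 u2 v v1 ->
  (forall x, u x <> 0) -> (forall x, ~ In x D -> u1 x <> 0) ->
  forall d1 d2, In d1 D -> In d2 D -> d1 = d2.
Proof.
  intros P H0 H1.
  assert (K : forall d1 d2, In d1 D -> In d2 D -> ~ d1 < d2).
  { intros d1 d2 I1 I2 L. destruct (list_predecessor D d1 d2 I1 L) as [d [Hd [Ld Hn]]].
    destruct (mvt_open (fun x => u x ^ 2) (fun x => 2 * u x * u1 x) d d2 Ld) as [z [Hz Ez]].
    - intros z Hz. apply (profile_sq_derive _ _ _ _ _ _ _ _ _ _ P). auto.
    - intros z _. apply (profile_sq_continuous _ _ _ _ _ _ _ _ _ _ P).
    - destruct (pr_jump P _ Hd) as [J1 _].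
      destruct (pr_jump P _ I2) as [J2 _].
      assert (E : u d2 ^ 2 = u d ^ 2) by (apply (Rmult_eq_reg_l g); auto; lra).
      rewrite E in Ez. specialize (H0 z). specialize (H1 z (Hn z Hz)).
      assert (Q : u z * (u1 z * (d2 - d)) = 0) by lra.
      apply Rmult_integral in Q. destruct Q as [Q|Q]; auto.
      apply Rmult_integral in Q. destruct Q as [Q|Q]; auto. lra. }
  intros d1 d2 I1 I2. pose proof (K d1 d2 I1 I2). pose proof (K d2 d1 I2 I1). lra.
Qed.

(** On each side of the only jump u keeps its sign, so the local change of sign at d is a global
    one. *)
Lemma profile_jump_sign a b gam g D u u1 u2 v v1 d :
  profile a b gam g D u u1 u2 v v1 -> In d D -> (forall d', In d' D -> d' = d) ->
  (forall x, u x <> 0) -> forall y z, 0 < y -> 0 < z -> u (d + y) * u (d - z) < 0.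
Proof.
  intros P Hd Hu H0 y z Hy Hz.
  assert (Hc : forall x, x <> d -> continuous u x).
  { intros x Hx. eapply is_derive_continuous. apply (pr_u P).
    intro Hin. apply Hx. auto. }
  destruct (pr_flip P _ Hd) as [e [He H]].
  specialize (H (d - e / 2) (d + e / 2) ltac:(lra) ltac:(lra)).
  assert (A : 0 < u (d + y) * u (d + e / 2)).
  { apply (same_sign_on u (fun x => d < x)); try lra; auto; intros; try lra. apply Hc; lra. }
  assert (B : 0 < u (d - z) * u (d - e / 2)).
  { apply (same_sign_on u (fun x => x < d)); try lra; auto; intros; try lra. apply Hc; lra. }
  assert (Q : 0 < (u (d + y) * u (d - z)) * (u (d + e / 2) * u (d - e / 2))).
  { replace ((u (d + y) * u (d - z)) * (u (d + e / 2) * u (d - e / 2))) with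
      ((u (d + y) * u (d + e / 2)) * (u (d - z) * u (d - e / 2))) by ring. nra. }
  nra.
Qed.

(** To the right of d the derivative 2 u u' keeps one sign, which the limit identifies as that of L
    ^ 2 - u d ^ 2. The products treat the increasing and the decreasing case together. *)
Lemma profile_jump_sq_monotone a b gam g D u u1 u2 v v1 d (L : R) :
  profile a b gam g D u u1 u2 v v1 -> (forall d', In d' D -> d' = d) ->
  (forall x, u x <> 0) -> (forall x, ~ In x D -> u1 x <> 0) ->
  is_lim u p_infty L -> u d ^ 2 <> L ^ 2 ->
  (forall x, d < x -> 0 < (u x ^ 2 - u d ^ 2) * (L ^ 2 - u d ^ 2)) /\
  (forall x y, d < x -> x < y -> 0 < (u y ^ 2 - u x ^ 2) * (L ^ 2 - u d ^ 2)).
Proof.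
  intros P Hu H0 H1 HL Hne.
  assert (HnD : forall x, d < x -> ~ In x D) by (intros x Hx Hin; apply Hu in Hin; lra).
  assert (Sc := profile_sq_continuous _ _ _ _ _ _ _ _ _ _ P).
  assert (Mv : forall x y, d <= x -> x < y -> exists z, d < z /\ u y ^ 2 - u x ^ 2 = 2 * u z * u1 z * (y - x)).
  { intros x y Hx Hxy.
    destruct (mvt_open (fun x => u x ^ 2) (fun x => 2 * u x * u1 x) x y Hxy) as [z [Hz Ez]].
    - intros z Hz. apply (profile_sq_derive _ _ _ _ _ _ _ _ _ _ P). apply HnD. lra.
    - intros z _. apply Sc.
    - exists z. split; [lra|auto]. }
  assert (Ss : forall x y, d < x -> d < y -> 0 < (2 * u x * u1 x) * (2 * u y * u1 y)).
  { intros x y. apply (same_sign_on (fun z => 2 * u z * u1 z) (fun x => d < x)).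
    - intros p q z Hp Hq Hz. lra.
    - intros z Hz. specialize (HnD z Hz). apply continuous_Rmult.
      + apply continuous_Rmult; [apply continuous_const|].
        eapply is_derive_continuous. apply (pr_u P). auto.
      + eapply is_derive_continuous. apply (pr_u1 P). auto.
    - intros z Hz. apply Rmult_integral_contrapositive_currified; auto. }
  assert (Cmp : forall x y x' y', d <= x -> x < y -> d <= x' -> x' < y' ->
    0 < (u y ^ 2 - u x ^ 2) * (u y' ^ 2 - u x' ^ 2)).
  { intros x y x' y' A B A' B'. destruct (Mv x y A B) as [z [Hz Ez]].
    destruct (Mv x' y' A' B') as [z' [Hz' Ez']]. rewrite Ez, Ez'.
    specialize (Ss z z' Hz Hz').
    replace (2 * u z * u1 z * (y - x) * (2 * u z' * u1 z' * (y' - x'))) with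
      ((2 * u z * u1 z) * (2 * u z' * u1 z') * ((y - x) * (y' - x'))) by ring.
    apply Rmult_lt_0_compat; auto. apply Rmult_lt_0_compat; lra. }
  assert (Lim : forall x y, d <= x -> x < y -> 0 < (u y ^ 2 - u x ^ 2) * (L ^ 2 - u d ^ 2)).
  { intros x y Hx Hxy.
    assert (A : 0 <= (u y ^ 2 - u x ^ 2) * (L ^ 2 - u d ^ 2)).
    { apply (is_lim_nonneg_R (fun z => (u y ^ 2 - u x ^ 2) * (u z ^ 2 - u d ^ 2)) d).
      - intros z Hz. left. apply Cmp; auto; lra.
      - apply (is_lim_continuous_comp (fun z => (u y ^ 2 - u x ^ 2) * (z ^ 2 - u d ^ 2))); auto.
        apply (ex_derive_continuous (V := R_NormedModule)). auto_derive. auto. }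
    destruct A as [A|A]; auto. symmetry in A. apply Rmult_integral in A.
    destruct A as [A|A]; [|lra]. specialize (Cmp x y x y Hx Hxy Hx Hxy). rewrite A in Cmp. lra. }
  split; intros; apply Lim; auto; lra.
Qed.

Lemma between_of_products (p q r : R) :
  0 < (p - q) * (r - q) -> 0 < (p - r) * (q - r) -> Rmin q r <= p <= Rmax q r.
Proof.
  intros H1 H2. unfold Rmin, Rmax. destruct (Rle_dec q r) as [H|H].
  - assert (q < r) by (destruct H; auto; subst; lra).
    split; apply Rnot_lt_le; intro C; nra.
  - split; apply Rnot_lt_le; intro C; nra.
Qed.

(** At a jump [a - 3 g u ^ 2 = - 2 a]. This factor never vanishes, so everywhere and in the far
    field its sign is opposite to that of a; in particular u has no zero, and the third zero of the
    energy is out of reach. The energy at the jump then forces b < 0, and the sign of g separates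
    the two bands. *)
Theorem profile_jump_nonzero_far_field a b gam g D u u1 u2 v v1 (l lm : R)
  (hgam : gam <> 0) (hg : g <> 0) :
  profile a b gam g D u u1 u2 v v1 -> D <> nil ->
  is_lim u p_infty l -> l <> 0 -> is_lim u m_infty lm ->
  exists x0, In x0 D /\ (forall d, In d D -> d = x0) /\
    (forall y, y <> 0 -> u (x0 + y) = - u (x0 - y)) /\
    gam ^ 2 = b * (a - g * l ^ 2) /\ (forall x, u x <> 0) /\
    (forall x, x0 < x -> g * u x ^ 2 <> a) /\
    ((g < 0 /\ a < 0 /\ b < 0 /\ 3 / 2 * gam ^ 2 < a * b /\
       (forall x y, x0 < x -> x < y -> u y ^ 2 < u x ^ 2)) \/
     (0 < g /\ 0 < a /\ b < 0 /\ (forall x y, x0 < x -> x < y -> u x ^ 2 < u y ^ 2))).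
Proof.
  intros P HD Hp Hl Hm.
  assert (G2 : 0 < gam ^ 2) by (apply pow2_gt_0; auto).
  assert (L2 : 0 < l ^ 2) by (apply pow2_gt_0; auto).
  destruct (profile_energy _ _ _ _ _ _ _ _ _ _ P) as [E HE].
  destruct (profile_far_right _ _ _ _ _ _ _ _ _ _ E l hgam P HE Hp) as [P1 P2].
  assert (Heq : gam ^ 2 = b * (a - g * l ^ 2)).
  { apply Rmult_integral in P1. destruct P1; [contradiction|lra]. }
  assert (Hb : b <> 0) by (intro; subst b; lra).
  destruct (profile_far_left _ _ _ _ _ _ _ _ _ _ E lm hgam P HE Hm) as [M1 M2].
  assert (Lm := other_far_field _ _ _ _ _ _ _ hgam hg Heq P2 Hl M1 M2).
  pose proof (profile_energy_slope _ _ _ _ _ _ _ _ _ _ E P HE) as S.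
  pose proof (potential_nonzero_far_field a b gam g E l) as F.
  assert (Sc := profile_sq_continuous _ _ _ _ _ _ _ _ _ _ P).
  assert (HaD : a - 3 * g * l ^ 2 <> 0).
  { intro Z. apply HD. apply (profile_singular_far_field _ _ _ _ _ _ _ _ _ _ E l hgam hg P); auto. lra. }
  destruct (list_last D) as [N|[d [Hd _]]]; [contradiction|].
  destruct (profile_jump_detuning _ _ _ _ _ _ _ _ _ _ hgam d P Hd) as [Ha Hag].
  assert (A2 : 0 < a ^ 2) by (apply pow2_gt_0; auto).
  assert (Hal : a - g * l ^ 2 <> 0) by (intro Z; rewrite Z in Heq; lra).
  assert (Une : forall x, u x ^ 2 <> l ^ 2).
  { intros x Hx. apply HD.
    apply (profile_equilibrium_global _ _ _ _ _ _ _ _ _ _ E (l ^ 2) P HE) with x; auto.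
    - intros d' Hd' Z. destruct (pr_jump P _ Hd') as [J _]. rewrite Z in J. lra.
    - intros z0 Hz0. apply nonzero_equilibrium_bound with l; auto. }
  assert (Sq : forall x, (u x ^ 2 - l ^ 2) ^ 2 <> 0).
  { intros x. apply pow_nonzero. specialize (Une x). lra. }
  assert (Jd : g * u d ^ 2 = a) by apply (pr_jump P _ Hd).
  assert (Dn : forall x, a - 3 * g * u x ^ 2 <> 0).
  { intros x Z. destruct (in_dec Req_dec_T x D) as [Hx|Hx].
    - destruct (pr_jump P _ Hx) as [J _]. lra.
    - specialize (S x Hx). rewrite Z, F in S; auto.
      assert (Q : b * g * (u x ^ 2 - l ^ 2) ^ 2 * (a - 3 * g * l ^ 2) = 0).
      { replace (2 * g * u x ^ 2 - a + g * l ^ 2) with (- (a - 3 * g * l ^ 2) / 3) in S by lra. lra. }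
      specialize (Sq x).
      repeat (apply Rmult_integral in Q; destruct Q as [Q|Q]; try contradiction). }
  assert (Ds : forall x, a * (a - 3 * g * u x ^ 2) < 0).
  { intros x. assert (0 < (a - 3 * g * u d ^ 2) * (a - 3 * g * u x ^ 2)); [|nra].
    apply (same_sign_on (fun z => a - 3 * g * u z ^ 2) (fun _ => True)); auto.
    intros z _. apply continuous_Rminus; [apply continuous_const|].
    apply continuous_Rmult; [apply continuous_const|auto]. }
  assert (Dl : a * (a - 3 * g * l ^ 2) < 0).
  { assert (H : 0 <= - a * (a - 3 * g * l ^ 2)).
    { apply (is_lim_nonneg_R (fun y => - a * (a - 3 * g * u y ^ 2)) 0).
      - intros y _. specialize (Ds y). lra.
      - apply (is_lim_continuous_comp (fun z => - a * (a - 3 * g * z ^ 2))); auto.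
        apply (ex_derive_continuous (V := R_NormedModule)). auto_derive. auto. }
    destruct H as [H|H]; [lra|]. symmetry in H. apply Rmult_integral in H. lra. }
  assert (U1 : forall x, ~ In x D -> u1 x <> 0).
  { intros x Hx Z. specialize (S x Hx). rewrite Z, F in S; auto.
    assert (Q : b * g * (u x ^ 2 - l ^ 2) ^ 2 * (2 * g * u x ^ 2 - a + g * l ^ 2) = 0) by lra.
    specialize (Sq x).
    apply Rmult_integral in Q. destruct Q as [Q|Q].
    - repeat (apply Rmult_integral in Q; destruct Q as [Q|Q]; try contradiction).
    - specialize (Ds x). replace (a - 3 * g * u x ^ 2) with (- (a - 3 * g * l ^ 2) / 2) in Ds by lra. lra. }
  assert (U0 : forall x, u x <> 0).
  { intros x Z. specialize (Ds x). rewrite Z in Ds. lra. }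
  assert (Hu : forall d', In d' D -> d' = d).
  { intros d' Hd'. apply (profile_single_jump _ _ _ _ _ _ _ _ _ _ hg P U0 U1); auto. }
  assert (Sd : u d ^ 2 <> l ^ 2) by apply Une.
  assert (HnD : forall x, x <> d -> ~ In x D) by (intros x Hx Hin; apply Hx; auto).
  destruct (profile_jump_sq_monotone _ _ _ _ _ _ _ _ _ _ d l P Hu U0 U1 Hp Sd) as [R1 R2].
  (* The left half-line by reflection; there the far field is lm, which has the same square as l. *)
  assert (Rl : forall x, x < d -> 0 < (u x ^ 2 - u d ^ 2) * (l ^ 2 - u d ^ 2)).
  { intros x Hx.
    destruct (profile_jump_sq_monotone _ _ _ _ _ _ _ _ _ _ (- d) lm (profile_reflect _ _ _ _ _ _ _ _ _ _ P)) as [T _].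
    - intros d' Hd'. apply in_map_opp in Hd'. apply Hu in Hd'. lra.
    - intros z. apply U0.
    - intros z Hz. rewrite in_map_opp in Hz. specialize (U1 _ Hz). lra.
    - apply is_lim_opp_arg. auto.
    - rewrite Ropp_involutive, Lm. auto.
    - specialize (T (- x) ltac:(lra)). rewrite !Ropp_involutive, Lm in T. auto. }
  assert (Btw : forall x, x <> d -> 0 < (u x ^ 2 - u d ^ 2) * (l ^ 2 - u d ^ 2)).
  { intros x Hx. destruct (Rlt_dec x d); [apply Rl; auto|apply R1; lra]. }
  assert (Far : forall x, 0 < (u x ^ 2 - l ^ 2) * (u d ^ 2 - l ^ 2)).
  { intros x. apply (same_sign_on (fun z => u z ^ 2 - l ^ 2) (fun _ => True)); auto.
    - intros z _. apply continuous_Rminus; [auto|apply continuous_const].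
    - intros z _. specialize (Une z). lra. }
  exists d. split; [auto|]. split; [auto|]. split.
  { intros y Hy. replace (- u (d - y)) with (-1 * u (d - y)) by ring.
    (* The degenerate value does not lie between the jump value and the far-field value of u ^ 2, so
       the cubic is invertible on the range of u on each side. *)
    assert (AL : 0 < (a - 3 * g * u d ^ 2) * (a - 3 * g * l ^ 2)).
    { replace (a - 3 * g * u d ^ 2) with (- 2 * a) by lra. lra. }
    apply (profile_symmetric _ _ _ _ _ _ _ _ _ _ hgam (-1) d
      (Rmin (u d ^ 2) (l ^ 2)) (Rmax (u d ^ 2) (l ^ 2)) P); auto.
    - intro; lra.
    - intros _. pose proof (pr_alg P d) as Al. rewrite Jd in Al.
      apply (Rmult_eq_reg_l gam); auto. lra.
    - pose proof (pow2_ge_0 (u d)). unfold Rmin, Rmax. destruct (Rle_dec (u d ^ 2) (l ^ 2)); lra.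
    - unfold Rmin, Rmax. destruct (Rle_dec (u d ^ 2) (l ^ 2)); auto. rewrite Rmult_comm. auto.
    - intros x Hx. apply between_of_products; auto.
    - right. intros z Hz. pose proof (profile_jump_sign _ _ _ _ _ _ _ _ _ _ d P Hd Hu U0 z z Hz Hz). lra. }
  split; [auto|]. split; [auto|]. split.
  { intros x Hx Z. specialize (R1 x Hx). replace (u x ^ 2) with (u d ^ 2) in R1.
    - lra.
    - apply (Rmult_eq_reg_l g); auto. lra. }
  assert (Nb : b < 0).
  { pose proof (HE d) as Ed. rewrite F in Ed; auto.
    replace (2 * g * u d ^ 2 - a + g * l ^ 2) with (a + g * l ^ 2) in Ed by lra.
    pose proof (pow2_ge_0 (v1 d)).
    assert (0 <= gam ^ 2 * v1 d ^ 2) by (apply Rmult_le_pos; lra).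
    assert (Q : 0 <= - b * (g * (a + g * l ^ 2) * (u d ^ 2 - l ^ 2) ^ 2)) by lra.
    assert (Pq : 0 < g * (a + g * l ^ 2) * (u d ^ 2 - l ^ 2) ^ 2).
    { apply Rmult_lt_0_compat.
      - assert (0 < g ^ 2) by (apply pow2_gt_0; auto). nra.
      - apply pow2_gt_0. lra. }
    apply Rnot_le_lt. intro C. assert (Pb : 0 < b) by lra.
    pose proof (Rmult_lt_0_compat _ _ Pb Pq). lra. }
  assert (Har : a < g * l ^ 2).
  { rewrite Heq in G2. clear - G2 Nb. nra. }
  destruct (Rlt_dec g 0) as [Ng|Ng].
  - left. assert (Na : a < 0) by (clear - Hag Ng; nra).
    split; [auto|split; [auto|split; [auto|split]]].
    + assert (0 < a - 3 * g * l ^ 2) by (clear - Dl Na; nra).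
      assert (b * (a - 3 * g * l ^ 2) < 0) by (clear - H Nb; nra). lra.
    + intros x y Hx Hxy. specialize (R2 x y Hx Hxy).
      assert (l ^ 2 < u d ^ 2) by (clear - Jd Har Ng; nra). clear - R2 H. nra.
  - right. assert (Pg : 0 < g) by lra. assert (Pa : 0 < a) by (clear - Hag Pg; nra).
    split; [auto|split; [auto|split; [auto|]]].
    intros x y Hx Hxy. specialize (R2 x y Hx Hxy).
    assert (u d ^ 2 < l ^ 2) by (clear - Jd Har Pg; nra). clear - R2 H. nra.
Qed.

Lemma exponential_decay_right (s s1 : R -> R) (d k : R) :
  (forall x, d <= x -> continuous s x) -> (forall x, d < x -> is_derive s x (s1 x)) ->
  (forall x, d < x -> s1 x = - k * s x) ->
  forall x, d < x -> s x = s d * exp (- k * (x - d)).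
Proof.
  intros Hc Hd H1 x Hx.
  assert (E : s d * exp (k * (d - d)) = s x * exp (k * (x - d))).
  { apply (constant_of_derive_0_off nil (fun x => s x * exp (k * (x - d))) d x); auto.
    - intros z Hz. apply continuous_Rmult; [apply Hc; lra|].
      apply (ex_derive_continuous (V := R_NormedModule)). auto_derive. auto.
    - intros z Hz _. specialize (Hd z ltac:(lra)). specialize (H1 z ltac:(lra)). der.
      rewrite H1. ring. }
  replace (k * (d - d)) with 0 in E by ring. rewrite exp_0, Rmult_1_r in E.
  rewrite E, Rmult_assoc, <- exp_plus. replace (k * (x - d) + - k * (x - d)) with 0 by ring.
  rewrite exp_0. ring.
Qed.

(** Between the jump, where u ^ 2 = a / g, and the far field, u ^ 2 passes the degenerate value a /
    (3 g). There the energy requires a / 3 to be a root of [bright_factor], that is, a b = 9/8 gam ^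
    2. *)
Theorem profile_jump_zero_far_field a b gam g D u u1 u2 v v1 (lm : R)
  (hgam : gam <> 0) (hg : g <> 0) :
  profile a b gam g D u u1 u2 v v1 -> D <> nil ->
  is_lim u p_infty 0 -> is_lim u m_infty lm ->
  lm = 0 /\ g < 0 /\ a < 0 /\ b < 0 /\ a * b = 9 / 8 * gam ^ 2 /\
  exists x0, In x0 D /\ (forall d, In d D -> d = x0) /\
    (forall y, y <> 0 -> u (x0 + y) = - u (x0 - y)).
Proof.
  intros P HD Hp Hm.
  assert (G2 : 0 < gam ^ 2) by (apply pow2_gt_0; auto).
  destruct (profile_energy _ _ _ _ _ _ _ _ _ _ P) as [E HE].
  destruct (profile_far_right _ _ _ _ _ _ _ _ _ _ E 0 hgam P HE Hp) as [_ P2].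
  assert (E0 : E = 0) by (unfold potential in P2; lra).
  destruct (profile_far_left _ _ _ _ _ _ _ _ _ _ E lm hgam P HE Hm) as [M1 M2].
  assert (Lm := far_fields_vanish _ _ _ _ _ _ hgam hg E0 M1 M2). subst lm E.
  pose proof (profile_energy_slope _ _ _ _ _ _ _ _ _ _ 0 P HE) as S.
  assert (Sc := profile_sq_continuous _ _ _ _ _ _ _ _ _ _ P).
  destruct (list_last D) as [N|[d [Hd Hlast]]]; [contradiction|].
  destruct (profile_jump_detuning _ _ _ _ _ _ _ _ _ _ hgam d P Hd) as [Ha Hag].
  destruct (pr_jump P _ Hd) as [Jd [Jd0 _]].
  assert (Sd : 0 < u d ^ 2) by (apply pow2_gt_0; auto).
  assert (Na : a < 0).
  { pose proof (HE d) as Ed. rewrite potential_bright, Jd in Ed. unfold bright_factor in Ed.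
    pose proof (pow2_ge_0 (v1 d)).
    assert (0 <= - a * (gam ^ 2 * u d ^ 2)) by nra. assert (0 < gam ^ 2 * u d ^ 2) by nra. nra. }
  assert (Ng : g < 0) by nra.
  assert (U0 : forall x, u x <> 0).
  { intros x Z. apply HD. apply (profile_equilibrium_global _ _ _ _ _ _ _ _ _ _ 0 0 P HE) with x.
    - intros d' Hd' Z'. destruct (pr_jump P _ Hd') as [_ [J _]].
      apply J. apply Rsqr_0_uniq. unfold Rsqr. lra.
    - lra.
    - apply bright_equilibrium_bound.
    - rewrite Z. ring. }
  assert (Hab : 8 * (a * b) = 9 * gam ^ 2).
  { pose proof (is_lim_sq _ _ _ Hp) as Hp2.
    destruct (proj1 (is_lim_p_infty_R _ _) Hp2 (u d ^ 2 / 3) ltac:(lra)) as [M HM].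
    pose proof (Rmax_l M d). pose proof (Rmax_r M d).
    specialize (HM (Rmax M d + 1) ltac:(lra)). apply Rabs_def2 in HM.
    destruct (intermediate_value (fun x => u x ^ 2) d (Rmax M d + 1) (u d ^ 2 / 3)) as [x [Hx Ex]]; auto.
    { nra. }
    rewrite Rmin_left in Hx by lra.
    assert (x <> d) by (intro; subst x; lra).
    specialize (S x (Hlast x ltac:(lra))). rewrite Ex, potential_bright, Rplus_0_r in S.
    replace (g * (u d ^ 2 / 3)) with (a / 3) in S by lra.
    replace (a - 3 * g * (u d ^ 2 / 3)) with 0 in S by lra.
    assert (Z : bright_factor a b gam (a / 3) = 0) by (apply (Rmult_eq_reg_l (u d ^ 2 / 3)); lra).
    unfold bright_factor in Z. apply (Rmult_eq_reg_l a); auto. lra. }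
  assert (Nb : b < 0) by nra.
  (* At a b = 9/8 gam ^ 2 both sides of the energy equation contain the factor
     [(a - 3 g u ^ 2) ^ 2]; what remains is u' ^ 2 = k u ^ 2. *)
  set (k := - (2 * b) / 9). assert (Hk : 0 < k) by (unfold k; lra).
  assert (S1 : forall x, ~ In x D -> u1 x ^ 2 = k * u x ^ 2).
  { intros x Hx. specialize (S x Hx). unfold potential in S.
    set (s := u x ^ 2) in *.
    (* Where that factor vanishes it cannot be cancelled, and [profile_second_order] gives the same
       value of u' ^ 2. *)
    destruct (Req_dec (a - 3 * g * s) 0) as [Z|Z].
    - pose proof (profile_second_order _ _ _ _ _ _ _ _ _ _ P x Hx) as O. fold s in O. rewrite Z in O.
      replace (g * s) with (a / 3) in O by lra.
      assert (Q : u x * (3 * g * u1 x ^ 2 + gam ^ 2 - b * (a - a / 3)) = 0) by lra.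
      apply Rmult_integral in Q. destruct Q as [Q|Q]; [destruct (U0 x Q)|].
      apply (Rmult_eq_reg_l (27 * g)); [|lra]. unfold k.
      assert (E3 : 3 * g * s = a) by lra.
      replace (27 * g * (- (2 * b) / 9 * s)) with (- 2 * b * (3 * g * s)) by field. rewrite E3. lra.
    - assert (Q : (a - 3 * g * s) ^ 2 * (u1 x ^ 2 - k * s) = 0).
      { unfold k. assert (E : gam ^ 2 = 8 / 9 * (a * b)) by lra. rewrite E in S. lra. }
      apply Rmult_integral in Q. destruct Q as [Q|Q]; [|lra].
      exfalso. apply (pow_nonzero (a - 3 * g * s) 2); auto. }
  assert (U1 : forall x, ~ In x D -> u1 x <> 0).
  { intros x Hx Z. specialize (S1 x Hx). rewrite Z in S1.
    assert (0 < u x ^ 2) by (apply pow2_gt_0; auto). assert (0 < k * u x ^ 2) by nra. lra. }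
  assert (Hu : forall d', In d' D -> d' = d).
  { intros d' Hd'. apply (profile_single_jump _ _ _ _ _ _ _ _ _ _ hg P U0 U1); auto. }
  split; [auto|]. split; [auto|]. split; [auto|]. split; [auto|]. split; [lra|].
  exists d. split; [auto|]. split; [auto|].
  set (K := 2 * sqrt k). assert (Hsq : 0 < sqrt k) by (apply sqrt_lt_R0; auto).
  assert (Dec : forall D u u1 u2 v v1 d, profile a b gam g D u u1 u2 v v1 ->
    (forall d', In d' D -> d' = d) -> (forall x, u x <> 0) -> (forall x, ~ In x D -> u1 x <> 0) ->
    (forall x, ~ In x D -> u1 x ^ 2 = k * u x ^ 2) -> is_lim u p_infty 0 ->
    forall x, d < x -> u x ^ 2 = u d ^ 2 * exp (- K * (x - d))).
  { clear - Hsq Hk. intros D u u1 u2 v v1 d P Hu U0 U1 S1 Hp.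
    assert (HnD : forall x, d < x -> ~ In x D) by (intros x Hx Hin; apply Hu in Hin; lra).
    assert (Ud : 0 < u d ^ 2) by (apply pow2_gt_0; auto).
    destruct (profile_jump_sq_monotone _ _ _ _ _ _ _ _ _ _ d 0 P Hu U0 U1 Hp) as [_ R2]; [lra|].
    apply (exponential_decay_right (fun x => u x ^ 2) (fun x => 2 * u x * u1 x)).
    - intros x _. apply (profile_sq_continuous _ _ _ _ _ _ _ _ _ _ P).
    - intros x Hx. apply (profile_sq_derive _ _ _ _ _ _ _ _ _ _ P). auto.
    - intros x Hx. specialize (S1 x (HnD x Hx)).
      assert (Q : (u1 x - sqrt k * u x) * (u1 x + sqrt k * u x) = 0).
      { assert (T := sqrt_sqrt k ltac:(lra)).
        transitivity (u1 x ^ 2 - sqrt k * sqrt k * u x ^ 2); [ring|rewrite T; lra]. }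
      apply Rmult_integral in Q. destruct Q as [Q|Q].
      (* The growing root contradicts the decrease of u ^ 2 away from the jump. *)
      + exfalso. assert (Ux : 0 < u x ^ 2) by (apply pow2_gt_0; auto).
        pose proof (profile_sq_derive _ _ _ _ _ _ _ _ _ _ P x (HnD x Hx)) as Ds.
        replace (u1 x) with (sqrt k * u x) in Ds by lra.
        apply is_derive_Reals in Ds.
        destruct (Ds (sqrt k * u x ^ 2)) as [e He]; [nra|]. pose proof (cond_pos e).
        specialize (He (e / 2) ltac:(lra)). rewrite Rabs_pos_eq in He by lra.
        specialize (He ltac:(lra)). apply Rabs_def2 in He.
        specialize (R2 x (x + e / 2) Hx ltac:(lra)).
        assert (B : u (x + e / 2) ^ 2 - u x ^ 2 < 0).
        { set (p := u (x + e / 2) ^ 2 - u x ^ 2) in *. set (q := u d ^ 2) in *. clearbody p q.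
          clear - R2 Ud. nra. }
        assert (((u (x + e / 2) ^ 2 - u x ^ 2) / (e / 2)) < 0).
        { apply Rmult_lt_reg_r with (e / 2); [lra|]. unfold Rdiv at 1.
          rewrite Rmult_assoc, Rinv_l, Rmult_0_l; lra. }
        nra.
      + unfold K. replace (u1 x) with (- (sqrt k * u x)) by lra. ring. }
  assert (Pos : forall y, 0 < y -> u (d + y) = - u (d - y)).
  { intros y Hy.
    assert (A := Dec D u u1 u2 v v1 d P Hu U0 U1 S1 Hp (d + y) ltac:(lra)).
    assert (B := Dec _ _ _ _ _ _ (- d) (profile_reflect _ _ _ _ _ _ _ _ _ _ P)).
    specialize (B ltac:(intros d' Hd'; apply in_map_opp in Hd'; apply Hu in Hd'; lra)).
    specialize (B (fun z => U0 (- z))).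
    specialize (B ltac:(intros z Hz; rewrite in_map_opp in Hz; specialize (U1 _ Hz); lra)).
    specialize (B ltac:(intros z Hz; rewrite in_map_opp in Hz; rewrite <- (S1 _ Hz); ring)).
    specialize (B (proj2 (is_lim_opp_arg u 0) Hm) (- d + y) ltac:(lra)). cbv beta in B.
    rewrite Ropp_involutive in B. replace (- (- d + y)) with (d - y) in B by ring.
    replace (- d + y - - d) with y in B by ring. replace (d + y - d) with y in A by ring.
    rewrite <- B in A.
    pose proof (profile_jump_sign _ _ _ _ _ _ _ _ _ _ d P Hd Hu U0 y y Hy Hy) as Sg.
    assert (Q : (u (d + y) - u (d - y)) * (u (d + y) + u (d - y)) = 0) by lra.
    apply Rmult_integral in Q. destruct Q as [Q|Q]; [|lra].
    replace (u (d + y)) with (u (d - y)) in Sg by lra. nra. }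
  intros y Hy. destruct (Rlt_dec 0 y) as [H|H]; [auto|].
  specialize (Pos (- y) ltac:(lra)). replace (d + - y) with (d - y) in Pos by ring.
  replace (d - - y) with (d + y) in Pos by ring. lra.
Qed.

(** * Harmonic fields *)

Lemma is_derive_C_pair (f h : R -> R) (x l1 l2 : R) :
  is_derive f x l1 -> is_derive h x l2 ->
  is_derive (V := C_R_NormedModule) (fun y => (f y, h y) : C) x ((l1, l2) : C).
Proof.
  intros Hf Hh.
  apply (is_derive_ext (V := C_R_NormedModule)
    (fun y => plus (scal (f y) ((1, 0) : C)) (scal (h y) ((0, 1) : C)))).
  { intros t. apply injective_projections; simpl;
      unfold plus, scal; simpl; unfold mult; simpl; ring. }
  replace ((l1, l2) : C) with (plus (scal l1 ((1, 0) : C_R_NormedModule)) (scal l2 ((0, 1) : C_R_NormedModule))).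
  2:{ apply injective_projections; simpl; unfold plus, scal; simpl; unfold mult; simpl; ring. }
  apply (is_derive_plus (V := C_R_NormedModule)).
  - apply (is_derive_scal_l (V := C_R_NormedModule) f x l1). exact Hf.
  - apply (is_derive_scal_l (V := C_R_NormedModule) h x l2). exact Hh.
Qed.

Lemma is_derive_C_fst (F : R -> C) (x : R) (l : C) :
  is_derive (V := C_R_NormedModule) F x l -> is_derive (fun y => fst (F y)) x (fst l).
Proof.
  intros H.
  assert (L : filterdiff (fst : C_R_NormedModule -> R_NormedModule) (locally (F x)) fst).
  { apply filterdiff_linear. apply (is_linear_fst (U := R_NormedModule) (V := R_NormedModule)). }
  exact (filterdiff_comp' F _ x _ _ H L).
Qed.

Lemma is_derive_C_snd (F : R -> C) (x : R) (l : C) :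
  is_derive (V := C_R_NormedModule) F x l -> is_derive (fun y => snd (F y)) x (snd l).
Proof.
  intros H.
  assert (L : filterdiff (snd : C_R_NormedModule -> R_NormedModule) (locally (F x)) snd).
  { apply filterdiff_linear. apply (is_linear_snd (U := R_NormedModule) (V := R_NormedModule)). }
  exact (filterdiff_comp' F _ x _ _ H L).
Qed.

Lemma harmonic_pair (w : R) (phi : R -> R) (x t : R) :
  harmonic w phi x t = (phi x * cos (w * t), - (phi x * sin (w * t))).
Proof.
  unfold harmonic. apply injective_projections; simpl; rewrite ?cos_neg, ?sin_neg; ring.
Qed.

Lemma Cmod_harmonic_sq (w : R) (phi : R -> R) (x t : R) : Cmod (harmonic w phi x t) ^ 2 = phi x ^ 2.
Proof.
  rewrite harmonic_pair. unfold Cmod. rewrite pow2_sqrt.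
  - simpl fst. simpl snd. pose proof (sin2_cos2 (w * t)) as H. unfold Rsqr in H.
    transitivity (phi x ^ 2 * (sin (w * t) * sin (w * t) + cos (w * t) * cos (w * t))); [ring|].
    rewrite H. ring.
  - simpl fst. simpl snd. pose proof (pow2_ge_0 (phi x * cos (w * t))).
    pose proof (pow2_ge_0 (- (phi x * sin (w * t)))). lra.
Qed.

Lemma C2_at_derive (f : R -> R) (x : R) :
  C2_at f x -> is_derive f x (Derive f x) /\ is_derive (Derive f) x (Derive_n f 2 x) /\
    continuous (Derive_n f 2) x.
Proof.
  intros [H1 H2]. apply locally_singleton in H1. destruct H1 as [H1 H3].
  split; [apply Derive_correct; auto|split; [|auto]].
  change (Derive_n f 2 x) with (Derive (Derive f) x). apply Derive_correct. exact H3.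
Qed.

Lemma C2_at_of_derive (f f1 f2 : R -> R) (x : R) :
  locally x (fun y => is_derive f y (f1 y)) -> locally x (fun y => is_derive f1 y (f2 y)) ->
  continuous f2 x -> C2_at f x /\ Derive_n f 2 x = f2 x.
Proof.
  intros H1 H2 H3.
  assert (E : locally x (fun y => locally y (fun z => f1 z = Derive f z))).
  { apply locally_locally. revert H1. apply filter_imp. intros y Hy. symmetry. apply is_derive_unique. auto. }
  assert (F : locally x (fun y => is_derive (Derive f) y (f2 y))).
  { generalize (filter_and _ _ E H2). apply filter_imp. intros y [A B].
    apply is_derive_ext_loc with f1; auto. }
  assert (G : locally x (fun y => f2 y = Derive_n f 2 y)).
  { revert F. apply filter_imp. intros y Hy. symmetry. apply is_derive_unique. exact Hy. }
  split; [split|].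
  - generalize (filter_and _ _ H1 F). apply filter_imp. intros y [A B]. split.
    + exists (f1 y). auto.
    + exists (f2 y). exact B.
  - apply continuous_ext_loc with f2; auto.
  - symmetry. exact (locally_singleton _ _ G).
Qed.

(** At t = 0 the phase is 1, so the real parts of (P) are already the two equations for the
    envelopes. *)
Lemma classical_at_equations wX wC gam g w u v x :
  classical_at wX wC gam g w u v x ->
  gam * v x = (w - wX - g * u x ^ 2) * u x /\
  Derive_n v 2 x = 2 * (gam * u x - (w - wC) * v x).
Proof.
  intros [HX [HC H]]. destruct (H 0) as [dtX [dtC [dC [dxx [H1 [H2 [H3 [H4 [H5 H6]]]]]]]]].
  assert (c0 : cos (w * 0) = 1) by (rewrite Rmult_0_r; apply cos_0).
  assert (s0 : sin (w * 0) = 0) by (rewrite Rmult_0_r; apply sin_0).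
  assert (T : forall (phi : R -> R) (d : C),
    is_derive (V := C_R_NormedModule) (fun s : R => harmonic w phi x s) 0 d -> snd d = - (w * phi x)).
  { intros phi d Hd. apply is_derive_C_snd in Hd.
    assert (A : is_derive (fun s => snd (harmonic w phi x s)) 0 (- (w * phi x))).
    { apply is_derive_ext with (fun s => - (phi x * sin (w * s))).
      - intros t. rewrite harmonic_pair. reflexivity.
      - auto_derive; auto. rewrite c0. ring. }
    apply is_derive_unique in A. apply is_derive_unique in Hd. congruence. }
  assert (X2 : fst dxx = Derive_n v 2 x).
  { apply is_derive_C_fst in H4.
    assert (A : is_derive (fun y => fst (dC y)) x (Derive_n v 2 x)).
    { apply is_derive_ext_loc with (Derive v).
      - revert H3. apply filter_imp. intros y Hy. apply is_derive_C_fst in Hy.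
        apply is_derive_unique in Hy. rewrite <- Hy. apply Derive_ext. intros z.
        rewrite harmonic_pair. simpl fst. rewrite c0. ring.
      - apply C2_at_derive in HC. tauto. }
    apply is_derive_unique in A. apply is_derive_unique in H4. congruence. }
  apply T in H1. apply T in H2. rewrite Cmod_harmonic_sq in H5. rewrite !harmonic_pair in H5.
  rewrite !harmonic_pair in H6.
  apply (f_equal fst) in H5. apply (f_equal fst) in H6. simpl in H5, H6.
  rewrite c0, s0 in H5, H6. rewrite H1 in H5. rewrite H2, X2 in H6. split; lra.
Qed.

Lemma classical_at_intro wX wC gam g w u v x :
  C2_at u x -> C2_at v x -> gam * v x = (w - wX - g * u x ^ 2) * u x ->
  Derive_n v 2 x = 2 * (gam * u x - (w - wC) * v x) ->
  classical_at wX wC gam g w u v x.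
Proof.
  intros HX HC E1 E2. split; [auto|split; [auto|]]. intros t.
  exists (- (w * u x * sin (w * t)), - (w * u x * cos (w * t))).
  exists (- (w * v x * sin (w * t)), - (w * v x * cos (w * t))).
  exists (fun y => (Derive v y * cos (w * t), - (Derive v y * sin (w * t)))).
  exists (Derive_n v 2 x * cos (w * t), - (Derive_n v 2 x * sin (w * t))).
  assert (T : forall phi : R -> R, is_derive (V := C_R_NormedModule) (fun s : R => harmonic w phi x s) t
    (- (w * phi x * sin (w * t)), - (w * phi x * cos (w * t)))).
  { intros phi. apply (is_derive_ext (V := C_R_NormedModule)
      (fun s => (phi x * cos (w * s), - (phi x * sin (w * s))))).
    - intros s. symmetry. apply harmonic_pair.
    - apply is_derive_C_pair; auto_derive; auto; ring. }
  split; [apply T|]. split; [apply T|]. split.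
  { destruct HC as [HC _]. revert HC. apply filter_imp. intros y [Hy _].
    apply (is_derive_ext (V := C_R_NormedModule) (fun z => (v z * cos (w * t), - (v z * sin (w * t))))).
    - intros s. symmetry. apply harmonic_pair.
    - apply Derive_correct in Hy. apply is_derive_C_pair; der; ring. }
  split.
  { destruct (C2_at_derive _ _ HC) as [_ [D2 _]].
    apply is_derive_C_pair; der; ring. }
  rewrite Cmod_harmonic_sq, !harmonic_pair. split; apply injective_projections; simpl.
  - transitivity (w * u x * cos (w * t)); [ring|].
    transitivity (((wX + g * u x ^ 2) * u x + gam * v x) * cos (w * t)); [rewrite E1; ring|ring].
  - transitivity (- (w * u x * sin (w * t))); [ring|].
    transitivity (- (((wX + g * u x ^ 2) * u x + gam * v x) * sin (w * t))); [rewrite E1; ring|ring].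
  - change (Derive (fun x : R => Derive (fun x0 : R => v x0) x) x) with (Derive_n v 2 x).
    rewrite E2. field.
  - change (Derive (fun x : R => Derive (fun x0 : R => v x0) x) x) with (Derive_n v 2 x).
    rewrite E2. field.
Qed.

Lemma C2_at_shift (f : R -> R) (c x : R) : C2_at f (x + c) -> C2_at (shift f c) x.
Proof.
  intros H. destruct H as [H1 H2].
  assert (Lc : forall P : R -> Prop, locally (x + c) P -> locally x (fun y => P (y + c))).
  { intros P HP. apply locally_R in HP. destruct HP as [e [He HP]]. apply locally_R. exists e.
    split; auto. intros y Hy. apply HP. replace (y + c - (x + c)) with (y - x) by ring. auto. }
  split.
  - generalize (Lc _ H1). apply filter_imp. intros y [A B]. split.
    + change (ex_derive_n (fun z => f (z + c)) 1 y). apply ex_derive_n_comp_trans. exact A.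
    + apply ex_derive_n_comp_trans. exact B.
  - apply continuous_ext with (fun y => Derive_n f 2 (y + c)).
    + intros y. symmetry. apply Derive_n_comp_trans.
    + apply (continuous_comp (fun y => y + c) (Derive_n f 2)); [|exact H2].
      apply continuous_Rplus; [apply continuous_id|apply continuous_const].
Qed.

Lemma classical_at_shift wX wC gam g w u v c x :
  classical_at wX wC gam g w u v (x + c) ->
  classical_at wX wC gam g w (shift u c) (shift v c) x.
Proof.
  intros H. destruct (classical_at_equations _ _ _ _ _ _ _ _ H) as [E1 E2]. destruct H as [HX [HC _]].
  apply classical_at_intro; try (apply C2_at_shift; auto); auto.
  unfold shift at 1. rewrite (Derive_n_comp_trans v 2 x c). exact E2.
Qed.

(** * Test functions *)

(** Carrying the derivatives as witnesses makes closure under sums, products and affine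
    substitutions a short induction; [smooth_upto_ex_derive_n] translates back to the iterated
    [Derive]. *)
Fixpoint smooth_upto (n : nat) (f : R -> R) : Prop :=
  match n with
  | O => True
  | S m => exists f1, (forall x, is_derive f x (f1 x)) /\ smooth_upto m f1
  end.

Lemma smooth_upto_pred n f : smooth_upto (S n) f -> smooth_upto n f.
Proof.
  revert f. induction n as [|n IH]; intros f H; [exact I|].
  destruct H as [f1 [H1 H2]]. exists f1. split; auto.
Qed.

Lemma smooth_upto_plus n f h :
  smooth_upto n f -> smooth_upto n h -> smooth_upto n (fun x => f x + h x).
Proof.
  revert f h. induction n as [|n IH]; intros f h; [auto|].
  intros [f1 [F1 F2]] [h1 [H1 H2]]. exists (fun x => f1 x + h1 x). split; auto.
  intros x. apply (is_derive_plus (V := R_NormedModule)); auto.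
Qed.

Lemma smooth_upto_scal n k f : smooth_upto n f -> smooth_upto n (fun x => k * f x).
Proof.
  revert f. induction n as [|n IH]; intros f; [auto|].
  intros [f1 [F1 F2]]. exists (fun x => k * f1 x). split; auto.
  intros x. apply (is_derive_scal f x k); auto.
Qed.

Lemma smooth_upto_mult n f h :
  smooth_upto n f -> smooth_upto n h -> smooth_upto n (fun x => f x * h x).
Proof.
  revert f h. induction n as [|n IH]; intros f h; [auto|].
  intros Hf Hh. pose proof (smooth_upto_pred _ _ Hf) as Pf. pose proof (smooth_upto_pred _ _ Hh) as Ph.
  destruct Hf as [f1 [F1 F2]]. destruct Hh as [h1 [H1 H2]].
  exists (fun x => f1 x * h x + f x * h1 x). split; [|apply smooth_upto_plus; auto].
  intros x. specialize (F1 x). specialize (H1 x). der. ring.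
Qed.

Lemma smooth_upto_affine n k c f : smooth_upto n f -> smooth_upto n (fun x => f (k * x + c)).
Proof.
  revert f. induction n as [|n IH]; intros f; [auto|].
  intros [f1 [F1 F2]]. exists (fun x => k * f1 (k * x + c)). split; [|apply smooth_upto_scal; auto].
  intros x. specialize (F1 (k * x + c)).
  apply (is_derive_comp f (fun y => k * y + c) x (f1 (k * x + c)) k); auto. auto_derive; auto. ring.
Qed.

Lemma smooth_upto_ex_derive_n n f : smooth_upto n f -> forall x, ex_derive_n f n x.
Proof.
  revert f. induction n as [|n IH]; intros f H x; [exact I|].
  destruct H as [f1 [F1 F2]]. destruct n as [|n].
  - exists (f1 x). apply F1.
  - specialize (IH f1 F2 x). simpl in IH |- *.
    apply ex_derive_ext with (Derive_n f1 n); auto. intros t.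
    transitivity (Derive_n (Derive_n f 1) n t).
    + apply Derive_n_ext. intros s. symmetry. apply is_derive_unique. apply F1.
    + rewrite Derive_n_comp. replace (n + 1)%nat with (S n) by lia. reflexivity.
Qed.

(** The family exp (- 1 / x) / x ^ k, extended by 0, is closed under differentiation up to linear
    combinations, so a single induction proves all its members smooth. *)
Definition flat (k : nat) (x : R) : R := if Rlt_dec 0 x then exp (- / x) / x ^ k else 0.

Lemma pow_exp (n : nat) (x : R) : exp x ^ n = exp (INR n * x).
Proof.
  induction n as [|n IH]; [simpl; rewrite Rmult_0_l, exp_0; auto|].
  rewrite S_INR. simpl. rewrite IH, <- exp_plus. f_equal. ring.
Qed.

(** With n = k + 1 and y = 1 / x, exp y = exp (y / n) ^ n >= (y / n) ^ n. The bound, used at index k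
    + 1, gives the derivative 0 at the origin, because [flat k h / h = flat (k + 1) h]. *)
Lemma flat_linear_bound (k : nat) : exists C, 0 <= C /\ forall x, 0 <= flat k x <= C * Rmax 0 x.
Proof.
  exists (INR (S k) ^ S k). split; [apply pow_le; apply pos_INR|].
  intros x. unfold flat. destruct (Rlt_dec 0 x) as [Hx|Hx].
  2:{ rewrite Rmax_left by lra. lra. }
  rewrite Rmax_right by lra.
  assert (Hk : 0 < INR (S k)) by (apply lt_0_INR; lia).
  assert (Xk : 0 < x ^ k) by (apply pow_lt; auto).
  set (y := / x). assert (Hy : 0 < y) by (apply Rinv_0_lt_compat; auto).
  split.
  { apply Rdiv_le_0_compat; auto. left. apply exp_pos. }
  assert (E : (y / INR (S k)) ^ S k <= exp y).
  { replace (exp y) with (exp (y / INR (S k)) ^ S k).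
    - apply pow_incr. split; [apply Rdiv_le_0_compat; lra|].
      pose proof (exp_ineq1_le (y / INR (S k))). lra.
    - rewrite pow_exp. f_equal. field. lra. }
  rewrite exp_Ropp. pose proof (exp_pos y).
  apply Rmult_le_reg_r with (exp y * x ^ k); [apply Rmult_lt_0_compat; auto|].
  replace (/ exp y / x ^ k * (exp y * x ^ k)) with 1 by (field; split; lra).
  replace (INR (S k) ^ S k * x * (exp y * x ^ k)) with (INR (S k) ^ S k * x ^ S k * exp y) by (simpl; ring).
  apply Rle_trans with (INR (S k) ^ S k * x ^ S k * (y / INR (S k)) ^ S k).
  - right. rewrite <- !Rpow_mult_distr. replace (INR (S k) * x * (y / INR (S k))) with 1.
    + rewrite pow1. auto.
    + unfold y. field. lra.
  - apply Rmult_le_compat_l; auto. apply Rmult_le_pos; apply pow_le; lra.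
Qed.

Lemma flat_derive (k : nat) (x : R) :
  is_derive (flat k) x (flat (S (S k)) x + - INR k * flat (S k) x).
Proof.
  destruct (Rtotal_order x 0) as [Hx|[Hx|Hx]].
  - apply is_derive_ext_loc with (fun _ => 0).
    + apply locally_R. exists (- x). split; [lra|]. intros y Hy. apply Rabs_def2 in Hy.
      unfold flat. destruct (Rlt_dec 0 y); lra.
    + evar_last; [apply @is_derive_const|]. unfold flat. destruct (Rlt_dec 0 x); [lra|].
      unfold zero; simpl. ring.
  - subst x. evar_last.
    + apply is_derive_Reals. instantiate (1 := 0). intros e He.
      destruct (flat_linear_bound (S k)) as [C [HC HB]].
      exists (mkposreal (e / (C + 1)) ltac:(apply Rdiv_lt_0_compat; lra)). intros h Hh Hd. simpl in Hd.
      assert (F0 : flat k 0 = 0) by (unfold flat; destruct (Rlt_dec 0 0); lra).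
      rewrite Rplus_0_l, F0, !Rminus_0_r.
      assert (E : flat k h / h = flat (S k) h).
      { unfold flat. destruct (Rlt_dec 0 h); simpl; field; auto.
        split; [apply pow_nonzero; auto|auto]. }
      rewrite E. destruct (HB h) as [B1 B2]. rewrite Rabs_pos_eq by auto.
      apply Rle_lt_trans with (C * Rabs h).
      * eapply Rle_trans; [exact B2|]. apply Rmult_le_compat_l; auto.
        apply Rmax_lub; [apply Rabs_pos|apply Rle_abs].
      * apply Rle_lt_trans with ((C + 1) * Rabs h); [pose proof (Rabs_pos h); nra|].
        apply Rmult_lt_reg_r with (/ (C + 1)); [apply Rinv_0_lt_compat; lra|].
        replace ((C + 1) * Rabs h * / (C + 1)) with (Rabs h) by (field; lra). exact Hd.
    + unfold flat. destruct (Rlt_dec 0 0); [lra|]. ring.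
  - apply is_derive_ext_loc with (fun y => exp (- / y) / y ^ k).
    + apply locally_R. exists x. split; [lra|]. intros y Hy. apply Rabs_def2 in Hy.
      unfold flat. destruct (Rlt_dec 0 y); [auto|lra].
    + assert (Xk : x ^ k <> 0) by (apply pow_nonzero; lra).
      auto_derive; [repeat split; auto; lra|].
      unfold flat. destruct (Rlt_dec 0 x); [|lra].
      destruct k as [|k].
      * simpl. field. lra.
      * simpl pred. simpl in Xk. replace (x ^ S k) with (x * x ^ k) by reflexivity.
        assert (x ^ k <> 0) by (apply pow_nonzero; lra).
        replace (x ^ S (S (S k))) with (x * x * x * x ^ k) by (simpl; ring).
        replace (x ^ S (S k)) with (x * x * x ^ k) by (simpl; ring).
        field. split; auto. lra.
Qed.

Lemma flat_smooth (n k : nat) : smooth_upto n (flat k).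
Proof.
  revert k. induction n as [|n IH]; intros k; [exact I|].
  exists (fun x => flat (S (S k)) x + - INR k * flat (S k) x). split.
  - apply flat_derive.
  - apply smooth_upto_plus; auto. apply smooth_upto_scal; auto.
Qed.

Lemma exists_bump (c r : R) :
  0 < r -> exists f : R -> R, (forall n, smooth_upto n f) /\
    (forall x, Rabs (x - c) < r -> 0 < f x) /\ (forall x, r <= Rabs (x - c) -> f x = 0).
Proof.
  intros Hr. exists (fun x => flat 0 (1 * x + (r - c)) * flat 0 (-1 * x + (r + c))).
  split; [|split].
  - intros n. apply smooth_upto_mult.
    + apply (smooth_upto_affine n 1 (r - c)). apply flat_smooth.
    + apply (smooth_upto_affine n (-1) (r + c)). apply flat_smooth.
  - intros x Hx. apply Rabs_def2 in Hx. unfold flat.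
    destruct (Rlt_dec 0 (1 * x + (r - c))); [|lra]. destruct (Rlt_dec 0 (-1 * x + (r + c))); [|lra].
    simpl. unfold Rdiv. rewrite Rinv_1, !Rmult_1_r. apply Rmult_lt_0_compat; apply exp_pos.
  - intros x Hx. unfold flat. destruct (Rlt_dec 0 (1 * x + (r - c))); [|ring].
    destruct (Rlt_dec 0 (-1 * x + (r + c))); [|ring]. exfalso.
    assert (Rabs (x - c) < r) by (apply Rabs_def1; lra). lra.
Qed.

(** * The weak equation at a jump *)

Lemma at_right_R (f : R -> R) (a l : R) :
  filterlim f (at_right a) (locally l) <->
  forall e, 0 < e -> exists d, 0 < d /\ forall x, a < x < a + d -> Rabs (f x - l) < e.
Proof.
  split.
  - intros H e He. assert (B := H (fun z => Rabs (z - l) < e)).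
    destruct B as [d Hd]. { apply locally_R. exists e. auto. }
    exists d. split; [apply cond_pos|]. intros x Hx. apply (Hd x).
    + change (Rabs (x - a) < d). apply Rabs_def1; lra.
    + lra.
  - intros H P HP. apply locally_R in HP. destruct HP as [e [He HP]].
    destruct (H e He) as [d [Hd H']]. exists (mkposreal d Hd). intros x Hx Hax.
    apply HP. apply H'. change (Rabs (x - a) < d) in Hx. apply Rabs_def2 in Hx. lra.
Qed.

Lemma at_left_R (f : R -> R) (a l : R) :
  filterlim f (at_left a) (locally l) <->
  forall e, 0 < e -> exists d, 0 < d /\ forall x, a - d < x < a -> Rabs (f x - l) < e.
Proof.
  split.
  - intros H e He. assert (B := H (fun z => Rabs (z - l) < e)).
    destruct B as [d Hd]. { apply locally_R. exists e. auto. }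
    exists d. split; [apply cond_pos|]. intros x Hx. apply (Hd x).
    + change (Rabs (x - a) < d). apply Rabs_def1; lra.
    + lra.
  - intros H P HP. apply locally_R in HP. destruct HP as [e [He HP]].
    destruct (H e He) as [d [Hd H']]. exists (mkposreal d Hd). intros x Hx Hax.
    apply HP. apply H'. change (Rabs (x - a) < d) in Hx. apply Rabs_def2 in Hx. lra.
Qed.

Lemma continuous_at_right (f : R -> R) (a : R) :
  continuous f a -> filterlim f (at_right a) (locally (f a)).
Proof.
  intros H. rewrite continuous_R in H. apply at_right_R. intros e He.
  destruct (H e He) as [d [Hd H']]. exists d. split; auto. intros x Hx. apply H'. apply Rabs_def1; lra.
Qed.

Lemma continuous_at_left (f : R -> R) (a : R) :
  continuous f a -> filterlim f (at_left a) (locally (f a)).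
Proof.
  intros H. rewrite continuous_R in H. apply at_left_R. intros e He.
  destruct (H e He) as [d [Hd H']]. exists d. split; auto. intros x Hx. apply H'. apply Rabs_def1; lra.
Qed.

Lemma filterlim_Rmult (F : (R -> Prop) -> Prop) {FF : Filter F} (f h : R -> R) (l m : R) :
  filterlim f F (locally l) -> filterlim h F (locally m) ->
  filterlim (fun x => f x * h x) F (locally (l * m)).
Proof.
  intros Hf Hh. apply (filterlim_comp_2 (G := locally l) (H := locally m) f h Rmult Hf Hh).
  apply (filterlim_mult (K := R_AbsRing) l m).
Qed.

Lemma filterlim_Rplus (F : (R -> Prop) -> Prop) {FF : Filter F} (f h : R -> R) (l m : R) :
  filterlim f F (locally l) -> filterlim h F (locally m) ->
  filterlim (fun x => f x + h x) F (locally (l + m)).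
Proof.
  intros Hf Hh. apply (filterlim_comp_2 (G := locally l) (H := locally m) f h Rplus Hf Hh).
  apply (filterlim_plus (V := R_NormedModule) l m).
Qed.

Lemma filterlim_Rminus (F : (R -> Prop) -> Prop) {FF : Filter F} (f h : R -> R) (l m : R) :
  filterlim f F (locally l) -> filterlim h F (locally m) ->
  filterlim (fun x => f x - h x) F (locally (l - m)).
Proof.
  intros Hf Hh. apply (filterlim_Rplus F f (fun x => - h x)); auto.
  apply (filterlim_comp _ _ _ h Ropp F (locally m)); auto. apply (filterlim_opp (V := R_NormedModule)).
Qed.

Lemma is_RInt_Rext (f h : R -> R) (a b l : R) :
  (forall x, Rmin a b < x < Rmax a b -> f x = h x) -> is_RInt f a b l -> is_RInt h a b l.
Proof. apply (is_RInt_ext (V := R_NormedModule)). Qed.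

(** The fundamental theorem when the endpoint is a jump: the values of F and f there are
    meaningless, and both are replaced by continuous extensions of their one-sided limits. *)
Lemma is_RInt_derive_open (F f : R -> R) (a b A B fa fb : R) :
  a < b -> (forall x, a < x < b -> is_derive F x (f x)) ->
  (forall x, a < x < b -> continuous f x) ->
  filterlim F (at_right a) (locally A) -> filterlim F (at_left b) (locally B) ->
  filterlim f (at_right a) (locally fa) -> filterlim f (at_left b) (locally fb) ->
  is_RInt f a b (B - A).
Proof.
  intros Hab HF Hf FA FB fA fB.
  destruct (C0_extension_lt F A B a b Hab) as [G [G1 [G2 [G3 G4]]]]; auto.
  { intros c Hc. exact (is_derive_continuous _ _ _ (HF c Hc)). }
  destruct (C0_extension_lt f fa fb a b Hab) as [h [h1 [h2 [h3 h4]]]]; auto.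
  assert (Hex : forall x, ex_RInt h a x).
  { intros x. apply (ex_RInt_continuous (V := R_CompleteNormedModule)). intros z _. apply h1. }
  assert (HD : forall x, is_derive (fun y => RInt h a y) x (h x)).
  { intros x. apply (is_derive_RInt (V := R_NormedModule) h (fun y => RInt h a y) a x).
    - apply filter_forall. intros y. apply (RInt_correct (V := R_CompleteNormedModule)). auto.
    - apply h1. }
  assert (E : RInt h a a - G a = RInt h a b - G b).
  { apply (constant_of_derive_0_off nil (fun x => RInt h a x - G x) a b Hab).
    - intros z _. apply continuous_Rminus; [|apply G1]. eapply is_derive_continuous. apply HD.
    - intros z Hz _. replace 0 with (h z - f z) by (rewrite h2; [ring|auto]).
      apply (is_derive_minus (V := R_NormedModule)); [apply HD|].
      apply is_derive_ext_loc with F; [|apply HF; auto].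
      apply locally_R. exists (Rmin (z - a) (b - z)). split; [apply Rmin_glb_lt; lra|].
      intros y Hy. apply Rabs_def2 in Hy.
      pose proof (Rmin_l (z - a) (b - z)). pose proof (Rmin_r (z - a) (b - z)).
      symmetry. apply G2. lra. }
  rewrite RInt_point, G3, G4 in E. change (@zero R_CompleteNormedModule) with 0 in E.
  replace (B - A) with (RInt h a b) by lra.
  apply (is_RInt_Rext h f).
  - intros x Hx. rewrite Rmin_left, Rmax_right in Hx by lra. apply h2. auto.
  - apply (RInt_correct (V := R_CompleteNormedModule)). auto.
Qed.

Lemma is_RInt_zero_on (f : R -> R) (a b : R) :
  (forall x, Rmin a b < x < Rmax a b -> f x = 0) -> is_RInt f a b 0.
Proof.
  intros H. apply (is_RInt_Rext (fun _ => 0)).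
  - intros x Hx. symmetry. auto.
  - pose proof (is_RInt_const (V := R_NormedModule) a b 0) as C.
    change (scal (b - a) 0) with ((b - a) * 0) in C. rewrite Rmult_0_r in C. exact C.
Qed.

Lemma is_RInt_Rplus (f h : R -> R) (a b l m : R) :
  is_RInt f a b l -> is_RInt h a b m -> is_RInt (fun x => f x + h x) a b (l + m).
Proof. apply (is_RInt_plus (V := R_NormedModule)). Qed.

Lemma is_RInt_Rscal (f : R -> R) (k a b l : R) :
  is_RInt f a b l -> is_RInt (fun x => k * f x) a b (k * l).
Proof. apply (is_RInt_scal (V := R_NormedModule)). Qed.

Lemma is_RInt_Rchasles (f : R -> R) (a b c l m : R) :
  is_RInt f a b l -> is_RInt f b c m -> is_RInt f a c (l + m).
Proof. apply (is_RInt_Chasles (V := R_NormedModule)). Qed.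

Lemma is_RInt_Runique (f : R -> R) (a b l m : R) : is_RInt f a b l -> is_RInt f a b m -> l = m.
Proof.
  intros H1 H2. apply (is_RInt_unique (V := R_CompleteNormedModule)) in H1.
  apply (is_RInt_unique (V := R_CompleteNormedModule)) in H2. congruence.
Qed.

Lemma continuity_2d_pt_section_l (T : R -> R -> R) (x t : R) :
  continuity_2d_pt T x t -> continuous (fun y => T y t) x.
Proof.
  intros H. apply continuous_R. intros e He. destruct (H (mkposreal e He)) as [d Hd].
  exists d. split; [apply cond_pos|]. intros y Hy. apply Hd; auto.
  rewrite Rminus_diag, Rabs_R0. apply cond_pos.
Qed.

Lemma continuity_2d_pt_swap (T : R -> R -> R) (x t : R) :
  continuity_2d_pt T x t -> continuity_2d_pt (fun s y => T y s) t x.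
Proof.
  intros H e. destruct (H e) as [d Hd]. exists d. intros s y Hs Hy. apply Hd; auto.
Qed.

Lemma continuity_2d_pt_of_snd (p : R -> R) (x t : R) :
  continuous p t -> continuity_2d_pt (fun _ s => p s) x t.
Proof.
  intros H e. destruct (proj1 (continuous_R p t) H e (cond_pos e)) as [d [Hd H']].
  exists (mkposreal d Hd). intros y s _ Hs. apply H'. auto.
Qed.

Lemma continuity_2d_pt_of_fst (p : R -> R) (x t : R) :
  continuous p x -> continuity_2d_pt (fun y _ => p y) x t.
Proof.
  intros H. apply (continuity_2d_pt_swap (fun _ y => p y)). apply continuity_2d_pt_of_snd. auto.
Qed.

Lemma time_derivative_RInt (k : R -> R) (T T1 : R -> R -> R) (p q t : R) :
  (forall x, continuous k x) ->
  (forall x t, is_derive (fun s => T x s) t (T1 x t)) ->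
  (forall x t, continuity_2d_pt T x t) -> (forall x t, continuity_2d_pt T1 x t) ->
  is_RInt (fun x => k x * T1 x t) p q (RInt (fun x => k x * T1 x t) p q) /\
  is_derive (fun s => RInt (fun x => k x * T x s) p q) t (RInt (fun x => k x * T1 x t) p q).
Proof.
  intros Hk HT C0 C1. split.
  { apply (RInt_correct (V := R_CompleteNormedModule)).
    apply (ex_RInt_continuous (V := R_CompleteNormedModule)). intros x _.
    apply continuous_Rmult; auto. apply continuity_2d_pt_section_l. auto. }
  assert (HD : forall x s, is_derive (fun z => k x * T x z) s (k x * T1 x s)).
  { intros x s. apply (is_derive_scal (fun z => T x z)). auto. }
  evar_last.
  - apply (is_derive_RInt_param (fun s x => k x * T x s) p q t).
    + apply filter_forall. intros s x _. exists (k x * T1 x s). apply HD.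
    + intros x _. apply continuity_2d_pt_ext with (fun s y => k y * T1 y s).
      { intros s y. symmetry. apply is_derive_unique. apply HD. }
      apply continuity_2d_pt_mult.
      * apply (continuity_2d_pt_of_snd k). auto.
      * apply (continuity_2d_pt_swap T1). auto.
    + apply filter_forall. intros s. apply (ex_RInt_continuous (V := R_CompleteNormedModule)). intros x _.
      apply continuous_Rmult; auto. apply continuity_2d_pt_section_l. auto.
  - apply RInt_ext. intros x _. apply is_derive_unique. apply HD.
Qed.

(** The integrand is the t-derivative of k T. Differentiation under the integral reduces the double
    integral to boundary terms at times M and - M, where T vanishes. *)
Lemma time_derivative_integral (k : R -> R) (T T1 T2 : R -> R -> R) (p q M : R) :
  (forall x, continuous k x) ->
  (forall x t, is_derive (fun s => T x s) t (T1 x t)) ->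
  (forall x t, is_derive (fun s => T1 x s) t (T2 x t)) ->
  (forall x t, continuity_2d_pt T x t) -> (forall x t, continuity_2d_pt T1 x t) ->
  (forall x t, continuity_2d_pt T2 x t) ->
  (forall x, T x M = 0) -> (forall x, T x (- M) = 0) ->
  exists J, (forall t, is_RInt (fun x => k x * T1 x t) p q (J t)) /\ is_RInt J (- M) M 0.
Proof.
  intros Hk HT HT1 C0 C1 C2 ZM ZM'.
  exists (fun t => RInt (fun x => k x * T1 x t) p q). split.
  - intros t. apply (time_derivative_RInt k T T1); auto.
  - set (Phi := fun s => RInt (fun x => k x * T x s) p q).
    assert (Z : forall s, (forall x, T x s = 0) -> Phi s = 0).
    { intros s Hs. apply is_RInt_unique. apply is_RInt_zero_on. intros x _. rewrite Hs. ring. }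
    replace 0 with (Phi M - Phi (- M)) by (rewrite !Z; auto; ring).
    apply (is_RInt_derive (V := R_CompleteNormedModule) Phi).
    + intros t _. apply (time_derivative_RInt k T T1); auto.
    + intros t _. eapply is_derive_continuous. apply (time_derivative_RInt k T1 T2); auto.
Qed.

(** The rectangle is split at x = 0, and on each half k is replaced by a continuous extension. *)
Lemma time_derivative_integral_jump (k : R -> R) (m1 m2 : R) (T T1 T2 : R -> R -> R) (M : R) :
  0 < M -> (forall x, x <> 0 -> continuous k x) ->
  filterlim k (at_right 0) (locally m1) -> filterlim k (at_left 0) (locally m2) ->
  (forall x t, is_derive (fun s => T x s) t (T1 x t)) ->
  (forall x t, is_derive (fun s => T1 x s) t (T2 x t)) ->
  (forall x t, continuity_2d_pt T x t) -> (forall x t, continuity_2d_pt T1 x t) ->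
  (forall x t, continuity_2d_pt T2 x t) ->
  (forall x, T x M = 0) -> (forall x, T x (- M) = 0) ->
  exists J, (forall t, is_RInt (fun x => k x * T1 x t) (- M) M (J t)) /\ is_RInt J (- M) M 0.
Proof.
  intros HM Hk Hr Hl HT HT1 C0 C1 C2 ZM ZM'.
  destruct (C0_extension_lt k m1 (k M) 0 M HM) as [kr [r1 [r2 _]]].
  { intros c Hc. apply Hk. lra. }
  { auto. }
  { apply continuous_at_left. apply Hk. lra. }
  destruct (C0_extension_lt k (k (- M)) m2 (- M) 0) as [kl [l1 [l2 _]]]; [lra| | |auto|].
  { intros c Hc. apply Hk. lra. }
  { apply continuous_at_right. apply Hk. lra. }
  destruct (time_derivative_integral kr T T1 T2 0 M M) as [Jr [Jr1 Jr2]]; auto.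
  destruct (time_derivative_integral kl T T1 T2 (- M) 0 M) as [Jl [Jl1 Jl2]]; auto.
  exists (fun t => Jl t + Jr t). split.
  - intros t. apply is_RInt_Rchasles with 0.
    + apply (is_RInt_Rext (fun x => kl x * T1 x t)); auto.
      intros x Hx. rewrite Rmin_left, Rmax_right in Hx by lra. rewrite l2; auto.
    + apply (is_RInt_Rext (fun x => kr x * T1 x t)); auto.
      intros x Hx. rewrite Rmin_left, Rmax_right in Hx by lra. rewrite r2; auto.
  - replace 0 with (0 + 0) by ring. apply is_RInt_Rplus; auto.
Qed.

Lemma test_function_derive_t (theta : R -> R -> R) (M : R) :
  test_function theta M -> forall k x t,
  is_derive (fun s => partial_derive 0 k theta x s) t (partial_derive 0 (S k) theta x t).
Proof.
  intros [H _] k x t. apply Derive_correct. exact (proj1 (H 0%nat (S k) x t)).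
Qed.

Lemma test_function_derive_x (theta : R -> R -> R) (M : R) :
  test_function theta M -> forall j x t,
  is_derive (fun y => partial_derive j 0 theta y t) x (partial_derive (S j) 0 theta x t).
Proof.
  intros [H _] j x t. apply Derive_correct. exact (proj1 (proj2 (H (S j) 0%nat x t))).
Qed.

Lemma derive_0_beyond (f : R -> R) (x l : R) :
  is_derive f x l -> (forall y, x <= y -> f y = 0) -> l = 0.
Proof.
  intros H Hz. apply is_derive_Reals in H. destruct (Req_dec l 0) as [|Hn]; auto. exfalso.
  destruct (H (Rabs l) (Rabs_pos_lt _ Hn)) as [d Hd]. pose proof (cond_pos d).
  specialize (Hd (d / 2) ltac:(lra)). rewrite Rabs_pos_eq in Hd by lra.
  specialize (Hd ltac:(lra)). rewrite !Hz in Hd by lra.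
  replace ((0 - 0) / (d / 2) - l) with (- l) in Hd by (field; lra).
  rewrite Rabs_Ropp in Hd. lra.
Qed.

Lemma derive_0_before (f : R -> R) (x l : R) :
  is_derive f x l -> (forall y, y <= x -> f y = 0) -> l = 0.
Proof.
  intros H Hz. assert (- l = 0); [|lra].
  apply (derive_0_beyond (fun y => f (- y)) (- x)).
  - apply is_derive_reflect. rewrite Ropp_involutive. auto.
  - intros y Hy. apply Hz. lra.
Qed.

Lemma is_RInt_C (f : R -> C) (a b l m : R) :
  is_RInt (fun x => fst (f x)) a b l -> is_RInt (fun x => snd (f x)) a b m ->
  is_RInt (V := C_R_NormedModule) f a b ((l, m) : C).
Proof. apply (is_RInt_fct_extend_pair (U := R_NormedModule) (V := R_NormedModule)). Qed.

Lemma is_RInt_C_fst (f : R -> C) (a b : R) (l : C) :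
  is_RInt (V := C_R_NormedModule) f a b l -> is_RInt (fun x => fst (f x)) a b (fst l).
Proof. apply (is_RInt_fct_extend_fst (U := R_NormedModule) (V := R_NormedModule)). Qed.

(** Two integrations by parts with the primitive [v theta_x - v1 theta]. The boundary terms at 0
    cancel because v1 is continuous there, although h, the second derivative of v, may jump. *)
Lemma spatial_integral_zero (v v1 h : R -> R) (m1 m2 : R) (theta : R -> R -> R) (M t : R) :
  test_function theta M -> 0 < M ->
  (forall x, is_derive v x (v1 x)) -> (forall x, continuous v1 x) ->
  (forall x, x <> 0 -> is_derive v1 x (h x)) -> (forall x, x <> 0 -> continuous h x) ->
  filterlim h (at_right 0) (locally m1) -> filterlim h (at_left 0) (locally m2) ->
  is_RInt (fun x => v x * partial_derive 2 0 theta x t - h x * theta x t) (- M) M 0.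
Proof.
  intros Ht HM Hv Hv1c Hv1 Hhc Hr Hl.
  set (th := fun x => theta x t). set (th1 := fun x => partial_derive 1 0 theta x t).
  set (th2 := fun x => partial_derive 2 0 theta x t).
  assert (D1 : forall x, is_derive th x (th1 x)) by (intros x; apply (test_function_derive_x theta M Ht 0)).
  assert (D2 : forall x, is_derive th1 x (th2 x)) by (intros x; apply (test_function_derive_x theta M Ht 1)).
  assert (D2c : forall x, continuous th2 x).
  { intros x. apply is_derive_continuous with (partial_derive 3 0 theta x t).
    apply (test_function_derive_x theta M Ht 2). }
  assert (Z0 : forall x, M <= Rabs x -> th x = 0) by (intros x Hx; apply Ht; auto).
  set (F := fun x => v x * th1 x - v1 x * th x).
  assert (Fc : forall x, continuous F x).
  { intros x. unfold F. apply continuous_Rminus; apply continuous_Rmult; auto;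
      eapply is_derive_continuous; eauto. }
  assert (HF : forall x, x <> 0 -> is_derive F x (v x * th2 x - h x * th x)).
  { intros x Hx. unfold F. specialize (Hv x). specialize (Hv1 x Hx). specialize (D1 x). specialize (D2 x).
    der. ring. }
  assert (fc : forall x, x <> 0 -> continuous (fun x => v x * th2 x - h x * th x) x).
  { intros x Hx. apply continuous_Rminus; apply continuous_Rmult; auto;
      eapply is_derive_continuous; eauto. }
  assert (FM : F M = 0).
  { unfold F. rewrite (Z0 M) by (rewrite Rabs_pos_eq; lra).
    rewrite (derive_0_beyond th M (th1 M)); auto; [ring|].
    intros y Hy. apply Z0. rewrite Rabs_pos_eq; lra. }
  assert (FM' : F (- M) = 0).
  { unfold F. rewrite (Z0 (- M)) by (rewrite Rabs_Ropp, Rabs_pos_eq; lra).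
    rewrite (derive_0_before th (- M) (th1 (- M))); auto; [ring|].
    intros y Hy. apply Z0. rewrite Rabs_left1; lra. }
  assert (vc : forall x, continuous v x) by (intros x; eapply is_derive_continuous; eauto).
  assert (thc : forall x, continuous th x) by (intros x; eapply is_derive_continuous; eauto).
  replace 0 with ((F 0 - F (- M)) + (F M - F 0)) by (rewrite FM, FM'; ring).
  apply is_RInt_Rchasles with 0.
  - apply is_RInt_derive_open with (F := F) (fa := v (- M) * th2 (- M) - h (- M) * th (- M))
      (fb := v 0 * th2 0 - m2 * th 0); try lra.
    + intros x Hx. apply HF. lra.
    + intros x Hx. apply fc. lra.
    + apply continuous_at_right. auto.
    + apply continuous_at_left. auto.
    + apply (continuous_at_right (fun x => v x * th2 x - h x * th x)). apply fc. lra.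
    + apply filterlim_Rminus; [typeclasses eauto| |]; apply filterlim_Rmult; try typeclasses eauto; auto;
        apply continuous_at_left; auto.
  - apply is_RInt_derive_open with (F := F) (fb := v M * th2 M - h M * th M)
      (fa := v 0 * th2 0 - m1 * th 0); try lra.
    + intros x Hx. apply HF. lra.
    + intros x Hx. apply fc. lra.
    + apply continuous_at_right. auto.
    + apply continuous_at_left. auto.
    + apply filterlim_Rminus; [typeclasses eauto| |]; apply filterlim_Rmult; try typeclasses eauto; auto;
        apply continuous_at_right; auto.
    + apply (continuous_at_left (fun x => v x * th2 x - h x * th x)). apply fc. lra.
Qed.

(** Once the equations that hold off 0 are inserted, each pairing consists of a t-derivative,
    treated by [time_derivative_integral_jump], and, for the second equation, of the spatial term of
    [spatial_integral_zero]. *)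
Lemma polariton_weak_of_C1 wX wC gam g w (u v v1 : R -> R) (m1 m2 : R) :
  (forall x, x <> 0 -> gam * v x = (w - wX - g * u x ^ 2) * u x) ->
  (forall x, is_derive v x (v1 x)) -> (forall x, continuous v1 x) ->
  (forall x, x <> 0 -> is_derive v1 x (2 * (gam * u x - (w - wC) * v x))) ->
  (forall x, x <> 0 -> continuous u x) ->
  filterlim u (at_right 0) (locally m1) -> filterlim u (at_left 0) (locally m2) ->
  polariton_weak wX wC gam g (harmonic w u) (harmonic w v).
Proof.
  intros Hal Hv Hv1c Hv1 Huc Hr Hl theta M Ht.
  destruct (Rle_lt_dec M 0) as [HM|HM].
  { assert (Z : forall x t, theta x t = 0).
    { intros x t. apply Ht. left. pose proof (Rabs_pos x). lra. }
    assert (Z1 : forall x t, partial_derive 0 1 theta x t = 0).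
    { intros x t. unfold partial_derive. simpl. rewrite (Derive_ext _ (fun _ => 0)) by auto. apply Derive_const. }
    assert (Z2 : forall x t, partial_derive 2 0 theta x t = 0).
    { intros x t. unfold partial_derive. transitivity (Derive_n (fun _ => 0) 2 x).
      - apply Derive_n_ext. intros y. simpl. auto.
      - rewrite Derive_n_const. reflexivity. }
    split; exists (fun _ => 0%C); split.
    - intros t. apply is_RInt_C; apply is_RInt_zero_on; intros x _; rewrite !harmonic_pair, Z, Z1; simpl; ring.
    - apply is_RInt_C; apply is_RInt_zero_on; intros x _; reflexivity.
    - intros t. apply is_RInt_C; apply is_RInt_zero_on; intros x _; rewrite !harmonic_pair, Z, Z1, Z2; simpl; ring.
    - apply is_RInt_C; apply is_RInt_zero_on; intros x _; reflexivity. }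
  set (th1 := partial_derive 0 1 theta). set (th2 := partial_derive 0 2 theta).
  assert (D1 : forall x t, is_derive (fun s => theta x s) t (th1 x t)) by (apply (test_function_derive_t theta M Ht 0)).
  assert (D2 : forall x t, is_derive (fun s => th1 x s) t (th2 x t)) by (apply (test_function_derive_t theta M Ht 1)).
  assert (C0 : forall x t, continuity_2d_pt theta x t).
  { intros x t. apply (proj2 (proj2 (proj1 Ht 0%nat 0%nat x t))). }
  assert (C1 : forall x t, continuity_2d_pt th1 x t).
  { intros x t. apply (proj2 (proj2 (proj1 Ht 0%nat 1%nat x t))). }
  assert (C2 : forall x t, continuity_2d_pt th2 x t).
  { intros x t. apply (proj2 (proj2 (proj1 Ht 0%nat 2%nat x t))). }
  assert (K : forall (k : R -> R) (n1 n2 : R) (p p1 p2 : R -> R),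
    (forall x, x <> 0 -> continuous k x) ->
    filterlim k (at_right 0) (locally n1) -> filterlim k (at_left 0) (locally n2) ->
    (forall t, is_derive p t (p1 t)) -> (forall t, is_derive p1 t (p2 t)) -> (forall t, continuous p2 t) ->
    exists J, (forall t, is_RInt (fun x => k x * (p1 t * theta x t + p t * th1 x t)) (- M) M (J t)) /\
      is_RInt J (- M) M 0).
  { intros k n1 n2 p p1 p2 Hk Hkr Hkl Hp Hp1 Hp2.
    assert (pc : forall t, continuous p t) by (intros t; eapply is_derive_continuous; eauto).
    assert (p1c : forall t, continuous p1 t) by (intros t; eapply is_derive_continuous; eauto).
    apply (time_derivative_integral_jump k n1 n2 (fun x t => p t * theta x t)
      (fun x t => p1 t * theta x t + p t * th1 x t)
      (fun x t => p2 t * theta x t + 2 * p1 t * th1 x t + p t * th2 x t)); auto.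
    - intros x t. specialize (Hp t). specialize (D1 x t). der. ring.
    - intros x t. specialize (Hp t). specialize (Hp1 t). specialize (D1 x t). specialize (D2 x t). der. ring.
    - intros x t. apply continuity_2d_pt_mult; auto. apply continuity_2d_pt_of_snd; auto.
    - intros x t. apply continuity_2d_pt_plus; apply continuity_2d_pt_mult; auto; apply continuity_2d_pt_of_snd; auto.
    - intros x t. repeat apply continuity_2d_pt_plus; apply continuity_2d_pt_mult; auto;
        try (apply continuity_2d_pt_of_snd; auto).
      apply (continuous_Rmult (fun _ => 2) p1); auto. apply continuous_const.
    - intros x. rewrite (proj2 Ht); [ring|right; rewrite Rabs_pos_eq; lra].
    - intros x. rewrite (proj2 Ht); [ring|right; rewrite Rabs_Ropp, Rabs_pos_eq; lra]. }
  (* The real and imaginary parts of the phase exp (- i w t), with their derivatives. *)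
  set (cp := fun t => cos (w * t)). set (cp1 := fun t => - w * sin (w * t)).
  set (sp := fun t => - sin (w * t)). set (sp1 := fun t => - w * cos (w * t)).
  assert (dc : forall t, is_derive cp t (cp1 t)) by (intros t; unfold cp, cp1; auto_derive; auto; ring).
  assert (dc1 : forall t, is_derive cp1 t (- w ^ 2 * cos (w * t))) by (intros t; unfold cp1; auto_derive; auto; ring).
  assert (ds : forall t, is_derive sp t (sp1 t)) by (intros t; unfold sp, sp1; auto_derive; auto; ring).
  assert (ds1 : forall t, is_derive sp1 t (w ^ 2 * sin (w * t))) by (intros t; unfold sp1; auto_derive; auto; ring).
  assert (dc2 : forall t, continuous (fun t => - w ^ 2 * cos (w * t)) t).
  { intros t. eapply is_derive_continuous. auto_derive; auto. }
  assert (ds2 : forall t, continuous (fun t => w ^ 2 * sin (w * t)) t).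
  { intros t. eapply is_derive_continuous. auto_derive; auto. }
  assert (vc : forall x, continuous v x) by (intros x; eapply is_derive_continuous; eauto).
  destruct (K u m1 m2 cp cp1 _ Huc Hr Hl dc dc1 dc2) as [Juc [Juc1 Juc2]].
  destruct (K u m1 m2 sp sp1 _ Huc Hr Hl ds ds1 ds2) as [Jus [Jus1 Jus2]].
  destruct (K v (v 0) (v 0) cp cp1 _ (fun x _ => vc x) (continuous_at_right v 0 (vc 0))
    (continuous_at_left v 0 (vc 0)) dc dc1 dc2) as [Jvc [Jvc1 Jvc2]].
  destruct (K v (v 0) (v 0) sp sp1 _ (fun x _ => vc x) (continuous_at_right v 0 (vc 0))
    (continuous_at_left v 0 (vc 0)) ds ds1 ds2) as [Jvs [Jvs1 Jvs2]].
  set (h := fun x => 2 * (gam * u x - (w - wC) * v x)).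
  assert (Sp : forall t, is_RInt (fun x => v x * partial_derive 2 0 theta x t - h x * theta x t) (- M) M 0).
  { intros t. apply spatial_integral_zero with (v1 := v1)
      (m1 := 2 * (gam * m1 - (w - wC) * v 0)) (m2 := 2 * (gam * m2 - (w - wC) * v 0)); auto.
    - intros x Hx. unfold h. apply continuous_Rmult; [apply continuous_const|].
      apply continuous_Rminus; apply continuous_Rmult; auto; apply continuous_const.
    - unfold h. apply filterlim_Rmult; [typeclasses eauto|apply filterlim_const|].
      apply filterlim_Rminus; [typeclasses eauto| |]; apply filterlim_Rmult;
        try typeclasses eauto; auto; try apply filterlim_const. apply continuous_at_right; auto.
    - unfold h. apply filterlim_Rmult; [typeclasses eauto|apply filterlim_const|].
      apply filterlim_Rminus; [typeclasses eauto| |]; apply filterlim_Rmult;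
        try typeclasses eauto; auto; try apply filterlim_const. apply continuous_at_left; auto. }
  (* The value of phi_X at its jump does not affect the integrals. *)
  assert (Off0 : forall (f1 f2 : R -> R) (l : R), (forall x, x <> 0 -> f1 x = f2 x) ->
    is_RInt f1 (- M) M l -> is_RInt f2 (- M) M l).
  { intros f1 f2 l E H1.
    assert (X : ex_RInt f1 (- M) 0 /\ ex_RInt f1 0 M).
    { split; [apply (ex_RInt_Chasles_1 (V := R_CompleteNormedModule) f1 (- M) 0 M)|
        apply (ex_RInt_Chasles_2 (V := R_CompleteNormedModule) f1 (- M) 0 M)];
      try lra; exists l; auto. }
    destruct X as [[l1 X1] [l2 X2]].
    assert (El : l = l1 + l2).
    { apply (is_RInt_Runique f1 (- M) M); auto. apply is_RInt_Rchasles with 0; auto. }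
    rewrite El. apply is_RInt_Rchasles with 0;
      apply (is_RInt_Rext f1); auto; intros x Hx;
      rewrite Rmin_left, Rmax_right in Hx by lra; apply E; lra. }
  split.
  (* Off 0 the cubic equation turns [(wX + g u ^ 2) u + gam v] into [w u], so that both components
     of the integrand are t-derivatives of u times phase times theta. *)
  - exists (fun t => (Jus t, -1 * Juc t)). split.
    + intros t. apply is_RInt_C.
      * apply (Off0 (fun x => u x * (sp1 t * theta x t + sp t * th1 x t))); auto.
        intros x Hx. rewrite Cmod_harmonic_sq, !harmonic_pair. specialize (Hal x Hx).
        simpl. fold th1. unfold sp, sp1.
        transitivity (- (u x * sin (w * t) * th1 x t) - ((wX + g * u x ^ 2) * u x + gam * v x) * cos (w * t) * theta x t).
        { rewrite Hal. ring. } { simpl; ring. }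
      * apply (Off0 (fun x => -1 * (u x * (cp1 t * theta x t + cp t * th1 x t)))).
        2:{ apply is_RInt_Rscal. auto. }
        intros x Hx. rewrite Cmod_harmonic_sq, !harmonic_pair. specialize (Hal x Hx).
        simpl. fold th1. unfold cp, cp1.
        transitivity (- (u x * cos (w * t) * th1 x t) + ((wX + g * u x ^ 2) * u x + gam * v x) * sin (w * t) * theta x t).
        { rewrite Hal. ring. } { simpl; ring. }
    + apply is_RInt_C; simpl; auto. replace 0 with (-1 * 0) by ring. apply is_RInt_Rscal. auto.
  - exists (fun t => (Jvs t + cos (w * t) / 2 * 0, -1 * Jvc t + - sin (w * t) / 2 * 0)). split.
    + intros t. apply is_RInt_C.
      * apply (Off0 (fun x => v x * (sp1 t * theta x t + sp t * th1 x t) +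
          cos (w * t) / 2 * (v x * partial_derive 2 0 theta x t - h x * theta x t))).
        2:{ apply is_RInt_Rplus; auto. apply is_RInt_Rscal. auto. }
        intros x Hx. rewrite !harmonic_pair. simpl fst. fold th1. unfold sp, sp1, h. simpl. field.
      * apply (Off0 (fun x => -1 * (v x * (cp1 t * theta x t + cp t * th1 x t)) +
          - sin (w * t) / 2 * (v x * partial_derive 2 0 theta x t - h x * theta x t))).
        2:{ apply is_RInt_Rplus; apply is_RInt_Rscal; auto. }
        intros x Hx. rewrite !harmonic_pair. simpl snd. fold th1. unfold cp, cp1, h. simpl. field.
    + assert (E : forall p q : R, p = p + q / 2 * 0) by (intros; field).
      apply is_RInt_C; simpl.
      * apply (is_RInt_Rext Jvs); auto.
      * apply (is_RInt_Rext (fun t => -1 * Jvc t)); auto.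
        replace 0 with (-1 * 0) by ring. apply is_RInt_Rscal. auto.
Qed.

(** Product test functions separate the localisation at the jump (eta) from the time dependence
    (chi). *)
Lemma test_function_product (eta chi : R -> R) (M : R) :
  (forall n, smooth_upto n eta) -> (forall n, smooth_upto n chi) ->
  (forall x, M <= Rabs x -> eta x = 0) -> (forall t, M <= Rabs t -> chi t = 0) ->
  test_function (fun x t => eta x * chi t) M /\
  (forall j k x t, partial_derive j k (fun x t => eta x * chi t) x t = Derive_n eta j x * Derive_n chi k t).
Proof.
  intros He Hc Ze Zc.
  assert (E : forall k y t, Derive_n (fun s => eta y * chi s) k t = Derive_n chi k t * eta y).
  { intros k y t. rewrite Derive_n_scal_l. ring. }
  assert (PD : forall j k x t, partial_derive j k (fun x t => eta x * chi t) x t = Derive_n eta j x * Derive_n chi k t).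
  { intros j k x t. unfold partial_derive.
    rewrite (Derive_n_ext _ (fun y => Derive_n chi k t * eta y)) by (intros y; apply E).
    rewrite Derive_n_scal_l. ring. }
  assert (DC : forall f, (forall n, smooth_upto n f) -> forall n x, continuous (Derive_n f n) x).
  { intros f Hf n x. apply (ex_derive_continuous (V := R_NormedModule)).
    apply (smooth_upto_ex_derive_n (S n) f). auto. }
  split; [|exact PD]. split.
  - intros j k x t. split; [|split].
    + apply (ex_derive_n_scal_l chi k (eta x)). apply smooth_upto_ex_derive_n. auto.
    + apply ex_derive_n_ext with (fun y => Derive_n chi k t * eta y).
      { intros y. symmetry. apply E. }
      apply (ex_derive_n_scal_l eta j). apply smooth_upto_ex_derive_n. auto.
    + apply continuity_2d_pt_ext with (fun x t => Derive_n eta j x * Derive_n chi k t).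
      { intros y s. symmetry. apply PD. }
      apply continuity_2d_pt_mult.
      * apply (continuity_2d_pt_of_fst (Derive_n eta j)). auto.
      * apply (continuity_2d_pt_of_snd (Derive_n chi k)). auto.
  - intros x t [H|H].
    + rewrite Ze; auto. ring.
    + rewrite Zc; auto. ring.
Qed.

Lemma smooth_derive (f : R -> R) (n : nat) (x : R) :
  (forall n, smooth_upto n f) -> is_derive (Derive_n f n) x (Derive_n f (S n) x).
Proof.
  intros Hf. apply Derive_correct. apply (smooth_upto_ex_derive_n (S n) f). auto.
Qed.

Lemma derive_0_outside (f : R -> R) (c r x l : R) :
  is_derive f x l -> (forall y, r <= Rabs (y - c) -> f y = 0) -> r <= Rabs (x - c) -> l = 0.
Proof.
  intros H Hz Hx. destruct (Rle_dec c x) as [L|L].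
  - apply (derive_0_beyond f x); auto. intros y Hy. apply Hz.
    rewrite Rabs_pos_eq in * by lra. lra.
  - apply (derive_0_before f x); auto. intros y Hy. apply Hz.
    rewrite Rabs_left in * by lra. lra.
Qed.

(* Testing against eta(x) chi(t) with eta supported near the jump d leaves
   (r1 - r2) eta(d) / 2 times the integral of cos(w t) chi(t). *)
Lemma weak_no_kink wX wC gam g w (u v v1 : R -> R) (d e m1 m2 r1 r2 : R) :
  0 < e -> polariton_weak wX wC gam g (harmonic w u) (harmonic w v) ->
  (forall x, continuous v x) ->
  (forall x, x <> d -> Rabs (x - d) < e -> is_derive v x (v1 x)) ->
  (forall x, x <> d -> Rabs (x - d) < e -> is_derive v1 x (2 * (gam * u x - (w - wC) * v x))) ->
  (forall x, x <> d -> Rabs (x - d) < e -> continuous u x) ->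
  filterlim u (at_right d) (locally m1) -> filterlim u (at_left d) (locally m2) ->
  filterlim v1 (at_right d) (locally r1) -> filterlim v1 (at_left d) (locally r2) ->
  r1 = r2.
Proof.
  intros He Hw vc Hv Hv1 uc ur ul v1r v1l.
  set (r := e / 2). assert (Hr : 0 < r < e) by (unfold r; lra).
  (* This choice keeps |w t| <= 1 < pi / 2 on the support of chi, so the integral of cos (w t) chi
     (t) is positive. *)
  set (tau := / (Rabs w + 1)).
  assert (Htau : 0 < tau).
  { apply Rinv_0_lt_compat. pose proof (Rabs_pos w). lra. }
  assert (Htw : Rabs w * tau <= 1).
  { unfold tau. pose proof (Rabs_pos w). apply Rmult_le_reg_r with (Rabs w + 1); [lra|].
    rewrite Rmult_assoc, Rinv_l; lra. }
  destruct (exists_bump d r (proj1 Hr)) as [eta [Es [Ep Ez]]].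
  destruct (exists_bump 0 tau Htau) as [chi [Cs [Cp Cz]]].
  set (M := Rabs d + e + tau).
  assert (Hd : - Rabs d <= d <= Rabs d) by (apply Rabs_le_between; lra).
  assert (HM : - M < d - r /\ d + r < M /\ tau < M).
  { unfold M. pose proof (Rabs_pos d). lra. }
  destruct (test_function_product eta chi M Es Cs) as [TF PD].
  { intros x Hx. apply Ez. apply Rnot_lt_le. intro C. apply Rabs_def2 in C.
    assert (Rabs x < M) by (apply Rabs_def1; lra). lra. }
  { intros t Ht. apply Cz. rewrite Rminus_0_r. lra. }
  destruct (proj2 (Hw _ M TF)) as [I [I1 I2]].
  set (eta1 := Derive_n eta 1). set (eta2 := Derive_n eta 2). set (chi1 := Derive_n chi 1).
  assert (D1 : forall x, is_derive eta x (eta1 x)) by (intros x; apply (smooth_derive eta 0 x Es)).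
  assert (D2 : forall x, is_derive eta1 x (eta2 x)) by (intros x; apply (smooth_derive eta 1 x Es)).
  assert (D3 : forall x, continuous eta2 x).
  { intros x. eapply is_derive_continuous. apply (smooth_derive eta 2 x Es). }
  assert (X1 : forall t, is_derive chi t (chi1 t)) by (intros t; apply (smooth_derive chi 0 t Cs)).
  assert (X2 : forall t, continuous chi1 t).
  { intros t. eapply is_derive_continuous. apply (smooth_derive chi 1 t Cs). }
  assert (Ez1 : forall x, r <= Rabs (x - d) -> eta1 x = 0).
  { intros x Hx. apply (derive_0_outside eta d r x); auto. }
  assert (Ez2 : forall x, r <= Rabs (x - d) -> eta2 x = 0).
  { intros x Hx. apply (derive_0_outside eta1 d r x); auto. }
  assert (ec : forall x, continuous eta x) by (intros x; eapply is_derive_continuous; eauto).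
  assert (e1c : forall x, continuous eta1 x) by (intros x; eapply is_derive_continuous; eauto).
  assert (xc : forall x, continuous chi x) by (intros x; eapply is_derive_continuous; eauto).
  set (h := fun x => 2 * (gam * u x - (w - wC) * v x)).
  (* A primitive of f off d. Only v1 can jump at d, so the integral of f over both sides is (r1 -
     r2) eta d. *)
  set (F := fun x => v x * eta1 x - v1 x * eta x).
  set (f := fun x => v x * eta2 x - h x * eta x).
  assert (HF : forall x, x <> d -> Rabs (x - d) < e -> is_derive F x (f x)).
  { intros x Hx Hxe. unfold F, f. specialize (Hv x Hx Hxe). specialize (Hv1 x Hx Hxe). fold (h x) in Hv1.
    specialize (D1 x). specialize (D2 x). der. ring. }
  assert (hc : forall x, x <> d -> Rabs (x - d) < e -> continuous h x).
  { intros x Hx Hxe. unfold h. apply continuous_Rmult; [apply continuous_const|].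
    apply continuous_Rminus; apply continuous_Rmult; auto; apply continuous_const. }
  assert (fc : forall x, x <> d -> Rabs (x - d) < e -> continuous f x).
  { intros x Hx Hxe. apply continuous_Rminus; apply continuous_Rmult; auto. }
  assert (hr : filterlim h (at_right d) (locally (2 * (gam * m1 - (w - wC) * v d)))).
  { unfold h. apply filterlim_Rmult; [typeclasses eauto|apply filterlim_const|].
    apply filterlim_Rminus; [typeclasses eauto| |]; apply filterlim_Rmult;
        try typeclasses eauto; auto; try apply filterlim_const. apply continuous_at_right; auto. }
  assert (hl : filterlim h (at_left d) (locally (2 * (gam * m2 - (w - wC) * v d)))).
  { unfold h. apply filterlim_Rmult; [typeclasses eauto|apply filterlim_const|].
    apply filterlim_Rminus; [typeclasses eauto| |]; apply filterlim_Rmult;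
        try typeclasses eauto; auto; try apply filterlim_const. apply continuous_at_left; auto. }
  assert (FR : is_RInt f d (d + r) (F (d + r) - (v d * eta1 d - r1 * eta d))).
  { apply is_RInt_derive_open with (F := F) (fb := f (d + r))
      (fa := v d * eta2 d - 2 * (gam * m1 - (w - wC) * v d) * eta d); try lra.
    - intros x Hx. apply HF; [lra|apply Rabs_def1; lra].
    - intros x Hx. apply fc; [lra|apply Rabs_def1; lra].
    - apply filterlim_Rminus; [typeclasses eauto| |]; apply filterlim_Rmult; try typeclasses eauto; auto;
        apply continuous_at_right; auto.
    - apply continuous_at_left. eapply is_derive_continuous. apply HF; [lra|apply Rabs_def1; lra].
    - apply filterlim_Rminus; [typeclasses eauto| |]; apply filterlim_Rmult; try typeclasses eauto; auto;
        apply continuous_at_right; auto.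
    - apply continuous_at_left. apply fc; [lra|apply Rabs_def1; lra]. }
  assert (FL : is_RInt f (d - r) d ((v d * eta1 d - r2 * eta d) - F (d - r))).
  { apply is_RInt_derive_open with (F := F) (fa := f (d - r))
      (fb := v d * eta2 d - 2 * (gam * m2 - (w - wC) * v d) * eta d); try lra.
    - intros x Hx. apply HF; [lra|apply Rabs_def1; lra].
    - intros x Hx. apply fc; [lra|apply Rabs_def1; lra].
    - apply continuous_at_right. eapply is_derive_continuous. apply HF; [lra|apply Rabs_def1; lra].
    - apply filterlim_Rminus; [typeclasses eauto| |]; apply filterlim_Rmult; try typeclasses eauto; auto;
        apply continuous_at_left; auto.
    - apply continuous_at_right. apply fc; [lra|apply Rabs_def1; lra].
    - apply filterlim_Rminus; [typeclasses eauto| |]; apply filterlim_Rmult; try typeclasses eauto; auto;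
        apply continuous_at_left; auto. }
  assert (Ar : Rabs (d + r - d) = r) by (rewrite Rabs_pos_eq; lra).
  assert (Al : Rabs (d - r - d) = r) by (rewrite Rabs_left; lra).
  assert (Fr0 : F (d + r) = 0) by (unfold F; rewrite Ez, Ez1 by lra; ring).
  assert (Fl0 : F (d - r) = 0) by (unfold F; rewrite Ez, Ez1 by lra; ring).
  assert (Out : forall x, r <= Rabs (x - d) -> f x = 0).
  { intros x Hx. unfold f. rewrite Ez, Ez2 by auto. ring. }
  assert (FI : is_RInt f (- M) M ((r1 - r2) * eta d)).
  { replace ((r1 - r2) * eta d) with
      (0 + (((v d * eta1 d - r2 * eta d) - F (d - r)) + ((F (d + r) - (v d * eta1 d - r1 * eta d)) + 0)))
      by (rewrite Fr0, Fl0; ring).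
    apply is_RInt_Rchasles with (d - r).
    { apply is_RInt_zero_on. intros x Hx. rewrite Rmin_left, Rmax_right in Hx by lra.
      apply Out. rewrite Rabs_left; lra. }
    apply is_RInt_Rchasles with d; auto. apply is_RInt_Rchasles with (d + r); auto.
    apply is_RInt_zero_on. intros x Hx. rewrite Rmin_left, Rmax_right in Hx by lra.
    apply Out. rewrite Rabs_pos_eq; lra. }
  assert (KI : exists k, is_RInt (fun x => v x * eta x) (- M) M k).
  { apply (ex_RInt_continuous (V := R_CompleteNormedModule)). intros x _. apply continuous_Rmult; auto. }
  destruct KI as [k KI].
  (* The part of the pairing without x-derivatives is k times the derivative of beta, whose integral
     over the time interval is 0. *)
  set (beta := fun t => - sin (w * t) * chi t).
  set (beta1 := fun t => - w * cos (w * t) * chi t - sin (w * t) * chi1 t).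
  assert (Db : forall t, is_derive beta t (beta1 t)).
  { intros t. unfold beta, beta1. specialize (X1 t). der. ring. }
  assert (cc : forall t, continuous (fun t => cos (w * t)) t).
  { intros t. eapply is_derive_continuous. auto_derive; auto. }
  assert (b1c : forall t, continuous beta1 t).
  { intros t. unfold beta1. apply continuous_Rminus; apply continuous_Rmult; auto.
    - apply continuous_Rmult; auto. apply continuous_const.
    - eapply is_derive_continuous. auto_derive; auto. }
  assert (EI : forall t, fst (I t) = beta1 t * k + cos (w * t) * chi t / 2 * ((r1 - r2) * eta d)).
  { intros t. specialize (I1 t). apply is_RInt_C_fst in I1.
    apply (is_RInt_Runique _ _ _ _ _ I1).
    apply (is_RInt_Rext (fun x => beta1 t * (v x * eta x) + cos (w * t) * chi t / 2 * f x)).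
    - intros x Hx. rewrite !PD, !harmonic_pair. fold eta2 chi1.
      change (Derive_n eta 0 x) with (eta x). change (Derive_n chi 0 t) with (chi t).
      unfold f, beta1, h. simpl fst. field.
    - apply is_RInt_Rplus; apply is_RInt_Rscal; auto. }
  apply is_RInt_C_fst in I2. simpl fst in I2.
  assert (BM : beta M = 0 /\ beta (- M) = 0).
  { unfold beta. rewrite !Cz; [split; ring| |]; rewrite Rminus_0_r.
    - rewrite Rabs_left; lra.
    - rewrite Rabs_pos_eq; lra. }
  assert (BI : is_RInt beta1 (- M) M 0).
  { replace 0 with (beta M - beta (- M)) by lra.
    apply (is_RInt_derive (V := R_CompleteNormedModule) beta); auto. }
  set (q := RInt (fun t => cos (w * t) * chi t) (- tau) tau).
  assert (Cq : forall t, continuous (fun t => cos (w * t) * chi t) t) by (intros t; apply continuous_Rmult; auto).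
  assert (Hq : 0 < q).
  { apply RInt_gt_0; [lra| |].
    - intros t Ht. apply Rmult_lt_0_compat.
      + assert (B : - 1 <= w * t <= 1).
        { apply Rabs_le_between. rewrite Rabs_mult.
          apply Rle_trans with (Rabs w * tau); auto. apply Rmult_le_compat_l; [apply Rabs_pos|].
          apply Rlt_le, Rabs_def1; lra. }
        apply cos_gt_0; pose proof PI2_1; lra.
      + apply Cp. rewrite Rminus_0_r. apply Rabs_def1; lra.
    - intros t _. apply Cq. }
  assert (QI : is_RInt (fun t => cos (w * t) * chi t) (- M) M q).
  { replace q with (0 + (q + 0)) by ring. apply is_RInt_Rchasles with (- tau).
    { apply is_RInt_zero_on. intros t Ht. rewrite Rmin_left, Rmax_right in Ht by lra.
      rewrite Cz; [ring|]. rewrite Rminus_0_r, Rabs_left; lra. }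
    apply is_RInt_Rchasles with tau.
    { apply (RInt_correct (V := R_CompleteNormedModule)).
      apply (ex_RInt_continuous (V := R_CompleteNormedModule)). auto. }
    apply is_RInt_zero_on. intros t Ht. rewrite Rmin_left, Rmax_right in Ht by lra.
    rewrite Cz; [ring|]. rewrite Rminus_0_r, Rabs_pos_eq; lra. }
  assert (Z : 0 = k * 0 + (r1 - r2) * eta d / 2 * q).
  { apply (is_RInt_Runique _ _ _ _ _ I2).
    apply (is_RInt_Rext (fun t => k * beta1 t + (r1 - r2) * eta d / 2 * (cos (w * t) * chi t))).
    - intros t _. rewrite EI. field.
    - apply is_RInt_Rplus; apply is_RInt_Rscal; auto. }
  assert (Ed : 0 < eta d) by (apply Ep; rewrite Rminus_diag, Rabs_R0; lra).
  assert (Q : (r1 - r2) * (eta d * q) = 0) by lra. apply Rmult_integral in Q.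
  destruct Q as [Q|Q]; [lra|]. apply Rmult_integral in Q. lra.
Qed.

(** [solution_off] assumes nothing about v' at a jump. But v'' is expressed through u and v, which
    have one-sided limits, and a primitive of a function with a one-sided limit has one as well. *)
Lemma right_limit_of_derivative (f h : R -> R) (d e m : R) :
  0 < e -> (forall x, d < x < d + e -> is_derive f x (h x)) ->
  (forall x, d < x < d + e -> continuous h x) -> filterlim h (at_right d) (locally m) ->
  exists r, filterlim f (at_right d) (locally r).
Proof.
  intros He Hf Hh Hm.
  destruct (C0_extension_lt h m (h (d + e / 2)) d (d + e / 2)) as [k [k1 [k2 _]]]; [lra| | | |].
  - intros c Hc. apply Hh. lra.
  - auto.
  - apply continuous_at_left. apply Hh. lra.
  - set (G := fun x => RInt k d x).
    assert (DG : forall x, is_derive G x (k x)).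
    { intros x. apply (is_derive_RInt (V := R_NormedModule) k G d x); [|apply k1].
      apply filter_forall. intros y. apply (RInt_correct (V := R_CompleteNormedModule)).
      apply (ex_RInt_continuous (V := R_CompleteNormedModule)). intros z _. apply k1. }
    set (c := d + e / 4).
    assert (E : forall x, d < x < d + e / 2 -> f x - G x = f c - G c).
    { assert (Hd : forall z, d < z < d + e / 2 -> is_derive (fun z => f z - G z) z 0).
      { intros z Hz. replace 0 with (h z - k z) by (rewrite k2; [ring|auto]).
        apply (is_derive_minus (V := R_NormedModule)); [apply Hf; lra|apply DG]. }
      intros x Hx. unfold c. destruct (Rtotal_order x (d + e / 4)) as [H|[H|H]]; [|subst; auto|symmetry];
        apply (constant_of_derive_0_off nil (fun z => f z - G z)); auto; intros z Hz;
        try (eapply is_derive_continuous); try intros _; apply Hd; lra. }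
    exists (f c - G c + G d).
    assert (L : filterlim (fun x => f c - G c + G x) (at_right d) (locally (f c - G c + G d))).
    { apply filterlim_Rplus; [typeclasses eauto|apply filterlim_const|].
      apply continuous_at_right. eapply is_derive_continuous. apply DG. }
    apply (filterlim_ext_loc (fun x => f c - G c + G x)); auto.
    exists (mkposreal (e / 2) ltac:(lra)). intros x Hx Hdx.
    change (Rabs (x - d) < e / 2) in Hx. apply Rabs_def2 in Hx. specialize (E x ltac:(lra)). lra.
Qed.

Lemma left_limit_reflect (f : R -> R) (d l : R) :
  filterlim (fun x => f (- x)) (at_right (- d)) (locally l) <-> filterlim f (at_left d) (locally l).
Proof.
  rewrite at_right_R, at_left_R. split; intros H e He; destruct (H e He) as [r [Hr H']]; exists r; split; auto.
  - intros x Hx. specialize (H' (- x)). rewrite Ropp_involutive in H'. apply H'. lra.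
  - intros x Hx. apply H'. lra.
Qed.

Lemma left_limit_of_derivative (f h : R -> R) (d e m : R) :
  0 < e -> (forall x, d - e < x < d -> is_derive f x (h x)) ->
  (forall x, d - e < x < d -> continuous h x) -> filterlim h (at_left d) (locally m) ->
  exists r, filterlim f (at_left d) (locally r).
Proof.
  intros He Hf Hh Hm.
  destruct (right_limit_of_derivative (fun x => f (- x)) (fun x => - h (- x)) (- d) e (- m) He) as [r Hr].
  - intros x Hx. apply is_derive_reflect. apply Hf. lra.
  - intros x Hx. apply (continuous_opp (V := R_NormedModule)). apply continuous_reflect. apply Hh. lra.
  - apply left_limit_reflect in Hm.
    apply (filterlim_comp _ _ _ (fun x => h (- x)) Ropp (at_right (- d)) (locally m)); auto.
    apply (filterlim_opp (V := R_NormedModule)).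
  - exists r. apply left_limit_reflect. exact Hr.
Qed.

Lemma is_derive_of_limits (f f1 : R -> R) (d e r : R) :
  0 < e -> continuous f d -> (forall x, x <> d -> Rabs (x - d) < e -> is_derive f x (f1 x)) ->
  filterlim f1 (at_right d) (locally r) -> filterlim f1 (at_left d) (locally r) ->
  is_derive f d r.
Proof.
  intros He Hc Hf Hr Hl. apply is_derive_Reals. intros eps Heps.
  destruct (proj1 (at_right_R _ _ _) Hr eps Heps) as [d1 [Hd1 H1]].
  destruct (proj1 (at_left_R _ _ _) Hl eps Heps) as [d2 [Hd2 H2]].
  assert (Hp : 0 < Rmin e (Rmin d1 d2)) by (repeat apply Rmin_glb_lt; auto).
  exists (mkposreal _ Hp). intros h Hh Hhd. simpl in Hhd.
  assert (A1 : Rmin e (Rmin d1 d2) <= e) by apply Rmin_l.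
  assert (A2 : Rmin e (Rmin d1 d2) <= d1) by (eapply Rle_trans; [apply Rmin_r|apply Rmin_l]).
  assert (A3 : Rmin e (Rmin d1 d2) <= d2) by (eapply Rle_trans; [apply Rmin_r|apply Rmin_r]).
  apply Rabs_def2 in Hhd.
  assert (Hcont : forall z, Rabs (z - d) < e -> continuous f z).
  { intros z Hz. destruct (Req_dec z d) as [->|Hn]; auto. eapply is_derive_continuous. apply Hf; auto. }
  destruct (Rlt_dec 0 h) as [L|L].
  - destruct (mvt_open f f1 d (d + h)) as [z [Hz Ez]]; [lra| | |].
    + intros z Hz. apply Hf; [lra|apply Rabs_def1; lra].
    + intros z Hz. apply Hcont. apply Rabs_def1; lra.
    + rewrite Ez. replace (f1 z * (d + h - d) / h) with (f1 z) by (field; auto). apply H1. lra.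
  - destruct (mvt_open f f1 (d + h) d) as [z [Hz Ez]]; [lra| | |].
    + intros z Hz. apply Hf; [lra|apply Rabs_def1; lra].
    + intros z Hz. apply Hcont. apply Rabs_def1; lra.
    + replace (f (d + h) - f d) with (- (f d - f (d + h))) by ring. rewrite Ez.
      replace (- (f1 z * (d - (d + h))) / h) with (f1 z) by (field; auto). apply H2. lra.
Qed.

Lemma continuous_of_sided (f : R -> R) (x : R) :
  filterlim f (at_right x) (locally (f x)) -> filterlim f (at_left x) (locally (f x)) -> continuous f x.
Proof.
  intros Hr Hl. apply continuous_R. intros e He.
  destruct (proj1 (at_right_R _ _ _) Hr e He) as [d1 [Hd1 H1]].
  destruct (proj1 (at_left_R _ _ _) Hl e He) as [d2 [Hd2 H2]].
  exists (Rmin d1 d2). split; [apply Rmin_glb_lt; auto|]. intros y Hy. apply Rabs_def2 in Hy.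
  pose proof (Rmin_l d1 d2). pose proof (Rmin_r d1 d2).
  destruct (Rtotal_order y x) as [L|[L|L]].
  - apply H2. lra.
  - subst. rewrite Rminus_diag, Rabs_R0. auto.
  - apply H1. lra.
Qed.

Lemma is_lim_sided (f : R -> R) (x l : R) :
  is_lim f x l <-> filterlim f (at_right x) (locally l) /\ filterlim f (at_left x) (locally l).
Proof.
  rewrite is_lim_R, at_right_R, at_left_R. split.
  - intros H. split; intros e He; destruct (H e He) as [d [Hd H']]; exists d; split; auto;
      intros y Hy; apply H'; try lra; apply Rabs_def1; lra.
  - intros [Hr Hl] e He. destruct (Hr e He) as [d1 [Hd1 H1]]. destruct (Hl e He) as [d2 [Hd2 H2]].
    exists (Rmin d1 d2). split; [apply Rmin_glb_lt; auto|]. intros y Hyx Hy. apply Rabs_def2 in Hy.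
    pose proof (Rmin_l d1 d2). pose proof (Rmin_r d1 d2).
    destruct (Rtotal_order y x) as [L|[L|L]]; [apply H2; lra|contradiction|apply H1; lra].
Qed.

Lemma filterlim_ext_right (f h : R -> R) (x e l : R) :
  0 < e -> (forall y, x < y < x + e -> f y = h y) ->
  filterlim f (at_right x) (locally l) -> filterlim h (at_right x) (locally l).
Proof.
  intros He E. apply filterlim_ext_loc. exists (mkposreal e He). intros y Hy Hxy.
  change (Rabs (y - x) < e) in Hy. apply Rabs_def2 in Hy. apply E. lra.
Qed.

Lemma filterlim_ext_left (f h : R -> R) (x e l : R) :
  0 < e -> (forall y, x - e < y < x -> f y = h y) ->
  filterlim f (at_left x) (locally l) -> filterlim h (at_left x) (locally l).
Proof.
  intros He E. apply filterlim_ext_loc. exists (mkposreal e He). intros y Hy Hxy.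
  change (Rabs (y - x) < e) in Hy. apply Rabs_def2 in Hy. apply E. lra.
Qed.

(** * From stationary solutions to profiles *)

Lemma sign_abs (s x : R) : s = 1 \/ s = - 1 -> 0 < s * x -> x = s * Rabs x.
Proof.
  intros [->| ->] H.
  - rewrite Rabs_pos_eq; lra.
  - rewrite Rabs_left; lra.
Qed.

(** If g m ^ 2 were not a, then [u = gam v / (a - g |u| ^ 2)] would converge at d. So g m ^ 2 = a,
    and the cubic gives v d = 0. As m > 0, u keeps its sign on each side of d; equal signs on both
    sides would again make u converge. *)
Lemma jump_structure (a g gam : R) (u v : R -> R) (d e m : R) :
  gam <> 0 -> 0 < e ->
  (forall x, x <> d -> Rabs (x - d) < e -> continuous u x) ->
  (forall x, x <> d -> Rabs (x - d) < e -> gam * v x = (a - g * u x ^ 2) * u x) ->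
  continuous v d -> discontinuity u d -> is_lim (fun x => Rabs (u x)) d m ->
  0 < m /\ g * m ^ 2 = a /\ v d = 0 /\
  exists s, (s = 1 \/ s = - 1) /\
    filterlim u (at_right d) (locally (s * m)) /\ filterlim u (at_left d) (locally (- s * m)) /\
    exists e', 0 < e' /\ forall x y, d - e' < x < d -> d < y < d + e' -> u x * u y < 0.
Proof.
  intros hgam He Hc Hal Hv Hdis Hm.
  assert (Hv' : is_lim v d (v d)) by (apply is_lim_sided; split; [apply continuous_at_right|apply continuous_at_left]; auto).
  assert (m0 : 0 <= m).
  { apply Rnot_lt_le. intro C. destruct (proj1 (is_lim_R _ _ _) Hm (- m) ltac:(lra)) as [r [Hr H]].
    specialize (H (d + r / 2) ltac:(lra) ltac:(apply Rabs_def1; lra)). apply Rabs_def2 in H.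
    pose proof (Rabs_pos (u (d + r / 2))). lra. }
  assert (mp : 0 < m).
  { destruct m0 as [|Z]; auto. exfalso. apply Hdis. exists 0. apply is_lim_R. intros r Hr.
    destruct (proj1 (is_lim_R _ _ _) Hm r Hr) as [b [Hb H]]. exists b. split; auto.
    intros x Hx Hxd. specialize (H x Hx Hxd). rewrite <- Z, Rminus_0_r, Rabs_Rabsolu in H.
    rewrite Rminus_0_r. auto. }
  assert (Hga : g * m ^ 2 = a).
  { apply NNPP. intro N. apply Hdis. exists (gam * v d * / (a - g * m ^ 2)).
    assert (L : filterlim (fun x => gam * v x * / (a - g * Rabs (u x) ^ 2)) (locally' d)
       (locally (gam * v d * / (a - g * m ^ 2)))).
    { apply filterlim_Rmult; [typeclasses eauto| |].
      - apply filterlim_Rmult; [typeclasses eauto|apply filterlim_const|exact Hv'].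
      - apply (is_lim_continuous_comp (fun z => / (a - g * z ^ 2)) _ d m Hm).
        apply (ex_derive_continuous (V := R_NormedModule)). auto_derive. lra. }
    apply (is_lim_ext_loc (fun x => gam * v x * / (a - g * Rabs (u x) ^ 2)) u d); [|exact L].
    destruct (proj1 (is_lim_R _ _ _)
      (is_lim_continuous_comp (fun z => a - g * z ^ 2) _ d m Hm
        ltac:(apply (ex_derive_continuous (V := R_NormedModule)); auto_derive; auto))
      (Rabs (a - g * m ^ 2)) ltac:(apply Rabs_pos_lt; lra)) as [b [Hb H]].
    assert (Hp : 0 < Rmin b e) by (apply Rmin_glb_lt; auto).
    exists (mkposreal _ Hp). intros x Hx Hxd. change (Rabs (x - d) < Rmin b e) in Hx.
    pose proof (Rmin_l b e). pose proof (Rmin_r b e).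
    rewrite (Hal x Hxd ltac:(lra)). specialize (H x Hxd ltac:(lra)). rewrite pow2_abs in *.
    field. intro Z. rewrite Z, Rminus_0_l, Rabs_Ropp in H. lra. }
  assert (Vd : v d = 0).
  { assert (A : is_lim (fun x => Rabs (gam * v x)) d (Rabs (gam * v d))).
    { apply (is_lim_continuous_comp (fun z => Rabs (gam * z)) v d (v d) Hv').
      apply (continuous_comp (fun z => gam * z) Rabs).
      - apply continuous_Rmult; [apply continuous_const|apply continuous_id].
      - apply continuous_Rabs. }
    assert (B : is_lim (fun x => Rabs (gam * v x)) d (Rabs (a - g * m ^ 2) * m)).
    { apply (is_lim_ext_loc (fun x => Rabs (a - g * Rabs (u x) ^ 2) * Rabs (u x))).
      - exists (mkposreal e He). intros x Hx Hxd. rewrite (Hal x Hxd Hx), Rabs_mult, pow2_abs. auto.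
      - apply (is_lim_continuous_comp (fun z => Rabs (a - g * z ^ 2) * z) _ d m Hm).
        apply continuous_Rmult; [|apply continuous_id].
        apply (continuous_comp (fun z => a - g * z ^ 2) Rabs); [|apply continuous_Rabs].
        apply (ex_derive_continuous (V := R_NormedModule)). auto_derive. auto. }
    apply is_lim_unique in A. apply is_lim_unique in B. rewrite A in B.
    apply (f_equal real) in B. change (Rabs (gam * v d) = Rabs (a - g * m ^ 2) * m) in B. rewrite Hga, Rminus_diag, Rabs_R0, Rmult_0_l in B.
    apply (Rmult_eq_reg_l gam); auto. rewrite Rmult_0_r. apply Rabs_eq_0. exact B. }
  split; [auto|split; [auto|split; [auto|]]].
  destruct (proj1 (is_lim_R _ _ _) Hm m mp) as [b [Hb Hbm]].
  set (r := Rmin b e). assert (Hr : 0 < r) by (apply Rmin_glb_lt; auto).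
  assert (r <= b) by apply Rmin_l. assert (r <= e) by apply Rmin_r.
  assert (Unz : forall x, x <> d -> Rabs (x - d) < r -> u x <> 0).
  { intros x Hx Hxd Z. specialize (Hbm x Hx ltac:(lra)). rewrite Z, Rabs_R0, Rminus_0_l, Rabs_Ropp in Hbm.
    rewrite Rabs_pos_eq in Hbm; lra. }
  assert (SR : forall x y, d < x < d + r -> d < y < d + r -> 0 < u x * u y).
  { intros x y. apply (same_sign_on u (fun x => d < x < d + r)).
    - intros p q z Hp Hq Hz. lra.
    - intros z Hz. apply Hc; [lra|apply Rabs_def1; lra].
    - intros z Hz. apply Unz; [lra|apply Rabs_def1; lra]. }
  assert (SL : forall x y, d - r < x < d -> d - r < y < d -> 0 < u x * u y).
  { intros x y. apply (same_sign_on u (fun x => d - r < x < d)).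
    - intros p q z Hp Hq Hz. lra.
    - intros z Hz. apply Hc; [lra|apply Rabs_def1; lra].
    - intros z Hz. apply Unz; [lra|apply Rabs_def1; lra]. }
  set (cr := d + r / 2). set (cl := d - r / 2).
  assert (Sg : forall c, u c <> 0 -> exists s, (s = 1 \/ s = - 1) /\ 0 < s * u c).
  { intros c Hn. destruct (Rlt_dec 0 (u c)); [exists 1|exists (-1)]; split; auto; lra. }
  destruct (Sg cr) as [s [Hs Hs1]]. { apply Unz; unfold cr; [lra|apply Rabs_def1; lra]. }
  destruct (Sg cl) as [s' [Hs' Hs1']]. { apply Unz; unfold cl; [lra|apply Rabs_def1; lra]. }
  assert (s2 : s * s = 1) by (destruct Hs; subst; ring).
  assert (s2' : s' * s' = 1) by (destruct Hs'; subst; ring).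
  assert (PR : forall x, d < x < d + r -> 0 < s * u x).
  { intros x Hx. specialize (SR cr x ltac:(unfold cr; lra) Hx).
    assert (0 < (s * u cr) * (s * u x)) by (replace ((s * u cr) * (s * u x)) with ((s * s) * (u cr * u x)) by ring; rewrite s2; lra).
    clear - H1 Hs1. nra. }
  assert (PL : forall x, d - r < x < d -> 0 < s' * u x).
  { intros x Hx. specialize (SL cl x ltac:(unfold cl; lra) Hx).
    assert (0 < (s' * u cl) * (s' * u x)) by (replace ((s' * u cl) * (s' * u x)) with ((s' * s') * (u cl * u x)) by ring; rewrite s2'; lra).
    clear - H1 Hs1'. nra. }
  destruct (proj1 (is_lim_sided _ _ _) Hm) as [MR ML].
  assert (LR : filterlim u (at_right d) (locally (s * m))).
  { apply (filterlim_ext_right (fun x => s * Rabs (u x)) u d r); auto.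
    - intros x Hx. symmetry. apply sign_abs; auto.
    - apply filterlim_Rmult; [typeclasses eauto|apply filterlim_const|auto]. }
  assert (LL : filterlim u (at_left d) (locally (s' * m))).
  { apply (filterlim_ext_left (fun x => s' * Rabs (u x)) u d r); auto.
    - intros x Hx. symmetry. apply sign_abs; auto.
    - apply filterlim_Rmult; [typeclasses eauto|apply filterlim_const|auto]. }
  assert (Hne : s' = - s).
  { destruct (Req_dec s s') as [E|E].
    - exfalso. apply Hdis. exists (s * m). apply is_lim_sided. split; auto. rewrite E. auto.
    - destruct Hs, Hs'; lra. }
  exists s. split; [auto|split; [auto|split]].
  - rewrite <- Hne. auto.
  - exists r. split; auto. intros x y Hx Hy. specialize (PR y Hy). specialize (PL x Hx). rewrite Hne in PL.
    assert (0 < (- s * u x) * (s * u y)) by (apply Rmult_lt_0_compat; auto).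
    replace ((- s * u x) * (s * u y)) with (- ((s * s) * (u x * u y))) in H1 by ring. rewrite s2 in H1. lra.
Qed.

Lemma profile_of_classical wX wC gam g w phiX phiC :
  classical_solution wX wC gam g w phiX phiC ->
  profile (w - wX) (w - wC) gam g nil phiX (Derive phiX) (Derive_n phiX 2) phiC (Derive phiC).
Proof.
  intros H.
  constructor.
  - intros x _. apply (C2_at_derive phiX x (proj1 (H x))).
  - intros x _. apply (C2_at_derive phiX x (proj1 (H x))).
  - intros x _. apply (C2_at_derive phiX x (proj1 (H x))).
  - intros x. apply (C2_at_derive phiC x (proj1 (proj2 (H x)))).
  - intros x _. rewrite <- (proj2 (classical_at_equations _ _ _ _ _ _ _ _ (H x))).
    apply (C2_at_derive phiC x (proj1 (proj2 (H x)))).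
  - intros x. eapply is_derive_continuous. apply (C2_at_derive phiC x (proj1 (proj2 (H x)))).
  - intros x. apply (classical_at_equations _ _ _ _ _ _ _ _ (H x)).
  - intros d [].
  - intros d [].
Qed.

(** The root with positive sign is as good as the other one: at a jump [a - g u ^ 2 = 0], so every
    profile condition there depends only on u ^ 2. *)
Definition normalized (D : list R) (phi : R -> R) (x : R) : R :=
  if in_dec Req_dec_T x D then real (Lim (fun y => Rabs (phi y)) x) else phi x.

Lemma normalized_off D phi x : ~ In x D -> normalized D phi x = phi x.
Proof. intros H. unfold normalized. destruct (in_dec Req_dec_T x D); tauto. Qed.

(** At a jump, [jump_structure] gives the one-sided limits of u, hence those of v'' and of v'. The
    weak equation equates the limits of v', so v is differentiable at d, and [Derive phiC d] is a
    genuine derivative instead of a default value. *)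
Lemma profile_of_stationary wX wC gam g w phiX phiC D (hgam : gam <> 0) :
  solution_off D wX wC gam g w phiX phiC ->
  (forall d : R, In d D -> discontinuity phiX d /\ ex_finite_lim (fun x => Rabs (phiX x)) d) ->
  profile (w - wX) (w - wC) gam g D (normalized D phiX) (Derive phiX) (Derive_n phiX 2) phiC (Derive phiC).
Proof.
  intros [Hcl [vc Hweak]] HD.
  set (a := w - wX). set (b := w - wC).
  assert (Al : forall x, ~ In x D -> gam * phiC x = (a - g * phiX x ^ 2) * phiX x).
  { intros x Hx. apply (classical_at_equations _ _ _ _ _ _ _ _ (Hcl x Hx)). }
  assert (DX : forall x, ~ In x D -> is_derive phiX x (Derive phiX x)).
  { intros x Hx. apply (C2_at_derive phiX x (proj1 (Hcl x Hx))). }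
  assert (DX1 : forall x, ~ In x D -> is_derive (Derive phiX) x (Derive_n phiX 2 x)).
  { intros x Hx. apply (C2_at_derive phiX x (proj1 (Hcl x Hx))). }
  assert (DC : forall x, ~ In x D -> is_derive phiC x (Derive phiC x)).
  { intros x Hx. apply (C2_at_derive phiC x (proj1 (proj2 (Hcl x Hx)))). }
  assert (DC1 : forall x, ~ In x D -> is_derive (Derive phiC) x (2 * (gam * phiX x - b * phiC x))).
  { intros x Hx. unfold b. rewrite <- (proj2 (classical_at_equations _ _ _ _ _ _ _ _ (Hcl x Hx))).
    apply (C2_at_derive phiC x (proj1 (proj2 (Hcl x Hx)))). }
  assert (Loc : forall x, ~ In x D -> locally x (fun y => phiX y = normalized D phiX y)).
  { intros x Hx. generalize (locally_not_In D x Hx). apply filter_imp. intros y Hy.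
    symmetry. apply normalized_off. auto. }
  assert (J : forall d, In d D -> exists m, is_lim (fun x => Rabs (phiX x)) d (Finite m) /\
    normalized D phiX d = m /\ 0 < m /\ g * m ^ 2 = a /\ phiC d = 0 /\
    (exists e', 0 < e' /\ forall x y, d - e' < x < d -> d < y < d + e' -> phiX x * phiX y < 0) /\
    is_derive phiC d (Derive phiC d) /\ continuous (Derive phiC) d).
  { intros d Hd. destruct (HD d Hd) as [Hdis [m Hm]].
    destruct (locally_punctured_not_In D d) as [e [He HnD]].
    destruct (jump_structure a g gam phiX phiC d e m hgam He) as [Hmp [Hgm [Hv0 [s [Hs [LR [LL Hflip]]]]]]]; auto.
    { intros x Hx Hxd. eapply is_derive_continuous. apply DX. auto. }
    exists m. split; [auto|]. split.
    { unfold normalized. destruct (in_dec Req_dec_T d D); [|tauto]. rewrite (is_lim_unique _ _ _ Hm). auto. }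
    split; [auto|split; [auto|split; [auto|split; [auto|]]]].
    set (h := fun x => 2 * (gam * phiX x - b * phiC x)).
    assert (hr : filterlim h (at_right d) (locally (2 * (gam * (s * m) - b * phiC d)))).
    { unfold h. apply filterlim_Rmult; [typeclasses eauto|apply filterlim_const|].
      apply filterlim_Rminus; [typeclasses eauto| |]; apply filterlim_Rmult;
        try typeclasses eauto; auto; try apply filterlim_const. apply continuous_at_right; auto. }
    assert (hl : filterlim h (at_left d) (locally (2 * (gam * (- s * m) - b * phiC d)))).
    { unfold h. apply filterlim_Rmult; [typeclasses eauto|apply filterlim_const|].
      apply filterlim_Rminus; [typeclasses eauto| |]; apply filterlim_Rmult;
        try typeclasses eauto; auto; try apply filterlim_const. apply continuous_at_left; auto. }
    assert (hc : forall x, x <> d -> Rabs (x - d) < e -> continuous h x).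
    { intros x Hx Hxe. unfold h. apply continuous_Rmult; [apply continuous_const|].
      apply continuous_Rminus; apply continuous_Rmult; auto; try apply continuous_const.
      eapply is_derive_continuous. apply DX. auto. }
    destruct (right_limit_of_derivative (Derive phiC) h d e (2 * (gam * (s * m) - b * phiC d)) He) as [r1 R1]; auto.
    { intros x Hx. apply DC1. apply HnD; [lra|apply Rabs_def1; lra]. }
    { intros x Hx. apply hc; [lra|apply Rabs_def1; lra]. }
    destruct (left_limit_of_derivative (Derive phiC) h d e (2 * (gam * (- s * m) - b * phiC d)) He) as [r2 R2]; auto.
    { intros x Hx. apply DC1. apply HnD; [lra|apply Rabs_def1; lra]. }
    { intros x Hx. apply hc; [lra|apply Rabs_def1; lra]. }
    assert (E : r1 = r2).
    { apply (weak_no_kink wX wC gam g w phiX phiC (Derive phiC) d e (s * m) (- s * m)); auto.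
      intros x Hx Hxe. eapply is_derive_continuous. apply DX. auto. }
    subst r2.
    assert (Dd : is_derive phiC d r1).
    { apply (is_derive_of_limits phiC (Derive phiC) d e r1); auto. }
    assert (Ed := is_derive_unique _ _ _ Dd). rewrite Ed. split; auto.
    apply continuous_of_sided; rewrite Ed; auto. }
  constructor.
  - intros x Hx. apply is_derive_ext_loc with phiX; auto.
  - auto.
  - intros x Hx. apply (C2_at_derive phiX x (proj1 (Hcl x Hx))).
  - intros x. destruct (in_dec Req_dec_T x D) as [Hx|Hx]; auto.
    destruct (J x Hx) as [m Hm]. apply Hm.
  - intros x Hx. rewrite normalized_off; auto.
  - intros x. destruct (in_dec Req_dec_T x D) as [Hx|Hx].
    + destruct (J x Hx) as [m Hm]. apply Hm.
    + eapply is_derive_continuous. apply DC1. auto.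
  - intros x. destruct (in_dec Req_dec_T x D) as [Hx|Hx].
    + destruct (J x Hx) as [m [_ [E1 [_ [E2 [E3 _]]]]]]. rewrite E1, E3, E2. ring.
    + rewrite normalized_off; auto.
  - intros d Hd. destruct (J d Hd) as [m [Hm [E1 [E2 [E3 _]]]]]. rewrite E1. repeat split; auto; [lra|].
    destruct (locally_punctured_not_In D d) as [e [He HnD]].
    assert (L2 := is_lim_sq _ _ _ Hm). apply continuous_R. intros r Hr.
    destruct (proj1 (is_lim_R _ _ _) L2 r Hr) as [q [Hq H']].
    exists (Rmin q e). split; [apply Rmin_glb_lt; auto|]. intros y Hy.
    pose proof (Rmin_l q e). pose proof (Rmin_r q e). rewrite E1.
    destruct (Req_dec y d) as [->|Hyd]; [rewrite E1, Rminus_diag, Rabs_R0; auto|].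
    rewrite normalized_off by (apply HnD; auto; lra).
    rewrite <- (pow2_abs (phiX y)). apply H'; auto. lra.
  - intros d Hd. destruct (J d Hd) as [m [_ [_ [_ [_ [_ [[e' [He' Hf]] _]]]]]]].
    destruct (locally_punctured_not_In D d) as [e [He HnD]].
    exists (Rmin e' e). split; [apply Rmin_glb_lt; auto|]. intros x y Hx Hy.
    pose proof (Rmin_l e' e). pose proof (Rmin_r e' e).
    rewrite !normalized_off; [apply Hf; lra| |]; apply HnD; try lra; apply Rabs_def1; lra.
Qed.

(** * Exhaustion *)

Lemma amp_inf_eq wX wC gam g w l :
  gam <> 0 -> gam ^ 2 = (w - wC) * (w - wX - g * l ^ 2) -> g <> 0 -> amp_inf wX wC gam g w = Rabs l.
Proof.
  intros hgam H hg. assert (G2 : 0 < gam ^ 2) by (apply pow2_gt_0; auto).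
  assert (Hb : w - wC <> 0) by (intro Z; rewrite Z in H; lra).
  unfold amp_inf. replace (w - wX - gam ^ 2 / (w - wC)) with (g * l ^ 2) by (rewrite H; field; auto).
  rewrite Rabs_mult, sqrt_mult by apply Rabs_pos.
  rewrite (Rabs_pos_eq (l ^ 2)) by apply pow2_ge_0. rewrite <- (pow2_abs l).
  rewrite sqrt_pow2 by apply Rabs_pos. field.
  apply Rgt_not_eq. apply sqrt_lt_R0. apply Rabs_pos_lt. auto.
Qed.

Lemma amp_jump_eq wX g w m : g <> 0 -> g * m ^ 2 = w - wX -> amp_jump wX g w = Rabs m.
Proof.
  intros hg H. unfold amp_jump. replace ((w - wX) / g) with (m ^ 2) by (rewrite <- H; field; auto).
  rewrite (Rabs_pos_eq (m ^ 2)) by apply pow2_ge_0. rewrite <- (pow2_abs m).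
  apply sqrt_pow2. apply Rabs_pos.
Qed.

Lemma is_lim_Rabs (f : R -> R) (x : Rbar) (l : R) :
  is_lim f x l -> is_lim (fun y => Rabs (f y)) x (Rabs l).
Proof. intros H. apply is_lim_continuous_comp; auto. apply continuous_Rabs. Qed.

Lemma bounded_of_limits (f : R -> R) (lp lm : R) :
  (forall x, continuous f x) -> is_lim f p_infty lp -> is_lim f m_infty lm -> bounded_fun f.
Proof.
  intros Hc Hp Hm.
  destruct (proj1 (is_lim_p_infty_R _ _) Hp 1 ltac:(lra)) as [A HA].
  destruct (proj1 (is_lim_m_infty_R _ _) Hm 1 ltac:(lra)) as [B HB].
  set (N := Rabs A + Rabs B + 1).
  pose proof (Rle_abs A). pose proof (Rle_abs (- B)). rewrite Rabs_Ropp in *.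
  pose proof (Rabs_pos A). pose proof (Rabs_pos B).
  destruct (continuity_ab_maj (fun x => Rabs (f x)) (- N) N) as [x0 [Hx0 _]]; [unfold N; lra| |].
  { intros c _. apply continuous_continuity_pt. apply (continuous_comp f Rabs); auto. apply continuous_Rabs. }
  exists (Rabs (f x0) + Rabs lp + Rabs lm + 1). intros x.
  pose proof (Rabs_pos (f x0)). pose proof (Rabs_pos lp). pose proof (Rabs_pos lm).
  destruct (Rlt_dec x (- N)) as [L|L]; [|destruct (Rlt_dec N x) as [L'|L']].
  - specialize (HB x ltac:(unfold N in *; lra)). pose proof (Rabs_triang_inv (f x) lm). lra.
  - specialize (HA x ltac:(unfold N in *; lra)). pose proof (Rabs_triang_inv (f x) lp). lra.
  - specialize (Hx0 x ltac:(lra)). lra.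
Qed.

Lemma is_lim_shift_p (f : R -> R) (c l : R) : is_lim f p_infty l -> is_lim (shift f c) p_infty l.
Proof.
  rewrite !is_lim_p_infty_R. intros H e He. destruct (H e He) as [M HM]. exists (M - c).
  intros x Hx. apply HM. lra.
Qed.

Lemma is_lim_shift_m (f : R -> R) (c l : R) : is_lim f m_infty l -> is_lim (shift f c) m_infty l.
Proof.
  rewrite !is_lim_m_infty_R. intros H e He. destruct (H e He) as [M HM]. exists (M - c).
  intros x Hx. apply HM. lra.
Qed.

Lemma is_lim_shift_0 (f : R -> R) (c l : R) : is_lim f c l <-> is_lim (shift f c) 0 l.
Proof.
  rewrite !is_lim_R. split; intros H e He; destruct (H e He) as [d [Hd H']]; exists d; split; auto.
  - intros x Hx Hxd. apply H'; [lra|]. replace (x + c - c) with (x - 0) by ring. auto.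
  - intros x Hx Hxd. specialize (H' (x - c)). unfold shift in H'.
    replace (x - c + c) with x in H' by ring. apply H'; [lra|]. rewrite Rminus_0_r. auto.
Qed.

Lemma has_far_field_shift (f : R -> R) (c : R) : has_far_field f -> has_far_field (shift f c).
Proof.
  intros [[lp Hp] [lm Hm]]. split; [exists lp; apply is_lim_shift_p|exists lm; apply is_lim_shift_m]; auto.
Qed.

Lemma continuous_shift (f : R -> R) (c x : R) : continuous f (x + c) -> continuous (shift f c) x.
Proof.
  intros H. apply (continuous_comp (fun y => y + c) f); auto.
  apply continuous_Rplus; [apply continuous_id|apply continuous_const].
Qed.

Lemma is_derive_shift (f : R -> R) (c x l : R) : is_derive f (x + c) l -> is_derive (shift f c) x l.
Proof.
  intros H. evar_last.
  - apply (is_derive_comp f (fun y => y + c) x l 1); auto. auto_derive; auto.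
  - apply (scal_one (V := R_NormedModule) l).
Qed.

Lemma bounded_fun_shift (f : R -> R) (c : R) : bounded_fun f -> bounded_fun (shift f c).
Proof. intros [M H]. exists M. intros x. apply H. Qed.

Lemma local_extremum_derive_0 (f : R -> R) (x l : R) :
  is_derive f x l -> local_extremum f x -> l = 0.
Proof.
  intros Hd [H|H]; apply locally_R in H; destruct H as [e [He H]].
  - apply (derive_0_at_max f x l e); auto.
  - assert (- l = 0); [|lra]. apply (derive_0_at_max (fun y => - f y) x (- l) e); auto.
    + apply (is_derive_opp (V := R_NormedModule)). auto.
    + intros y Hy. specialize (H y Hy). lra.
Qed.

Lemma local_extremum_of_sign (f : R -> R) (c x0 : R) :
  c <> 0 -> (forall x, 0 <= c * (f x0 - f x)) -> local_extremum f x0.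
Proof.
  intros Hc H. destruct (Rlt_dec 0 c).
  - left. apply filter_forall. intros y. specialize (H y). nra.
  - right. apply filter_forall. intros y. specialize (H y). nra.
Qed.

Lemma envelope_constant a g gam (u v : R -> R) :
  gam <> 0 -> (forall x, gam * v x = (a - g * u x ^ 2) * u x) -> is_constant u -> is_constant v.
Proof.
  intros hgam Al [c Hc]. exists (/ gam * ((a - g * c ^ 2) * c)). intros x.
  rewrite <- (Hc x), <- Al. field. auto.
Qed.

Lemma envelope_bounded a g gam (u v : R -> R) :
  gam <> 0 -> (forall x, gam * v x = (a - g * u x ^ 2) * u x) -> bounded_fun u -> bounded_fun v.
Proof.
  intros hgam Al [M HM]. exists (/ Rabs gam * ((Rabs a + Rabs g * M ^ 2) * M)). intros x.
  assert (Hg : 0 < Rabs gam) by (apply Rabs_pos_lt; auto).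
  apply Rmult_le_reg_l with (Rabs gam); auto.
  replace (Rabs gam * (/ Rabs gam * ((Rabs a + Rabs g * M ^ 2) * M))) with ((Rabs a + Rabs g * M ^ 2) * M) by (field; lra).
  rewrite <- Rabs_mult, Al, Rabs_mult. specialize (HM x). pose proof (Rabs_pos (u x)).
  assert (u x ^ 2 <= M ^ 2) by (rewrite <- (pow2_abs (u x)); nra).
  pose proof (pow2_ge_0 (u x)). pose proof (Rabs_pos a). pose proof (Rabs_pos g).
  apply Rmult_le_compat; auto; try apply Rabs_pos.
  eapply Rle_trans; [apply Rabs_triang|]. rewrite Rabs_Ropp, Rabs_mult, (Rabs_pos_eq (u x ^ 2)) by auto.
  nra.
Qed.

Lemma envelope_reflect a g gam eps (u v : R -> R) x y :
  gam <> 0 -> (forall x, gam * v x = (a - g * u x ^ 2) * u x) -> eps = 1 \/ eps = - 1 ->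
  u x = eps * u y -> v x = eps * v y.
Proof.
  intros hgam Al He E. apply (Rmult_eq_reg_l gam); auto.
  replace (gam * (eps * v y)) with (eps * (gam * v y)) by ring. rewrite !Al, E.
  destruct He; subst; ring.
Qed.

Lemma band_low wX wC w : w - wX < 0 -> w - wC < 0 -> w < Rmin wC wX.
Proof. intros. apply Rmin_glb_lt; lra. Qed.

Lemma band_high wX wC w : 0 < w - wX -> 0 < w - wC -> Rmax wC wX < w.
Proof. intros. apply Rmax_lub_lt; lra. Qed.

Lemma band_low_inv wX wC w : w < Rmin wC wX -> w - wX < 0 /\ w - wC < 0.
Proof. intros H. pose proof (Rmin_l wC wX). pose proof (Rmin_r wC wX). lra. Qed.

Lemma band_high_inv wX wC w : Rmax wC wX < w -> 0 < w - wX /\ 0 < w - wC.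
Proof. intros H. pose proof (Rmax_l wC wX). pose proof (Rmax_r wC wX). lra. Qed.

(** The extremum of phi_X passes to phi_C because [a (a - 3 g u ^ 2) > 0] makes the cubic monotone
    on the range of phi_X; for the same reason phi_C has no other critical point. *)
Theorem classical_bright_soliton wX wC gam g w phiX phiC (lm : R) (hgam : gam <> 0) (hg : g <> 0) :
  classical_solution wX wC gam g w phiX phiC ->
  is_lim phiX p_infty 0 -> is_lim phiX m_infty lm -> ~ is_constant phiX ->
  g < 0 /\ (band21 wX wC gam w \/ band22 wX wC gam w) /\
  exists x0, bright_soliton wX wC gam g w (shift phiX x0) (shift phiC x0).
Proof.
  intros Hcl Hp Hm Hnc. assert (P := profile_of_classical _ _ _ _ _ _ _ Hcl).
  set (a := w - wX) in *. set (b := w - wC) in *.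
  set (u1 := Derive phiX) in *. set (v1 := Derive phiC) in *.
  destruct (smooth_profile_bright _ _ _ _ _ _ _ _ _ lm hgam hg P Hp Hm Hnc)
    as [Hg [Hband [_ [x0 [U0 [_ [Hmax [Hev [Huni HD]]]]]]]]].
  destruct (profile_nil _ _ _ _ _ _ _ _ _ P) as [Du _].
  assert (Al := pr_alg P).
  split; [auto|]. split.
  { destruct Hband as [[A [B C]]|[A [B C]]].
    - left. split; [apply band_low; auto|auto].
    - right. split; [apply band_high; auto|]. split; auto. apply Rmult_lt_0_compat; auto. }
  assert (Bu : bounded_fun phiX).
  { exists (Rabs (phiX x0)). intros x. apply Rsqr_le_abs_0. unfold Rsqr. specialize (Hmax x). lra. }
  exists x0. split; [|split; [|split; [|split; [|split; [|split]]]]].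
  - intros x. apply classical_at_shift. apply Hcl.
  - intros x. unfold shift. replace (- x + x0) with (x0 - x) by ring.
    replace (x + x0) with (x0 + x) by ring. auto.
  - intros x. unfold shift. rewrite <- (Rmult_1_l (phiC (x + x0))).
    apply (envelope_reflect a g gam 1 phiX phiC); auto. rewrite Rmult_1_l.
    replace (- x + x0) with (x0 - x) by ring. replace (x + x0) with (x0 + x) by ring. auto.
  - apply bounded_fun_shift. auto.
  - apply bounded_fun_shift. apply (envelope_bounded a g gam phiX); auto.
  - exists 0. split.
    + apply (local_extremum_of_sign _ (phiX x0)); auto. intros x. unfold shift.
      rewrite Rplus_0_l. specialize (Hmax (x + x0)). nra.
    + intros x Hx. assert (Z : u1 (x + x0) = 0).
      { apply (local_extremum_derive_0 (shift phiX x0) x); auto. apply is_derive_shift. apply Du. }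
      apply Huni in Z. lra.
  - exists 0. split.
    + assert (Ha : a <> 0).
      { intro Z. specialize (HD x0). rewrite Z in HD. lra. }
      apply (local_extremum_of_sign _ (a * gam * phiX x0)).
      { repeat apply Rmult_integral_contrapositive_currified; auto. }
      intros x. unfold shift. rewrite Rplus_0_l. set (y := x + x0).
      replace (a * gam * phiX x0 * (phiC x0 - phiC y)) with
        (a * phiX x0 * (gam * phiC x0 - gam * phiC y)) by ring.
      rewrite !Al. set (p := phiX x0) in *. set (q := phiX y) in *.
      replace (a * p * ((a - g * p ^ 2) * p - (a - g * q ^ 2) * q)) with
        ((p * (p - q)) * (a * (a - g * (p ^ 2 + p * q + q ^ 2)))) by ring.
      assert (A2 : 0 < a ^ 2) by (apply pow2_gt_0; auto).
      assert (T1 : q ^ 2 <= p ^ 2) by apply Hmax.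
      assert (T2 : 0 <= p ^ 2 + p * q + q ^ 2 <= 3 * p ^ 2) by (clear - T1; split; nra).
      assert (T3 : 0 < a * (a - 3 * g * p ^ 2)) by apply HD.
      apply Rmult_le_pos; [clear - T1; nra|].
      (* The second factor is affine in t and positive at t = 0 and at t = 3 p ^ 2. *)
      set (t := p ^ 2 + p * q + q ^ 2) in *. clearbody t. clear - A2 T2 T3.
      destruct (Rle_dec 0 (a * g)); nra.
    + intros x Hx. assert (Z : v1 (x + x0) = 0).
      { apply (local_extremum_derive_0 (shift phiC x0) x); auto. apply is_derive_shift.
        apply (pr_v P). }
      pose proof (profile_v1_eq _ _ _ _ _ _ _ _ _ _ P (x + x0) (fun z => z)) as W.
      rewrite Z, Rmult_0_r in W. symmetry in W. apply Rmult_integral in W.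
      destruct W as [W|W].
      * specialize (HD (x + x0)). rewrite W in HD. lra.
      * apply Huni in W. lra.
Qed.

Theorem classical_dark_soliton wX wC gam g w phiX phiC (l lm : R) (hgam : gam <> 0) (hg : g <> 0) :
  classical_solution wX wC gam g w phiX phiC ->
  is_lim phiX p_infty l -> l <> 0 -> is_lim phiX m_infty lm -> ~ is_constant phiX ->
  0 < g /\ (band11 wX wC gam w \/ band12 wX wC gam w) /\
  amp_inf wX wC gam g w = Rabs l /\
  exists x0, dark_soliton wX wC gam g w (shift phiX x0) (shift phiC x0).
Proof.
  intros Hcl Hp Hl Hm Hnc. assert (P := profile_of_classical _ _ _ _ _ _ _ Hcl).
  set (a := w - wX) in *. set (b := w - wC) in *.
  set (u1 := Derive phiX) in *. set (v1 := Derive phiC) in *.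
  destruct (smooth_profile_dark _ _ _ _ _ _ _ _ _ l lm hgam hg P Hp Hl Hm Hnc)
    as [Hg [Hband [_ [Heq [U1 [HD [x0 Hodd]]]]]]].
  destruct (profile_nil _ _ _ _ _ _ _ _ _ P) as [Du [Du1 _]].
  assert (Al := pr_alg P).
  split; [auto|]. split; [|split].
  - destruct Hband as [[A [B C]]|[A [B C]]].
    + left. split; [apply band_low; auto|split; auto]. fold a b. nra.
    + right. split; [apply band_high; auto|auto].
  - apply amp_inf_eq; auto.
  - exists x0.
    assert (Bu : bounded_fun phiX).
    { apply (bounded_of_limits phiX l lm); auto. intros x. eapply is_derive_continuous. apply Du. }
    split; [|split; [|split; [|split; [|split; [|split]]]]].
    + intros x. apply classical_at_shift. apply Hcl.
    + intros x. unfold shift. replace (- x + x0) with (x0 + - x) by ring. rewrite Hodd.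
      f_equal. f_equal. ring.
    + intros x. unfold shift. replace (- phiC (x + x0)) with (-1 * phiC (x + x0)) by ring.
      apply (envelope_reflect a g gam (-1) phiX phiC); auto.
      replace (- x + x0) with (x0 + - x) by ring. rewrite Hodd.
      replace (x0 - - x) with (x + x0) by ring. ring.
    + apply (strictly_monotone_of_derive _ (shift u1 x0)).
      * intros x. apply is_derive_shift. apply Du.
      * intros x. apply continuous_shift. eapply is_derive_continuous. apply Du1.
      * intros x. apply U1.
    + apply (strictly_monotone_of_derive _ (shift v1 x0)).
      * intros x. apply is_derive_shift. apply (pr_v P).
      * intros x. apply continuous_shift. apply (pr_v1_cont P).
      * intros x Z. unfold shift in Z.
        pose proof (profile_v1_eq _ _ _ _ _ _ _ _ _ _ P (x + x0) (fun z => z)) as W.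
        rewrite Z, Rmult_0_r in W. symmetry in W. apply Rmult_integral in W.
        destruct W as [W|W].
        -- specialize (HD (x + x0)). rewrite W in HD. lra.
        -- apply (U1 _ W).
    + apply bounded_fun_shift. auto.
    + apply bounded_fun_shift. apply (envelope_bounded a g gam phiX); auto.
Qed.

Lemma classical_far_field_soliton wX wC gam g w phiX phiC (hgam : gam <> 0) :
  classical_solution wX wC gam g w phiX phiC -> has_far_field phiX -> ~ is_constant phiX ->
  exists x0, soliton wX wC gam g w (shift phiX x0) (shift phiC x0).
Proof.
  intros Hcl [[lp Hp] [lm Hm]] Hnc.
  destruct (Req_dec g 0) as [->|hg].
  { exfalso. apply Hnc. assert (P := profile_of_classical _ _ _ _ _ _ _ Hcl).
    apply (profile_linear_constant _ _ _ _ _ _ _ _ _ lp lm hgam P Hp Hm). }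
  destruct (Req_dec lp 0) as [->|Hl].
  - destruct (classical_bright_soliton _ _ _ _ _ _ _ lm hgam hg Hcl Hp Hm Hnc) as [A [B [x0 C]]].
    exists x0. right. left. auto.
  - destruct (classical_dark_soliton _ _ _ _ _ _ _ lp lm hgam hg Hcl Hp Hl Hm Hnc) as [A [B [_ [x0 C]]]].
    exists x0. left. auto.
Qed.

Theorem jump_soliton wX wC gam g w phiX phiC D (hgam : gam <> 0) :
  D <> nil -> solution_off D wX wC gam g w phiX phiC ->
  (forall d : R, In d D -> discontinuity phiX d /\ ex_finite_lim (fun x => Rabs (phiX x)) d) ->
  has_far_field phiX -> has_far_field phiC ->
  exists x0, soliton wX wC gam g w (shift phiX x0) (shift phiC x0).
Proof.
  intros HDn Hsol HD HfX HfC.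
  assert (P := profile_of_stationary _ _ _ _ _ _ _ _ hgam Hsol HD).
  destruct Hsol as [Hcl [vc Hweak]].
  set (a := w - wX) in *. set (b := w - wC) in *. set (u := normalized D phiX) in *.
  destruct HfX as [[lp Hp] [lm Hm]].
  assert (Hup : is_lim u p_infty lp).
  { destruct (list_upper_bound D) as [X HX]. apply is_lim_p_infty_ext with phiX X; auto.
    intros x Hx. symmetry. apply normalized_off. auto. }
  assert (Hum : is_lim u m_infty lm).
  { destruct (list_upper_bound (map Ropp D)) as [X HX]. apply is_lim_opp_arg.
    apply is_lim_p_infty_ext with (fun x => phiX (- x)) X; [|apply is_lim_opp_arg; auto].
    intros x Hx. symmetry. apply normalized_off. rewrite <- in_map_opp. auto. }
  assert (hg : g <> 0).
  { intro Z. subst g. apply HDn. apply (profile_linear_constant _ _ _ _ _ _ _ _ _ lp lm hgam P Hup Hum). }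
  assert (Al := pr_alg P).
  (* The part of the conclusion shared by zero and nonzero far fields: it needs only a single jump
     and the odd symmetry about it. *)
  assert (Common : forall x0, In x0 D -> (forall d, In d D -> d = x0) ->
    (forall y, y <> 0 -> u (x0 + y) = - u (x0 - y)) ->
    discontinuous_soliton wX wC gam g w (shift phiX x0) (shift phiC x0) /\
    is_lim (fun x => Rabs (shift phiX x0 x)) 0 (amp_jump wX g w) /\
    (forall x, x <> 0 -> shift phiX x0 x = u (x + x0)) /\ phiC x0 = 0).
  { intros x0 Hx0 Hu Hodd. destruct (HD x0 Hx0) as [Hdis [m Hmm]].
    assert (HnD : forall x, x <> x0 -> ~ In x D) by (intros x Hx Hin; apply Hx; auto).
    assert (Off : forall x, x <> x0 -> u x = phiX x) by (intros x Hx; apply normalized_off; auto).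
    assert (uc : forall x, x <> x0 -> continuous phiX x).
    { intros x Hx. eapply is_derive_continuous. apply (C2_at_derive phiX x). apply Hcl. auto. }
    destruct (jump_structure a g gam phiX phiC x0 1 m hgam) as [Hmp [Hgm [Hv0 [s [Hs [LR [LL _]]]]]]]; auto; [lra| |].
    { intros x Hx _. apply (classical_at_equations _ _ _ _ _ _ _ _ (Hcl x (HnD x Hx))). }
    split; [|split; [|split; [|auto]]].
    - split; [split; [|split]|split; [|split; [|split; [|split; [|split; [|split]]]]]].
      + intros x Hx. apply classical_at_shift. apply Hcl. apply HnD. intro Z. apply Hx. left. lra.
      + intros x. apply continuous_shift. auto.
      + apply (polariton_weak_of_C1 wX wC gam g w (shift phiX x0) (shift phiC x0)
          (shift (Derive phiC) x0) (s * m) (- s * m)).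
        * intros x Hx. unfold shift. fold a. rewrite <- Off by lra. apply Al.
        * intros x. apply is_derive_shift. apply (pr_v P).
        * intros x. apply continuous_shift. apply (pr_v1_cont P).
        * intros x Hx. apply is_derive_shift. unfold shift. fold b. rewrite <- Off by lra.
          apply (pr_v1 P). apply HnD. lra.
        * intros x Hx. apply continuous_shift. apply uc. lra.
        * rewrite at_right_R in *. intros e He. destruct (LR e He) as [d [Hd H]]. exists d. split; auto.
          intros x Hx. apply H. lra.
        * rewrite at_left_R in *. intros e He. destruct (LL e He) as [d [Hd H]]. exists d. split; auto.
          intros x Hx. apply H. lra.
      + intros x Hx. unfold shift. rewrite <- !Off by lra.
        replace (- x + x0) with (x0 + - x) by ring. rewrite Hodd by lra. f_equal. f_equal. ring.
      + intros x. unfold shift. destruct (Req_dec x 0) as [->|Hx].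
        { replace (- 0 + x0) with x0 by ring. rewrite Rplus_0_l, Hv0. ring. }
        replace (- phiC (x + x0)) with (-1 * phiC (x + x0)) by ring.
        apply (envelope_reflect a g gam (-1) u phiC); auto.
        replace (- x + x0) with (x0 + - x) by ring. rewrite Hodd by lra.
        replace (x0 - - x) with (x + x0) by ring. ring.
      + apply bounded_fun_shift.
        destruct (bounded_of_limits (fun x => u x ^ 2) (lp ^ 2) (lm ^ 2)) as [M HM].
        { apply (profile_sq_continuous _ _ _ _ _ _ _ _ _ _ P). }
        { apply is_lim_sq. auto. } { apply is_lim_sq. auto. }
        (* Boundedness comes from the continuous function u ^ 2 through |u| <= u ^ 2 + 1; the last
           summand covers the arbitrary value at the jump. *)
        exists (M + 1 + Rabs (phiX x0)). intros x. pose proof (Rabs_pos (phiX x0)).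
        assert (0 <= M) by (eapply Rle_trans; [apply Rabs_pos|apply (HM 0)]).
        destruct (Req_dec x x0) as [->|Hx]; [lra|]. specialize (HM x).
        rewrite (Rabs_pos_eq (u x ^ 2)) in HM by apply pow2_ge_0. rewrite Off in HM by auto.
        rewrite <- pow2_abs in HM. pose proof (Rabs_pos (phiX x)). nra.
      + apply bounded_fun_shift. destruct HfC as [[cp Hcp] [cm Hcm]]. apply (bounded_of_limits phiC cp cm); auto.
      + apply has_far_field_shift. split; [exists lp|exists lm]; auto.
      + apply has_far_field_shift. auto.
      + intros [l Hl]. apply Hdis. exists l. apply is_lim_shift_0. auto.
    - rewrite (amp_jump_eq wX g w m hg Hgm), Rabs_pos_eq by lra.
      apply (is_lim_shift_0 (fun x => Rabs (phiX x)) x0 m). auto.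
    - intros x Hx. unfold shift. symmetry. apply Off. lra. }
  destruct (Req_dec lp 0) as [Z|Hl].
  - subst lp. destruct (profile_jump_zero_far_field _ _ _ _ _ _ _ _ _ _ lm hgam hg P HDn Hup Hum)
      as [Lm [Ng [Na [Nb [Hab [x0 [Hx0 [Hu Hodd]]]]]]]]. subst lm.
    destruct (Common x0 Hx0 Hu Hodd) as [C1 [C2 [C3 C4]]].
    exists x0. right. right. split; auto. right. right.
    split; [auto|split; [apply band_low; auto|split; [auto|split; [split|]]]].
    + apply is_lim_shift_p. auto.
    + apply is_lim_shift_m. auto.
    + destruct HfC as [[cp Hcp] [cm Hcm]].
      assert (Lv : forall t, 0 = t -> / gam * ((a - g * t ^ 2) * t) = 0) by (intros t <-; ring).
      assert (V0 : forall x, / gam * ((a - g * u x ^ 2) * u x) = phiC x).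
      { intros x. rewrite <- Al. field. auto. }
      assert (K : forall (x : Rbar), is_lim u x 0 -> is_lim phiC x 0).
      { intros x H. apply (is_lim_ext (fun y => / gam * ((a - g * u y ^ 2) * u y))); auto.
        replace (Finite 0) with (Finite (/ gam * ((a - g * 0 ^ 2) * 0))) by (f_equal; ring).
        apply (is_lim_continuous_comp (fun z => / gam * ((a - g * z ^ 2) * z))); auto.
        apply (ex_derive_continuous (V := R_NormedModule)). auto_derive. auto. }
      split; [apply is_lim_shift_p|apply is_lim_shift_m]; auto.
  - destruct (profile_jump_nonzero_far_field _ _ _ _ _ _ _ _ _ _ lp lm hgam hg P HDn Hup Hl Hum)
      as [x0 [Hx0 [Hu [Hodd [Heq [Unz [Hna Hcase]]]]]]].
    destruct (Common x0 Hx0 Hu Hodd) as [C1 [C2 [C3 C4]]].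
    assert (Linf : is_lim (fun x => Rabs (shift phiX x0 x)) p_infty (amp_inf wX wC gam g w)).
    { rewrite (amp_inf_eq wX wC gam g w lp); auto. apply (is_lim_Rabs (shift phiX x0)). apply is_lim_shift_p. auto. }
    exists x0. right. right. split; auto.
    destruct Hcase as [[Ng [Na [Nb [Hab Hdec]]]]|[Pg [Pa [Nb Hinc]]]].
    + left. split; [auto|split; [split; [apply band_low; auto|auto]|]].
      split; [auto|split; [|split; [auto|]]].
      * intros x y Hx Hxy. rewrite !C3 by lra. apply Rsqr_lt_abs_0. unfold Rsqr.
        specialize (Hdec (x + x0) (y + x0) ltac:(lra) ltac:(lra)). lra.
      (* By the cubic phi_C vanishes only where u = 0 or g u ^ 2 = a, and to the right of the jump
         neither occurs. *)
      * assert (Vnz : forall x, x0 < x -> phiC x <> 0).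
        { intros x Hx Z. specialize (Al x). rewrite Z, Rmult_0_r in Al. symmetry in Al.
          apply Rmult_integral in Al. destruct Al as [Al|Al]; [|apply (Unz x Al)].
          apply (Hna x Hx). lra. }
        assert (Vodd : odd_fun (shift phiC x0)) by apply C1.
        intros x Hx. unfold shift at 1. rewrite Rplus_0_l, C4, Rabs_R0. apply Rabs_pos_lt.
        destruct (Rlt_dec 0 x) as [L|L]; [apply Vnz; lra|].
        specialize (Vodd x). intro Z. rewrite Z in Vodd. apply (Vnz (- x + x0)); [lra|].
        unfold shift in Vodd. rewrite Vodd. ring.
    + right. left. split; [auto|split; [unfold band32, a, b in *; lra|]].
      split; [auto|split; [|auto]].
      intros x y Hx Hxy. rewrite !C3 by lra. apply Rsqr_lt_abs_0. unfold Rsqr.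
      specialize (Hinc (x + x0) (y + x0) ltac:(lra) ltac:(lra)). lra.
Qed.

Theorem stationary_soliton wX wC gam g w phiX phiC (hgam : gam <> 0) :
  stationary_solution wX wC gam g w phiX phiC -> has_far_field phiX -> has_far_field phiC ->
  ~ (is_constant phiX /\ is_constant phiC) ->
  exists x0 : R, soliton wX wC gam g w (shift phiX x0) (shift phiC x0).
Proof.
  intros [D [Hsol HD]] HX HC Hnc. destruct D as [|d D].
  - destruct Hsol as [Hcl _].
    assert (Hcl' : classical_solution wX wC gam g w phiX phiC) by (intros x; apply Hcl; auto).
    apply classical_far_field_soliton; auto. intro K. apply Hnc. split; auto.
    apply (envelope_constant (w - wX) g gam phiX); auto.
    apply (pr_alg (profile_of_classical _ _ _ _ _ _ _ Hcl')).
  - apply (jump_soliton wX wC gam g w phiX phiC (d :: D)); auto. discriminate.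
Qed.

(** * Far fields of dark and bright solitons *)

Lemma bounded_increasing_limit (f : R -> R) (X : R) :
  (forall x y, X < x -> x < y -> f x <= f y) -> bounded_fun f ->
  exists l : R, is_lim f p_infty l /\ forall x, X < x -> f x <= l.
Proof.
  intros Hmono [M HM].
  destruct (completeness (fun y => exists x, X < x /\ y = f x)) as [l [Hub Hlub]].
  - exists M. intros y [x [_ ->]]. eapply Rle_trans; [apply Rle_abs|auto].
  - exists (f (X + 1)), (X + 1). split; [lra|auto].
  - assert (Hle : forall x, X < x -> f x <= l) by (intros x Hx; apply Hub; exists x; auto).
    exists l. split; auto. apply is_lim_p_infty_R. intros e He.
    assert (exists x1, X < x1 /\ l - e < f x1) as [x1 [Hx1 H1]].
    { apply NNPP. intro C. assert (l <= l - e); [|lra]. apply Hlub. intros y [x [Hx ->]].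
      apply Rnot_lt_le. intro K. apply C. exists x. auto. }
    exists x1. intros x Hx. specialize (Hmono x1 x Hx1 Hx). specialize (Hle x ltac:(lra)).
    apply Rabs_def1; lra.
Qed.

Lemma bounded_fun_opp (f : R -> R) : bounded_fun f -> bounded_fun (fun x => - f x).
Proof. intros [M H]. exists M. intros x. rewrite Rabs_Ropp. auto. Qed.

Lemma odd_monotone_far_field (f : R -> R) :
  odd_fun f -> strictly_monotone f -> bounded_fun f ->
  exists l : R, l <> 0 /\ is_lim f p_infty l /\ is_lim f m_infty (- l) /\
    forall x, Rabs (f x) <= Rabs l.
Proof.
  intros Hodd Hs Hb.
  assert (f0 : f 0 = 0) by (specialize (Hodd 0); rewrite Ropp_0 in Hodd; lra).
  assert (Main : forall h : R -> R, odd_fun h -> (forall x y, x < y -> h x < h y) -> bounded_fun h -> h 0 = 0 ->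
    exists l, 0 < l /\ is_lim h p_infty (Finite l) /\ forall x, Rabs (h x) <= l).
  { intros h Ho Hm HB h0.
    assert (K : forall X, exists l : R, is_lim h p_infty l /\ forall x, X < x -> h x <= l).
    { intros X. apply bounded_increasing_limit; auto. intros x y _ L. left. auto. }
    destruct (K 0) as [l [Hl Hle]]. exists l. split; [|split; auto].
    - specialize (Hle 1 ltac:(lra)). specialize (Hm 0 1 ltac:(lra)). lra.
    - intros x. assert (Hall : forall x, h x <= l).
      { intros y. pose proof (Rle_abs y).
        apply Rle_trans with (h (Rabs y + 1)); [left; apply Hm; lra|apply Hle; pose proof (Rabs_pos y); lra]. }
      pose proof (Hall x). pose proof (Hall (- x)). rewrite Ho in H0. apply Rabs_le. lra. }
  assert (Lm : forall l : R, is_lim f p_infty l -> is_lim f m_infty (- l)).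
  { intros l Hl. apply is_lim_opp_arg. apply (is_lim_ext (fun x => - f x)).
    - intros x. symmetry. apply Hodd.
    - apply (is_lim_opp f p_infty l Hl). }
  destruct Hs as [Hi|Hd].
  - destruct (Main f Hodd Hi Hb f0) as [l [H1 [H2 H3]]]. exists l. rewrite (Rabs_pos_eq l) by lra.
    split; [lra|auto].
  - destruct (Main (fun x => - f x)) as [l [H1 [H2 H3]]].
    { intros x. rewrite Hodd. auto. }
    { intros x y L. specialize (Hd x y L). lra. }
    { apply bounded_fun_opp. auto. }
    { rewrite f0. ring. }
    assert (Hl : is_lim f p_infty (- l)).
    { apply (is_lim_ext (fun x => - - f x)); [intros; ring|]. apply (is_lim_opp (fun x => - f x) p_infty l H2). }
    exists (- l). rewrite Rabs_Ropp, (Rabs_pos_eq l) by lra. split; [lra|]. split; [auto|]. split; [auto|].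
    intros x. rewrite <- Rabs_Ropp. auto.
Qed.

(** Far fields are not part of the definition of a dark soliton; they exist by monotonicity and
    boundedness, and this makes the classification applicable. *)
Theorem dark_soliton_band_and_amplitude wX wC gam g w phiX phiC (hgam : gam <> 0) (hg : 0 < g) :
  dark_soliton wX wC gam g w phiX phiC ->
  (band11 wX wC gam w \/ band12 wX wC gam w) /\
  far_field (fun x => Rabs (phiX x)) (amp_inf wX wC gam g w) /\
  is_lub (fun y => exists x : R, y = Rabs (phiX x)) (amp_inf wX wC gam g w).
Proof.
  intros [Hcl [Ho [_ [Hs [_ [Hb _]]]]]].
  destruct (odd_monotone_far_field phiX Ho Hs Hb) as [l [Hl [Hp [Hm Hle]]]].
  assert (Hnc : ~ is_constant phiX).
  { intros [c Hc]. destruct Hs as [Hs|Hs]; specialize (Hs 0 1 ltac:(lra)); rewrite !Hc in Hs; lra. }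
  assert (Hg0 : g <> 0) by lra.
  destruct (classical_dark_soliton _ _ _ _ _ _ _ l (- l) hgam Hg0 Hcl Hp Hl Hm Hnc) as [_ [B [A _]]].
  rewrite A. split; [auto|split; [split|split]].
  - apply is_lim_Rabs in Hp. auto.
  - apply is_lim_Rabs in Hm. rewrite Rabs_Ropp in Hm. auto.
  - intros y [x ->]. auto.
  - intros M HM. apply is_lim_Rabs in Hp. apply Rnot_lt_le. intro C.
    destruct (proj1 (is_lim_p_infty_R _ _) Hp (Rabs l - M) ltac:(lra)) as [N HN].
    specialize (HN (N + 1) ltac:(lra)). apply Rabs_def2 in HN.
    specialize (HM (Rabs (phiX (N + 1))) (ex_intro _ _ eq_refl)). lra.
Qed.

(** Rolle's theorem without derivatives. *)
Lemma interior_extremum (f : R -> R) (x y : R) :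
  x < y -> (forall z, x <= z <= y -> continuous f z) -> f x = f y ->
  exists z, x < z < y /\ local_extremum f z.
Proof.
  intros Hxy Hc E.
  destruct (continuity_ab_maj f x y) as [p [Hp1 Hp2]]; [lra|intros; apply continuous_continuity_pt; auto|].
  destruct (continuity_ab_min f x y) as [q [Hq1 Hq2]]; [lra|intros; apply continuous_continuity_pt; auto|].
  assert (Int : forall z, x < z < y -> ((forall c, x <= c <= y -> f c <= f z) \/ (forall c, x <= c <= y -> f z <= f c)) ->
    exists z, x < z < y /\ local_extremum f z).
  { intros z Hz H. exists z. split; auto.
    assert (Hr : 0 < Rmin (z - x) (y - z)) by (apply Rmin_glb_lt; lra).
    pose proof (Rmin_l (z - x) (y - z)). pose proof (Rmin_r (z - x) (y - z)).
    destruct H as [H|H]; [left|right]; apply locally_R; exists (Rmin (z - x) (y - z)); split; auto;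
      intros c Hcz; apply Rabs_def2 in Hcz; apply H; lra. }
  destruct (Req_dec (f p) (f x)) as [Ep|Ep].
  - destruct (Req_dec (f q) (f x)) as [Eq|Eq].
    + apply (Int ((x + y) / 2)); [lra|]. left. intros c Hcc. specialize (Hp1 c Hcc).
      specialize (Hq1 ((x + y) / 2) ltac:(lra)). lra.
    + apply (Int q); auto. assert (q <> x) by (intro; subst; auto). assert (q <> y) by (intro; subst; lra). lra.
  - apply (Int p); auto. assert (p <> x) by (intro; subst; auto). assert (p <> y) by (intro; subst; lra). lra.
Qed.

(** By evenness the only extremum is at 0, so by Rolle's argument f is injective on the positive
    axis, hence monotone and convergent there. *)
Lemma even_single_extremum_far_field (f : R -> R) :
  (forall x, continuous f x) -> even_fun f -> bounded_fun f -> (exists! x : R, local_extremum f x) ->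
  exists l : R, is_lim f p_infty l /\ is_lim f m_infty l.
Proof.
  intros Hc He Hb [x0 [Hx0 Hu]].
  assert (Z : x0 = 0).
  { assert (local_extremum f (- x0)); [|apply Hu in H; lra].
    assert (G : forall P : R -> Prop, (forall y, P y -> P (- y)) -> locally x0 P -> locally (- x0) P).
    { intros P HP HL. apply locally_R in HL. destruct HL as [e [Hpe HL]]. apply locally_R. exists e. split; auto.
      intros y Hy. rewrite <- (Ropp_involutive y). apply HP. apply HL. rewrite <- Rabs_Ropp.
      replace (- (- y - x0)) with (y - - x0) by ring. auto. }
    destruct Hx0 as [H|H]; [left|right]; rewrite He; apply (G _) in H; auto; intros y Hy; rewrite He; auto. }
  subst x0.
  assert (Inj : forall x y, 0 < x -> x < y -> f x <> f y).
  { intros x y Hx Hxy E. destruct (interior_extremum f x y Hxy) as [z [Hz Ez]]; auto.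
    apply Hu in Ez. lra. }
  (* Deform the pair (1, 2) into (x, y); the increment never vanishes on the way. *)
  assert (Sgn : forall x y, 0 < x -> x < y -> 0 < (f 2 - f 1) * (f y - f x)).
  { intros x y Hx Hxy.
    set (h := fun t => f ((1 - t) * 2 + t * y) - f ((1 - t) * 1 + t * x)).
    replace (f 2 - f 1) with (h 0) by (unfold h; f_equal; [f_equal; ring|f_equal; f_equal; ring]).
    replace (f y - f x) with (h 1) by (unfold h; f_equal; [f_equal; ring|f_equal; f_equal; ring]).
    apply (same_sign_on h (fun t => 0 <= t <= 1)); try lra.
    - intros p q z Hp Hq Hz. lra.
    - intros z _. unfold h. apply continuous_Rminus.
      + apply (continuous_comp (fun t => (1 - t) * 2 + t * y) f); auto.
        apply (ex_derive_continuous (V := R_NormedModule)). auto_derive. auto.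
      + apply (continuous_comp (fun t => (1 - t) * 1 + t * x) f); auto.
        apply (ex_derive_continuous (V := R_NormedModule)). auto_derive. auto.
    - intros z Hz. unfold h. intro E. apply (Inj ((1 - z) * 1 + z * x) ((1 - z) * 2 + z * y)); [| |lra].
      + destruct (Req_dec z 0) as [->|]; [lra|]. assert (0 < z * x) by (apply Rmult_lt_0_compat; lra). lra.
      + destruct (Req_dec z 1) as [->|]; [lra|]. assert (0 <= z * (y - x)) by (apply Rmult_le_pos; lra). lra. }
  assert (K : exists l : R, is_lim f p_infty l).
  { specialize (Inj 1 2 ltac:(lra) ltac:(lra)).
    destruct (Rlt_dec (f 1) (f 2)) as [L|L].
    - destruct (bounded_increasing_limit f 0) as [l [Hl _]]; auto.
      + intros x y Hx Hxy. specialize (Sgn x y Hx Hxy). nra.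
      + exists l. auto.
    - destruct (bounded_increasing_limit (fun x => - f x) 0) as [l [Hl _]].
      + intros x y Hx Hxy. specialize (Sgn x y Hx Hxy). nra.
      + apply bounded_fun_opp. auto.
      + exists (- l). apply (is_lim_ext (fun x => - - f x)); [intros; ring|].
        apply (is_lim_opp (fun x => - f x) p_infty l Hl). }
  destruct K as [l Hl]. exists l. split; auto. apply is_lim_opp_arg.
  apply (is_lim_ext f); auto.
Qed.

(** With [y = b (a - q0)] the root equation becomes [2 y ^ 2 - 3 gam ^ 2 y + a b gam ^ 2 = 0], and
    the claimed formula is its larger solution. *)
Lemma bright_peak_value a b gam q0 :
  gam <> 0 -> q0 < 0 -> 0 < a * (a - 3 * q0) -> bright_factor a b gam q0 = 0 ->
  ((a < 0 /\ b < 0 /\ gam ^ 2 < a * b < 9 / 8 * gam ^ 2) \/ (0 < a /\ 0 < b /\ a * b < gam ^ 2)) ->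
  - a + gam ^ 2 / b * (3 / 4 + sqrt (9 / 16 - a * b / (2 * gam ^ 2))) = - q0.
Proof.
  intros hgam Hq HD H0 Hband. assert (G2 : 0 < gam ^ 2) by (apply pow2_gt_0; auto).
  assert (Hb : b <> 0) by lra.
  set (y := b * (a - q0)).
  assert (Hy : 2 * y ^ 2 - 3 * gam ^ 2 * y + a * b * gam ^ 2 = 0).
  { unfold y. unfold bright_factor in H0. apply (Rmult_eq_compat_l (- b)) in H0. lra. }
  (* The two solutions are symmetric about 3/4 gam ^ 2, so this inequality selects the sign of the
     square root. *)
  assert (Hy34 : 3 / 4 * gam ^ 2 <= y).
  { destruct Hband as [[A [B C]]|[A [B C]]].
    - assert (K1 : a < 3 * q0) by (clear - HD A; nra).
      assert (K2 : 2 / 3 * (a * b) < y) by (unfold y; clear - K1 B; nra).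
      assert (K3 : 0 < y) by (assert (0 < a * b) by lra; lra).
      clearbody y. apply Rnot_lt_le. intro K.
      assert (K4 : y * (2 * y - 3 / 2 * gam ^ 2) < 0) by (clear - K K3; nra).
      assert (K5 : gam ^ 2 * (a * b - 3 / 2 * y) < 0) by (clear - K2 G2; nra). lra.
    - assert (K1 : a * b < y) by (unfold y; clear - Hq B; nra).
      assert (K2 : 0 < a * b) by (apply Rmult_lt_0_compat; auto).
      clearbody y. apply Rnot_lt_le. intro K.
      assert (K4 : y * (y - gam ^ 2) < 0) by (clear - K K1 K2 G2; nra).
      assert (K5 : gam ^ 2 * (a * b - y) < 0) by (clear - K1 G2; nra). lra. }
  assert (E : sqrt (9 / 16 - a * b / (2 * gam ^ 2)) = y / gam ^ 2 - 3 / 4).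
  { apply sqrt_lem_1.
    - replace (9 / 16 - a * b / (2 * gam ^ 2)) with ((y / gam ^ 2 - 3 / 4) ^ 2); [apply pow2_ge_0|].
      replace (a * b) with ((3 * gam ^ 2 * y - 2 * y ^ 2) / gam ^ 2); [field; lra|].
      apply (Rmult_eq_reg_r (gam ^ 2)); [|lra]. unfold Rdiv. rewrite Rmult_assoc, Rinv_l; lra.
    - apply Rmult_le_reg_r with (gam ^ 2); auto. unfold Rdiv at 1. rewrite Rmult_minus_distr_r, Rmult_assoc, Rinv_l; lra.
    - replace (a * b) with ((3 * gam ^ 2 * y - 2 * y ^ 2) / gam ^ 2); [field; lra|].
      apply (Rmult_eq_reg_r (gam ^ 2)); [|lra]. unfold Rdiv. rewrite Rmult_assoc, Rinv_l; lra. }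
  rewrite E. replace (3 / 4 + (y / gam ^ 2 - 3 / 4)) with (y / gam ^ 2) by ring.
  unfold y. field. lra.
Qed.

Theorem bright_soliton_band_and_peak wX wC gam g w phiX phiC (hgam : gam <> 0) (hg : g < 0) :
  bright_soliton wX wC gam g w phiX phiC ->
  (band21 wX wC gam w \/ band22 wX wC gam w) /\
  far_field phiX 0 /\ far_field phiC 0 /\
  (forall x : R, Rabs g * phiX x ^ 2 <= bright_peak wX wC gam w) /\
  (exists x : R, Rabs g * phiX x ^ 2 = bright_peak wX wC gam w).
Proof.
  intros [Hcl [He [_ [Hb [_ [Hu _]]]]]].
  assert (P := profile_of_classical _ _ _ _ _ _ _ Hcl).
  destruct (profile_nil _ _ _ _ _ _ _ _ _ P) as [Du _].
  destruct (even_single_extremum_far_field phiX) as [l [Hp Hm]]; auto.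
  { intros x. eapply is_derive_continuous. apply Du. }
  assert (Hnc : ~ is_constant phiX).
  { intros [c Hc]. destruct Hu as [x0 [_ Hu]].
    assert (K : forall x, local_extremum phiX x).
    { intros x. left. apply filter_forall. intros y. rewrite !Hc. lra. }
    pose proof (Hu 0 (K 0)). pose proof (Hu 1 (K 1)). lra. }
  assert (Hg0 : g <> 0) by lra.
  destruct (Req_dec l 0) as [->|Hl].
  (* A nonzero far field would make the solution a dark soliton, which requires g > 0. *)
  2:{ exfalso. destruct (classical_dark_soliton _ _ _ _ _ _ _ l l hgam Hg0 Hcl Hp Hl Hm Hnc) as [A _]. lra. }
  destruct (classical_bright_soliton _ _ _ _ _ _ _ 0 hgam Hg0 Hcl Hp Hm Hnc) as [_ [B _]].
  split; [auto|]. split; [split; auto|].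
  destruct (smooth_profile_bright _ _ _ _ _ _ _ _ _ 0 hgam Hg0 P Hp Hm Hnc)
    as [_ [Hband [_ [x0 [U0 [H0 [Hmax [_ [_ HD]]]]]]]]].
  assert (Al := pr_alg P).
  assert (U2 : 0 < phiX x0 ^ 2) by (apply pow2_gt_0; auto).
  assert (Pk : bright_peak wX wC gam w = Rabs g * phiX x0 ^ 2).
  { unfold bright_peak. rewrite (bright_peak_value _ _ gam (g * phiX x0 ^ 2)); auto.
    - rewrite Rabs_left by auto. ring.
    - nra.
    - specialize (HD x0). replace (3 * (g * phiX x0 ^ 2)) with (3 * g * phiX x0 ^ 2) by ring. auto. }
  rewrite Pk. split; [|split].
  - assert (K : forall (x : Rbar), is_lim phiX x 0 -> is_lim phiC x 0).
    { intros x H. apply (is_lim_ext (fun y => / gam * ((w - wX - g * phiX y ^ 2) * phiX y))).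
      - intros y. rewrite <- Al. field. auto.
      - replace (Finite 0) with (Finite (/ gam * ((w - wX - g * 0 ^ 2) * 0))) by (f_equal; ring).
        apply (is_lim_continuous_comp (fun z => / gam * ((w - wX - g * z ^ 2) * z))); auto.
        apply (ex_derive_continuous (V := R_NormedModule)). auto_derive. auto. }
    split; auto.
  - intros x. apply Rmult_le_compat_l; [apply Rabs_pos|auto].
  - exists x0. auto.
Qed.

(** * Existence by separation of variables *)

(** The solution of u' = f (u) is the inverse of the time map T, chosen by [epsilon]. The mean value
    theorem gives [u y - u x = f c * (y - x)] with |c - u x| <= F |y - x|, so the continuity of f
    suffices for the derivative. *)
Lemma separable_inverse (f T : R -> R) (p q F : R) (J : R -> Prop) :
  (forall z, p < z < q -> continuous f z /\ 0 < f z <= F /\ is_derive T z (/ f z)) ->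
  (forall x, J x -> exists z, p < z < q /\ T z = x) ->
  (forall x, J x -> locally x J) ->
  exists u, forall x, J x -> p < u x < q /\ T (u x) = x /\ is_derive u x (f (u x)).
Proof.
  intros Hf Hr Ho.
  set (u := fun x => epsilon (inhabits 0) (fun z => p < z < q /\ T z = x)).
  assert (Hu : forall x, J x -> p < u x < q /\ T (u x) = x).
  { intros x Hx. apply (epsilon_spec (inhabits 0) (fun z => p < z < q /\ T z = x)). auto. }
  assert (Mv : forall z z', p < z < q -> p < z' < q -> z < z' ->
    exists c, z < c < z' /\ z' - z = f c * (T z' - T z)).
  { intros z z' Hz Hz' L. destruct (mvt_open T (fun c => / f c) z z' L) as [c [Hc Ec]].
    - intros c Hc. apply Hf. lra.
    - intros c Hc. eapply is_derive_continuous. apply Hf. lra.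
    - exists c. split; auto. rewrite Ec. field.
      destruct (Hf c ltac:(lra)) as [_ [K _]]. lra. }
  assert (Mv' : forall x y, J x -> J y -> x <> y ->
    exists c, p < c < q /\ Rabs (c - u x) <= F * Rabs (y - x) /\ u y - u x = f c * (y - x)).
  { intros x y Hx Hy Hne. destruct (Hu x Hx) as [Ux Tx]. destruct (Hu y Hy) as [Uy Ty].
    assert (u x <> u y) by (intro E; apply Hne; rewrite <- Tx, <- Ty, E; auto).
    destruct (Rlt_dec (u x) (u y)) as [L|L].
    - destruct (Mv _ _ Ux Uy L) as [c [Hc Ec]]. rewrite Tx, Ty in Ec. exists c.
      destruct (Hf c ltac:(lra)) as [_ [K _]]. split; [lra|split; [|auto]].
      assert (0 < y - x) by nra.
      rewrite !Rabs_pos_eq by lra. nra.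
    - destruct (Mv _ _ Uy Ux ltac:(lra)) as [c [Hc Ec]]. rewrite Tx, Ty in Ec. exists c.
      destruct (Hf c ltac:(lra)) as [_ [K _]]. split; [lra|split; [|lra]].
      assert (0 < x - y) by nra.
      rewrite !Rabs_left by lra. nra. }
  exists u. intros x Hx. destruct (Hu x Hx) as [Ux Tx]. split; [auto|split; [auto|]].
  apply is_derive_Reals. intros eps Heps.
  destruct (proj1 (continuous_R f (u x)) (proj1 (Hf _ Ux)) eps Heps) as [d [Hd Hcont]].
  destruct (proj1 (locally_R _ _) (Ho x Hx)) as [e [He HJ]].
  assert (HF : 0 < F) by (destruct (Hf _ Ux) as [_ [K _]]; lra).
  assert (Hp : 0 < Rmin e (d / F)) by (apply Rmin_glb_lt; auto; apply Rdiv_lt_0_compat; auto).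
  exists (mkposreal _ Hp). intros h Hh Hhd. simpl in Hhd.
  pose proof (Rmin_l e (d / F)). pose proof (Rmin_r e (d / F)).
  assert (Jy : J (x + h)) by (apply HJ; replace (x + h - x) with h by ring; lra).
  destruct (Mv' x (x + h) Hx Jy ltac:(lra)) as [c [Hc [Hc1 Hc2]]].
  rewrite Hc2. replace (x + h - x) with h in * by ring.
  replace (f c * h / h) with (f c) by (field; auto). apply Hcont.
  eapply Rle_lt_trans; [exact Hc1|]. apply Rlt_le_trans with (F * (d / F)).
  - apply Rmult_lt_compat_l; lra.
  - right. field. lra.
Qed.

(* The bound f z <= K (q - z) makes T diverge logarithmically at q. *)
Lemma time_map_reaches (f T : R -> R) (p q al K : R) :
  p < al < q -> 0 < K ->
  (forall z, p < z < q -> 0 < f z <= K * (q - z) /\ is_derive T z (/ f z)) ->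
  forall x, T al <= x -> exists z, al <= z < q /\ T z = x.
Proof.
  intros Hal HK Hf x Hx.
  set (z1 := q - (q - al) * exp (- (K * (x - T al)))).
  assert (He : 0 < exp (- (K * (x - T al))) <= 1).
  { split; [apply exp_pos|]. rewrite <- exp_0. assert (0 <= K * (x - T al)) by nra.
    destruct (Req_dec (K * (x - T al)) 0) as [->|]; [rewrite Ropp_0; lra|].
    left. apply exp_increasing. lra. }
  assert (Hz1 : al <= z1 < q) by (unfold z1; nra).
  assert (Tz1 : x <= T z1).
  { destruct (Req_dec al z1) as [E|E].
    - rewrite <- E. assert (Z : (q - al) * (1 - exp (- (K * (x - T al)))) = 0) by (unfold z1 in E; lra).
      apply Rmult_integral in Z. destruct Z as [Z|Z]; [lra|].
      assert (exp (- (K * (x - T al))) = exp 0) by (rewrite exp_0; lra).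
      apply exp_inv in H. assert (K * (x - T al) = 0) by lra. apply Rmult_integral in H0. lra.
    - set (h := fun z => K * T z + ln (q - z)).
      destruct (mvt_open h (fun z => K * / f z - / (q - z)) al z1) as [c [Hc Ec]]; [lra| | |].
      + intros z Hz. destruct (Hf z ltac:(lra)) as [_ Dz]. unfold h. auto_derive.
        * split; [eexists; exact Dz|split; [lra|auto]].
        * replace (Derive (fun x : R => T x) z) with (/ f z) by (symmetry; apply is_derive_unique; exact Dz).
          unfold Rminus. ring.
      + intros z Hz. destruct (Hf z ltac:(lra)) as [_ Dz].
        apply (ex_derive_continuous (V := R_NormedModule)). unfold h. auto_derive.
        split; [eexists; exact Dz|split; [lra|auto]].
      + destruct (Hf c ltac:(lra)) as [[F1 F2] _].
        assert (0 <= K * / f c - / (q - c)).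
        { assert (/ (K * (q - c)) <= / f c) by (apply Rinv_le_contravar; lra).
          assert (/ (q - c) = K * / (K * (q - c))) by (field; lra). nra. }
        assert (0 <= h z1 - h al) by (rewrite Ec; apply Rmult_le_pos; lra).
        unfold h in H0. replace (q - z1) with ((q - al) * exp (- (K * (x - T al)))) in H0 by (unfold z1; ring).
        rewrite ln_mult, ln_exp in H0 by lra. nra. }
  destruct (intermediate_value_on T al z1 x) as [z [Hz Ez]]; [lra| | |].
  - intros z Hz. eapply is_derive_continuous. apply (Hf z). lra.
  - nra.
  - exists z. split; [lra|auto].
Qed.

Lemma exists_time_map (f : R -> R) (p q al : R) :
  p < al < q -> (forall z, p < z < q -> continuous f z /\ 0 < f z) ->
  exists T, T al = 0 /\ forall z, p < z < q -> is_derive T z (/ f z).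
Proof.
  intros Hal Hf. exists (fun z => RInt (fun y => / f y) al z). split; [apply is_RInt_unique; apply (is_RInt_point (V := R_NormedModule))|].
  assert (Hc : forall z, p < z < q -> continuous (fun y => / f y) z).
  { intros z Hz. destruct (Hf z Hz) as [C P]. apply (continuous_comp f Rinv); auto.
    apply (ex_derive_continuous (V := R_NormedModule)). auto_derive. lra. }
  intros z Hz. apply (is_derive_RInt (V := R_NormedModule) (fun y => / f y) _ al z); [|apply Hc; auto].
  apply locally_R. exists (Rmin (z - p) (q - z)). split; [apply Rmin_glb_lt; lra|].
  intros y Hy. apply Rabs_def2 in Hy. pose proof (Rmin_l (z - p) (q - z)). pose proof (Rmin_r (z - p) (q - z)).
  apply (RInt_correct (V := R_CompleteNormedModule)). apply (ex_RInt_continuous (V := R_CompleteNormedModule)).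
  intros c Hcc. apply Hc. unfold Rmin, Rmax in Hcc. destruct (Rle_dec al y); lra.
Qed.

Lemma time_map_increasing (f T : R -> R) (p q : R) :
  (forall z, p < z < q -> 0 < f z /\ is_derive T z (/ f z)) ->
  forall z z', p < z < q -> p < z' < q -> z < z' -> T z < T z'.
Proof.
  intros Hf z z' Hz Hz' L. destruct (mvt_open T (fun c => / f c) z z' L) as [c [Hc Ec]].
  - intros c Hc. apply Hf. lra.
  - intros c Hc. eapply is_derive_continuous. apply Hf. lra.
  - destruct (Hf c ltac:(lra)) as [K _]. apply Rinv_0_lt_compat in K.
    assert (0 < / f c * (z' - z)) by (apply Rmult_lt_0_compat; lra). lra.
Qed.

(** T is increasing, so after the time T z1 the solution lies beyond z1. *)
Lemma time_map_limit (f T u : R -> R) (p q X : R) :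
  p < q ->
  (forall z, p < z < q -> 0 < f z /\ is_derive T z (/ f z)) ->
  (forall x, X < x -> p < u x < q /\ T (u x) = x) -> is_lim u p_infty q.
Proof.
  intros Hpq Hf Hu. apply is_lim_p_infty_R. intros e He.
  set (z1 := q - Rmin e (q - p) / 2).
  assert (0 < Rmin e (q - p)) by (apply Rmin_glb_lt; lra).
  pose proof (Rmin_l e (q - p)). pose proof (Rmin_r e (q - p)).
  assert (Hz1 : p < z1 < q) by (unfold z1; lra).
  exists (Rmax X (T z1)). intros x Hx. pose proof (Rmax_l X (T z1)). pose proof (Rmax_r X (T z1)).
  destruct (Hu x ltac:(lra)) as [Ux Tx].
  assert (z1 < u x).
  { apply Rnot_le_lt. intro C. destruct (Req_dec (u x) z1) as [E|E]; [rewrite E in Tx; lra|].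
    pose proof (time_map_increasing f T p q Hf (u x) z1 Ux Hz1 ltac:(lra)). lra. }
  apply Rabs_def1; unfold z1 in *; lra.
Qed.

(** The solution starts slightly before time 0, at some c < 0, so that it is differentiable from
    both sides at 0, where it will be joined to its odd reflection. *)
Lemma separable_half_line (f : R -> R) (p q al K : R) :
  p < al < q -> 0 < K ->
  (forall z, p < z < q -> continuous f z /\ 0 < f z <= K * (q - z)) ->
  exists u c, c < 0 /\ u 0 = al /\ (forall x, c < x -> p < u x < q /\ is_derive u x (f (u x))) /\
    is_lim u p_infty q.
Proof.
  intros Hal HK Hf.
  destruct (exists_time_map f p q al Hal) as [T [T0 HT]].
  { intros z Hz. destruct (Hf z Hz). split; [auto|lra]. }
  assert (Hf' : forall z, p < z < q -> 0 < f z /\ is_derive T z (/ f z)).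
  { intros z Hz. destruct (Hf z Hz). split; [lra|auto]. }
  assert (Inc := time_map_increasing f T p q Hf').
  set (z0 := (p + al) / 2). assert (Hz0 : p < z0 < al) by (unfold z0; lra).
  assert (c0 : T z0 < 0) by (rewrite <- T0; apply Inc; lra).
  destruct (separable_inverse f T p q (K * (q - p)) (fun x => T z0 < x)) as [u Hu].
  - intros z Hz. destruct (Hf z Hz) as [C [A B]]. split; [auto|split; [split; [auto|]|auto]]. nra.
  - intros x Hx. destruct (Rle_dec 0 x) as [L|L].
    + destruct (time_map_reaches f T p q al K Hal HK) with (x := x) as [z [Hz Ez]].
      * intros z Hz. destruct (Hf z Hz). split; auto.
      * lra.
      * exists z. split; [lra|auto].
    + destruct (intermediate_value_on T z0 al x) as [z [Hz Ez]]; [lra| | |].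
      * intros z Hz. eapply is_derive_continuous. apply HT. lra.
      * rewrite T0. nra.
      * exists z. split; [lra|auto].
  - intros x Hx. apply locally_R. exists (x - T z0). split; [lra|]. intros y Hy. apply Rabs_def2 in Hy. lra.
  - exists u, (T z0). split; [auto|split; [|split]].
    + destruct (Hu 0 c0) as [U0 [E _]].
      destruct (Rtotal_order (u 0) al) as [L|[L|L]]; auto; exfalso.
      * pose proof (Inc (u 0) al U0 Hal L). lra.
      * pose proof (Inc al (u 0) Hal U0 L). lra.
    + intros x Hx. destruct (Hu x Hx) as [A [_ B]]. auto.
    + apply (time_map_limit f T u p q (T z0)); auto; [lra|].
      intros x Hx. destruct (Hu x Hx) as [A [B _]]. auto.
Qed.

(** The linear bounds at both ends make both travel times infinite; negative times are reached by
    applying the one-sided lemma to the reflected problem. *)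
Lemma separable_full_line (f : R -> R) (p q al K : R) :
  p < al < q -> 0 < K ->
  (forall z, p < z < q -> continuous f z /\ 0 < f z /\ f z <= K * (q - z) /\ f z <= K * (z - p)) ->
  exists u, u 0 = al /\ (forall x, p < u x < q /\ is_derive u x (f (u x))) /\
    is_lim u p_infty q /\ is_lim u m_infty p.
Proof.
  intros Hal HK Hf.
  destruct (exists_time_map f p q al Hal) as [T [T0 HT]].
  { intros z Hz. destruct (Hf z Hz) as [A [B _]]. auto. }
  assert (Hf' : forall z, p < z < q -> 0 < f z /\ is_derive T z (/ f z)).
  { intros z Hz. destruct (Hf z Hz) as [A [B _]]. auto. }
  assert (Inc := time_map_increasing f T p q Hf').
  assert (HR : forall z, - q < z < - p -> is_derive (fun y => - T (- y)) z (/ f (- z))).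
  { intros z Hz. rewrite <- (Ropp_involutive (/ f (- z))). apply (is_derive_opp (V := R_NormedModule)).
    apply is_derive_reflect. apply HT. lra. }
  destruct (separable_inverse f T p q (K * (q - p)) (fun x => True)) as [u Hu].
  - intros z Hz. destruct (Hf z Hz) as [C [A [B _]]]. split; [auto|split; [split; [auto|]|auto]]. nra.
  - intros x _. destruct (Rle_dec 0 x) as [L|L].
    + destruct (time_map_reaches f T p q al K Hal HK) with (x := x) as [z [Hz Ez]].
      * intros z Hz. destruct (Hf z Hz) as [C [A [B _]]]. split; auto.
      * lra.
      * exists z. split; [lra|auto].
    + destruct (time_map_reaches (fun z => f (- z)) (fun z => - T (- z)) (- q) (- p) (- al) K) with (x := - x)
        as [z [Hz Ez]]; auto; try lra.
      * intros z Hz. destruct (Hf (- z) ltac:(lra)) as [C [A [_ B]]]. split; auto. split; auto. lra.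
      * rewrite Ropp_involutive. lra.
      * exists (- z). split; lra.
  - intros x _. apply filter_forall. auto.
  - exists u. split; [|split; [|split]].
    + destruct (Hu 0 I) as [U0 [E _]].
      destruct (Rtotal_order (u 0) al) as [L|[L|L]]; auto; exfalso.
      * pose proof (Inc (u 0) al U0 Hal L). lra.
      * pose proof (Inc al (u 0) Hal U0 L). lra.
    + intros x. destruct (Hu x I) as [A [_ B]]. auto.
    + apply (time_map_limit f T u p q 0); auto; [lra|].
      intros x _. destruct (Hu x I) as [A [B _]]. auto.
    + apply is_lim_opp_arg. apply (is_lim_ext (fun x => - - u (- x))); [intros; ring|].
      rewrite <- (Ropp_involutive p).
      apply (is_lim_opp (fun x => - u (- x)) p_infty (Finite (- p))).
      apply (time_map_limit (fun z => f (- z)) (fun z => - T (- z)) (fun x => - u (- x)) (- q) (- p) 0); [lra| |].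
      * intros z Hz. split; [apply Hf'; lra|apply HR; auto].
      * intros x _. destruct (Hu (- x) I) as [A [B _]]. rewrite Ropp_involutive. split; lra.
Qed.

(** * From the first-order equation to classical solutions *)

Definition second_order (a b gam g : R) (u u1 u2 : R -> R) (x : R) : Prop :=
  - 6 * g * u x * u1 x ^ 2 + (a - 3 * g * u x ^ 2) * u2 x = 2 * u x * (gam ^ 2 - b * (a - g * u x ^ 2)).

(** The derivative of the energy equation, divided by [2 (a - 3 g u ^ 2) u']; turning points are
    therefore excluded here. *)
Lemma second_order_of_energy a b gam g E (u u1 u2 : R -> R) x :
  is_derive u x (u1 x) -> is_derive u1 x (u2 x) ->
  locally x (fun y => ((a - 3 * g * u y ^ 2) * u1 y) ^ 2 = potential a b gam g (u y ^ 2) + E) ->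
  (a - 3 * g * u x ^ 2) * u1 x <> 0 -> second_order a b gam g u u1 u2 x.
Proof.
  intros Du Du1 HE Hn. set (w := (a - 3 * g * u x ^ 2) * u1 x) in *.
  assert (A : is_derive (fun y => ((a - 3 * g * u y ^ 2) * u1 y) ^ 2) x
    (2 * w * (- 6 * g * u x * u1 x ^ 2 + (a - 3 * g * u x ^ 2) * u2 x))) by (unfold w; der; ring).
  assert (B : is_derive (fun y => ((a - 3 * g * u y ^ 2) * u1 y) ^ 2) x
    (2 * w * (2 * u x * (gam ^ 2 - b * (a - g * u x ^ 2))))).
  { apply is_derive_ext_loc with (fun y => potential a b gam g (u y ^ 2) + E).
    - revert HE. apply filter_imp. auto.
    - unfold potential, w. der. ring. }
  apply is_derive_unique in A. apply is_derive_unique in B. rewrite A in B.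
  unfold second_order. apply (Rmult_eq_reg_l (2 * w)); auto.
Qed.

Definition photon (a gam g : R) (u : R -> R) (x : R) : R := / gam * ((a - g * u x ^ 2) * u x).

Lemma photon_derive a gam g (u u1 : R -> R) x :
  is_derive u x (u1 x) -> is_derive (photon a gam g u) x (/ gam * ((a - 3 * g * u x ^ 2) * u1 x)).
Proof. intros H. unfold photon. der. ring. Qed.

Lemma photon_second_derive a b gam g (u u1 u2 : R -> R) x :
  gam <> 0 -> is_derive u x (u1 x) -> is_derive u1 x (u2 x) -> second_order a b gam g u u1 u2 x ->
  is_derive (fun y => / gam * ((a - 3 * g * u y ^ 2) * u1 y)) x
    (2 * (gam * u x - b * photon a gam g u x)).
Proof.
  intros hgam D1 D2 H. unfold photon. der. unfold second_order in H.
  transitivity (/ gam * (- 6 * g * u x * u1 x ^ 2 + (a - 3 * g * u x ^ 2) * u2 x)); [ring|].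
  rewrite H. field. auto.
Qed.

Lemma classical_at_of_second_order wX wC gam g w (u u1 u2 : R -> R) x :
  gam <> 0 ->
  locally x (fun y => is_derive u y (u1 y) /\ is_derive u1 y (u2 y) /\
    second_order (w - wX) (w - wC) gam g u u1 u2 y) ->
  continuous u2 x ->
  classical_at wX wC gam g w u (photon (w - wX) gam g u) x.
Proof.
  intros hgam H Hc.
  set (a := w - wX) in *. set (b := w - wC) in *.
  destruct (C2_at_of_derive u u1 u2 x) as [CX _]; auto.
  { revert H. apply filter_imp. tauto. }
  { revert H. apply filter_imp. tauto. }
  destruct (locally_singleton _ _ H) as [D1 _].
  destruct (C2_at_of_derive (photon a gam g u) (fun y => / gam * ((a - 3 * g * u y ^ 2) * u1 y))
     (fun y => 2 * (gam * u y - b * photon a gam g u y)) x) as [CC E].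
  { revert H. apply filter_imp. intros y [A [B C]]. apply photon_derive. auto. }
  { revert H. apply filter_imp. intros y [A [B C]]. apply photon_second_derive with u2; auto. }
  { apply continuous_Rmult; [apply continuous_const|].
    apply continuous_Rminus; apply continuous_Rmult; try apply continuous_const.
    - eapply is_derive_continuous; eauto.
    - eapply is_derive_continuous. apply photon_derive. eauto. }
  apply classical_at_intro; auto. unfold photon. fold a. field. auto.
Qed.

(** [(l ^ 2 - z ^ 2) ^ 2 * far_rad z] is [potential + E] at s = z ^ 2 for the nonzero far field
    l. *)
Definition far_rad (a b g l z : R) : R := b * g * (a - g * l ^ 2 - 2 * g * z ^ 2).

(* u' as a function of u for a nonzero far field l; k = 1 or -1 selects the branch of the root. *)
Definition far_rate (a b g l k z : R) : R :=
  k * (l ^ 2 - z ^ 2) * sqrt (far_rad a b g l z) / (a - 3 * g * z ^ 2).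

Definition far_rate' (a b g l k z : R) : R :=
  (k * (- 2 * z) * sqrt (far_rad a b g l z) +
   k * (l ^ 2 - z ^ 2) * (b * g * (- 4 * g * z) / (2 * sqrt (far_rad a b g l z)))) / (a - 3 * g * z ^ 2)
  + k * (l ^ 2 - z ^ 2) * sqrt (far_rad a b g l z) * (6 * g * z) / (a - 3 * g * z ^ 2) ^ 2.

Lemma far_rate_derive a b g l k z :
  0 < far_rad a b g l z -> a - 3 * g * z ^ 2 <> 0 ->
  is_derive (far_rate a b g l k) z (far_rate' a b g l k z) /\ continuous (far_rate' a b g l k) z.
Proof.
  intros H1 H2. assert (0 < sqrt (far_rad a b g l z)) by (apply sqrt_lt_R0; auto).
  split.
  - assert (Dr : is_derive (far_rad a b g l) z (b * g * (- 4 * g * z))).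
    { unfold far_rad. auto_derive; auto. ring. }
    assert (Ds := is_derive_sqrt _ z _ Dr H1). unfold far_rate, far_rate'.
    set (S := fun z => sqrt (far_rad a b g l z)) in *.
    apply is_derive_ext with (fun z => k * (l ^ 2 - z ^ 2) * S z / (a - 3 * g * z ^ 2)); [auto|].
    change (sqrt (far_rad a b g l z)) with (S z) in *.
    auto_derive; [repeat split; auto; eexists; exact Ds|].
    replace (Derive (fun x => S x) z) with (b * g * (- 4 * g * z) / (2 * S z))
      by (symmetry; apply is_derive_unique; exact Ds).
    field. split; [auto|lra].
  - unfold far_rate', far_rad in *.
    apply (ex_derive_continuous (V := R_NormedModule)). auto_derive.
    simpl in *. repeat split; auto; try lra.
    apply Rmult_integral_contrapositive_currified; auto.
    unfold Rminus in *. rewrite ?Rmult_1_r in *. lra.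
Qed.

(** The chain rule gives u'' in terms of u. As u ^ 2 stays away from l ^ 2, u' does not vanish and
    [second_order_of_energy] applies. *)
Lemma far_branch a b gam g l k (u : R -> R) x :
  k * k = 1 -> gam ^ 2 = b * (a - g * l ^ 2) ->
  locally x (fun y => is_derive u y (far_rate a b g l k (u y)) /\
    0 < far_rad a b g l (u y) /\ a - 3 * g * u y ^ 2 <> 0 /\ u y ^ 2 <> l ^ 2) ->
  let u1 := fun y => far_rate a b g l k (u y) in
  let u2 := fun y => far_rate' a b g l k (u y) * far_rate a b g l k (u y) in
  is_derive u x (u1 x) /\ is_derive u1 x (u2 x) /\ continuous u2 x /\ second_order a b gam g u u1 u2 x.
Proof.
  intros Hk Heq H u1 u2. destruct (locally_singleton _ _ H) as [D1 [Hr [HD Hl]]].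
  destruct (far_rate_derive a b g l k (u x) Hr HD) as [F1 F2].
  assert (uc : continuous u x) by (eapply is_derive_continuous; eauto).
  assert (D2 : is_derive u1 x (u2 x)).
  { unfold u1, u2. evar_last.
    - apply (is_derive_comp (far_rate a b g l k) u x); eauto.
    - unfold scal; simpl; unfold mult; simpl. ring. }
  assert (Hw : forall z, 0 < far_rad a b g l z -> a - 3 * g * z ^ 2 <> 0 ->
    (a - 3 * g * z ^ 2) * far_rate a b g l k z = k * (l ^ 2 - z ^ 2) * sqrt (far_rad a b g l z)).
  { intros z Hz1 Hz2. unfold far_rate. field. auto. }
  split; [auto|split; [auto|split]].
  - unfold u2. apply continuous_Rmult.
    + apply (continuous_comp u (far_rate' a b g l k)); auto.
    + eapply is_derive_continuous. exact D2.
  - apply (second_order_of_energy a b gam g (- potential a b gam g (l ^ 2)) u u1 u2 x D1 D2).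
    + revert H. apply filter_imp. intros y [_ [Hy1 [Hy2 _]]]. unfold u1. rewrite Hw by auto.
      assert (Sq := sqrt_sqrt _ (Rlt_le _ _ Hy1)).
      rewrite (potential_nonzero_far_field a b gam g _ l); [|auto|lra].
      transitivity (k * k * (l ^ 2 - u y ^ 2) ^ 2 * (sqrt (far_rad a b g l (u y)) * sqrt (far_rad a b g l (u y)))); [ring|].
      rewrite Sq, Hk. unfold far_rad. ring.
    + unfold u1. rewrite Hw by auto. assert (0 < sqrt (far_rad a b g l (u x))) by (apply sqrt_lt_R0; auto).
      repeat apply Rmult_integral_contrapositive_currified; try lra.
      intro Z. rewrite Z in Hk. lra.
Qed.

(** The double zero of the energy at the far field is a simple zero of its square root. The linear
    factor q - z is split off to provide the bound that makes the travel time to q infinite. *)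
Lemma far_rate_bound a b g l k p q :
  p < q -> q ^ 2 = l ^ 2 ->
  (forall z, p <= z <= q -> 0 < far_rad a b g l z /\ a - 3 * g * z ^ 2 <> 0) ->
  exists K, 0 < K /\ forall z, p <= z <= q ->
    far_rate a b g l k z = (q - z) * (k * (q + z) * sqrt (far_rad a b g l z) / (a - 3 * g * z ^ 2)) /\
    k * (q + z) * sqrt (far_rad a b g l z) / (a - 3 * g * z ^ 2) <= K.
Proof.
  intros Hpq Hq H.
  destruct (continuity_ab_maj (fun z => k * (q + z) * sqrt (far_rad a b g l z) / (a - 3 * g * z ^ 2)) p q)
    as [z0 [H0 _]]; [lra| |].
  - intros c Hc. destruct (H c Hc) as [H1 H2]. apply continuous_continuity_pt.
    apply (ex_derive_continuous (V := R_NormedModule)). unfold far_rad in *. auto_derive. simpl in *.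
    repeat split; auto.
  - exists (Rabs (k * (q + z0) * sqrt (far_rad a b g l z0) / (a - 3 * g * z0 ^ 2)) + 1). split.
    + pose proof (Rabs_pos (k * (q + z0) * sqrt (far_rad a b g l z0) / (a - 3 * g * z0 ^ 2))). lra.
    + intros z Hz. split.
      * unfold far_rate. rewrite <- Hq. field. apply H. auto.
      * specialize (H0 z Hz). cbv beta in H0.
        pose proof (Rle_abs (k * (q + z0) * sqrt (far_rad a b g l z0) / (a - 3 * g * z0 ^ 2))). lra.
Qed.

Lemma far_rate_factor_pos a b g l k q z :
  0 < far_rad a b g l z -> 0 < k * (q + z) * (a - 3 * g * z ^ 2) ->
  0 < k * (q + z) * sqrt (far_rad a b g l z) / (a - 3 * g * z ^ 2).
Proof.
  intros H1 H2. assert (0 < sqrt (far_rad a b g l z)) by (apply sqrt_lt_R0; auto).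
  assert (HD : a - 3 * g * z ^ 2 <> 0) by (intro Z; rewrite Z in H2; lra).
  assert (0 < (a - 3 * g * z ^ 2) ^ 2) by (apply pow2_gt_0; auto).
  replace (k * (q + z) * sqrt (far_rad a b g l z) / (a - 3 * g * z ^ 2)) with
    (k * (q + z) * (a - 3 * g * z ^ 2) * sqrt (far_rad a b g l z) / (a - 3 * g * z ^ 2) ^ 2) by (field; auto).
  apply Rdiv_lt_0_compat; auto. apply Rmult_lt_0_compat; auto.
Qed.

Theorem dark_profile_exists wX wC gam g w l :
  gam <> 0 -> 0 < g -> 0 < l -> gam ^ 2 = (w - wC) * (w - wX - g * l ^ 2) ->
  0 < (w - wX) * (w - wX - 3 * g * l ^ 2) ->
  exists phiX phiC, classical_solution wX wC gam g w phiX phiC /\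
    is_lim phiX p_infty l /\ is_lim phiX m_infty (- l).
Proof.
  intros hgam Hg Hl Heq HD. set (a := w - wX) in *. set (b := w - wC) in *.
  assert (G2 : 0 < gam ^ 2) by (apply pow2_gt_0; auto).
  assert (Ha : a <> 0) by (intro Z; rewrite Z in HD; lra).
  (* Taking k as the sign of a, which is also the sign of [a - 3 g z ^ 2] on [- l, l], makes the
     rate positive. *)
  assert (exists k, k * k = 1 /\ 0 < k * a) as [k [Hk Hka]].
  { destruct (Rlt_dec 0 a); [exists 1|exists (-1)]; split; lra. }
  assert (Hkl : 0 < k * (a - 3 * g * l ^ 2)).
  { assert (0 < (k * a) * (k * (a - 3 * g * l ^ 2))); [|clear - H Hka; nra].
    replace ((k * a) * (k * (a - 3 * g * l ^ 2))) with ((k * k) * (a * (a - 3 * g * l ^ 2))) by ring.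
    rewrite Hk. lra. }
  assert (Zl : forall z, - l <= z <= l -> z ^ 2 <= l ^ 2) by (intros z Hz; nra).
  assert (L2 : 0 < l ^ 2) by (apply pow2_gt_0; lra).
  assert (HDz : forall z, - l <= z <= l -> 0 < k * (a - 3 * g * z ^ 2)).
  { intros z Hz. specialize (Zl z Hz). pose proof (pow2_ge_0 z).
    clear - Zl H L2 Hka Hkl. destruct (Rle_dec 0 (k * g)); nra. }
  assert (Hkm : 0 < k * (a - g * l ^ 2)) by (clear - Hka Hkl; lra).
  assert (Hkb : 0 < k * b).
  { rewrite Heq in G2. assert (0 < (k * b) * (k * (a - g * l ^ 2))); [|clear - H Hkm; nra].
    replace ((k * b) * (k * (a - g * l ^ 2))) with ((k * k) * (b * (a - g * l ^ 2))) by ring. rewrite Hk. lra. }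
  assert (HR : forall z, - l <= z <= l -> 0 < far_rad a b g l z).
  { intros z Hz. specialize (Zl z Hz). pose proof (pow2_ge_0 z). unfold far_rad.
    assert (0 < k * (a - g * l ^ 2 - 2 * g * z ^ 2)).
    { clear - Zl H L2 Hkm Hkl. destruct (Rle_dec 0 (k * g)); nra. }
    assert (0 < g * ((k * b) * (k * (a - g * l ^ 2 - 2 * g * z ^ 2))))
      by (apply Rmult_lt_0_compat; [auto|apply Rmult_lt_0_compat; auto]).
    replace (g * ((k * b) * (k * (a - g * l ^ 2 - 2 * g * z ^ 2)))) with
      ((k * k) * (b * g * (a - g * l ^ 2 - 2 * g * z ^ 2))) in H1 by ring.
    rewrite Hk in H1. lra. }
  assert (HDn : forall z, - l <= z <= l -> a - 3 * g * z ^ 2 <> 0).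
  { intros z Hz Z. specialize (HDz z Hz). rewrite Z in HDz. lra. }
  destruct (far_rate_bound a b g l k (- l) l) as [K [HK HB]]; [lra|auto|auto|].
  destruct (separable_full_line (far_rate a b g l k) (- l) l 0 K) as [u [U0 [Hu [Hp Hm]]]]; [lra|auto| |].
  { intros z Hz. assert (Hz' : - l <= z <= l) by lra.
    split; [eapply is_derive_continuous; apply far_rate_derive; auto|].
    destruct (HB z Hz') as [E B].
    assert (P : 0 < k * (l + z) * sqrt (far_rad a b g l z) / (a - 3 * g * z ^ 2)).
    { apply far_rate_factor_pos; auto. specialize (HDz z Hz').
      replace (k * (l + z) * (a - 3 * g * z ^ 2)) with ((l + z) * (k * (a - 3 * g * z ^ 2))) by ring.
      apply Rmult_lt_0_compat; lra. }
    split; [rewrite E; apply Rmult_lt_0_compat; lra|]. split; [rewrite E; nra|].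
    destruct (HB (- z) ltac:(lra)) as [E' B'].
    (* The rate is even in z, so the bound at the end l yields the one at - l. *)
    assert (Ev : far_rate a b g l k z = far_rate a b g l k (- z)).
    { unfold far_rate, far_rad. replace ((- z) ^ 2) with (z ^ 2) by ring. auto. }
    rewrite Ev, E'. replace (z - - l) with (l - - z) by ring. nra. }
  exists u, (photon a gam g u). split; [|auto].
  intros x. apply (classical_at_of_second_order wX wC gam g w u (fun y => far_rate a b g l k (u y))
    (fun y => far_rate' a b g l k (u y) * far_rate a b g l k (u y))); auto.
  - apply filter_forall. intros y.
    destruct (far_branch a b gam g l k u y Hk Heq) as [B1 [B2 [_ B4]]]; auto.
    apply filter_forall. intros t. destruct (Hu t) as [T1 T2]. split; [auto|].
    split; [apply HR; lra|split; [apply HDn; lra|]]. intro Z. nra.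
  - apply (far_branch a b gam g l k u x Hk Heq).
    apply filter_forall. intros t. destruct (Hu t) as [T1 T2]. split; [auto|].
    split; [apply HR; lra|split; [apply HDn; lra|]]. intro Z. nra.
Qed.

Lemma is_derive_glue (f h : R -> R) (x l : R) :
  f x = h x -> is_derive f x l -> is_derive h x l ->
  is_derive (fun y => if Rlt_dec y x then h y else f y) x l.
Proof.
  intros E Hf Hh. apply is_derive_Reals. apply is_derive_Reals in Hf. apply is_derive_Reals in Hh.
  intros e He. destruct (Hf e He) as [d1 H1]. destruct (Hh e He) as [d2 H2].
  assert (Hp : 0 < Rmin d1 d2) by (apply Rmin_glb_lt; apply cond_pos).
  exists (mkposreal _ Hp). intros t Ht Htd. simpl in Htd.
  pose proof (Rmin_l d1 d2). pose proof (Rmin_r d1 d2).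
  destruct (Rlt_dec x x); [lra|]. destruct (Rlt_dec (x + t) x).
  - rewrite E. apply H2; auto. lra.
  - apply H1; auto. lra.
Qed.

(* A branch u on a neighbourhood of [0, oo) with g u(0) ^ 2 = a, extended as an odd function,
   has phi_C = 0 and a continuous phi_C' at the jump. *)
Theorem jump_profile_exists wX wC gam g w l p al q :
  gam <> 0 -> gam ^ 2 = (w - wC) * (w - wX - g * l ^ 2) -> q ^ 2 = l ^ 2 ->
  p < al < q -> al <> 0 -> g * al ^ 2 = w - wX ->
  (forall z, p <= z <= q -> 0 < far_rad (w - wX) (w - wC) g l z /\
     (q + z) * (w - wX - 3 * g * z ^ 2) < 0) ->
  exists phiX phiC, stationary_solution wX wC gam g w phiX phiC /\
    has_far_field phiX /\ has_far_field phiC /\ ~ is_constant phiX.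
Proof.
  intros hgam Heq Hq Hal Hal0 Hga Hz. set (a := w - wX) in *. set (b := w - wC) in *.
  assert (HDn : forall z, p <= z <= q -> a - 3 * g * z ^ 2 <> 0).
  { intros z Hzz Z. destruct (Hz z Hzz) as [_ K]. rewrite Z in K. lra. }
  (* The branch -1 of the root: since [(q + z) (a - 3 g z ^ 2) < 0], it is the one with positive
     rate. *)
  destruct (far_rate_bound a b g l (-1) p q) as [K [HK HB]]; [lra|auto| |].
  { intros z Hzz. split; [apply Hz; auto|auto]. }
  destruct (separable_half_line (far_rate a b g l (-1)) p q al K Hal HK) as [u [c [Hc [U0 [Hu Hp]]]]].
  { intros z Hzz. destruct (Hz z ltac:(lra)) as [R1 R2].
    split; [eapply is_derive_continuous; apply far_rate_derive; auto; apply HDn; lra|].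
    destruct (HB z ltac:(lra)) as [E B].
    assert (P : 0 < -1 * (q + z) * sqrt (far_rad a b g l z) / (a - 3 * g * z ^ 2)).
    { apply far_rate_factor_pos; auto. lra. }
    rewrite E. split; [apply Rmult_lt_0_compat; lra|nra]. }
  assert (Hne : forall x, c < x -> u x ^ 2 <> l ^ 2).
  { intros x Hx Z. destruct (Hu x Hx) as [T1 _]. rewrite <- Hq in Z.
    assert (Q : (u x - q) * (q + u x) = 0) by lra. apply Rmult_integral in Q. destruct Q as [Q|Q]; [lra|].
    destruct (Hz (u x) ltac:(lra)) as [_ T2]. rewrite Q in T2. lra. }
  set (u1 := fun y => far_rate a b g l (-1) (u y)).
  set (u2 := fun y => far_rate' a b g l (-1) (u y) * far_rate a b g l (-1) (u y)).
  assert (Br : forall x, c < x -> is_derive u x (u1 x) /\ is_derive u1 x (u2 x) /\ continuous u2 x /\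
    second_order a b gam g u u1 u2 x).
  { intros x Hx. apply (far_branch a b gam g l (-1) u x); auto; [lra|].
    apply locally_R. exists (x - c). split; [lra|]. intros y Hy. apply Rabs_def2 in Hy.
    destruct (Hu y ltac:(lra)) as [T1 T2]. split; [auto|].
    split; [apply Hz; lra|split; [apply HDn; lra|apply Hne; lra]]. }
  clearbody u1 u2.
  set (phiX := fun x => if Rlt_dec x 0 then - u (- x) else u x).
  set (U1 := fun x => if Rlt_dec x 0 then u1 (- x) else u1 x).
  set (U2 := fun x => if Rlt_dec x 0 then - u2 (- x) else u2 x).
  assert (Pos : forall (f h : R -> R) x, 0 < x -> locally x (fun y => f y = if Rlt_dec y 0 then h y else f y)).
  { intros f h x Hx. apply locally_R. exists x. split; auto. intros y Hy. apply Rabs_def2 in Hy.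
    destruct (Rlt_dec y 0); lra. }
  assert (Neg : forall (f h : R -> R) x, x < 0 -> locally x (fun y => h y = if Rlt_dec y 0 then h y else f y)).
  { intros f h x Hx. apply locally_R. exists (- x). split; [lra|]. intros y Hy. apply Rabs_def2 in Hy.
    destruct (Rlt_dec y 0); lra. }
  assert (D1 : forall x, x <> 0 -> is_derive phiX x (U1 x)).
  { intros x Hx. unfold U1. destruct (Rlt_dec x 0) as [L|L].
    - apply is_derive_ext_loc with (fun y => - u (- y)); [apply Neg; auto|].
      rewrite <- (Ropp_involutive (u1 (- x))). apply (is_derive_opp (V := R_NormedModule)).
      apply is_derive_reflect. apply Br. lra.
    - apply is_derive_ext_loc with u; [apply Pos; lra|apply Br; lra]. }
  assert (D2 : forall x, x <> 0 -> is_derive U1 x (U2 x)).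
  { intros x Hx. unfold U2. destruct (Rlt_dec x 0) as [L|L].
    - apply is_derive_ext_loc with (fun y => u1 (- y)); [apply Neg; auto|].
      apply is_derive_reflect. apply Br. lra.
    - apply is_derive_ext_loc with u1; [apply Pos; lra|apply Br; lra]. }
  assert (C2 : forall x, x <> 0 -> continuous U2 x).
  { intros x Hx. destruct (Rlt_dec x 0) as [L|L].
    - apply continuous_ext_loc with (fun y => - u2 (- y)); [apply (Neg u2 (fun y => - u2 (- y))); auto|].
      apply (continuous_opp (V := R_NormedModule)). apply continuous_reflect. apply Br. lra.
    - apply continuous_ext_loc with u2; [apply Pos; lra|apply Br; lra]. }
  assert (SO : forall x, x <> 0 -> second_order a b gam g phiX U1 U2 x).
  { intros x Hx. unfold phiX, U1, U2, second_order. destruct (Rlt_dec x 0) as [L|L].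
    - destruct (Br (- x) ltac:(lra)) as [_ [_ [_ S]]]. unfold second_order in S.
      replace ((- u (- x)) ^ 2) with (u (- x) ^ 2) by ring. lra.
    - apply Br. lra. }
  set (V := photon a gam g u). set (V1 := fun y => / gam * ((a - 3 * g * u y ^ 2) * u1 y)).
  set (phiC := photon a gam g phiX).
  set (v1 := fun x => if Rlt_dec x 0 then V1 (- x) else V1 x).
  assert (DV : forall x, c < x -> is_derive V x (V1 x)) by (intros x Hx; apply photon_derive; apply Br; auto).
  assert (DV1 : forall x, c < x -> continuous V1 x).
  { intros x Hx. destruct (Br x Hx) as [B1 [B2 [_ B4]]].
    eapply is_derive_continuous. apply (photon_second_derive a b gam g u u1 u2); auto. }
  assert (EV : forall x, phiC x = if Rlt_dec x 0 then - V (- x) else V x).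
  { intros x. unfold phiC, V, phiX, photon. destruct (Rlt_dec x 0); [|auto].
    replace ((- u (- x)) ^ 2) with (u (- x) ^ 2) by ring. ring. }
  assert (V00 : V 0 = 0) by (unfold V, photon; rewrite U0, Hga; ring).
  assert (DC : forall x, is_derive phiC x (v1 x)).
  { intros x. apply is_derive_ext with (fun y => if Rlt_dec y 0 then - V (- y) else V y).
    { intros t. symmetry. apply EV. }
    assert (DN : forall x, x <= 0 -> is_derive (fun y => - V (- y)) x (V1 (- x))).
    { intros y Hy. rewrite <- (Ropp_involutive (V1 (- y))). apply (is_derive_opp (V := R_NormedModule)).
      apply is_derive_reflect. apply DV. lra. }
    unfold v1. destruct (Rlt_dec x 0) as [L|L].
    - apply is_derive_ext_loc with (fun y => - V (- y)); [apply (Neg V (fun y => - V (- y))); auto|apply DN; lra].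
    - destruct (Req_dec x 0) as [->|Hx].
      + apply is_derive_glue.
        * rewrite Ropp_0, V00. ring.
        * apply DV. lra.
        * specialize (DN 0 ltac:(lra)). rewrite Ropp_0 in DN. auto.
      + apply is_derive_ext_loc with V; [apply Pos; lra|apply DV; lra]. }
  assert (CV1 : forall x, continuous v1 x).
  { intros x. destruct (Rtotal_order x 0) as [L|[->|L]].
    - apply continuous_ext_loc with (fun y => V1 (- y)); [apply (Neg V1 (fun y => V1 (- y))); auto|].
      apply continuous_reflect. apply DV1. lra.
    - apply continuous_of_sided.
      + replace (v1 0) with (V1 0) by (unfold v1; destruct (Rlt_dec 0 0); lra).
        apply (filterlim_ext_right V1 v1 0 1); [lra| |apply continuous_at_right; apply DV1; lra].
        intros y Hy. unfold v1. destruct (Rlt_dec y 0); lra.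
      + replace (v1 0) with ((fun y => V1 (- y)) 0) by (unfold v1; rewrite Ropp_0; destruct (Rlt_dec 0 0); lra).
        apply (filterlim_ext_left (fun y => V1 (- y)) v1 0 1); [lra| |].
        * intros y Hy. unfold v1. destruct (Rlt_dec y 0); lra.
        * apply (continuous_at_left (fun y => V1 (- y)) 0). apply continuous_reflect. apply DV1. lra.
    - apply continuous_ext_loc with V1; [apply Pos; lra|apply DV1; lra]. }
  assert (Cu : forall x, c < x -> continuous u x).
  { intros x Hx. exact (is_derive_continuous _ _ _ (proj1 (Br x Hx))). }
  assert (LR : filterlim phiX (at_right 0) (locally al)).
  { rewrite <- U0. apply (filterlim_ext_right u phiX 0 1); [lra| |].
    - intros y Hy. unfold phiX. destruct (Rlt_dec y 0); lra.
    - apply continuous_at_right. apply Cu. lra. }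
  assert (LL : filterlim phiX (at_left 0) (locally (- al))).
  { replace (- al) with ((fun y => - u (- y)) 0) by (rewrite Ropp_0, U0; auto).
    apply (filterlim_ext_left (fun y => - u (- y)) phiX 0 1); [lra| |].
    - intros y Hy. unfold phiX. destruct (Rlt_dec y 0); lra.
    - apply (continuous_at_left (fun y => - u (- y)) 0).
      apply (continuous_opp (V := R_NormedModule)). apply continuous_reflect.
      apply Cu. lra. }
  assert (Dis : discontinuity phiX 0).
  { intros [L HL]. apply is_lim_sided in HL. destruct HL as [HR HL].
    assert (E1 : L = al) by (apply (filterlim_locally_unique (F := at_right 0) phiX); auto).
    assert (E2 : L = - al) by (apply (filterlim_locally_unique (F := at_left 0) phiX); auto).
    lra. }
  assert (LX : is_lim phiX p_infty q).
  { apply is_lim_p_infty_ext with u 0; auto. intros x Hx. unfold phiX. destruct (Rlt_dec x 0); lra. }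
  assert (LXm : is_lim phiX m_infty (- q)).
  { apply is_lim_opp_arg. apply is_lim_p_infty_ext with (fun x => - u x) 0; [|apply (is_lim_opp u p_infty q Hp)].
    intros x Hx. unfold phiX. destruct (Rlt_dec (- x) 0); [rewrite Ropp_involutive; auto|lra]. }
  assert (LC : forall (x : Rbar) (L : R), is_lim phiX x L -> ex_finite_lim phiC x).
  { intros x L HL. exists (/ gam * ((a - g * L ^ 2) * L)).
    apply (is_lim_continuous_comp (fun z => / gam * ((a - g * z ^ 2) * z))); auto.
    apply (ex_derive_continuous (V := R_NormedModule)). auto_derive. auto. }
  exists phiX, phiC. split; [|split; [|split]].
  - exists (0 :: nil). split; [split; [|split]|].
    + intros x Hx. assert (Hx0 : x <> 0) by (intro Z; apply Hx; left; auto).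
      apply (classical_at_of_second_order wX wC gam g w phiX U1 U2); auto.
      apply locally_R. exists (Rabs x). split; [apply Rabs_pos_lt; auto|].
      intros y Hy. assert (y <> 0).
      { intro Z. subst y. rewrite Rminus_0_l, Rabs_Ropp in Hy. lra. }
      auto.
    + intros x. eapply is_derive_continuous. apply DC.
    + apply (polariton_weak_of_C1 wX wC gam g w phiX phiC v1 al (- al)); auto.
      * intros x Hx. unfold phiC, photon. fold a. field. auto.
      * intros x Hx. apply is_derive_ext_loc with (fun y => / gam * ((a - 3 * g * phiX y ^ 2) * U1 y)).
        { destruct (Rlt_dec x 0) as [L|L].
          - generalize (Neg V1 (fun y => V1 (- y)) x L) (Neg u (fun y => - u (- y)) x L) (Neg u1 (fun y => u1 (- y)) x L).
            intros A1 A2 A3. generalize (filter_and _ _ A1 (filter_and _ _ A2 A3)). apply filter_imp.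
            intros y [Y1 [Y2 Y3]]. unfold v1, phiX, U1. rewrite <- Y1, <- Y2, <- Y3. unfold V1.
            replace ((- u (- y)) ^ 2) with (u (- y) ^ 2) by ring. auto.
          - assert (L' : 0 < x) by lra.
            generalize (Pos V1 (fun y => V1 (- y)) x L') (Pos u (fun y => - u (- y)) x L') (Pos u1 (fun y => u1 (- y)) x L').
            intros A1 A2 A3. generalize (filter_and _ _ A1 (filter_and _ _ A2 A3)). apply filter_imp.
            intros y [Y1 [Y2 Y3]]. unfold v1, phiX, U1. rewrite <- Y1, <- Y2, <- Y3. auto. }
        apply (photon_second_derive a b gam g phiX U1 U2); auto.
      * intros x Hx. eapply is_derive_continuous. apply D1. auto.
    + intros d [<-|[]]. split; [auto|]. exists (Rabs al). apply is_lim_sided. split.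
      * apply (filterlim_comp _ _ _ phiX Rabs (at_right 0) (locally al)); auto. apply continuous_Rabs.
      * rewrite <- Rabs_Ropp. apply (filterlim_comp _ _ _ phiX Rabs (at_left 0) (locally (- al))); auto.
        apply continuous_Rabs.
  - split; [exists q|exists (- q)]; auto.
  - split; [apply (LC p_infty q)|apply (LC m_infty (- q))]; auto.
  - intros [k Hk]. apply Dis. exists k. apply (is_lim_ext (fun _ => k)); [intros; auto|apply is_lim_const].
Qed.

(** [y ^ 2 * bright_rad y] is [bright_factor] at q = q0 (1 - y ^ 2): the substitution extracts the
    zero at the turning point as a square. *)
Definition bright_rad (b q0 q2 y : R) : R := 2 * b * q0 * (q0 * (1 - y ^ 2) - q2).

Definition bright_slope (a b k q0 q2 y : R) : R :=
  k * sqrt (bright_rad b q0 q2 y) / (a - 3 * q0 * (1 - y ^ 2)).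

Definition bright_slope' (a b k q0 q2 y : R) : R :=
  k * (2 * b * q0 * (q0 * (- 2 * y)) / (2 * sqrt (bright_rad b q0 q2 y))) / (a - 3 * q0 * (1 - y ^ 2))
  - k * sqrt (bright_rad b q0 q2 y) * (6 * q0 * y) / (a - 3 * q0 * (1 - y ^ 2)) ^ 2.

Lemma bright_slope_derive a b k q0 q2 y :
  0 < bright_rad b q0 q2 y -> a - 3 * q0 * (1 - y ^ 2) <> 0 ->
  is_derive (bright_slope a b k q0 q2) y (bright_slope' a b k q0 q2 y) /\
  continuous (bright_slope' a b k q0 q2) y.
Proof.
  intros H1 H2. assert (0 < sqrt (bright_rad b q0 q2 y)) by (apply sqrt_lt_R0; auto).
  split.
  - assert (Dr : is_derive (bright_rad b q0 q2) y (2 * b * q0 * (q0 * (- 2 * y)))).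
    { unfold bright_rad. auto_derive; auto. ring. }
    assert (Ds := is_derive_sqrt _ y _ Dr H1). unfold bright_slope, bright_slope'.
    set (S := fun z => sqrt (bright_rad b q0 q2 z)) in *.
    apply is_derive_ext with (fun y => k * S y / (a - 3 * q0 * (1 - y ^ 2))); [auto|].
    change (sqrt (bright_rad b q0 q2 y)) with (S y) in *.
    auto_derive; [repeat split; auto; eexists; exact Ds|].
    replace (Derive (fun x => S x) y) with (2 * b * q0 * (q0 * (- 2 * y)) / (2 * S y))
      by (symmetry; apply is_derive_unique; exact Ds).
    field. split; [auto|lra].
  - unfold bright_slope', bright_rad in *. apply (ex_derive_continuous (V := R_NormedModule)). auto_derive.
    simpl in *. repeat split; auto; try lra.
    apply Rmult_integral_contrapositive_currified; auto.
    unfold Rminus in *. rewrite ?Rmult_1_r in *. lra.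
Qed.

(** Carries the second-order equation over to the turning point, which [second_order_of_energy] does
    not reach. *)
Lemma second_order_residual_continuous a b gam g (u u1 u2 : R -> R) x :
  continuous u x -> continuous u1 x -> continuous u2 x ->
  continuous (fun x => - 6 * g * u x * u1 x ^ 2 + (a - 3 * g * u x ^ 2) * u2 x -
    2 * u x * (gam ^ 2 - b * (a - g * u x ^ 2))) x.
Proof.
  intros C0 C1 C2.
  assert (Sq : forall f : R -> R, continuous f x -> continuous (fun y => f y ^ 2) x).
  { intros f Hf. apply (continuous_comp f (fun z => z ^ 2)); [exact Hf|].
    apply (ex_derive_continuous (V := R_NormedModule)). auto_derive. exact I. }
  apply continuous_Rminus; [apply continuous_Rplus|].
  - apply (continuous_Rmult (fun y => - 6 * g * u y) (fun y => u1 y ^ 2)); [|apply Sq; exact C1].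
    apply (continuous_Rmult (fun _ => - 6 * g) u); [apply continuous_const|exact C0].
  - apply (continuous_Rmult (fun y => a - 3 * g * u y ^ 2) u2); [|exact C2].
    apply (continuous_comp u (fun z => a - 3 * g * z ^ 2)); [exact C0|].
    apply (ex_derive_continuous (V := R_NormedModule)). auto_derive. exact I.
  - apply (continuous_comp u (fun z => 2 * z * (gam ^ 2 - b * (a - g * z ^ 2)))); [exact C0|].
    apply (ex_derive_continuous (V := R_NormedModule)). auto_derive. exact I.
Qed.

(* Here q0 and q2 are the roots of bright_factor; substituting g u ^ 2 = q0 (1 - y ^ 2) makes
   the turning point g u ^ 2 = q0 a regular point y = 0 of a first-order equation. *)
Theorem bright_profile_exists wX wC gam g w q0 q2 :
  gam <> 0 -> 0 < q0 * g ->
  (forall q, bright_factor (w - wX) (w - wC) gam q = - 2 * (w - wC) * (q - q0) * (q - q2)) ->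
  0 < (w - wX) * (w - wX - 3 * q0) ->
  0 < (w - wC) * q0 * (q0 - q2) -> 0 < - (w - wC) * q0 * q2 ->
  exists phiX phiC, classical_solution wX wC gam g w phiX phiC /\
    is_lim phiX p_infty 0 /\ is_lim phiX m_infty 0 /\ ~ is_constant phiX.
Proof.
  intros hgam Hq0 HF HD HR1 HR2. set (a := w - wX) in *. set (b := w - wC) in *.
  assert (Ha : a <> 0) by (intro Z; rewrite Z in HD; lra).
  assert (Hg : g <> 0) by (intro Z; rewrite Z in Hq0; lra).
  assert (exists k, k * k = 1 /\ 0 < k * a) as [k [Hk Hka]].
  { destruct (Rlt_dec 0 a); [exists 1|exists (-1)]; split; lra. }
  assert (Hkq : 0 < k * (a - 3 * q0)).
  { assert (0 < (k * a) * (k * (a - 3 * q0))); [|clear - H Hka; nra].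
    replace ((k * a) * (k * (a - 3 * q0))) with ((k * k) * (a * (a - 3 * q0))) by ring. rewrite Hk. lra. }
  assert (Y2 : forall y, -1 <= y <= 1 -> 0 <= 1 - y ^ 2 <= 1) by (intros y Hy; nra).
  assert (KD : forall y, -1 <= y <= 1 -> 0 < k * (a - 3 * q0 * (1 - y ^ 2))).
  { intros y Hy. specialize (Y2 y Hy). clear - Y2 Hka Hkq. set (t := 1 - y ^ 2) in *. clearbody t.
    replace (k * (a - 3 * q0 * t)) with ((1 - t) * (k * a) + t * (k * (a - 3 * q0))) by ring.
    destruct (Req_dec t 0) as [->|]; [lra|].
    assert (0 < t * (k * (a - 3 * q0))) by (apply Rmult_lt_0_compat; lra).
    assert (0 <= (1 - t) * (k * a)) by (apply Rmult_le_pos; lra). lra. }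
  assert (RD : forall y, -1 <= y <= 1 -> 0 < bright_rad b q0 q2 y).
  { intros y Hy. specialize (Y2 y Hy). unfold bright_rad. clear - Y2 HR1 HR2.
    set (t := 1 - y ^ 2) in *. clearbody t.
    replace (2 * b * q0 * (q0 * t - q2)) with (2 * (t * (b * q0 * (q0 - q2)) + (1 - t) * (- b * q0 * q2))) by ring.
    destruct (Req_dec t 0) as [->|]; [lra|].
    assert (0 < t * (b * q0 * (q0 - q2))) by (apply Rmult_lt_0_compat; lra).
    assert (0 <= (1 - t) * (- b * q0 * q2)) by (apply Rmult_le_pos; lra). lra. }
  set (D := fun y => a - 3 * q0 * (1 - y ^ 2)).
  assert (Dn : forall y, -1 <= y <= 1 -> D y <> 0).
  { intros y Hy Z. unfold D in Z. specialize (KD y Hy). rewrite Z in KD. lra. }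
  set (Phi := bright_slope a b k q0 q2).
  assert (Pd : forall y, -1 <= y <= 1 -> is_derive Phi y (bright_slope' a b k q0 q2 y) /\
     continuous (bright_slope' a b k q0 q2) y).
  { intros y Hy. apply bright_slope_derive; auto. apply Dn. auto. }
  assert (Pp : forall y, -1 <= y <= 1 -> 0 < Phi y).
  { intros y Hy. assert (0 < sqrt (bright_rad b q0 q2 y)) by (apply sqrt_lt_R0; auto).
    specialize (KD y Hy). specialize (Dn y Hy). unfold D in Dn.
    unfold Phi, bright_slope.
    replace (k * sqrt (bright_rad b q0 q2 y) / (a - 3 * q0 * (1 - y ^ 2))) with
      ((k * k) * sqrt (bright_rad b q0 q2 y) / (k * (a - 3 * q0 * (1 - y ^ 2)))).
    - rewrite Hk, Rmult_1_l. apply Rdiv_lt_0_compat; auto.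
    - field. split; [auto|]. intro Z. rewrite Z in Hk. lra. }
  destruct (continuity_ab_maj Phi (-1) 1) as [ym [Hym1 Hym2]]; [lra| |].
  { intros c Hc. apply continuous_continuity_pt. eapply is_derive_continuous. apply Pd. auto. }
  (* With u proportional to sqrt (1 - y ^ 2), one has u' = - u y y' / (1 - y ^ 2). The equation y' =
     (1 - y ^ 2) Phi thus gives u' = - u y Phi, which satisfies the energy equation; y increases
     from -1 to 1, and both ends correspond to the far field u = 0. *)
  set (rate := fun y => (1 - y ^ 2) * Phi y).
  destruct (separable_full_line rate (-1) 1 0 (2 * Phi ym)) as [y [Y0 [Hy [Hp Hm]]]]; [lra| | |].
  { specialize (Pp ym Hym2). lra. }
  { intros z Hz. assert (Hz' : -1 <= z <= 1) by lra. specialize (Pp z Hz'). specialize (Hym1 z Hz').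
    assert (E : rate z = (1 - z) * (1 + z) * Phi z) by (unfold rate; ring).
    split; [|split; [|split]].
    - unfold rate. apply continuous_Rmult.
      + apply (ex_derive_continuous (V := R_NormedModule)). auto_derive. auto.
      + eapply is_derive_continuous. apply Pd. auto.
    - rewrite E. apply Rmult_lt_0_compat; [apply Rmult_lt_0_compat|]; lra.
    - rewrite E. assert ((1 + z) * Phi z <= 2 * Phi ym) by nra.
      replace ((1 - z) * (1 + z) * Phi z) with ((1 - z) * ((1 + z) * Phi z)) by ring.
      rewrite (Rmult_comm (2 * Phi ym)). apply Rmult_le_compat_l; lra.
    - rewrite E. assert ((1 - z) * Phi z <= 2 * Phi ym) by nra.
      replace ((1 - z) * (1 + z) * Phi z) with ((1 + z) * ((1 - z) * Phi z)) by ring.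
      rewrite (Rmult_comm (2 * Phi ym)). replace (z - -1) with (1 + z) by ring. apply Rmult_le_compat_l; lra. }
  assert (Y1 : forall x, 0 < 1 - y x ^ 2) by (intros x; destruct (Hy x) as [B _]; nra).
  set (m := sqrt (q0 / g)).
  assert (Hm2 : g * m ^ 2 = q0).
  { unfold m. rewrite pow2_sqrt; [field; auto|]. replace (q0 / g) with (q0 * g / g ^ 2) by (field; auto).
    apply Rdiv_le_0_compat; [lra|apply pow2_gt_0; auto]. }
  assert (Hm0 : m <> 0) by (intro Z; rewrite Z in Hm2; apply Hg; nra).
  set (u := fun x => m * sqrt (1 - y x ^ 2)).
  assert (us : forall x, g * u x ^ 2 = q0 * (1 - y x ^ 2)).
  { intros x. unfold u. rewrite Rpow_mult_distr, pow2_sqrt by (specialize (Y1 x); lra). rewrite <- Hm2. ring. }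
  set (u1 := fun x => - (u x * y x * Phi (y x))).
  set (u2 := fun x => - (u1 x * y x * Phi (y x) + u x * rate (y x) * Phi (y x) +
     u x * y x * (bright_slope' a b k q0 q2 (y x) * rate (y x)))).
  assert (Dy : forall x, is_derive y x (rate (y x))) by (intros x; apply Hy).
  assert (Hy' : forall x, -1 <= y x <= 1) by (intros x; destruct (Hy x); lra).
  assert (Du : forall x, is_derive u x (u1 x)).
  { intros x. specialize (Dy x). specialize (Y1 x). unfold u, u1. auto_derive.
    - split; [eexists; exact Dy|split; [simpl; lra|auto]].
    - replace (Derive (fun x0 : R => y x0) x) with (rate (y x)) by (symmetry; apply is_derive_unique; exact Dy).
      unfold u, rate. set (s := sqrt (1 - y x ^ 2)).
      assert (Hs : 0 < s) by (apply sqrt_lt_R0; auto).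
      assert (Es : s * s = 1 - y x ^ 2) by (apply sqrt_sqrt; lra).
      replace (1 + - (y x * (y x * 1))) with (1 - y x ^ 2) by ring. fold s. rewrite <- Es. field. lra. }
  assert (DP : forall x, is_derive (fun x => Phi (y x)) x (bright_slope' a b k q0 q2 (y x) * rate (y x))).
  { intros x. evar_last.
    - apply (is_derive_comp Phi y x); [apply Pd; auto|apply Dy].
    - unfold scal; simpl; unfold mult; simpl. ring. }
  assert (Du1 : forall x, is_derive u1 x (u2 x)).
  { intros x. specialize (Dy x). specialize (Du x). specialize (DP x). unfold u1.
    set (P := fun t => Phi (y t)). change (is_derive P x (bright_slope' a b k q0 q2 (y x) * rate (y x))) in DP.
    apply is_derive_ext with (fun x => - (u x * y x * P x)); [auto|].
    unfold u2. change (Phi (y x)) with (P x). clearbody P. der. ring. }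
  assert (Cy : forall x, continuous y x) by (intros x; eapply is_derive_continuous; eauto).
  assert (G : forall (h h1 z P r S : R -> R) x, continuous h x -> continuous h1 x -> continuous z x ->
    continuous P x -> continuous r x -> continuous S x ->
    continuous (fun x => - (h1 x * z x * P x + h x * r x * P x + h x * z x * (S x * r x))) x).
  { intros h h1 z P r S x C1 C2 C3 C4 C5 C6. apply (continuous_opp (V := R_NormedModule)).
    apply continuous_Rplus; [apply continuous_Rplus|]; apply continuous_Rmult; try assumption;
      apply continuous_Rmult; assumption. }
  assert (Cu2 : forall x, continuous u2 x).
  { intros x. assert (CP : continuous (fun t => Phi (y t)) x) by (eapply is_derive_continuous; eauto).
    assert (Cr : continuous (fun t => rate (y t)) x).
    { unfold rate. apply continuous_Rmult; auto. apply (continuous_comp y (fun z => 1 - z ^ 2)); auto.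
      apply (ex_derive_continuous (V := R_NormedModule)). auto_derive. auto. }
    assert (Cs : continuous (fun t => bright_slope' a b k q0 q2 (y t)) x).
    { apply (continuous_comp y (bright_slope' a b k q0 q2)); auto. apply Pd. auto. }
    assert (Cu : continuous u x) by (eapply is_derive_continuous; eauto).
    assert (Cu1 : continuous u1 x) by (eapply is_derive_continuous; eauto).
    apply (G u u1 y (fun t => Phi (y t)) (fun t => rate (y t)) (fun t => bright_slope' a b k q0 q2 (y t))); auto. }
  assert (En : forall x, ((a - 3 * g * u x ^ 2) * u1 x) ^ 2 = potential a b gam g (u x ^ 2) + 0).
  { intros x. rewrite potential_bright, HF, us. replace (3 * g * u x ^ 2) with (3 * (g * u x ^ 2)) by ring.
    rewrite us. assert (Hn := Dn _ (Hy' x)). unfold D in Hn.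
    assert (Q : (a - 3 * (q0 * (1 - y x ^ 2))) * u1 x = - (k * u x * y x * sqrt (bright_rad b q0 q2 (y x)))).
    { unfold u1, Phi, bright_slope. field. lra. }
    rewrite Q. assert (Sq := sqrt_sqrt _ (Rlt_le _ _ (RD _ (Hy' x)))).
    transitivity ((k * k) * u x ^ 2 * y x ^ 2 * (sqrt (bright_rad b q0 q2 (y x)) * sqrt (bright_rad b q0 q2 (y x)))); [ring|].
    rewrite Hk, Sq. unfold bright_rad. ring. }
  assert (Ynz : forall x, x <> 0 -> y x <> 0).
  { intros x Hx Z.
    assert (Inc := monotone_of_derive_sign y (fun x => rate (y x)) (fun _ => True) 1 (fun _ _ _ _ _ _ => I)
      (fun z _ => Dy z)). assert (Hr : forall z, True -> 0 < 1 * rate (y z)).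
    { intros z _. unfold rate. rewrite Rmult_1_l. apply Rmult_lt_0_compat; auto. }
    specialize (Inc Hr). destruct (Rlt_dec x 0) as [L|L].
    - specialize (Inc x 0 I I L). lra.
    - specialize (Inc 0 x I I ltac:(lra)). lra. }
  assert (Unz : forall x, u x <> 0).
  { intros x Z. unfold u in Z. apply Rmult_integral in Z. destruct Z as [Z|Z]; auto.
    specialize (Y1 x). apply sqrt_lt_R0 in Y1. lra. }
  assert (SO' : forall x, x <> 0 -> second_order a b gam g u u1 u2 x).
  { intros x Hx. apply (second_order_of_energy a b gam g 0 u u1 u2 x); auto.
    - apply filter_forall. auto.
    - assert (Hn := Dn _ (Hy' x)). unfold D in Hn. specialize (Pp _ (Hy' x)).
      replace (3 * g * u x ^ 2) with (3 * q0 * (1 - y x ^ 2)) by (specialize (us x); lra).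
      apply Rmult_integral_contrapositive_currified; auto. unfold u1.
      apply Ropp_neq_0_compat. apply Rmult_integral_contrapositive_currified; [|lra].
      apply Rmult_integral_contrapositive_currified; auto. }
  assert (SO : forall x, second_order a b gam g u u1 u2 x).
  { intros x. destruct (Req_dec x 0) as [->|Hx]; auto.
    set (Res := fun x => - 6 * g * u x * u1 x ^ 2 + (a - 3 * g * u x ^ 2) * u2 x -
      2 * u x * (gam ^ 2 - b * (a - g * u x ^ 2))).
    assert (Res 0 = 0); [|unfold second_order, Res in *; lra].
    apply (continuous_value_at_accumulation Res (fun x => x = 0)).
    - apply second_order_residual_continuous; auto; eapply is_derive_continuous; eauto.
    - intros e He. exists (e / 2). split; [apply Rabs_def1; lra|lra].
    - apply filter_forall. intros z Hz. specialize (SO' z Hz). unfold second_order in SO'. unfold Res. lra. }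
  assert (Lim : forall (x : Rbar) (s : R), s ^ 2 = 1 -> is_lim y x s -> is_lim u x 0).
  { intros x s Hs HL. replace (Finite 0) with (Finite (m * sqrt (1 - s ^ 2))).
    - apply (is_lim_continuous_comp (fun z => m * sqrt (1 - z ^ 2))); auto.
      apply continuous_Rmult; [apply continuous_const|].
      apply (continuous_comp (fun z => 1 - z ^ 2) sqrt).
      + apply (ex_derive_continuous (V := R_NormedModule)). auto_derive. auto.
      + apply continuous_sqrt.
    - rewrite Hs, Rminus_diag, sqrt_0. f_equal. ring. }
  exists u, (photon a gam g u). split; [|split; [|split]].
  - intros x. apply (classical_at_of_second_order wX wC gam g w u u1 u2); auto.
    apply filter_forall. auto.
  - apply (Lim p_infty 1); auto. ring.
  - apply (Lim m_infty (-1)); auto. ring.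
  - intros [c Hc]. assert (L0 := Lim p_infty 1 ltac:(ring) Hp).
    assert (Lc : is_lim u p_infty c) by (apply (is_lim_ext (fun _ => c)); [intros; auto|apply is_lim_const]).
    apply is_lim_unique in L0. apply is_lim_unique in Lc. rewrite L0 in Lc.
    apply (f_equal real) in Lc. simpl in Lc. apply (Unz 0). rewrite Hc. auto.
Qed.

(** * Existence in each band *)

Lemma sqrt_ratio (s g : R) : 0 < s * g -> 0 < sqrt (s / g) /\ g * sqrt (s / g) ^ 2 = s.
Proof.
  intros H. assert (Hg : g <> 0) by (intro Z; rewrite Z in H; lra).
  assert (P : 0 < s / g).
  { replace (s / g) with (s * g / g ^ 2) by (field; auto). apply Rdiv_lt_0_compat; auto. apply pow2_gt_0. auto. }
  split; [apply sqrt_lt_R0; auto|]. rewrite pow2_sqrt by lra. field. auto.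
Qed.

(** The sign of b g (a b - gam ^ 2) is that of g times a - gam ^ 2 / b, so the equilibrium equation
    has a real solution l. The last identity is the origin of the edge 3/2 gam ^ 2: there the far
    field meets the degenerate value. *)
Lemma far_field_value a b gam g :
  gam <> 0 -> b <> 0 -> 0 < b * g * (a * b - gam ^ 2) ->
  exists l, 0 < l /\ gam ^ 2 = b * (a - g * l ^ 2) /\ b * (a - 3 * g * l ^ 2) = 3 * gam ^ 2 - 2 * (a * b).
Proof.
  intros hgam Hb H. destruct (sqrt_ratio (a - gam ^ 2 / b) g) as [L1 L2].
  { replace ((a - gam ^ 2 / b) * g) with (b * g * (a * b - gam ^ 2) / b ^ 2) by (field; auto).
    apply Rdiv_lt_0_compat; auto. apply pow2_gt_0. auto. }
  exists (sqrt ((a - gam ^ 2 / b) / g)). split; [auto|].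
  replace (3 * g * sqrt ((a - gam ^ 2 / b) / g) ^ 2) with
    (3 * (g * sqrt ((a - gam ^ 2 / b) / g) ^ 2)) by ring.
  rewrite L2. split; field; auto.
Qed.

Lemma dark_soliton_exists wX wC gam g w :
  gam <> 0 -> 0 < g -> band11 wX wC gam w \/ band12 wX wC gam w ->
  exists phiX phiC : R -> R, dark_soliton wX wC gam g w phiX phiC.
Proof.
  intros hgam Hg Hband. set (a := w - wX). set (b := w - wC).
  assert (G2 : 0 < gam ^ 2) by (apply pow2_gt_0; auto).
  assert (Hc : (a < 0 /\ b < 0 /\ a * b < gam ^ 2) \/ (0 < a /\ 0 < b /\ gam ^ 2 < a * b < 3 / 2 * gam ^ 2)).
  { destruct Hband as [[H1 H2]|[H1 H2]].
    - apply band_low_inv in H1. left. unfold a, b. lra.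
    - apply band_high_inv in H1. right. unfold a, b. lra. }
  destruct (far_field_value a b gam g) as [l [L1 [L2 L3]]]; auto; [lra| |].
  { destruct Hc as [[A [B C]]|[A [B C]]].
    - assert (0 < g * (- b * (gam ^ 2 - a * b))); [|lra]. repeat apply Rmult_lt_0_compat; lra.
    - repeat apply Rmult_lt_0_compat; lra. }
  destruct (dark_profile_exists wX wC gam g w l) as [phiX [phiC [Hcl [Hp Hm]]]]; auto.
  { fold a. assert (Q : 0 < a * b * (a * (a - 3 * g * l ^ 2))); [|].
    - replace (a * b * (a * (a - 3 * g * l ^ 2))) with (a * (a * (b * (a - 3 * g * l ^ 2)))) by ring.
      rewrite L3. replace (a * (a * (3 * gam ^ 2 - 2 * (a * b)))) with (a ^ 2 * (3 * gam ^ 2 - 2 * (a * b))) by ring.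
      apply Rmult_lt_0_compat; [apply pow2_gt_0; lra|lra].
    - assert (0 < a * b) by (clear - Hc; destruct Hc as [[A [B _]]|[A [B _]]]; nra). clear - Q H. nra. }
  assert (Hnc : ~ is_constant phiX).
  { intros [c Hc']. assert (Lc : forall x : Rbar, is_lim phiX x c).
    { intros x. apply (is_lim_ext (fun _ => c)); [intros; auto|apply is_lim_const]. }
    pose proof (is_lim_unique _ _ _ (Lc p_infty)) as E1. rewrite (is_lim_unique _ _ _ Hp) in E1.
    pose proof (is_lim_unique _ _ _ (Lc m_infty)) as E2. rewrite (is_lim_unique _ _ _ Hm) in E2.
    apply (f_equal real) in E1. apply (f_equal real) in E2. simpl in E1, E2. lra. }
  assert (Hg0 : g <> 0) by lra. assert (Hl0 : l <> 0) by lra.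
  destruct (classical_dark_soliton _ _ _ _ _ _ _ l (- l) hgam Hg0 Hcl Hp Hl0 Hm Hnc) as [_ [_ [_ [x0 H]]]].
  exists (shift phiX x0), (shift phiC x0). auto.
Qed.

Lemma bright_soliton_exists wX wC gam g w :
  gam <> 0 -> g < 0 -> band21 wX wC gam w \/ band22 wX wC gam w ->
  exists phiX phiC : R -> R, bright_soliton wX wC gam g w phiX phiC.
Proof.
  intros hgam Hg Hband. set (a := w - wX). set (b := w - wC).
  assert (G2 : 0 < gam ^ 2) by (apply pow2_gt_0; auto).
  assert (Hc : (a < 0 /\ b < 0 /\ gam ^ 2 < a * b < 9 / 8 * gam ^ 2) \/ (0 < a /\ 0 < b /\ a * b < gam ^ 2)).
  { destruct Hband as [[H1 H2]|[H1 H2]].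
    - apply band_low_inv in H1. left. unfold a, b. lra.
    - apply band_high_inv in H1. right. unfold a, b. lra. }
  assert (Hb : b <> 0) by lra.
  assert (Hab : 0 < a * b) by (destruct Hc as [[A [B C]]|[A [B C]]]; [lra|apply Rmult_lt_0_compat; auto]).
  set (r := sqrt (gam ^ 2 * (9 * gam ^ 2 - 8 * (a * b)))).
  assert (Hrad : 0 < gam ^ 2 * (9 * gam ^ 2 - 8 * (a * b))) by (apply Rmult_lt_0_compat; lra).
  assert (Hr : 0 < r) by (apply sqrt_lt_R0; auto).
  assert (Hr2 : r * r = gam ^ 2 * (9 * gam ^ 2 - 8 * (a * b))) by (apply sqrt_sqrt; lra).
  (* The solutions of [2 y ^ 2 - 3 gam ^ 2 y + a b gam ^ 2 = 0], which is [bright_factor] in the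
     variable y = b (a - q); the larger one belongs to the peak. *)
  set (y0 := (3 * gam ^ 2 + r) / 4). set (y2 := (3 * gam ^ 2 - r) / 4).
  assert (Ys : y0 + y2 = 3 / 2 * gam ^ 2) by (unfold y0, y2; field).
  assert (Yp : y0 * y2 = gam ^ 2 * (a * b) / 2).
  { unfold y0, y2. replace ((3 * gam ^ 2 + r) / 4 * ((3 * gam ^ 2 - r) / 4)) with ((9 * (gam ^ 2) ^ 2 - r * r) / 16) by field.
    rewrite Hr2. field. }
  assert (Yd : y0 - y2 = r / 2) by (unfold y0, y2; field).
  assert (Y0 : 3 / 4 * gam ^ 2 < y0) by (unfold y0; lra).
  (* (y0 - a b) (y2 - a b) = a b (a b - gam ^ 2) decides the position of y0 relative to a b. *)
  assert (Yab : (y0 - a * b) * (y2 - a * b) = a * b * (a * b - gam ^ 2)) by (replace ((y0 - a * b) * (y2 - a * b))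
     with (y0 * y2 - a * b * (y0 + y2) + (a * b) * (a * b)) by ring; rewrite Ys, Yp; field).
  assert (Hpos : 0 < b * (y0 - a * b)).
  { destruct Hc as [[A [B C]]|[A [B C]]].
    - assert (K : 0 < (y0 - a * b) * (y2 - a * b)) by (rewrite Yab; apply Rmult_lt_0_compat; lra).
      assert (y2 < a * b) by lra. assert (y0 < a * b) by (clear - K H; nra). clear - H0 B. nra.
    - assert (K : (y0 - a * b) * (y2 - a * b) < 0).
      { rewrite Yab. assert (0 < a * b * (gam ^ 2 - a * b)) by (apply Rmult_lt_0_compat; lra). lra. }
      assert (a * b < y0) by (assert (y2 < y0) by lra; clear - K H; nra). clear - H B. nra. }
  set (q0 := a - y0 / b). set (q2 := a - y2 / b).
  assert (Eq0 : b * (a - q0) = y0) by (unfold q0; field; auto).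
  assert (Eq2 : b * (a - q2) = y2) by (unfold q2; field; auto).
  assert (B2 : 0 < b ^ 2) by (apply pow2_gt_0; auto).
  assert (Nq0 : q0 < 0).
  { apply Rmult_lt_reg_l with (b ^ 2); auto. replace (b ^ 2 * q0) with (- (b * (y0 - a * b))) by (rewrite <- Eq0; ring). lra. }
  assert (Edif : b * (q0 - q2) = - (r / 2)) by (rewrite <- Yd, <- Eq0, <- Eq2; ring).
  destruct (bright_profile_exists wX wC gam g w q0 q2) as [phiX [phiC [Hcl [Hp [Hm Hnc]]]]]; auto; fold a b.
  - clear - Nq0 Hg. nra.
  - intros q. unfold bright_factor. apply (Rmult_eq_reg_l b); auto.
    transitivity (- 2 * ((b * (a - q)) * (b * (a - q)) - (b * (a - q)) * (y0 + y2) + y0 * y2)).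
    + rewrite Ys, Yp. field.
    + rewrite <- Eq0, <- Eq2. ring.
  - destruct Hc as [[A [B C]]|[A [B C]]].
    + assert (a < 3 * q0); [|clear - A H; nra].
      apply Ropp_lt_cancel, Rmult_lt_reg_l with (- b); [lra|].
      assert (- b * - (3 * q0) = 3 * (a * b) - 3 * y0) by (rewrite <- Eq0; ring). lra.
    + apply Rmult_lt_0_compat; lra.
  - replace (b * q0 * (q0 - q2)) with (q0 * (b * (q0 - q2))) by ring. rewrite Edif.
    replace (q0 * - (r / 2)) with (- q0 * (r / 2)) by ring. apply Rmult_lt_0_compat; lra.
  - assert (E : b * (- b * q0 * q2) = a * (gam ^ 2 - a * b) * b).
    { transitivity (- ((y0 - a * b) * (y2 - a * b))); [rewrite <- Eq0, <- Eq2; ring|rewrite Yab; ring]. }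
    assert (E' : - b * q0 * q2 = a * (gam ^ 2 - a * b)) by (apply (Rmult_eq_reg_l b); auto; lra).
    rewrite E'. destruct Hc as [[A [B C]]|[A [B C]]]; [|apply Rmult_lt_0_compat; lra].
    replace (a * (gam ^ 2 - a * b)) with (- a * (a * b - gam ^ 2)) by ring. apply Rmult_lt_0_compat; lra.
  - assert (Hg0 : g <> 0) by lra.
    destruct (classical_bright_soliton _ _ _ _ _ _ _ 0 hgam Hg0 Hcl Hp Hm Hnc) as [_ [_ [x0 H]]].
    exists (shift phiX x0), (shift phiC x0). auto.
Qed.

Lemma decreasing_soliton_exists wX wC gam g w :
  gam <> 0 -> g < 0 -> band31 wX wC gam w ->
  exists phiX phiC : R -> R,
    discontinuous_soliton wX wC gam g w phiX phiC /\ decreasing_profile wX wC gam g w phiX phiC.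
Proof.
  intros hgam Hg [H1 H2]. apply band_low_inv in H1 as H1'.
  set (a := w - wX) in *. set (b := w - wC) in *. destruct H1' as [Na Nb].
  assert (G2 : 0 < gam ^ 2) by (apply pow2_gt_0; auto).
  destruct (far_field_value a b gam g) as [l [L1 [L2 L3]]]; auto; [lra| |].
  { replace (b * g * (a * b - gam ^ 2)) with (- b * - g * (a * b - gam ^ 2)) by ring.
    repeat apply Rmult_lt_0_compat; lra. }
  destruct (sqrt_ratio a g) as [M1 M2]; [clear - Na Hg; nra|]. set (m := sqrt (a / g)) in *.
  assert (D3 : 0 < a - 3 * g * l ^ 2).
  { assert (b * (a - 3 * g * l ^ 2) < 0) by lra. clear - H Nb. nra. }
  assert (Hlm : l < m).
  { assert (a - g * l ^ 2 < 0) by (rewrite L2 in G2; clear - G2 Nb; nra).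
    assert (l ^ 2 < m ^ 2) by (clear - H M2 Hg; nra). clear - H0 L1 M1. nra. }
  (* Separation of variables yields increasing solutions, so the decreasing amplitude is obtained on
     the negative side, from - m up to - l. The bound - m - 1 only leaves room to the left of the
     starting value. *)
  destruct (jump_profile_exists wX wC gam g w l (- m - 1) (- m) (- l)) as [phiX [phiC [Hst [HX [HC Hnc]]]]];
    auto; try lra.
  { fold a. rewrite <- M2. ring. }
  { intros z Hz. fold a b. assert (l ^ 2 <= z ^ 2) by (clear - Hz L1; nra).
    assert (K : 0 < a - 3 * g * z ^ 2) by (clear - H D3 Hg; nra). split.
    - unfold far_rad. assert (0 < a - g * l ^ 2 - 2 * g * z ^ 2) by (clear - H D3 Hg; nra).
      replace (b * g) with (- b * - g) by ring. repeat apply Rmult_lt_0_compat; lra.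
    - assert (0 < (l - z) * (a - 3 * g * z ^ 2)) by (apply Rmult_lt_0_compat; lra). lra. }
  destruct (stationary_soliton wX wC gam g w phiX phiC hgam Hst HX HC) as [x0 Hs]; [tauto|].
  exists (shift phiX x0), (shift phiC x0).
  (* The sign of g and the band exclude every other alternative of [soliton], including the
     exceptional frequency with a b = 9/8 gam ^ 2. *)
  destruct Hs as [[A _]|[[_ [B _]]|[Hd [[_ [_ K]]|[[A _]|[_ [_ [A _]]]]]]]]; try lra; auto.
  - exfalso. destruct B as [[_ B]|[B _]]; [fold a b in B; lra|]. apply band_high_inv in B. unfold a, b in *. lra.
  - exfalso. fold a b in A. lra.
Qed.

Lemma increasing_soliton_exists wX wC gam g w :
  gam <> 0 -> 0 < g -> band32 wX wC w ->
  exists phiX phiC : R -> R,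
    discontinuous_soliton wX wC gam g w phiX phiC /\ increasing_profile wX wC gam g w phiX.
Proof.
  intros hgam Hg [H1 H2].
  set (a := w - wX) in *. set (b := w - wC) in *.
  assert (Pa : 0 < a) by (unfold a; lra). assert (Nb : b < 0) by (unfold b; lra).
  assert (G2 : 0 < gam ^ 2) by (apply pow2_gt_0; auto).
  assert (Hab : a * b < 0) by (clear - Pa Nb; nra).
  destruct (far_field_value a b gam g) as [l [L1 [L2 L3]]]; auto; [lra| |].
  { replace (b * g * (a * b - gam ^ 2)) with (- b * g * (gam ^ 2 - a * b)) by ring.
    repeat apply Rmult_lt_0_compat; lra. }
  destruct (sqrt_ratio a g) as [M1 M2]; [apply Rmult_lt_0_compat; lra|]. set (m := sqrt (a / g)) in *.
  assert (Hal : a - g * l ^ 2 < 0) by (rewrite L2 in G2; clear - G2 Nb; nra).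
  assert (Hlm : m < l).
  { assert (m ^ 2 < l ^ 2) by (clear - Hal M2 Hg; nra). clear - H L1 M1. nra. }
  (* Any lower end between m / sqrt 3 and m keeps [a - 3 g z ^ 2] negative on the whole interval; 3
     (3/4) ^ 2 = 27/16 exceeds 1. *)
  destruct (jump_profile_exists wX wC gam g w l (3 / 4 * m) m l) as [phiX [phiC [Hst [HX [HC Hnc]]]]];
    auto; try lra.
  { intros z Hz. fold a b. assert (9 / 16 * m ^ 2 <= z ^ 2) by (clear - Hz M1; nra).
    assert (K : a - 3 * g * z ^ 2 < 0) by (clear - H M2 Hg Pa; nra). split.
    - unfold far_rad. assert (0 < - (a - g * l ^ 2 - 2 * g * z ^ 2)).
      { assert (0 <= g * z ^ 2) by (apply Rmult_le_pos; [lra|apply pow2_ge_0]). lra. }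
      replace (b * g * (a - g * l ^ 2 - 2 * g * z ^ 2)) with (- b * g * - (a - g * l ^ 2 - 2 * g * z ^ 2)) by ring.
      apply Rmult_lt_0_compat; auto. apply Rmult_lt_0_compat; lra.
    - assert (0 < (l + z) * - (a - 3 * g * z ^ 2)) by (apply Rmult_lt_0_compat; lra). lra. }
  destruct (stationary_soliton wX wC gam g w phiX phiC hgam Hst HX HC) as [x0 Hs]; [tauto|].
  exists (shift phiX x0), (shift phiC x0).
  destruct Hs as [[_ [B _]]|[[A _]|[Hd [[A _]|[[_ [_ K]]|[A _]]]]]]; try lra; auto.
  exfalso. destruct B as [[B _]|[B _]]; [apply band_low_inv in B|apply band_high_inv in B]; unfold a, b in *; lra.
Qed.

Theorem theorem2 (wX wC gam g : R) (hgam : gam <> 0) :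
  (* exhaustion *)
  (forall (w : R) (phiX phiC : R -> R),
     stationary_solution wX wC gam g w phiX phiC ->
     has_far_field phiX -> has_far_field phiC ->
     ~ (is_constant phiX /\ is_constant phiC) ->
     exists x0 : R, soliton wX wC gam g w (shift phiX x0) (shift phiC x0))
  /\
  (* dark solitons *)
  (0 < g ->
   forall w : R,
     ((exists phiX phiC : R -> R, dark_soliton wX wC gam g w phiX phiC) <->
      (band11 wX wC gam w \/ band12 wX wC gam w)) /\
     (forall phiX phiC : R -> R,
        dark_soliton wX wC gam g w phiX phiC ->
        far_field (fun x => Rabs (phiX x)) (amp_inf wX wC gam g w) /\
        is_lub (fun y => exists x : R, y = Rabs (phiX x))
               (amp_inf wX wC gam g w)))
  /\
  (* bright solitons *)
  (g < 0 ->
   forall w : R,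
     ((exists phiX phiC : R -> R, bright_soliton wX wC gam g w phiX phiC) <->
      (band21 wX wC gam w \/ band22 wX wC gam w)) /\
     (forall phiX phiC : R -> R,
        bright_soliton wX wC gam g w phiX phiC ->
        far_field phiX 0 /\ far_field phiC 0 /\
        (forall x : R, Rabs g * phiX x ^ 2 <= bright_peak wX wC gam w) /\
        (exists x : R, Rabs g * phiX x ^ 2 = bright_peak wX wC gam w)))
  /\
  (* discontinuous solitons, (a) *)
  (g < 0 ->
   forall w : R, band31 wX wC gam w ->
     exists phiX phiC : R -> R,
       discontinuous_soliton wX wC gam g w phiX phiC /\
       decreasing_profile wX wC gam g w phiX phiC)
  /\
  (* discontinuous solitons, (b) *)
  (0 < g ->
   forall w : R, band32 wX wC w ->
     exists phiX phiC : R -> R,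
       discontinuous_soliton wX wC gam g w phiX phiC /\
       increasing_profile wX wC gam g w phiX)
  /\
  (wC < wX -> forall w : R, ~ band32 wX wC w).
Proof.
  split; [|split; [|split; [|split; [|split]]]].
  - intros w phiX phiC. apply stationary_soliton. exact hgam.
  - intros Hg w. split; [split|].
    + intros [phiX [phiC H]]. exact (proj1 (dark_soliton_band_and_amplitude _ _ _ _ _ _ _ hgam Hg H)).
    + apply dark_soliton_exists; auto.
    + intros phiX phiC H. exact (proj2 (dark_soliton_band_and_amplitude _ _ _ _ _ _ _ hgam Hg H)).
  - intros Hg w. split; [split|].
    + intros [phiX [phiC H]]. exact (proj1 (bright_soliton_band_and_peak _ _ _ _ _ _ _ hgam Hg H)).
    + apply bright_soliton_exists; auto.
    + intros phiX phiC H. exact (proj2 (bright_soliton_band_and_peak _ _ _ _ _ _ _ hgam Hg H)).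
  - intros Hg w. apply decreasing_soliton_exists; auto.
  - intros Hg w. apply increasing_soliton_exists; auto.
  - intros Hw w [H1 H2]. lra.
Qed.
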